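(* Let $0\le\ell\le k$ be an integer, and let $(u,p)\in H^{\ell+1}(\Omega)\times H^{\ell}(\Omega)$ be the solution of the mixed Poisson problem (C) with $f\in H^{\ell+1}(\Omega)$. Let $\Omega$ be such that $L^2$-$H^2$-regularity holds and let the approximation assumption $(E_f)$ hold for some $k_f\ge\ell$ and with $r=\ell+1$. Let $(u_h,\bar p_h)\in\Sigma_h\times Q_h$ be the solution of the unfitted mixed FEM (M). Then $$\|u^{\mathcal E}-u_h\|_{\Sigma}+\gamma_u|u_h|_j\lesssim h^{\ell+1}\|u\|_{H^{\ell+1}(\Omega)}+h^{\ell+1}\|f\|_{H^{\ell+1}(\Omega)},$$ $$\|\bar p_h-\mathcal E_h^0p\|_{\Omega^{\mathcal T}}\lesssim h^{\ell+2}\|u\|_{H^{\ell+1}(\Omega)}+h^{\ell+2}\|f\|_{H^{\ell+1}(\Omega)} .$$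
   Context: Geometry. $\Omega\subset\mathbb R^d$, $d\in\{2,3\}$, is a bounded open domain with Lipschitz boundary $\Gamma$; $\widetilde\Omega\supseteq\overline\Omega$ is a background domain with a shape regular, quasi-uniform simplicial triangulation $\widetilde{\mathcal T}_h$ of mesh size $h$. Active mesh: $\mathcal T_h=\{T\in\widetilde{\mathcal T}_h:\operatorname{meas}_d(T\cap\Omega)>0\}$; cut mesh: $\mathcal T_h^\Gamma=\{T\in\widetilde{\mathcal T}_h:\operatorname{meas}_{d-1}(T\cap\Gamma)>0\}$; uncut interior elements: $\mathcal T_h^i=\mathcal T_h\setminus\mathcal T_h^\Gamma$. $\Omega^{\mathcal T}$ is the domain covered by $\mathcal T_h$. For a facet $F$ shared by two elements of $\mathcal T_h$, $\omega_F$ denotes the union of these two elements. Patches. $\mathcal C_h=\{\mathcal T_\omega\}$ is a set of disjoint patches of neighbouring elements of $\mathcal T_h$ (with domains $\omega$). Each patch contains at least one root element $T_\omega\in\mathcal T_h^i$; every $T\in\mathcal T_h^\Gamma$ lies in some patch; the number of elements per patch is uniformly bounded, and the number of patch-interior facets to be crossed to get from any element of a patch to its root is uniformly bounded (uniformly in patch, cut position and $h$). All elements that are neither cut nor directly adjacent to cut elements form trivial patches $\{T\}$. $\mathcal F_h^\omega$ is the set of facets interior to the patch and $\mathcal F_h^{\mathcal C}=\bigcup\mathcal F_h^\omega$. Spaces. $(\cdot,\cdot)_S,\|\cdot\|_S$ are the $L^2(S)$ inner product and norm. $k\in\mathbb N_0$; $\mathbb P^k(\mathcal T_h)$: discontinuous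 piecewise polynomials of degree $\le k$; $\mathbb{RT}^k(\mathcal T_h)=\{v\in H(\operatorname{div};\Omega^{\mathcal T}): v|_T\in[\mathcal P^k(T)]^d+\mathcal P^k(T)\mathbf x\ \forall T\}$. $\Sigma_h=\mathbb{RT}^k(\mathcal T_h)$, $Q_h=\mathbb P^k(\mathcal T_h)$. $\mathcal E_h^0:L^2(\Omega)\to Q_h$ is defined by $(\mathcal E_h^0q,r_h)_{\Omega^{\mathcal T}}=(q,r_h)_\Omega$ for all $r_h\in Q_h$. Ghost penalty. $j_h(u_h,v_h)=\sum_{F\in\mathcal F_h^{\mathcal C}}j_F(u_h,v_h)$ is a symmetric non-negative bilinear form on the piecewise polynomial space $R_h$ under consideration (it may depend on the polynomial degree of $R_h$), with semi-norm $|\cdot|_j$, satisfying: (GP1a) for piecewise polynomials $r_h$ of the degree in question on $\omega_F$, $j_F(r_h,r_h)\gtrsim\inf_{v}\|v-r_h\|_{\omega_F}^2$, the infimum over polynomials $v$ of that degree on $\omega_F$; $j_F$ is continuous w.r.t. the $L^2(\omega_F)$-norm; (GP1b) $\|r_h\|_\Omega+|r_h|_j\simeq\|r_h\|_{\Omega^{\mathcal T}}$ for $r_h\in R_h$; (GP2) for a suitable interpolation operator $\mathcal I_R$ into $R_h$, $|\mathcal I_Rr|_j\lesssim h^m|r|_{H^m(\Omega_j^{\mathcal T})}\le h^m|r|_{H^m(\Omega^{\mathcal T})}$ for $m\in\{0,\dots,k+1\}$ and $r\in H^m(\Omega^{\mathcal T})$, where $\Omega_j^{\mathcal T}$ is the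 union of the elements on which the stabilization acts. Continuous problem (C). For $f\in L^2(\Omega)$, $p_D\in H^{1/2}(\Gamma)$: $(u,v)_\Omega+(\operatorname{div}v,p)_\Omega=\langle v\cdot n,p_D\rangle$ for all $v\in H(\operatorname{div},\Omega)$ and $(\operatorname{div}u,q)_\Omega=-(f,q)_\Omega$ for all $q\in L^2(\Omega)$. Method (M). Let $\gamma_u\ge0$ be fixed, $a_h(u_h,v_h)=(u_h,v_h)_\Omega+\gamma_uj_h(u_h,v_h)$, $b_h(v_h,q_h)=(\operatorname{div}v_h,q_h)_{\Omega^{\mathcal T}}$, and let $f_h:\Omega^{\mathcal T}\to\mathbb R$ in $L^2(\Omega^{\mathcal T})$ be given. Find $(u_h,\bar p_h)\in\Sigma_h\times Q_h$ with $a_h(u_h,v_h)+b_h(v_h,\bar p_h)=(v_h\cdot n,p_D)_\Gamma$ for all $v_h\in\Sigma_h$ and $b_h(u_h,q_h)=-(f_h,q_h)_{\Omega^{\mathcal T}}$ for all $q_h\in Q_h$. Extensions. $\mathcal E:H^m(\Omega)\to H^m(\Omega^{\mathcal T})$ is a bounded linear extension operator; $p^{\mathcal E}=\mathcal Ep$, $u^{\mathcal E}=\nabla p^{\mathcal E}$, $f^{\mathcal E}=-\operatorname{div}u^{\mathcal E}$. These are assumed to be proper extensions: $\|u^{\mathcal E}\|_{H^m(\Omega^{\mathcal T})}\lesssim\|u\|_{H^m(\Omega)}$ and $\|f^{\mathcal E}\|_{H^m(\Omega^{\mathcal T})}\lesssim\|f\|_{H^m(\Omega)}$ whenever the right-hand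 sides are finite. Assumption $(E_f)$ (with parameter $k_f\in\mathbb N_0$): for $r\in\{0,\dots,k_f+1\}$, $\|f_h-f^{\mathcal E}\|_{\Omega^{\mathcal T}}+h^{-1}\|f_h-f\|_{-2}\lesssim h^r\|f\|_{H^r(\Omega)}$, where $\|g\|_{-2}=\sup_{0\ne v\in H^2(\Omega)\cap H^1_0(\Omega)}(g,v)_\Omega/\|v\|_{H^2(\Omega)}$. Norm: $\|v\|_\Sigma^2=\|v\|_{\Omega_\gamma}^2+\|\operatorname{div}v\|_{\Omega^{\mathcal T}}^2$ with $\|v\|_{\Omega_\gamma}=\|v\|_{\Omega^{\mathcal T}}$ if $\gamma_u>0$ and $\|v\|_{\Omega_\gamma}=\|v\|_\Omega$ if $\gamma_u=0$. $L^2$-$H^2$-regularity of $\Omega$: for every $g\in L^2(\Omega)$ the solution $z\in H_0^1(\Omega)$ of $-\Delta z=g$ lies in $H^2(\Omega)$ and $\|z\|_{H^2(\Omega)}\lesssim\|g\|_\Omega$. $a\lesssim b$ means $a\le cb$ with $c$ independent of the mesh size and the cut position; $\gtrsim$ and $\simeq$ are analogous. *)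

(* Defs.v *)
(* Written over MathComp-Analysis. *)
From HB Require Import structures.
From mathcomp Require Import all_boot all_order all_algebra.
From mathcomp Require Import all_classical all_reals all_analysis.

Set Implicit Arguments.
Unset Strict Implicit.
Unset Printing Implicit Defensive.

Import Order.TTheory GRing.Theory Num.Theory.
Import numFieldNormedType.Exports.

Local Open Scope classical_set_scope.
Local Open Scope ring_scope.

(* The sigma-algebra on R^n is the one generated by the coordinates, which is
   the Borel sigma-algebra. *)
Section MeasurableRow.
Context (R : realType) (n : nat).

Let coords : 'I_n -> 'rV[R]_n -> R := fun i x => x 0 i.

Let row_set0 : g_sigma_preimage coords set0.
Proof. exact: sigma_algebra0. Qed.

Let row_setC A : g_sigma_preimage coords A -> g_sigma_preimage coords (~` A).
Proof. exact: sigma_algebraC. Qed.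

Let row_bigcup (F : _^nat) : (forall i, g_sigma_preimage coords (F i)) ->
  g_sigma_preimage coords (\bigcup_i (F i)).
Proof. exact: sigma_algebra_bigcup. Qed.

HB.instance Definition _ :=
  @isMeasurable.Build (measure_tuple_display default_measure_display)
    'rV[R]_n (g_sigma_preimage coords) row_set0 row_setC row_bigcup.

End MeasurableRow.

Section MeasurableRowTheory.
Context {R : realType}.

Lemma measurable_coord n (i : 'I_n) :
  measurable_fun [set: 'rV[R]_n] (fun x : 'rV[R]_n => x 0 i).
Proof.
move=> _ Y mY; rewrite setTI; apply: sub_sigma_algebra => /=.
rewrite -bigcup_seq/=; exists i => /=; first by rewrite mem_index_enum.
by exists Y => //; rewrite setTI.
Qed.

Lemma measurable_row d (T : measurableType d) n (f : T -> 'rV[R]_n) :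
  (forall i, measurable_fun [set: T] (fun t => f t 0 i)) ->
  measurable_fun [set: T] f.
Proof.
move=> mf.
pose coords (i : 'I_n) (x : 'rV[R]_n) := x 0 i.
have sub : g_sigma_preimage (fun i => coords i \o f) `<=` measurable.
  apply: smallest_sub; first exact: sigma_algebra_measurable.
  by rewrite -bigcup_seq/=; apply: bigcup_sub => i _ A [B mB <-]; exact: mf.
by move=> _ A mA; apply: sub; rewrite g_sigma_preimage_comp; exists A.
Qed.

Definition row_cons n (xy : measurableTypeR R * 'rV[R]_n) : 'rV[R]_n.+1 :=
  \row_i oapp (fun j => xy.2 0 j) xy.1 (unlift ord0 i).

Lemma measurable_row_cons n : measurable_fun setT (@row_cons n).
Proof.
apply: measurable_row => i.
rewrite /row_cons; under eq_fun do rewrite mxE.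
case: unliftP => [j _|_] /=; last exact: measurable_fst.
exact: (measurableT_comp (measurable_coord j) measurable_snd).
Qed.

HB.instance Definition _ n :=
  @isMeasurableFun.Build _ _ _ _ (@row_cons n) (@measurable_row_cons n).

Section Step.
Context (n : nat) (m : {sigma_finite_measure set 'rV[R]_n -> \bar R}).

Let step := pushforward (@lebesgue_measure R \x m)%E (@row_cons n).


Let step0 : step set0 = 0%E.
Proof. by rewrite /step /pushforward preimage_set0 measure0. Qed.

Let step_ge0 A : (0 <= step A)%E.
Proof. exact: measure_ge0. Qed.

Let step_sigma_additive : semi_sigma_additive step.
Proof.
exact: measure_semi_sigma_additive.
Qed.

HB.instance Definition _ := isMeasure.Build _ _ _
  step step0 step_ge0 step_sigma_additive.


Let step_sigma_finite : sigma_finite setT step.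
Proof.
have /sigma_finiteP[A [AT And Aoo]] := sigma_finiteT (@lebesgue_measure R).
have /sigma_finiteP[B [BT Bnd Boo]] := sigma_finiteT m.
pose F k := A k `*` B k.
have FT : [set: _] = \bigcup_k F k.
  rewrite -setXTT AT BT predeqE => -[x y]; split.
    move=> [/= [i _ Aix] [j _ Bjy]]; exists (maxn i j) => //; split.
    - by move: x Aix; exact/subsetPset/And/leq_maxl.
    - by move: y Bjy; exact/subsetPset/Bnd/leq_maxr.
  by move=> [i _ []/= ? ?]; split; exists i.
have mF k : measurable (F k) /\ ((@lebesgue_measure R \x m) (F k) < +oo)%E.
  have [? ?] := Aoo k; have [? ?] := Boo k; split; first exact: measurableX.
  by rewrite product_measure1E// lte_mul_pinfty// ge0_fin_numE.
pose uncons (x : 'rV[R]_n.+1) : measurableTypeR R * 'rV[R]_n :=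
  (x 0 ord0, \row_j x 0 (lift ord0 j)).
have consK : cancel (@row_cons n) uncons.
  move=> [a y]; rewrite /uncons /row_cons mxE unlift_none; congr pair.
  by apply/rowP => j; rewrite !mxE liftK.
have muncons : measurable_fun setT uncons.
  apply/measurable_fun_pairP; split => /=; first exact: measurable_coord.
  apply: measurable_row => i; rewrite /uncons /comp /=.
  by under eq_fun do rewrite mxE; exact: measurable_coord.
exists (fun i => uncons @^-1` (F i)).
  by rewrite -preimage_bigcup -FT preimage_setT.
move=> i; have [mFi Fioo] := mF i; split.
  by rewrite -[X in measurable X]setTI; exact: muncons.
rewrite /step /pushforward.
suff -> : @row_cons n @^-1` (uncons @^-1` F i) = F i by [].
by apply/seteqP; split => z /=; rewrite consK.
Qed.

HB.instance Definition _ := @Measure_isSigmaFinite.Build _ _ _ step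
  step_sigma_finite.

Definition lebesgue_step : {sigma_finite_measure set 'rV[R]_n.+1 -> \bar R} :=
  step.

End Step.

(* Lebesgue measure on R^n: the image of lebesgue_measure \x leb (n - 1) under
   R * R^(n-1) = R^n. *)
Fixpoint leb n : {sigma_finite_measure set 'rV[R]_n -> \bar R} :=
  if n is n'.+1 then lebesgue_step (leb n') else \d_(0 : 'rV[R]_0).

End MeasurableRowTheory.

Section EuclideanSpace.
Context {R : realType} {d : nat}.
Local Notation pt := 'rV[R]_d.

(* The library norm of a matrix is the maximum norm, hence enorm. *)
Definition enorm (x : pt) : R := Num.sqrt (\sum_i x 0 i ^+ 2).

Definition ediam (A : set pt) : \bar R :=
  maxe 0%E (ereal_sup [set (enorm (xy.1 - xy.2))%:E | xy in A `*` A]).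

(* s-dimensional Hausdorff measure, s > 0, without the normalising factor. *)
Definition hausdorff_delta (s : nat) (delta : R) (A : set pt) : \bar R :=
  ereal_inf [set (\sum_(0 <= i <oo) ediam (U i) ^+ s)%E
            | U in [set U : (set pt)^nat |
                    A `<=` \bigcup_i U i /\
                    forall i, (ediam (U i) <= delta%:E)%E]].

Definition hausdorff (s : nat) (A : set pt) : \bar R :=
  ereal_sup [set hausdorff_delta s delta A | delta in [set delta | 0 < delta]].

Definition bdry (Om : set pt) : set pt := closure Om `\` interior Om.

Definition bounded_dom (Om : set pt) : Prop :=
  exists M, forall x, Om x -> enorm x <= M.

Definition is_domain (Om : set pt) : Prop :=
  [/\ open Om, connected Om & Om !=set0].

(* Near each boundary point, Om is the set below a Lipschitz graph over the
   hyperplane orthogonal to some unit vector e; the graph is given as a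
   Lipschitz function g on R^d that is constant along e. *)
Definition lipschitz_boundary (Om : set pt) : Prop :=
  forall x, bdry Om x ->
  exists (e : pt) (rho L : R) (g : pt -> R),
    [/\ enorm e = 1, 0 < rho,
        forall y z, `|g y - g z| <= L * enorm (y - z),
        forall y t, g (y + t *: e) = g y &
        forall y, enorm (y - x) < rho ->
          (Om y <-> \sum_i y 0 i * e 0 i < g y)].

Definition vcoord (v : pt -> pt) (i : 'I_d) : pt -> R := fun x => v x 0 i.

Definition L2 (S : set pt) (u : pt -> R) : Prop :=
  measurable_fun S u /\ (\int[leb d]_(x in S) (u x ^+ 2)%:E < +oo)%E.

Definition ip (S : set pt) (u v : pt -> R) : R :=
  \int[leb d]_(x in S) (u x * v x).

Definition nrm (S : set pt) (u : pt -> R) : R := Num.sqrt (ip S u u).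

Definition L2v (S : set pt) (v : pt -> pt) : Prop :=
  forall i, L2 S (vcoord v i).

Definition ipv (S : set pt) (v w : pt -> pt) : R :=
  \sum_i ip S (vcoord v i) (vcoord w i).

Definition nrmv (S : set pt) (v : pt -> pt) : R := Num.sqrt (ipv S v v).

Definition pder (i : 'I_d) (phi : pt -> R) : pt -> R :=
  fun x => 'D_(delta_mx 0 i : pt) phi x.

Definition mder (al : 'I_d -> nat) (phi : pt -> R) : pt -> R :=
  foldr (fun i psi => iter (al i) (pder i) psi) phi (enum 'I_d).

Definition smooth (phi : pt -> R) : Prop :=
  forall s : seq 'I_d, let psi := foldr pder phi s in
    continuous psi /\ forall x i, derivable psi x (delta_mx 0 i : pt).

Definition test_fun (Om : set pt) (phi : pt -> R) : Prop :=
  smooth phi /\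
  exists K : set pt, [/\ compact K, K `<=` Om & forall x, ~ K x -> phi x = 0].

(* The weak derivative of multi-index al, required to be in L^2. *)
Definition is_wder (Om : set pt) (al : 'I_d -> nat) (u g : pt -> R) : Prop :=
  L2 Om g /\
  forall phi, test_fun Om phi ->
    ip Om u (mder al phi) = (-1) ^+ (\sum_i al i)%N * ip Om g phi.

Definition wder (Om : set pt) (al : 'I_d -> nat) (u : pt -> R) : pt -> R :=
  xget (fun=> 0) [set g | is_wder Om al u g].

Definition wgrad (Om : set pt) (u : pt -> R) : pt -> pt :=
  fun x => \row_i wder Om (fun j => (j == i)%N) u x.

Definition is_wdiv (Om : set pt) (v : pt -> pt) (g : pt -> R) : Prop :=
  L2 Om g /\
  forall phi, test_fun Om phi ->
    ipv Om v (fun x => \row_i pder i phi x) = - ip Om g phi.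

Definition wdiv (Om : set pt) (v : pt -> pt) : pt -> R :=
  xget (fun=> 0) [set g | is_wdiv Om v g].

Definition Hdiv (Om : set pt) (v : pt -> pt) : Prop :=
  L2v Om v /\ exists g, is_wdiv Om v g.

Definition Hm (Om : set pt) (m : nat) (u : pt -> R) : Prop :=
  L2 Om u /\
  forall al : 'I_d -> nat, (\sum_i al i <= m)%N -> exists g, is_wder Om al u g.

Definition hsemi (Om : set pt) (m : nat) (u : pt -> R) : R :=
  Num.sqrt (\sum_(al : {ffun 'I_d -> 'I_m.+1} | (\sum_i al i == m)%N)
              nrm Om (wder Om (fun i => al i) u) ^+ 2).

Definition hnorm (Om : set pt) (m : nat) (u : pt -> R) : R :=
  Num.sqrt (\sum_(al : {ffun 'I_d -> 'I_m.+1} | (\sum_i al i <= m)%N)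
              nrm Om (wder Om (fun i => al i) u) ^+ 2).

Definition Hmv (Om : set pt) (m : nat) (v : pt -> pt) : Prop :=
  forall i, Hm Om m (vcoord v i).

Definition hsemiv (Om : set pt) (m : nat) (v : pt -> pt) : R :=
  Num.sqrt (\sum_i hsemi Om m (vcoord v i) ^+ 2).

Definition hnormv (Om : set pt) (m : nat) (v : pt -> pt) : R :=
  Num.sqrt (\sum_i hnorm Om m (vcoord v i) ^+ 2).

Definition H10 (Om : set pt) (u : pt -> R) : Prop :=
  Hm Om 1 u /\
  forall eps, 0 < eps ->
    exists phi, test_fun Om phi /\ hnorm Om 1 (u \- phi) < eps.

(* g : bdry Om -> R is the trace of P in H^1(Om), as a limit in L^2(bdry Om) of
   boundary values of smooth functions approximating P. *)
Definition is_trace (Om : set pt) (P g : pt -> R) : Prop :=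
  measurable_fun (bdry Om) g /\
  forall eps, 0 < eps ->
    exists phi, [/\ smooth phi, hnorm Om 1 (P \- phi) < eps &
      (\int[hausdorff d.-1]_(x in bdry Om) ((phi x - g x) ^+ 2)%:E
         < eps%:E)%E].

(* H^(1/2) of the boundary as the trace space of H^1(Om). *)
Definition Hhalf (Om : set pt) (g : pt -> R) : Prop :=
  exists P, Hm Om 1 P /\ is_trace Om P g.

(* The duality pairing of the normal trace of v in H(div, Om) with g in
   H^(1/2), defined by Green's formula with an extension P of g. *)
Definition normal_pairing (Om : set pt) (v : pt -> pt) (g : pt -> R) : R :=
  let P := xget (fun=> 0) [set P | Hm Om 1 P /\ is_trace Om P g] in
  ipv Om v (wgrad Om P) + ip Om (wdiv Om v) P.

Definition poisson_solution (Om : set pt) (g z : pt -> R) : Prop :=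
  H10 Om z /\
  forall w, H10 Om w -> ipv Om (wgrad Om z) (wgrad Om w) = ip Om g w.

Definition L2_H2_regular (Om : set pt) : Prop :=
  exists c : R, forall g, L2 Om g -> forall z, poisson_solution Om g z ->
    Hm Om 2 z /\ hnorm Om 2 z <= c * nrm Om g.

Definition norm_m2 (Om : set pt) (g : pt -> R) : \bar R :=
  ereal_sup [set (ip Om g v / hnorm Om 2 v)%:E
            | v in [set v | [/\ Hm Om 2 v, H10 Om v & hnorm Om 2 v != 0]]].

Definition mixed_poisson (Om : set pt) (f pD : pt -> R)
    (u : pt -> pt) (p : pt -> R) : Prop :=
  [/\ Hdiv Om u, L2 Om p,
      forall v, Hdiv Om v ->
        ipv Om u v + ip Om (wdiv Om v) p = normal_pairing Om v pD &
      forall q, L2 Om q -> ip Om (wdiv Om u) q = - ip Om f q].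

Definition poly_fun (q : nat) (p : pt -> R) : Prop :=
  exists c : {ffun 'I_d -> 'I_q.+1} -> R, forall x,
    p x = \sum_(al : {ffun 'I_d -> 'I_q.+1} | (\sum_i al i <= q)%N)
            c al * \prod_i x 0 i ^+ al i.

Definition poly_funv (q : nat) (v : pt -> pt) : Prop :=
  forall i, poly_fun q (vcoord v i).

Definition RTpoly (k : nat) (v : pt -> pt) : Prop :=
  exists w s, [/\ poly_funv k w, poly_fun k s & forall x, v x = w x + s x *: x].

End EuclideanSpace.

Section Mesh.
Context {R : realType} {d : nat}.
Local Notation pt := 'rV[R]_d.

Definition hull (P : {set 'I_d.+1}) (a : 'I_d.+1 -> pt) : set pt :=
  [set x | exists lam : 'I_d.+1 -> R,
     [/\ forall i, 0 <= lam i, forall i, i \notin P -> lam i = 0,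
         \sum_i lam i = 1 & x = \sum_i lam i *: a i]].

Record mesh := Mesh {
  elt : finType;
  node : elt -> 'I_d.+1 -> pt
}.

Section OneMesh.
Context (M : mesh).
Implicit Types (T : elt M) (F P : {set elt M}).

Definition cell T : set pt := hull [set: 'I_d.+1]%SET (node T).

Definition cells (F : {set elt M}) : set pt :=
  [set x | exists2 T, T \in F & cell T x].

Definition shared T T' : {set 'I_d.+1} :=
  [set i | [exists j, node T i == node T' j]]%SET.

Definition adjacent T T' : bool := (T != T') && (#|shared T T'| == d).

Definition diam T : R := fine (ediam (cell T)).

Definition mesh_size : R := \big[Num.max/0]_T diam T.

Definition triangulation (Omt : set pt) : Prop :=
  [/\ forall T,
        \matrix_(i < d) (node T (lift ord0 i) - node T ord0) \in unitmx,
      forall T T', T != T' -> shared T T' != [set: 'I_d.+1]%SET,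
      forall T T', T != T' ->
        cell T `&` cell T' `<=` hull (shared T T') (node T) &
      closure Omt = cells [set: elt M]%SET].

Definition shape_regular (c : R) : Prop :=
  forall T, exists x rho, [/\ 0 < rho, diam T <= c * rho &
    forall y, enorm (y - x) <= rho -> cell T y].

Definition quasi_uniform (c : R) : Prop :=
  forall T, mesh_size <= c * diam T.

Context (Om : set pt).

Definition active : {set elt M} :=
  [set T | `[< (0 < leb d (cell T `&` Om))%E >]]%SET.

Definition cut_elts : {set elt M} :=
  [set T | `[< (0 < hausdorff d.-1 (cell T `&` bdry Om))%E >]]%SET.

Definition uncut : {set elt M} := (active :\: cut_elts)%SET.

Definition OmT : set pt := interior (cells active).

Record patches (CC : {set {set elt M}}) (Nel Npath : nat) : Prop := {
  patch_active : forall P, P \in CC -> P \subset active;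
  patch_disjoint : finset.trivIset CC;
  patch_cut : cut_elts \subset finset.cover CC;
  patch_card : forall P, P \in CC -> (#|P| <= Nel)%N;
  patch_root : forall P, P \in CC ->
    exists T0, [/\ T0 \in P, T0 \in uncut & forall T, T \in P ->
      exists s, [/\ path [rel S S' | (S' \in P) && adjacent S S'] T s,
                    last T s = T0 & (size s <= Npath)%N]];
  patch_trivial : forall T, T \in active -> T \notin cut_elts ->
    (forall T', T' \in cut_elts -> ~~ adjacent T T') -> [set T]%SET \in CC
}.

(* A facet is represented by the pair of elements sharing it. *)
Definition patch_facets (CC : {set {set elt M}}) : {set {set elt M}} :=
  [set F | [exists T, exists T',
     [&& F == [set T; T']%SET, adjacent T T' &
         [exists P in CC, (T \in P) && (T' \in P)]]]]%SET.

Definition dg (k : nat) (q : pt -> R) : Prop :=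
  measurable_fun OmT q /\
  forall T, T \in active ->
    exists p, poly_fun k p /\ forall x, interior (cell T) x -> q x = p x.

Definition dgv (k : nat) (v : pt -> pt) : Prop :=
  forall i, dg k (vcoord v i).

Definition RT (k : nat) (v : pt -> pt) : Prop :=
  Hdiv OmT v /\
  forall T, T \in active ->
    exists p, RTpoly k p /\ forall x, interior (cell T) x -> v x = p x.

Definition is_E0 (k : nat) (E0 : (pt -> R) -> (pt -> R)) : Prop :=
  forall q, L2 Om q ->
    dg k (E0 q) /\ forall r, dg k r -> ip OmT (E0 q) r = ip Om q r.

Section GhostPenalty.
Context (CC : {set {set elt M}}).
Context (j : {set elt M} -> (pt -> pt) -> (pt -> pt) -> R).

Definition jh (v w : pt -> pt) : R := \sum_(F in patch_facets CC) j F v w.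

Definition jnorm (v : pt -> pt) : R := Num.sqrt (jh v v).

Definition stabilized : set pt :=
  interior [set x | exists2 F, F \in patch_facets CC & cells F x].

(* The stabilized space is RT^k, whose elements are piecewise polynomials of
   degree k + 1. That the interpolation operator of gp_interp is suitable means
   that it has optimal order in L^2; otherwise the zero operator would do. *)
Record ghost_penalty (k : nat) (c : R) : Prop := {
  gp_linearl : forall F, F \in patch_facets CC -> forall a u v w,
    dgv k.+1 u -> dgv k.+1 v -> dgv k.+1 w ->
    j F (fun x => a *: u x + v x) w = a * j F u w + j F v w;
  gp_linearr : forall F, F \in patch_facets CC -> forall a u v w,
    dgv k.+1 u -> dgv k.+1 v -> dgv k.+1 w ->
    j F w (fun x => a *: u x + v x) = a * j F w u + j F w v;
  gp_sym : forall v w, RT k v -> RT k w -> jh v w = jh w v;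
  gp_ge0 : forall v, RT k v -> 0 <= jh v v;
  gp_lower : forall F, F \in patch_facets CC -> forall r, dgv k.+1 r ->
    inf [set nrmv (cells F) (fun x => v x - r x) ^+ 2 | v in poly_funv k.+1]
      <= c * j F r r;
  gp_continuous : forall F, F \in patch_facets CC -> forall v w,
    dgv k.+1 v -> dgv k.+1 w ->
    `|j F v w| <= c * nrmv (cells F) v * nrmv (cells F) w;
  gp_equiv_le : forall r, RT k r -> nrmv Om r + jnorm r <= c * nrmv OmT r;
  gp_equiv_ge : forall r, RT k r -> nrmv OmT r <= c * (nrmv Om r + jnorm r);
  gp_interp : exists I : (pt -> pt) -> (pt -> pt),
    forall m r, (m <= k.+1)%N -> Hmv OmT m r ->
    [/\ RT k (I r),
        nrmv OmT (fun x => r x - I r x) <= c * mesh_size ^+ m * hsemiv OmT m r &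
        jnorm (I r) <= c * mesh_size ^+ m * hsemiv stabilized m r]
}.

Definition unfitted_fem (k : nat) (gammau : R) (fh pD : pt -> R)
    (uh : pt -> pt) (ph : pt -> R) : Prop :=
  [/\ RT k uh, dg k ph,
      forall v, RT k v ->
        ipv Om uh v + gammau * jh uh v + ip OmT (wdiv OmT v) ph
          = normal_pairing Om v pD &
      forall q, dg k q -> ip OmT (wdiv OmT uh) q = - ip OmT fh q].

End GhostPenalty.

Record extension_operator (E : (pt -> R) -> (pt -> R)) (c : nat -> R) : Prop := {
  ext_linear : forall a v w, L2 Om v -> L2 Om w ->
    {ae leb d, forall x, OmT x -> E (a *: v + w) x = a * E v x + E w x};
  ext_id : forall v, L2 Om v -> {ae leb d, forall x, Om x -> E v x = v x};
  ext_bounded : forall m v, Hm Om m v ->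
    Hm OmT m (E v) /\ hnorm OmT m (E v) <= c m * hnorm Om m v
}.

Definition extu (E : (pt -> R) -> (pt -> R)) (p : pt -> R) : pt -> pt :=
  wgrad OmT (E p).

Definition extf (E : (pt -> R) -> (pt -> R)) (p : pt -> R) : pt -> R :=
  fun x => - wdiv OmT (extu E p) x.

Definition proper_extension (E : (pt -> R) -> (pt -> R)) (c : nat -> R)
    (f : pt -> R) (u : pt -> pt) (p : pt -> R) : Prop :=
  (forall m, Hmv Om m u ->
     Hmv OmT m (extu E p) /\ hnormv OmT m (extu E p) <= c m * hnormv Om m u) /\
  (forall m, Hm Om m f ->
     Hm OmT m (extf E p) /\ hnorm OmT m (extf E p) <= c m * hnorm Om m f).

Definition assumption_Ef (c : R) (kf r : nat) (f fE fh : pt -> R) : Prop :=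
  (r <= kf.+1)%N /\
  ((nrm OmT (fh \- fE)%R)%:E + (mesh_size^-1)%:E * norm_m2 Om (fh \- f)%R
     <= (c * mesh_size ^+ r * hnorm Om r f)%:E)%E.

Definition norm_gamma (gammau : R) (v : pt -> pt) : R :=
  if 0 < gammau then nrmv OmT v else nrmv Om v.

Definition norm_Sigma (gammau : R) (v : pt -> pt) : R :=
  Num.sqrt (norm_gamma gammau v ^+ 2 + nrm OmT (wdiv OmT v) ^+ 2).

End OneMesh.
End Mesh.

Arguments mesh : clear implicits.

(* Main.v *)
Require Import Defs.
From HB Require Import structures.
From mathcomp Require Import all_boot all_order all_algebra.
From mathcomp Require Import ring lra zify.
From mathcomp Require Import all_classical all_reals all_analysis.
From mathcomp Require Import measurable_realfun.

(* Write e = ph - E0 p and let A be the data error |u - uh|_Om + gam c |uh|_j.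
   Subtracting (M) from (C) shows |(div v, e)| <= A |v| for Raviart-Thomas v.
   Testing with bubble and facet fields bounds the cell oscillations and the
   jumps of e, boundary facets included, by h A; a smooth partition of unity on
   a grid of width h, with connectedness of the active cells, then gives a test
   function on the active domain that is O(h A)-close to e and has gradient
   O(A).  Hence (div rho, e) is controlled for every rho in H(div), with no
   inf-sup condition and no interpolation of rho.  The energy argument with
   v = uh - I uE gives the velocity bound, and Aubin-Nitsche duality the
   pressure bound. *)

Set Implicit Arguments.
Unset Strict Implicit.
Unset Printing Implicit Defensive.

Import Order.TTheory GRing.Theory Num.Theory.
Import numFieldNormedType.Exports.

Local Open Scope classical_set_scope.
Local Open Scope ring_scope.

(** A cut cell may have an arbitrarily small part in [Om], so every local estimate is made on a
    whole cell of the active mesh, which contains a cube of size comparable to [h]; the cut position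
    then enters no constant. The active domain has no regularity uniform in [h], hence no boundary
    value problem is ever solved on it. A compactly supported test function can be close to e
    because Raviart-Thomas fields have a free normal trace on the boundary of the active domain: in
    a weak sense e vanishes there, and the same test function shows that e is O(h A) on the strip
    outside [Om]. The duality argument needs this strip bound, since the extended dual field has
    divergence -e only inside [Om]. The one divergence theorem used on a cell concerns fields f(x)(x
    - a_i) with a_i a vertex: they are tangent to every facet except the one opposite to a_i, so
    conformity of a discrete field is checked facet by facet without surface integrals. Polynomial
    inequalities are scaled from one fixed bump, so that their constants depend only on the degree,
    the dimension and the ratio of the cube to [h]. *)

Ltac le_eq := rewrite le_eqVlt; apply/orP; left; apply/eqP.

(** * Boxes as a generating system for Lebesgue measure *)

Section Box.
Context {R : realType}.
Definition obox n (a b : 'rV[R]_n) : set 'rV[R]_n :=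
 [set x | forall i, a 0 i < x 0 i < b 0 i].
Lemma setI_obox n : setI_closed [set A | exists a b : 'rV[R]_n, A = obox a b].
move=> _ _ [a [b ->]] [a' [b' ->]].
exists (\row_i Num.max (a 0 i) (a' 0 i)), (\row_i Num.min (b 0 i) (b' 0 i)).
apply/seteqP; split => x /=.
 case=> h1 h2 i; rewrite !mxE gt_max lt_min.
 move: (h1 i) (h2 i) => /andP[a1 a2] /andP[b1 b2].
 by rewrite a1 a2 b1 b2.
move=> h; split => i; move: (h i);
 rewrite !mxE gt_max lt_min => /andP[/andP[p1 p2] /andP[p3 p4]];
 by rewrite ?p1 ?p2 ?p3 ?p4.
Qed.

Lemma mobox n (a b : 'rV[R]_n) : measurable (obox a b).
have -> : obox a b = \big[setI/setT]_(i < n)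
  ((fun x : 'rV[R]_n => x 0 i) @^-1` `]a 0 i, b 0 i[%classic).
 apply/seteqP; split => x /=.
  by move=> h; rewrite -bigcap_seq => i _ /=; rewrite in_itv/=.
 by rewrite -bigcap_seq => h i; have := h i (mem_index_enum i); rewrite /= in_itv.
apply: bigsetI_measurable => i _.
by rewrite -[X in measurable X]setTI; exact: measurable_coord.
Qed.

(** A half-space where one coordinate exceeds c is a countable union of boxes, so the coordinates
    are already measurable for the sigma-algebra that boxes generate. This supplies the pi-system
    for uniqueness of measures and for the Dynkin argument in [fundamental_tbump]. *)
Lemma row_measurableE n : (@measurable _ 'rV[R]_n) =
 <<s [set A | exists a b : 'rV[R]_n, A = obox a b] >>.
set G := [set A | _]; apply/seteqP; split; last first.
 apply: smallest_sub; first exact: sigma_algebra_measurable.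
 by move=> _ [a [b ->]]; exact: mobox.
apply: smallest_sub; first exact: smallest_sigma_algebra.
rewrite -bigcup_seq; apply: bigcup_sub => i _ A [Y mY <-].
pose f : g_sigma_algebraType G -> R := fun x => x 0 i.
suff mf : measurable_fun setT f by exact: (mf measurableT Y mY).
apply: (@measurability _ _ _ _ _ _ (@RGenOInfty.G R)).
 exact: RGenOInfty.measurableE.
move=> _ [_ [c ->] <-]; rewrite setTI.
have -> : f @^-1` `]c, +oo[%classic = \bigcup_(k in @setT nat)
  obox (\row_j if j == i then c else - k%:R) (const_mx k%:R).
 apply/seteqP; split => x /=.
  rewrite in_itv/= andbT => cx.
  exists (Num.truncn (\sum_j `|x 0 j|)).+1 => // j; rewrite !mxE.
  have h : `|x 0 j| < (Num.truncn (\sum_j `|x 0 j|)).+1%:R.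
   apply: le_lt_trans (truncnS_gt _).
   by rewrite (bigD1 j)//= lerDl sumr_ge0.
  move: h; rewrite ltr_norml => /andP[h1 ->]; rewrite andbT.
  by case: eqVneq => [->|].
 by case=> k _ /(_ i); rewrite !mxE eqxx in_itv/= andbT => /andP[].
apply: bigcupT_measurable => k.
by apply: sub_sigma_algebra; do 2 eexists.
Qed.

Lemma bigcup_obox n :
 \bigcup_(k in @setT nat) obox (const_mx (- k%:R)) (const_mx k%:R : 'rV[R]_n) = setT.
apply/seteqP; split => // x _.
exists (Num.truncn (\sum_j `|x 0 j|)).+1 => // j; rewrite !mxE -ltr_norml.
apply: le_lt_trans (truncnS_gt _).
by rewrite (bigD1 j)//= lerDl sumr_ge0.
Qed.

Lemma leb_obox n (a b : 'rV[R]_n) : (forall i, a 0 i <= b 0 i) ->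
 leb n (obox a b) = (\prod_i (b 0 i - a 0 i))%:E.
elim: n a b => [|n IH] a b ab.
 rewrite big_ord0 /= diracE.
 by rewrite mem_set// => -[].
rewrite [LHS]/=/pushforward.
have -> : row_cons (n:=n) @^-1` obox a b =
  `]a 0 ord0, b 0 ord0[%classic `*`
   obox (\row_j a 0 (lift ord0 j)) (\row_j b 0 (lift ord0 j)).
 apply/seteqP; split => -[x y] /=.
  move=> h; split.
   by have := h ord0; rewrite /row_cons !mxE unlift_none /= in_itv.
  by move=> j; have := h (lift ord0 j); rewrite /row_cons !mxE liftK.
 rewrite in_itv/= => -[h1 h2] i; rewrite /row_cons !mxE.
 by case: unliftP => [j ->|->] //=; have := h2 j; rewrite !mxE.
rewrite product_measure1E; [|exact: measurable_itv|exact: mobox].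
rewrite IH; last by move=> j; rewrite !mxE.
rewrite [X in (X * _)%E]lebesgue_measure_itv /= lte_fin big_ord_recl.
under eq_bigr do rewrite !mxE.
case: ltP => [_|]; first by rewrite -EFinB -EFinM.
rewrite le_eqVlt ltNge ab orbF => /eqP ->.
by rewrite subrr mul0r mul0e.
Qed.

(** Boxes are stable under intersection and exhaust the space by sets of finite measure. A box with
    a side of nonpositive length is empty, so the hypothesis may be restricted to strict corners. *)
Lemma leb_unique n (mu : {measure set 'rV[R]_n -> \bar R}) :
 (forall a b : 'rV[R]_n, (forall i, a 0 i < b 0 i) ->
   mu (obox a b) = (\prod_i (b 0 i - a 0 i))%:E) ->
 forall A, measurable A -> mu A = leb n A.
move=> H A mA.
pose G := [set A | exists a b : 'rV[R]_n, A = obox a b].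
have HG B : G B -> leb n B = mu B.
 move=> [a [b ->]].
 have [ab|/existsNP[i /negP]] := pselect (forall i, a 0 i < b 0 i).
  by rewrite H// leb_obox// => i; exact: ltW.
 rewrite -leNgt => ba.
 suff -> : obox a b = set0 by rewrite !measure0.
 by apply/seteqP; split => // x /(_ i); rewrite ltNge; case: ltP => //=; lra.
apply/esym.
apply: (measure_unique G (fun k => obox (const_mx (- k%:R)) (const_mx k%:R : 'rV[R]_n))) => //.
- exact: row_measurableE.
- exact: setI_obox.
- by move=> i; do 2 eexists.
- exact: bigcup_obox.
- move=> k; apply: (@le_lt_trans _ _ (leb n (obox (const_mx (- k%:R)) (const_mx k%:R)))) => //.
 by rewrite leb_obox ?ltry// => i; rewrite !mxE; have := ler0n R k; lra.
Qed.

End Box.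

(** * Lebesgue measure under translations, dilations and linear maps *)

Section LebMaps.
Context {R : realType}.
Local Notation pt n := 'rV[R]_n.
(** Links the topology of the maximum norm with the sigma-algebra of the coordinates: an open set is
    the union of the countably many boxes with rational corners that it contains. *)
Lemma open_meas n (O : set (pt n)) : open O -> measurable O.
move=> oO.
pose B (pq : 'rV[rat]_n * 'rV[rat]_n) : set (pt n) :=
 if pselect (obox (map_mx ratr pq.1) (map_mx ratr pq.2) `<=` O) is left _
 then obox (map_mx ratr pq.1) (map_mx ratr pq.2) else set0.
have -> : O = \bigcup_pq B pq.
 apply/seteqP; split => [x Ox|x [pq _]]; last first.
  by rewrite /B; case: pselect => // h /h.
 have := oO _ Ox; rewrite /interior => /nbhs_ballP[e /= e0 eO].
 have lo i : exists q : rat, ratr q \in `]x 0 i - e, x 0 i[.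
  by apply: rat_in_itvoo; lra.
 have hi i : exists q : rat, ratr q \in `]x 0 i, x 0 i + e[.
  by apply: rat_in_itvoo; lra.
 have [p hp] := choice lo; have [q hq] := choice hi.
 exists (\row_i p i, \row_i q i) => //; rewrite /B; case: pselect => /=.
  move=> _ i; rewrite !mxE; have := hp i; have := hq i.
  by rewrite !in_itv/= => /andP[-> _] /andP[_ ->].
 case=> y yb; apply: eO; rewrite mx_norm_ball /ball_/=.
 rewrite /Num.Def.normr/= mx_normrE; apply/bigmax_ltP; split => // -[i j] _ /=.
 rewrite !mxE !ord1; move: (yb j); rewrite !mxE.
 have := hp j; have := hq j; rewrite !in_itv/= => /andP[_ h1] /andP[h2 _].
 by move=> /andP[h3 h4]; rewrite ltr_norml; apply/andP; split; lra.
apply: countable_bigcupT_measurable; first exact: countableP.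
move=> pq; rewrite /B; case: pselect => // _.
exact: mobox.
Qed.

Lemma closed_meas n (O : set (pt n)) : closed O -> measurable O.
by move=> cO; rewrite -(setCK O); apply: measurableC; apply: open_meas;
 exact: closed_openC.
Qed.

Lemma cont_meas n (f : pt n -> R) :
 continuous f -> measurable_fun setT f.
move=> cf; apply: (@measurability _ _ _ _ _ _ (@RGenOpens.G R)).
 exact: RGenOpens.measurableE.
move=> _ [_ [a [b ->]] <-]; rewrite setTI; apply: open_meas.
by apply: open_comp; [move=> x _; exact: cf|exact: interval_open].
Qed.

Section Scale.
Context n (phi : pt n -> pt n) (c : R) (mphi : measurable_fun setT phi) (c0 : 0 <= c).
Let push := measure_function_pushforward__canonical__measure_function_Measure (leb n) mphi.
Context (H : forall A, measurable A -> leb n (phi @^-1` A) = (c%:E * leb n A)%E).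
(** Change of variables for a map that multiplies all volumes by one constant. Translations,
    dilations and the shear of [flux_match] are of this kind, so no Jacobian determinant is ever
    computed. *)
Lemma ge0_int_scale D (f : pt n -> \bar R) : measurable D ->
 measurable_fun D f -> (forall x, D x -> (0 <= f x)%E) ->
 (\int[leb n]_(x in phi @^-1` D) f (phi x) = c%:E * \int[leb n]_(x in D) f x)%E.
move=> mD mf f0.
have := @ge0_integral_pushforward _ _ _ _ _ _ mphi (leb n) D f mD mf.
move=> <-; last by move=> x; rewrite inE; exact: f0.
rewrite -(@ge0_integral_mscale _ _ _ (leb n) D mD (NngNum c0) f mf f0).
by apply: (@eq_measure_integral _ _ _ D (mscale (NngNum c0) (leb n)) push) => A mA _; exact: H.
Qed.

Lemma scale_integrable D (f : pt n -> \bar R) : measurable D ->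
 (leb n).-integrable D f -> (leb n).-integrable (phi @^-1` D) (f \o phi).
move=> mD /integrableP[mf foo]; apply/integrableP; split.
 apply: (measurable_comp mD) => //; first by move=> _ [x Dx <-].
 exact: measurable_funTS.
rewrite (@ge0_int_scale D (fun x => `|f x|)%E)//.
 by apply: lte_mul_pinfty => //; exact: integral_ge0.
exact: measurableT_comp.
Qed.

Lemma Rint_scale D (f : pt n -> R) : measurable D ->
 (leb n).-integrable D (EFin \o f) ->
 \int[leb n]_(x in phi @^-1` D) f (phi x) = c * \int[leb n]_(x in D) f x.
move=> mD fi; rewrite /Rintegral integralE [in RHS]integralE.
have mf : measurable_fun D (EFin \o f) by case/integrableP: fi.
have ep : (\int[leb n]_(x in phi @^-1` D) ((fun x => (f (phi x))%:E)^\+)%E x =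
  c%:E * \int[leb n]_(x in D) (EFin \o f)^\+ x)%E.
 have <- := @ge0_int_scale D (EFin \o f)^\+%E mD
  (measurable_funepos mf) (fun x _ => funepos_ge0 _ x).
 by apply: eq_integral => x _; rewrite !funeposE.
have en : (\int[leb n]_(x in phi @^-1` D) ((fun x => (f (phi x))%:E)^\-)%E x =
  c%:E * \int[leb n]_(x in D) (EFin \o f)^\- x)%E.
 have <- := @ge0_int_scale D (EFin \o f)^\-%E mD
  (measurable_funeneg mf) (fun x _ => funeneg_ge0 _ x).
 by apply: eq_integral => x _; rewrite !funenegE.
rewrite ep en.
have fp := integrable_pos_fin_num mD fi; have fn := integrable_neg_fin_num mD fi.
rewrite -[X in fine (_ * X - _)%E](fineK fp) -[X in fine (_ - _ * X)%E](fineK fn).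
by rewrite -!EFinM -!EFinB/= -mulrBr; congr (_ * _); apply/esym; exact: (fineB fp fn).
Qed.

End Scale.

Section PushUnique.
Context n (phi : pt n -> pt n) (c : R) (mphi : measurable_fun setT phi) (c0 : 0 < c).
Let push := measure_function_pushforward__canonical__measure_function_Measure (leb n) mphi.
Lemma leb_pushforward_unique :
 (forall a b : pt n, (forall i, a 0 i < b 0 i) ->
  leb n (phi @^-1` obox a b) = (c * \prod_i (b 0 i - a 0 i))%:E) ->
 forall A, measurable A -> leb n (phi @^-1` A) = (c%:E * leb n A)%E.
move=> H A mA; have ci0 : 0 <= c^-1 by rewrite invr_ge0 ltW.
pose nu : {measure set (pt n) -> \bar R} :=
 mscale (NngNum ci0) push.
have nuE B : nu B = (c^-1%:E * leb n (phi @^-1` B))%E by [].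
have nuA : nu A = leb n A.
 apply: leb_unique => // a b ab; rewrite nuE H// -EFinM mulrA mulVf ?mul1r//.
 by rewrite gt_eqF.
by rewrite -nuA nuE muleA -EFinM mulfV ?gt_eqF// mul1e.
Qed.

End PushUnique.
Lemma measurable_row_add d (T : measurableType d) n (f g : T -> pt n) :
 measurable_fun setT f -> measurable_fun setT g ->
 measurable_fun setT (fun x => f x + g x).
move=> mf mg; apply: measurable_row => i; under eq_fun do rewrite mxE.
by apply: measurable_funD; apply: (measurableT_comp (measurable_coord i)).
Qed.

Lemma maffine n (x0 : pt n) (r : R) :
 measurable_fun setT (fun x : pt n => x0 + r *: x).
apply: measurable_row => i; under eq_fun do rewrite !mxE.
apply: measurable_funD => //; apply: measurable_funM => //; exact: measurable_coord.
Qed.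

Lemma leb_affine n (x0 : pt n) (r : R) A : 0 < r -> measurable A ->
 leb n ((fun x => x0 + r *: x) @^-1` A) = ((r ^- n)%:E * leb n A)%E.
move=> r0 mA; apply: leb_pushforward_unique => //.
- exact: maffine.
- by rewrite invr_gt0 exprn_gt0.
move=> a b ab.
have -> : (fun x : pt n => x0 + r *: x) @^-1` obox a b =
  obox (r^-1 *: (a - x0)) (r^-1 *: (b - x0)).
 apply/seteqP; split => x /= h i; move: (h i); rewrite !mxE /=.
  by rewrite ltr_pdivrMl// ltr_pdivlMl// => /andP[h1 h2]; apply/andP; split; lra.
 by rewrite ltr_pdivrMl// ltr_pdivlMl// => /andP[h1 h2]; apply/andP; split; lra.
rewrite leb_obox.
 congr EFin; under eq_bigr do rewrite !mxE -mulrBr.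
 rewrite big_split/= prodr_const card_ord exprVn; congr (_ * _).
 by apply: eq_bigr => i _; ring.
by move=> i; rewrite !mxE ler_pM2l ?invr_gt0// lerB// ltW.
Qed.

Lemma mtranslate n (y : pt n) : measurable_fun setT (fun x : pt n => y + x).
Proof. by apply: measurable_row_add. Qed.
Lemma leb_translate n (y : pt n) A : measurable A ->
 leb n ((fun x => y + x) @^-1` A) = leb n A.
move=> mA; have := leb_affine y ltr01 mA; rewrite expr1n invr1 mul1e => <-.
by congr (leb n _); apply/seteqP; split => x /=; rewrite scale1r.
Qed.

Lemma ge0_integral_translate n (y : pt n) (f : pt n -> \bar R) :
 measurable_fun setT f -> (forall x, (0 <= f x)%E) ->
 (\int[leb n]_x f (y + x)%R = \int[leb n]_x f x)%E.
move=> mf f0; rewrite -[X in integral _ X (fun x => f (y + x))](preimage_setT (fun x => y + x)).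
rewrite (@ge0_int_scale n (fun x => y + x) 1)// ?mul1e//.
- exact: mtranslate.
- by move=> A mA; rewrite mul1e leb_translate.
Qed.

(* Uniqueness of Haar measure: integrating [1_Q y * 1_A (phi x + y)] in both orders. *)
Lemma leb_linear n (phi psi : pt n -> pt n) :
 measurable_fun setT phi -> measurable_fun setT psi ->
 (forall x y, phi (x + y) = phi x + phi y) -> cancel phi psi -> cancel psi phi ->
 exists2 c : R, 0 < c &
  forall A, measurable A -> leb n (phi @^-1` A) = (c%:E * leb n A)%E.
move=> mphi mpsi phiD phiK psiK.
pose Q : set (pt n) := obox 0 (const_mx 1).
have mQ : measurable Q by exact: mobox.
have Q1 : leb n Q = 1%E.
 rewrite leb_obox; last by move=> i; rewrite !mxE.
 by under eq_bigr do rewrite !mxE subr0; rewrite big1.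
have mpre (f : pt n -> pt n) B : measurable_fun setT f -> measurable B -> measurable (f @^-1` B).
 by move=> mf mB; rewrite -[X in measurable X]setTI; exact: mf.
have phi0 : phi 0 = 0 by apply: (addrI (phi 0)); rewrite -phiD !addr0.
have phiN x : phi (- x) = - phi x.
 by apply: (addrI (phi x)); rewrite -phiD !subrr.
have mphiN : measurable_fun setT (fun x => - phi x).
 rewrite (_ : (fun x => - phi x) = (fun x => 0 + (-1) *: phi x)).
  exact: (measurableT_comp (maffine 0 (-1)) mphi).
 by apply/funext => x; rewrite add0r scaleN1r.
pose K := leb n [set x | Q (- phi x)].
have key A : measurable A -> leb n (phi @^-1` A) = (K * leb n A)%E.
 move=> mA.
 pose F (xy : pt n * pt n) : \bar R := (\1_Q xy.2 * \1_A (phi xy.1 + xy.2))%:E.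
 pose G (xy : pt n * pt n) : \bar R := (\1_Q (xy.2 - phi xy.1) * \1_A xy.2)%:E.
 have mF : measurable_fun setT F.
  apply/measurable_EFinP; apply: measurable_funM.
   exact: (measurableT_comp (measurable_indic _) measurable_snd).
  apply: (measurableT_comp (measurable_indic _)) => //.
  by apply: measurable_row_add => //; exact: (measurableT_comp mphi measurable_fst).
 have mG : measurable_fun setT G.
  apply/measurable_EFinP; apply: measurable_funM.
   apply: (measurableT_comp (measurable_indic _)) => //.
   by apply: measurable_row_add => //; exact: (measurableT_comp mphiN measurable_fst).
  exact: (measurableT_comp (measurable_indic _) measurable_snd).
 have F0 z : (0 <= F z)%E by rewrite lee_fin mulr_ge0.
 have G0 z : (0 <= G z)%E by rewrite lee_fin mulr_ge0.
 have E1 y : (\int[leb n]_x F (x, y) = (\1_Q y)%:E * leb n (phi @^-1` A))%E.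
  have mphiA := mpre _ _ mphi mA.
  rewrite -(leb_translate (psi y) mphiA).
  have mt : measurable ((fun x => psi y + x) @^-1` (phi @^-1` A)).
   exact: (mpre _ _ (mtranslate _)).
  have := @integral_indic _ _ _ (leb n) setT measurableT _ mt.
  rewrite setIT => <-.
  rewrite -ge0_integralZl//; last first.
   by apply/measurable_EFinP; exact: measurable_indic.
  apply: eq_integral => x _; rewrite /F /= EFinM; congr (_ * _)%E; congr EFin.
  rewrite [RHS](_ : _ = \1_A (phi (psi y + x)))//.
  by rewrite phiD psiK addrC.
 have E2 x : (\int[leb n]_y F (x, y) = \int[leb n]_y G (x, y))%E.
  rewrite -(@ge0_integral_translate _ (- phi x) (fun y => F (x, y)))//.
   apply: eq_integral => y _; rewrite /F /G /=; congr (_ * _)%:E.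
    by rewrite addrC.
   by rewrite addrA subrr add0r.
  exact: (measurableT_comp mF (measurable_pair1 _)).
 have E3 y : (\int[leb n]_x G (x, y) = (\1_A y)%:E * K)%E.
  have mKs : measurable ((fun x => - phi x) @^-1` Q) by exact: mpre.
  rewrite /K -(leb_translate (- psi y) mKs).
  have mt : measurable ((fun x => - psi y + x) @^-1` ((fun x => - phi x) @^-1` Q)).
   exact: (mpre _ _ (mtranslate _)).
  have := @integral_indic _ _ _ (leb n) setT measurableT _ mt.
  rewrite setIT => <-.
  rewrite -ge0_integralZl//; last first.
   by apply/measurable_EFinP; exact: measurable_indic.
  apply: eq_integral => x _; rewrite /G /= mulrC EFinM; congr (_ * _)%E; congr EFin.
  rewrite [RHS](_ : _ = \1_Q (- phi (- psi y + x)))//.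
  by rewrite phiD phiN psiK opprD opprK.
 have := @fubini_tonelli _ _ _ _ _ (leb n) (leb n) F mF F0.
 under eq_integral do rewrite E2.
 rewrite (@fubini_tonelli _ _ _ _ _ (leb n) (leb n) G mG G0).
 under eq_integral do rewrite E3.
 under [RHS]eq_integral do rewrite E1.
 rewrite ge0_integralZr//; last 2 first.
  by apply/measurable_EFinP; exact: measurable_indic.
  exact: measure_ge0.
 rewrite ge0_integralZr//; last first.
  by apply/measurable_EFinP; exact: measurable_indic.
 rewrite !integral_indic// !setIT => h.
 have {}h : (leb n A * K = leb n Q * leb n (phi @^-1` A))%E by exact: h.
 by rewrite muleC h Q1 mul1e.
(* The preimage under [psi] of the unit cube is sent back to the cube, whose measure is 1; hence [K]
   can be neither 0 nor infinite. *)
have := key _ (mpre _ _ mpsi mQ).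
have -> : phi @^-1` (psi @^-1` Q) = Q.
 by apply/seteqP; split => x /=; rewrite phiK.
rewrite Q1.
have K0 : (0 <= K)%E by exact: measure_ge0.
have x0 : (0 <= leb n (psi @^-1` Q))%E by exact: measure_ge0.
move: K0 x0 key; case: K => [c||] //; case: (leb n _) => [x||] //.
- move=> c0 x0 key [cx]; exists c => //.
 rewrite lt_neqAle -lee_fin c0 andbT; apply/eqP => c0'.
 by move: cx; rewrite -c0' mul0r => /eqP; rewrite oner_eq0.
- rewrite lee_fin le_eqVlt => /predU1P[<-|c0] _ _; last by rewrite gt0_muley.
 by rewrite mul0e => /eqP; rewrite onee_eq0.
- move=> _; rewrite lee_fin le_eqVlt => /predU1P[<-|c0] _; last by rewrite gt0_mulye.
 by rewrite mule0 => /eqP; rewrite onee_eq0.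
Qed.

End LebMaps.

(** * Cauchy-Schwarz and triangle inequalities for semi-definite forms *)

Section Quad.
Context {R : realType}.
(** Stated for a quadratic polynomial so that it serves the scalar and the vector inner products as
    well as the ghost penalty, which is only semi-definite. If C = 0, a linear polynomial of
    constant sign forces B = 0. *)
Lemma quad_CS (A B C : R) : 0 <= A -> 0 <= C ->
 (forall t, 0 <= A + t * B *+ 2 + t ^+ 2 * C) -> `|B| <= Num.sqrt A * Num.sqrt C.
move=> A0 C0 H.
suff h : B ^+ 2 <= A * C.
 by rewrite -sqrtrM// -sqrtr_sqr ler_sqrt// mulr_ge0.
have [C0'|C0'] := eqVneq C 0.
 have [->|B0] := eqVneq B 0; first by rewrite expr0n/= C0' mulr0.
 have := H (- (A + 1) / (2 * B)); rewrite C0' mulr0 addr0 mulr2n.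
 have -> : - (A + 1) / (2 * B) * B = - (A + 1) / 2 by field.
 lra.
have Cp : 0 < C by rewrite lt_neqAle eq_sym C0' C0.
have := H (- B / C).
have -> : A + - B / C * B *+ 2 + (- B / C) ^+ 2 * C = (A * C - B ^+ 2) / C.
 by rewrite mulr2n; field.
by rewrite pmulr_lge0 ?invr_gt0// subr_ge0.
Qed.

Lemma sqrt_triangle (A B C D : R) : 0 <= A -> 0 <= C ->
 `|B| <= Num.sqrt A * Num.sqrt C -> D = A + B *+ 2 + C ->
 Num.sqrt D <= Num.sqrt A + Num.sqrt C.
move=> A0 C0 h ->.
rewrite -[leRHS]ger0_norm ?addr_ge0// -sqrtr_sqr; apply: ler_wsqrtr.
rewrite sqrrD !sqr_sqrtr// lerD2r lerD2l lerMn2r /=.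
exact: le_trans (ler_norm _) h.
Qed.

End Quad.

(** * Square-integrable scalar functions on a measurable set *)

Section L2Theory.
Context {R : realType} {d : nat}.
Local Notation pt := 'rV[R]_d.
Local Notation mu := (leb d).
Implicit Types (S : set pt) (u v w : pt -> R) (V W : pt -> pt).
Lemma L2_integrable S u v : measurable S -> L2 S u -> L2 S v ->
 mu.-integrable S (EFin \o (fun x => u x * v x)).
move=> mS [mu1 iu] [mv iv].
have sq w : L2 S w -> mu.-integrable S (fun x => (w x ^+ 2)%:E).
 move=> [mw iw]; apply/integrableP; split.
  by apply/measurable_EFinP; exact: measurable_funX.
 by under eq_integral do rewrite gee0_abs ?lee_fin ?sqr_ge0//.
apply: (@le_integrable _ _ _ mu S mS _ (fun x => (u x ^+ 2)%:E + (v x ^+ 2)%:E)%E).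
- by apply/measurable_EFinP; exact: measurable_funM.
- move=> x _; rewrite /= lee_fin normrM [leRHS]ger0_norm ?addr_ge0 ?sqr_ge0//.
 rewrite -[u x ^+ 2]real_normK ?num_real// -[v x ^+ 2]real_normK ?num_real//.
 have := sqr_ge0 (`|u x| - `|v x|); have := sqr_ge0 (`|u x| + `|v x|).
 by rewrite !expr2; lra.
- by apply: integrableD => //; apply: sq.
Qed.

Lemma L2_sq_integrable S u : measurable S -> L2 S u ->
 mu.-integrable S (EFin \o (fun x => u x ^+ 2)).
move=> mS uS; have := L2_integrable mS uS uS.
by congr (_.-integrable _ _); apply/funext => x /=; rewrite expr2.
Qed.

Lemma L2D S u v : measurable S -> L2 S u -> L2 S v -> L2 S (fun x => u x + v x).
move=> mS uS vS; have [mu1 _] := uS; have [mv _] := vS.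
split; first exact: measurable_funD.
have /integrableP[_] := integrableD mS (integrableZl mS 2 (L2_sq_integrable mS uS))
 (integrableZl mS 2 (L2_sq_integrable mS vS)).
apply: le_lt_trans; apply: ge0_le_integral => //.
- by move=> x _; rewrite lee_fin sqr_ge0.
- by apply/measurable_EFinP; apply: measurable_funX; exact: measurable_funD.
- apply: measurableT_comp => //; apply: emeasurable_funD; apply: measurable_funeM;
  by apply/measurable_EFinP; exact: measurable_funX.
- move=> x _; rewrite [leRHS](_ : _ = `|2 * u x ^+ 2 + 2 * v x ^+ 2|%:E)// lee_fin -subr_ge0.
 apply: le_trans (_ : 2 * u x ^+ 2 + 2 * v x ^+ 2 - (u x + v x) ^+ 2 <= _).
  by have := sqr_ge0 (u x - v x); rewrite !expr2; lra.
 by rewrite lerB// ler_norm.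
Qed.

Lemma L2Z S a u : measurable S -> L2 S u -> L2 S (fun x => a * u x).
move=> mS uS; have [mu1 iu] := uS; split; first exact: measurable_funM.
under eq_integral do rewrite exprMn EFinM.
rewrite ge0_integralZl//.
- by apply: lte_mul_pinfty; rewrite ?lee_fin ?sqr_ge0.
- by apply/measurable_EFinP; exact: measurable_funX.
- by move=> x _; rewrite lee_fin sqr_ge0.
- by rewrite lee_fin sqr_ge0.
Qed.

Lemma L2_eq S u v : (forall x, S x -> u x = v x) -> L2 S u -> L2 S v.
move=> uv [mu1 iu]; split.
 by apply: eq_measurable_fun mu1 => x; rewrite inE; exact: uv.
by rewrite (eq_integral (fun x => (u x ^+ 2)%:E))// => x /set_mem Sx; rewrite uv.
Qed.

Lemma L2N S u : measurable S -> L2 S u -> L2 S (fun x => - u x).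
Proof. by move=> mS /(L2Z (-1) mS); apply: L2_eq => x _; rewrite mulN1r. Qed.
Lemma L2B S u v : measurable S -> L2 S u -> L2 S v -> L2 S (fun x => u x - v x).
Proof. by move=> mS uS vS; apply: (L2D mS uS); exact: L2N. Qed.
Lemma L20 S : L2 S (fun=> 0).
split; first exact: measurable_cst.
by under eq_integral do rewrite expr0n/=; rewrite integral0.
Qed.

Lemma L2_sum S I (r : seq I) (P : pred I) (F : I -> pt -> R) : measurable S ->
 (forall i, P i -> L2 S (F i)) -> L2 S (fun x => \sum_(i <- r | P i) F i x).
move=> mS H; elim: r => [|i r IH].
 by apply: L2_eq (L20 S) => x _; rewrite big_nil.
have [Pi|Pi] := boolP (P i).
 by apply: L2_eq (L2D mS (H i Pi) IH) => x _; rewrite big_cons Pi.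
by apply: L2_eq IH => x _; rewrite big_cons (negbTE Pi).
Qed.

Lemma ipC S u v : ip S u v = ip S v u.
Proof. by congr fine; apply: eq_integral => x _; rewrite mulrC. Qed.
Lemma eq_ip S u v u' v' : (forall x, S x -> u x = u' x) -> (forall x, S x -> v x = v' x) ->
 ip S u v = ip S u' v'.
Proof. by move=> h k; apply: eq_Rintegral => x /set_mem Sx; rewrite h// k. Qed.
Lemma ipDl S u v w : measurable S -> L2 S u -> L2 S v -> L2 S w ->
 ip S (fun x => u x + v x) w = ip S u w + ip S v w.
move=> mS uS vS wS; rewrite -RintegralD//; try exact: L2_integrable.
by apply: eq_Rintegral => x _; rewrite mulrDl.
Qed.

Lemma ipZl S a u w : measurable S -> L2 S u -> L2 S w ->
 ip S (fun x => a * u x) w = a * ip S u w.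
move=> mS uS wS; rewrite -RintegralZl//; last exact: L2_integrable.
by apply: eq_Rintegral => x _; rewrite mulrA.
Qed.

Lemma ipNl S u w : measurable S -> L2 S u -> L2 S w ->
 ip S (fun x => - u x) w = - ip S u w.
move=> mS uS wS; rewrite -mulN1r -ipZl//.
by apply: eq_ip => x _ //; rewrite mulN1r.
Qed.

Lemma ipBl S u v w : measurable S -> L2 S u -> L2 S v -> L2 S w ->
 ip S (fun x => u x - v x) w = ip S u w - ip S v w.
Proof. by move=> mS uS vS wS; rewrite ipDl ?ipNl//; exact: L2N. Qed.
Lemma ipDr S u v w : measurable S -> L2 S u -> L2 S v -> L2 S w ->
 ip S w (fun x => u x + v x) = ip S w u + ip S w v.
Proof. by move=> *; rewrite ipC ipDl// !(ipC S w). Qed.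
Lemma ipZr S a u w : measurable S -> L2 S u -> L2 S w ->
 ip S w (fun x => a * u x) = a * ip S w u.
Proof. by move=> *; rewrite ipC ipZl// ipC. Qed.
Lemma ipBr S u v w : measurable S -> L2 S u -> L2 S v -> L2 S w ->
 ip S w (fun x => u x - v x) = ip S w u - ip S w v.
Proof. by move=> *; rewrite ipC ipBl// !(ipC S w). Qed.
Lemma ip0l S w : ip S (fun=> 0) w = 0.
rewrite /ip /Rintegral; under eq_integral do rewrite mul0r.
by rewrite integral0.
Qed.

Lemma ip0r S w : ip S w (fun=> 0) = 0.
Proof. by rewrite ipC ip0l. Qed.
Lemma ip_suml S I (r : seq I) (P : pred I) (F : I -> pt -> R) w : measurable S ->
 (forall i, P i -> L2 S (F i)) -> L2 S w ->
 ip S (fun x => \sum_(i <- r | P i) F i x) w = \sum_(i <- r | P i) ip S (F i) w.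
move=> mS H wS; elim: r => [|i r IH].
 rewrite big_nil -[RHS](ip0l S w); apply: eq_ip => x _ //; by rewrite big_nil.
rewrite big_cons; have [Pi|Pi] := boolP (P i).
 rewrite -IH -ipDl//; [|exact: H|exact: L2_sum].
 by apply: eq_ip => x _ //; rewrite big_cons Pi.
by rewrite -IH; apply: eq_ip => x _ //; rewrite big_cons (negbTE Pi).
Qed.

Lemma ip_ge0 S u : 0 <= ip S u u.
Proof. by apply: Rintegral_ge0 => x _; rewrite -expr2 sqr_ge0. Qed.
Lemma nrm_ge0 S u : 0 <= nrm S u. Proof. exact: sqrtr_ge0. Qed.
Lemma nrm_sq S u : nrm S u ^+ 2 = ip S u u.
Proof. by rewrite sqr_sqrtr// ip_ge0. Qed.
Lemma ip_CS S u v : measurable S -> L2 S u -> L2 S v ->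
 `|ip S u v| <= nrm S u * nrm S v.
move=> mS uS vS; apply: quad_CS; try exact: ip_ge0.
move=> t; have vt := L2Z t mS vS.
have := ip_ge0 S (fun x => u x + t * v x).
rewrite ipDl//; last exact: L2D.
rewrite !ipDr// !ipZr// !ipZl// (ipC S v u) mulr2n.
by congr (0 <= _); ring.
Qed.

Lemma nrmD S u v : measurable S -> L2 S u -> L2 S v ->
 nrm S (fun x => u x + v x) <= nrm S u + nrm S v.
move=> mS uS vS; apply: sqrt_triangle (ip_CS mS uS vS) _; try exact: ip_ge0.
rewrite ipDl//; last exact: L2D.
by rewrite !ipDr// (ipC S v u) mulr2n; ring.
Qed.

Lemma nrmN S u : nrm S (fun x => - u x) = nrm S u.
Proof. by congr Num.sqrt; congr fine; apply: eq_integral => x _; rewrite mulrNN. Qed.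
Lemma nrmB S u v : measurable S -> L2 S u -> L2 S v ->
 nrm S (fun x => u x - v x) <= nrm S u + nrm S v.
Proof. by move=> mS uS vS; rewrite -(nrmN S v); apply: nrmD => //; exact: L2N. Qed.
Lemma eq_nrm S u v : (forall x, S x -> u x = v x) -> nrm S u = nrm S v.
Proof. by move=> h; congr Num.sqrt; apply: eq_ip. Qed.
Lemma nrm0 S : nrm S (fun=> 0) = 0.
Proof. by rewrite /nrm ip0l sqrtr0. Qed.
Lemma L2_sub S S' u : measurable S -> measurable S' -> S `<=` S' -> L2 S' u -> L2 S u.
move=> mS mS' SS' [mu1 iu]; split; first exact: measurable_funS mu1.
apply: le_lt_trans iu; apply: ge0_subset_integral => //.
- by apply/measurable_EFinP; exact: measurable_funX.
- by move=> x _; rewrite lee_fin sqr_ge0.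
Qed.

Lemma nrm_sub S S' u : measurable S -> measurable S' -> S `<=` S' -> L2 S' u ->
 nrm S u <= nrm S' u.
move=> mS mS' SS' uS'; apply: ler_wsqrtr.
have uS := L2_sub mS mS' SS' uS'.
apply: fine_le.
- by apply: (integrable_fin_num mS); exact: L2_integrable.
- by apply: (integrable_fin_num mS'); exact: L2_integrable.
- apply: ge0_subset_integral => //.
  by have /integrableP[] := L2_integrable mS' uS' uS'.
 by move=> x _; rewrite lee_fin -expr2 sqr_ge0.
Qed.

Lemma nrm_le S u v : measurable S -> L2 S u -> L2 S v ->
 (forall x, S x -> `|u x| <= `|v x|) -> nrm S u <= nrm S v.
move=> mS uS vS uv; apply: ler_wsqrtr; apply: le_Rintegral => //; try exact: L2_integrable.
move=> x Sx; rewrite -!expr2 -(real_normK (num_real (u x))) -(real_normK (num_real (v x))).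
by rewrite ler_sqr ?nnegrE// uv.
Qed.

Lemma eq_ip_ae S u v w : measurable S -> L2 S u -> L2 S v -> L2 S w ->
 {ae mu, forall x, S x -> u x = v x} -> ip S u w = ip S v w.
move=> mS uS vS wS [N [mN N0 sub]]; congr fine; apply: ae_eq_integral => //.
- by have /integrableP[] := L2_integrable mS uS wS.
- by have /integrableP[] := L2_integrable mS vS wS.
- exists N; split => // x /= h; apply: sub => /= k; apply: h => Sx.
 by rewrite k.
Qed.

Lemma eq_nrm_ae S u v : measurable S -> L2 S u -> L2 S v ->
 {ae mu, forall x, S x -> u x = v x} -> nrm S u = nrm S v.
move=> mS uS vS uv; congr Num.sqrt.
by rewrite (eq_ip_ae mS uS vS uS uv) ipC (eq_ip_ae mS uS vS vS uv).
Qed.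

Lemma nrm0_ae S u : measurable S -> L2 S u -> nrm S u = 0 ->
 {ae mu, forall x, S x -> u x = 0}.
move=> mS uS /eqP; rewrite sqrtr_eq0 => h.
have /(integrable_fin_num mS) fi := L2_integrable mS uS uS.
have h0 : (\int[mu]_(x in S) `|(u x * u x)%:E| = 0)%E.
 under eq_integral do rewrite gee0_abs ?lee_fin -?expr2 ?sqr_ge0//.
 apply/eqP; rewrite eq_le; apply/andP; split; last first.
  by apply: integral_ge0 => x _; rewrite lee_fin sqr_ge0.
 move: h fi; rewrite /ip /Rintegral; case: (integral _ _ _) => //.
have mm : measurable_fun S (fun x => (u x * u x)%:E).
 by have /integrableP[] := L2_integrable mS uS uS.
have [N [mN N0 sub]] := (ae_eq_integral_abs mu mS mm).1 h0.
exists N; split => // x /= h'; apply: sub => /= k; apply: h' => Sx.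
by have := k Sx => -[] /eqP; rewrite mulf_eq0 orbb => /eqP.
Qed.

Lemma nrm_setU S S' u : measurable S -> measurable S' -> [disjoint S & S'] ->
 L2 (S `|` S') u -> nrm (S `|` S') u ^+ 2 = nrm S u ^+ 2 + nrm S' u ^+ 2.
move=> mS mS' dSS uS; rewrite !nrm_sq; apply: Rintegral_setU => //.
by apply: L2_integrable => //; exact: measurableU.
Qed.

Lemma ip_setU S S' u v : measurable S -> measurable S' -> [disjoint S & S'] ->
 L2 (S `|` S') u -> L2 (S `|` S') v -> ip (S `|` S') u v = ip S u v + ip S' u v.
move=> mS mS' dSS uS vS; apply: Rintegral_setU => //.
by apply: L2_integrable => //; exact: measurableU.
Qed.

Lemma ip_mkcond S S' u v : S `<=` S' -> (forall x, S' x -> ~ S x -> u x * v x = 0) ->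
 ip S u v = ip S' u v.
move=> SS' h; rewrite /ip Rintegral_mkcond [in RHS]Rintegral_mkcond.
apply: eq_Rintegral => x _; rewrite !patchE.
case: ifPn => [/set_mem Sx|/negP nS].
 by rewrite mem_set//; exact: SS'.
by case: ifPn => // /set_mem S'x; rewrite h// => /mem_set.
Qed.

Lemma bounded_L2 S u M : measurable S -> (mu S < +oo)%E -> measurable_fun S u ->
 (forall x, S x -> `|u x| <= M) -> L2 S u.
move=> mS Soo mu1 uM; split => //.
apply: (@le_lt_trans _ _ (\int[mu]_(x in S) (M ^+ 2)%:E)%E).
 apply: ge0_le_integral => //.
 - by move=> x _; rewrite lee_fin sqr_ge0.
 - by apply/measurable_EFinP; exact: measurable_funX.
 - move=> x Sx; rewrite lee_fin -(real_normK (num_real (u x))) ler_sqr ?nnegrE//.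
   exact: uM.
  exact: le_trans (normr_ge0 _) (uM x Sx).
by rewrite integral_cst// lte_mul_pinfty// lee_fin sqr_ge0.
Qed.

Lemma nrm_bounded S u M : measurable S -> (mu S < +oo)%E -> measurable_fun S u ->
 (forall x, S x -> `|u x| <= M) -> nrm S u ^+ 2 <= M ^+ 2 * fine (mu S).
move=> mS Soo mu1 uM; have uS := bounded_L2 mS Soo mu1 uM.
rewrite nrm_sq; have <- : \int[mu]_(x in S) (M ^+ 2) = M ^+ 2 * fine (mu S).
 by rewrite Rintegral_cst.
apply: le_Rintegral => //; first exact: L2_integrable.
 have : L2 S (fun=> M) by apply: (@bounded_L2 _ _ `|M|).
 by move=> MS; have := L2_sq_integrable mS MS.
move=> x Sx; rewrite -expr2 -(real_normK (num_real (u x))) ler_sqr ?nnegrE//.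
 exact: uM.
exact: le_trans (normr_ge0 _) (uM x Sx).
Qed.

End L2Theory.

(** * Square-integrable vector fields *)

Section L2Vec.
Context {R : realType} {d : nat}.
Local Notation pt := 'rV[R]_d.
Local Notation mu := (leb d).
Implicit Types (S : set pt) (V W X : pt -> pt).
Lemma L2vD S V W : measurable S -> L2v S V -> L2v S W -> L2v S (fun x => V x + W x).
by move=> mS VS WS i; apply: L2_eq (L2D mS (VS i) (WS i)) => x _; rewrite /vcoord mxE.
Qed.

Lemma L2vZ S a V : measurable S -> L2v S V -> L2v S (fun x => a *: V x).
Proof. by move=> mS VS i; apply: L2_eq (L2Z a mS (VS i)) => x _; rewrite /vcoord mxE. Qed.
Lemma L2vN S V : measurable S -> L2v S V -> L2v S (fun x => - V x).
Proof. by move=> mS VS i; apply: L2_eq (L2N mS (VS i)) => x _; rewrite /vcoord mxE. Qed.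
Lemma L2vB S V W : measurable S -> L2v S V -> L2v S W -> L2v S (fun x => V x - W x).
Proof. by move=> mS VS WS; apply: L2vD => //; exact: L2vN. Qed.
Lemma L2v_sub S S' V : measurable S -> measurable S' -> S `<=` S' -> L2v S' V -> L2v S V.
Proof. by move=> mS mS' SS' VS i; exact: L2_sub (VS i). Qed.
Lemma ipvC S V W : ipv S V W = ipv S W V.
Proof. by apply: eq_bigr => i _; exact: ipC. Qed.
Lemma eq_ipv S V W V' W' : (forall x, S x -> V x = V' x) -> (forall x, S x -> W x = W' x) ->
 ipv S V W = ipv S V' W'.
move=> h k; apply: eq_bigr => i _.
by apply: eq_ip => x Sx; rewrite /vcoord (h,k).
Qed.

Lemma ipvDl S V W X : measurable S -> L2v S V -> L2v S W -> L2v S X ->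
 ipv S (fun x => V x + W x) X = ipv S V X + ipv S W X.
move=> mS VS WS XS; rewrite -big_split/=; apply: eq_bigr => i _.
rewrite -ipDl//; try exact: VS; try exact: WS; try exact: XS.
by apply: eq_ip => x _ //; rewrite /vcoord mxE.
Qed.

Lemma ipvZl S a V X : measurable S -> L2v S V -> L2v S X ->
 ipv S (fun x => a *: V x) X = a * ipv S V X.
move=> mS VS XS; rewrite mulr_sumr; apply: eq_bigr => i _.
rewrite -ipZl//; try exact: VS; try exact: XS.
by apply: eq_ip => x _ //; rewrite /vcoord mxE.
Qed.

Lemma ipvNl S V X : measurable S -> L2v S V -> L2v S X ->
 ipv S (fun x => - V x) X = - ipv S V X.
move=> mS VS XS; rewrite -mulN1r -ipvZl//.
by apply: eq_ipv => x _ //; rewrite scaleN1r.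
Qed.

Lemma ipvBl S V W X : measurable S -> L2v S V -> L2v S W -> L2v S X ->
 ipv S (fun x => V x - W x) X = ipv S V X - ipv S W X.
Proof. by move=> *; rewrite ipvDl// ?ipvNl//; exact: L2vN. Qed.
Lemma ipvDr S V W X : measurable S -> L2v S V -> L2v S W -> L2v S X ->
 ipv S X (fun x => V x + W x) = ipv S X V + ipv S X W.
Proof. by move=> *; rewrite ipvC ipvDl// !(ipvC S X). Qed.
Lemma ipvZr S a V X : measurable S -> L2v S V -> L2v S X ->
 ipv S X (fun x => a *: V x) = a * ipv S X V.
Proof. by move=> *; rewrite ipvC ipvZl// ipvC. Qed.
Lemma ipvBr S V W X : measurable S -> L2v S V -> L2v S W -> L2v S X ->
 ipv S X (fun x => V x - W x) = ipv S X V - ipv S X W.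
Proof. by move=> *; rewrite ipvC ipvBl// !(ipvC S X). Qed.
Lemma ipv_ge0 S V : 0 <= ipv S V V.
Proof. by apply: sumr_ge0 => i _; exact: ip_ge0. Qed.
Lemma nrmv_ge0 S V : 0 <= nrmv S V. Proof. exact: sqrtr_ge0. Qed.
Lemma nrmv_sq S V : nrmv S V ^+ 2 = ipv S V V.
Proof. by rewrite sqr_sqrtr// ipv_ge0. Qed.
Lemma nrmv_sqE S V : nrmv S V ^+ 2 = \sum_i nrm S (vcoord V i) ^+ 2.
Proof. by rewrite nrmv_sq; apply: eq_bigr => i _; rewrite nrm_sq. Qed.
Lemma nrm_vcoord S V i : nrm S (vcoord V i) <= nrmv S V.
rewrite -(@ler_sqr _ (nrm _ _)) ?nnegrE ?nrm_ge0 ?nrmv_ge0// nrmv_sqE (bigD1 i)//=.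
by rewrite lerDl sumr_ge0// => j _; rewrite sqr_ge0.
Qed.

Lemma ipv_CS S V W : measurable S -> L2v S V -> L2v S W ->
 `|ipv S V W| <= nrmv S V * nrmv S W.
move=> mS VS WS; apply: quad_CS; try exact: ipv_ge0.
move=> t; have Wt := L2vZ t mS WS.
have := ipv_ge0 S (fun x => V x + t *: W x).
rewrite ipvDl//; last exact: L2vD.
rewrite !ipvDr// !ipvZr// !ipvZl// (ipvC S W V) mulr2n.
by congr (0 <= _); ring.
Qed.

Lemma nrmvD S V W : measurable S -> L2v S V -> L2v S W ->
 nrmv S (fun x => V x + W x) <= nrmv S V + nrmv S W.
move=> mS VS WS; apply: sqrt_triangle (ipv_CS mS VS WS) _; try exact: ipv_ge0.
rewrite ipvDl//; last exact: L2vD.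
by rewrite !ipvDr// (ipvC S W V) mulr2n; ring.
Qed.

Lemma nrmvN S V : nrmv S (fun x => - V x) = nrmv S V.
congr Num.sqrt; apply: eq_bigr => i _; congr fine; apply: eq_integral => x _.
by rewrite /vcoord mxE mulrNN.
Qed.

Lemma nrmvB S V W : measurable S -> L2v S V -> L2v S W ->
 nrmv S (fun x => V x - W x) <= nrmv S V + nrmv S W.
Proof. by move=> mS VS WS; rewrite -(nrmvN S W); apply: nrmvD => //; exact: L2vN. Qed.
Lemma nrmv_sub S S' V : measurable S -> measurable S' -> S `<=` S' -> L2v S' V ->
 nrmv S V <= nrmv S' V.
move=> mS mS' SS' VS'; rewrite -(@ler_sqr _ (nrmv _ _)) ?nnegrE ?nrmv_ge0// !nrmv_sqE.
apply: ler_sum => i _; rewrite ler_sqr ?nnegrE ?nrm_ge0//.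
exact: nrm_sub (VS' i).
Qed.

Lemma eq_ipv_ae S V W X : measurable S -> L2v S V -> L2v S W -> L2v S X ->
 {ae mu, forall x, S x -> V x = W x} -> ipv S V X = ipv S W X.
move=> mS VS WS XS [N [mN N0 sub]]; apply: eq_bigr => i _.
apply: eq_ip_ae => //; try exact: VS; try exact: WS; try exact: XS.
exists N; split => // x /= h; apply: sub => /= k; apply: h => Sx.
by rewrite /vcoord k.
Qed.

Lemma eq_nrmv_ae S V W : measurable S -> L2v S V -> L2v S W ->
 {ae mu, forall x, S x -> V x = W x} -> nrmv S V = nrmv S W.
move=> mS VS WS VW; congr Num.sqrt.
by rewrite (eq_ipv_ae mS VS WS VS VW) ipvC (eq_ipv_ae mS VS WS WS VW).
Qed.

End L2Vec.

(** * Smooth functions of one variable and the smooth step *)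

Section Smooth1.
Context {R : realType}.
Implicit Types (f g : R -> R).
Definition smooth1 f := forall n x, derivable ((derive1n (n) f)) x 1.
(** The bound on the order makes products, inverses and affine substitutions accessible to
    induction: their derivative formulas contain the original functions again, one order less being
    asked of them. *)
Definition smoothN N f := forall n x, (n <= N)%N -> derivable ((derive1n (n) f)) x 1.
Lemma derive1SnE f n : (derive1n (n.+1) f) = derive1n n (derive1 f).
Proof. by rewrite derive1Sn. Qed.
Lemma smoothNS N f : smoothN N.+1 f <->
 (forall x, derivable f x 1) /\ smoothN N ((derive1 f)).
split=> [h|[h0 h]].
 split; first by move=> x; exact: (h 0%N).
 by move=> n x nN; have := h n.+1 x nN; rewrite derive1SnE.
by case=> [|n] x nN; [exact: h0|rewrite derive1SnE; exact: h].
Qed.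

Lemma smoothN_le N M f : (M <= N)%N -> smoothN N f -> smoothN M f.
Proof. by move=> MN h n x nM; apply: h; exact: leq_trans MN. Qed.
Lemma smooth1_uptoD N f g : smoothN N f -> smoothN N g ->
 smoothN N (fun x => f x + g x).
elim: N f g => [|N IH] f g.
 move=> hf hg [|//] x _; apply: derivableD; [exact: (hf 0%N)|exact: (hg 0%N)].
move=> /smoothNS[f0 fN] /smoothNS[g0 gN]; apply/smoothNS; split.
 by move=> x; apply: derivableD.
have -> : derive1 (fun x => f x + g x) = (fun x => derive1 f x + derive1 g x).
 by apply/funext => x; rewrite !derive1E deriveD.
exact: IH.
Qed.

Lemma smoothNM N f g : smoothN N f -> smoothN N g ->
 smoothN N (fun x => f x * g x).
elim: N f g => [|N IH] f g.
 move=> hf hg [|//] x _; apply: derivableM; [exact: (hf 0%N)|exact: (hg 0%N)].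
move=> hf hg; have /smoothNS[f0 fN] := hf; have /smoothNS[g0 gN] := hg.
apply/smoothNS; split.
 by move=> x; apply: derivableM.
have -> : derive1 (fun x => f x * g x) = (fun x => f x * derive1 g x + derive1 f x * g x).
 by apply/funext => x; rewrite !derive1E deriveM// [in RHS](mulrC _ (g x)).
have hf' := smoothN_le (leqnSn N) hf; have hg' := smoothN_le (leqnSn N) hg.
exact: (smooth1_uptoD (IH _ _ hf' gN) (IH _ _ fN hg')).
Qed.

Lemma smooth1_uptoC N (c : R) : smoothN N (fun=> c).
elim: N c => [|N IH] c; first by move=> [|//] x _; exact: derivable_cst.
apply/smoothNS; split; first by move=> x; exact: derivable_cst.
have -> : derive1 (fun=> c) = (fun=> 0) :> (R -> R).
 by apply/funext => x; rewrite derive1E derive_cst.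
exact: IH.
Qed.

Lemma smoothN_comp N f (a b : R) : smoothN N f ->
 smoothN N (fun x => f (a * x + b)).
have H g (x : R) : (forall x, derivable g x 1) ->
  is_derive x 1 (fun x => g (a * x + b)) (a * derive1 g (a * x + b)).
 move=> dg; have h1 : is_derive x 1 (fun x => a * x + b) a.
  apply: is_derive_eq; by rewrite /GRing.scale/=; ring.
 have h2 : is_derive (a * x + b) 1 g (derive1 g (a * x + b)).
  by rewrite derive1E; apply/derivableP.
 by have := @is_derive1_comp _ g (fun x => a * x + b) x _ _ h2 h1; rewrite mulrC.
elim: N f => [|N IH] f.
 by move=> hf [|//] x _; have [] := H f x (fun y => hf 0%N y isT).
move=> /smoothNS[f0 fN]; apply/smoothNS; split.
 by move=> x; have [] := H f x f0.
have -> : derive1 (fun x => f (a * x + b)) = (fun x => a * derive1 f (a * x + b)).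
 by apply/funext => x; rewrite derive1E; have [_ ->] := H f x f0.
by apply: smoothNM; [exact: smooth1_uptoC|exact: IH].
Qed.

Lemma smoothNV N f : (forall x, f x != 0) -> smoothN N f ->
 smoothN N (fun x => (f x)^-1).
move=> fn0.
have H x : derivable f x 1 -> is_derive x 1 (fun x => (f x)^-1) (- (f x ^- 2) * derive1 f x).
 move=> df; rewrite derive1E.
 have := @is_deriveV _ f x _ 1 (fn0 x) (derivableP df).
 by rewrite /GRing.scale.
elim: N => [|N IH] hf.
 by move=> [|//] x _; have [] := H x (hf 0%N x isT).
have /smoothNS[f0 fN] := hf.
apply/smoothNS; split; first by move=> x; have [] := H x (f0 x).
have -> : derive1 (fun x => (f x)^-1) = (fun x => -1 * ((f x)^-1 * (f x)^-1) * derive1 f x).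
 apply/funext => x; rewrite derive1E; have [_ ->] := H x (f0 x).
 by rewrite mulN1r -exprVn expr2.
have hN := IH (smoothN_le (leqnSn _) hf).
apply: smoothNM => //; apply: smoothNM; first exact: smooth1_uptoC.
exact: smoothNM.
Qed.

Lemma smooth1P f : smooth1 f <-> forall N, smoothN N f.
Proof. by split=> [h N n x _|h n x]; [exact: h|exact: (h n)]. Qed.
Lemma smooth1D f g : smooth1 f -> smooth1 g -> smooth1 (fun x => f x + g x).
Proof. by move=> /smooth1P hf /smooth1P hg; apply/smooth1P => N; exact: smooth1_uptoD. Qed.
Lemma smooth1M f g : smooth1 f -> smooth1 g -> smooth1 (fun x => f x * g x).
Proof. by move=> /smooth1P hf /smooth1P hg; apply/smooth1P => N; exact: smoothNM. Qed.
Lemma smooth1C (c : R) : smooth1 (fun=> c).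
Proof. by apply/smooth1P => N; exact: smooth1_uptoC. Qed.
Lemma smooth1_comp f (a b : R) : smooth1 f -> smooth1 (fun x => f (a * x + b)).
Proof. by move=> /smooth1P hf; apply/smooth1P => N; exact: smoothN_comp. Qed.
Lemma smooth1V f : (forall x, f x != 0) -> smooth1 f -> smooth1 (fun x => (f x)^-1).
Proof. by move=> h /smooth1P hf; apply/smooth1P => N; exact: smoothNV. Qed.
Lemma smooth1_id : smooth1 id.
case=> [|n] x; first exact: derivable_id.
rewrite derive1SnE; have -> : derive1 (@id R) = fun=> 1.
 by apply/funext => y; rewrite derive1E derive_id.
exact: smooth1C.
Qed.

Lemma smooth1X f n : smooth1 f -> smooth1 (fun x => f x ^+ n).
move=> hf; elim: n => [|n IH].
 rewrite (_ : (fun x => _) = fun=> 1); first exact: smooth1C.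
 by apply/funext => x; rewrite expr0.
rewrite (_ : (fun x => _) = (fun x => f x * f x ^+ n)); first exact: smooth1M.
by apply/funext => x; rewrite exprS.
Qed.

Lemma smooth1_derive f : smooth1 f -> smooth1 (derive1 f).
Proof. by move=> h n x; rewrite -derive1SnE; exact: h. Qed.
Lemma smooth1_derivable f x : smooth1 f -> derivable f x 1.
Proof. by move=> h; exact: (h 0%N). Qed.
Lemma smooth1_continuous f : smooth1 f -> continuous f.
Proof. by move=> h x; apply/differentiable_continuous/derivable1_diffP; exact: smooth1_derivable. Qed.
(** The case [n] = 0 is the classical exp(-1/t). The powers of 1/t make the family closed under
    differentiation up to linear combinations, which yields derivatives of all orders at once. *)
Definition flat n (t : R) : R := if 0 < t then t^-1 ^+ n * expR (- t^-1) else 0.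
Lemma flat_ge0 n t : 0 <= flat n t.
rewrite /flat; case: ifP => // t0.
by rewrite mulr_ge0 ?expR_ge0// exprn_ge0// invr_ge0 ltW.
Qed.

Lemma flat_gt0 n t : 0 < t -> 0 < flat n t.
Proof. by move=> t0; rewrite /flat t0 mulr_gt0 ?expR_gt0// exprn_gt0// invr_gt0. Qed.
(** With s = 1/t and m = n + 2, raise 1 + s/m <= exp(s/m) to the power m. The quadratic decay at 0
    is what makes the difference quotients of [flat n] tend to 0 there. *)
Lemma flat_le n : exists C : R, forall t, 0 < t -> flat n t <= C * t ^+ 2.
exists (n.+2%:R ^+ n.+2) => t t0.
rewrite /flat t0.
have ti : 0 < t^-1 by rewrite invr_gt0.
have nn : 0 < n.+2%:R :> R by rewrite ltr0n.
have h : (t^-1 / n.+2%:R) ^+ n.+2 <= expR (t^-1).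
 have -> : expR (t^-1) = (expR (t^-1 / n.+2%:R)) ^+ n.+2.
  by rewrite -expRM_natl; congr expR; rewrite mulrC divfK// gt_eqF.
 apply: lerXn2r; rewrite ?nnegrE ?expR_ge0 ?divr_ge0//; first exact: ltW.
 by rewrite (le_trans _ (expR_ge1Dx _))// lerDr.
rewrite expRN ler_pdivrMr ?expR_gt0//.
apply: le_trans (_ : n.+2%:R ^+ n.+2 * t ^+ 2 * (t^-1 / n.+2%:R) ^+ n.+2 <= _).
 rewrite expr_div_n [_ * t ^+ 2]mulrC -mulrA [X in _ * X]mulrC divfK; last first.
  by rewrite expf_neq0// gt_eqF.
 have -> : t^-1 ^+ n.+2 = t^-1 ^+ 2 * t^-1 ^+ n by rewrite -exprD.
 by rewrite mulrA -exprMn divff ?gt_eqF// expr1n mul1r.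
by rewrite ler_wpM2l// mulr_ge0// ?exprn_ge0// ltW.
Qed.

Lemma flat_derive n (t : R) :
 is_derive t 1 (flat n) (flat n.+2 t - n%:R * flat n.+1 t).
have [t0|t0|->] := ltgtP t 0.
- have E : \forall x \near t, cst (0 : R) x = flat n x.
  near=> x; rewrite /flat ltNge (_ : x <= 0)//.
  have : x \in `]-oo, 0[ by near: x; apply: near_in_itvNyo; rewrite in_itv.
  by rewrite in_itv/= => /ltW.
 rewrite [X in is_derive _ _ _ X](_ : _ = 0).
  by apply: (near_eq_is_derive E); exact: is_derive_cst.
 by rewrite /flat ltNge ltW//= mulr0 subr0.
- pose F (s : R) := s ^+ n * expR (- s).
 have E : \forall x \near t, F (x^-1) = flat n x.
  near=> x; rewrite /flat (_ : 0 < x)//.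
  have : x \in `]0, +oo[ by near: x; apply: near_in_itvoy; rewrite in_itv/= t0.
  by rewrite in_itv/= andbT.
 apply: (near_eq_is_derive E).
 have dV : is_derive t 1 (fun x : R => x^-1) (- (t ^- 2)).
  apply: is_derive_eq (@is_deriveV _ id t 1 1 (lt0r_neq0 t0) (is_derive_id t 1)) _.
  by rewrite /GRing.scale /= mulr1.
 have dF : is_derive (t^-1) 1 F
   (t^-1 ^+ n * - expR (- t^-1) + (n%:R * t^-1 ^+ n.-1) * expR (- t^-1)).
  have dN : is_derive (t^-1) 1 (fun s : R => - s) (-1).
   exact: is_deriveN.
  have dE := @is_derive1_comp _ expR (fun s => - s) _ _ _ (is_derive_expR (- t^-1)) dN.
  have dX := @is_deriveX _ _ (@id R) n (t^-1) 1 1 (is_derive_id _ _).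
  have FE : F = ((@id R) ^+ n * (expR \o (fun s => - s))).
   by apply/funext => s; rewrite /F !fctE.
  rewrite FE; apply: is_derive_eq (is_deriveM dX dE) _.
  by rewrite !fctE /GRing.scale /=; ring.
 apply: is_derive_eq (@is_derive1_comp _ F (fun x => x^-1) t _ _ dF dV) _.
 rewrite /flat t0; case: n {E F dF} => [|n] /=.
  by rewrite expr0 -exprVn; ring.
 by rewrite -exprVn !exprS; ring.
- have f0 m : flat m 0 = 0 by rewrite /flat ltxx.
 rewrite !f0 mulr0 subr0.
 have [C HC] := flat_le n.
 have C0 : 0 <= C.
  by have := le_trans (flat_ge0 n 1) (HC 1 ltr01); rewrite expr1n mulr1.
 suff h : (fun h : R => h^-1 *: (flat n (h *: 1 + 0) - flat n 0)) @ 0^' --> (0 : R).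
  by apply: DeriveDef; [apply/cvg_ex; exists 0; exact: h|exact: cvg_lim h].
 apply/cvgrPdist_le => e e0; near=> h.
 rewrite sub0r normrN f0 subr0 addr0 [h *: 1]mulr1 /GRing.scale /= normrM normfV.
 have hn0 : h != 0 by near: h; exact: nbhs_dnbhs_neq.
 have hh : 0 < `|h| by rewrite normr_gt0.
 rewrite mulrC ler_pdivrMr// ger0_norm ?flat_ge0//.
 have [hp|hp] := ltP 0 h; last first.
  by rewrite /flat ltNge hp /= mulr_ge0// ltW.
 apply: (le_trans (HC _ hp)); rewrite expr2 mulrA gtr0_norm//; apply: ler_wpM2r; first exact: ltW.
 have : `|h| <= e / (C + 1).
  near: h; apply: dnbhs0_le; rewrite divr_gt0// ltr_wpDl//.
 rewrite gtr0_norm// ler_pdivlMr ?ltr_wpDl// => k.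
 by apply: le_trans k; rewrite mulrC; apply: ler_wpM2l; [exact: ltW|rewrite lerDl].
Unshelve. all: by end_near.
Qed.

Lemma smooth1_flat n : smooth1 (flat n).
apply/smooth1P => N; elim: N n => [|N IH] n.
 by move=> [|//] x _; have [] := flat_derive n x.
apply/smoothNS; split; first by move=> x; have [] := flat_derive n x.
have -> : derive1 (flat n) = (fun x => flat n.+2 x + (- n%:R) * flat n.+1 x).
 by apply/funext => x; rewrite derive1E; have [_ ->] := flat_derive n x; rewrite mulNr.
by apply: smooth1_uptoD => //; apply: smoothNM => //; exact: smooth1_uptoC.
Qed.

(** Smooth transition from 0 for t <= 0 to 1 for t >= 1. The denominator is positive because t and 1
    - t are never both nonpositive. *)
Definition step (t : R) : R := flat 0 t / (flat 0 t + flat 0 (1 - t)).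
Lemma step_den t : 0 < flat 0 t + flat 0 (1 - t).
have [t0|t0] := ltP 0 t; first by rewrite ltr_pwDl ?flat_gt0 ?flat_ge0.
by rewrite ltr_pwDr ?flat_ge0// flat_gt0// subr_gt0 (le_lt_trans t0).
Qed.

Lemma smooth1_step : smooth1 step.
apply: smooth1M; first exact: smooth1_flat.
apply: smooth1V; first by move=> x; rewrite gt_eqF// step_den.
apply: smooth1D; first exact: smooth1_flat.
rewrite (_ : (fun x => _) = (fun x => flat 0 ((-1) * x + 1))).
 by apply: smooth1_comp; exact: smooth1_flat.
by apply/funext => x; rewrite mulN1r addrC.
Qed.

Lemma step_ge0 t : 0 <= step t.
Proof. by rewrite divr_ge0 ?flat_ge0// ltW// step_den. Qed.
Lemma step_le1 t : step t <= 1.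
Proof. by rewrite ler_pdivrMr ?step_den// mul1r lerDl flat_ge0. Qed.
Lemma step0 t : t <= 0 -> step t = 0.
Proof. by move=> t0; rewrite /step {1}/flat ltNge t0 mul0r. Qed.
Lemma step1 t : 1 <= t -> step t = 1.
move=> t1; rewrite /step (_ : flat 0 (1 - t) = 0) ?addr0; last first.
 by rewrite /flat ltNge subr_le0 t1.
by rewrite divff// gt_eqF// flat_gt0// (lt_le_trans ltr01).
Qed.

Lemma step_gt0 t : 0 < t -> 0 < step t.
Proof. by move=> t0; rewrite divr_gt0 ?flat_gt0// step_den. Qed.
End Smooth1.

(** * Partial derivatives, difference quotients and translations *)

Section Partial.
Context {R : realType} {d : nat}.
Local Notation pt := 'rV[R]_d.
Local Notation mu := (leb d).
Local Notation e_ i := (delta_mx 0 i : pt).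
Implicit Types (f g : pt -> R).
Lemma is_derive_line f (x v : pt) (t l : R) :
 is_derive t (1 : R) (fun s : R => f (x + s *: v)) l <-> is_derive (x + t *: v) v f l.
have E : (fun h : R => h^-1 *: (((fun s : R => f (x + s *: v)) \o shift t) (h *: (1 : R))
       - f (x + t *: v))) =
  (fun h : R => h^-1 *: ((f \o shift (x + t *: v)) (h *: v) - f (x + t *: v))).
 apply/funext => h /=; congr (_ *: (f _ - _)).
 by rewrite scalerDl [h *: 1]mulr1 addrCA.
split=> -[dh dl]; split.
- by rewrite /derivable -E.
- by rewrite -dl /derive -E.
- by rewrite /derivable /= E.
- by rewrite -dl /derive /= E.
Qed.

Lemma derivable_line f (x v : pt) (t : R) :
 derivable f (x + t *: v) v ->
 is_derive t (1 : R) (fun s : R => f (x + s *: v)) ('D_v f (x + t *: v)).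
Proof. by move=> h; apply/is_derive_line; exact: derivableP. Qed.
Lemma coord_MVT f i x t : (forall y, derivable f y (e_ i)) ->
 exists2 xi, `|xi| <= `|t| & f (x + t *: e_ i) - f x = t * pder i f (x + xi *: e_ i).
move=> df.
have D s := derivable_line (df (x + s *: e_ i)).
have C (A : set R) : {within A, continuous (fun s : R => f (x + s *: e_ i))}.
 apply: continuous_subspaceT => s.
 by apply/differentiable_continuous/derivable1_diffP; have [] := D s.
have [t0|t0] := leP 0 t.
 have [c /[!in_itv]/= /andP[c0 ct]] := MVT_segment t0 (fun s _ => D s) (C _).
 rewrite scale0r addr0 subr0 => E; exists c; last by rewrite E mulrC.
 by rewrite !ger0_norm.
have [c /[!in_itv]/= /andP[c0 ct]] := MVT_segment (ltW t0) (fun s _ => D s) (C _).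
rewrite scale0r addr0 sub0r => E; exists c.
 by rewrite !ler0_norm ?lerN2// ltW.
by rewrite -opprB E mulrN opprK mulrC.
Qed.

Definition C1 f := continuous f /\
 forall i, (forall x, derivable f x (e_ i)) /\ continuous (pder i f).
Definition bsupp f := exists M, forall x, M < `|x| -> f x = 0.
Lemma smooth_pder f i : smooth f -> smooth (pder i f).
Proof. by move=> h s; have := h (rcons s i); rewrite -cats1 foldr_cat. Qed.
Lemma smooth_C1 f : smooth f -> C1 f.
move=> h; split; first by have [] := h [::].
move=> i; split; first by move=> x; have [_ /(_ x i)] := h [::].
by have [] := h [:: i].
Qed.

Lemma C1_is_derive f i x : C1 f -> is_derive x (e_ i) f (pder i f x).
Proof. by case=> _ /(_ i)[h _]; exact: derivableP. Qed.
Lemma pder_is f i x l : is_derive x (e_ i) f l -> pder i f x = l.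
Proof. by case. Qed.
Lemma C1M f g : C1 f -> C1 g -> C1 (fun x => f x * g x) /\
 (forall i x, pder i (fun x => f x * g x) x = pder i f x * g x + f x * pder i g x).
move=> hf hg.
have D i x : is_derive x (e_ i) (fun x => f x * g x) (pder i f x * g x + f x * pder i g x).
 apply: is_derive_eq (is_deriveM (C1_is_derive i x hf) (C1_is_derive i x hg)) _.
 by rewrite /GRing.scale /= addrC [g x * _]mulrC.
have E i : pder i (fun x => f x * g x) = (fun x => pder i f x * g x + f x * pder i g x).
 by apply/funext => x; apply: pder_is.
case: hf => cf hf; case: hg => cg hg.
split; last by move=> i x; rewrite E.
split; first by move=> x; exact: (cvgM (cf x) (cg x)).
move=> i; split; first by move=> x; have [] := D i x.
rewrite E => x; have [_ cfi] := hf i; have [_ cgi] := hg i.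
exact: (cvgD (cvgM (cfi x) (cg x)) (cvgM (cf x) (cgi x))).
Qed.

Lemma C1D f g : C1 f -> C1 g -> C1 (fun x => f x + g x) /\
 (forall i x, pder i (fun x => f x + g x) x = pder i f x + pder i g x).
move=> hf hg.
have D i x : is_derive x (e_ i) (fun x => f x + g x) (pder i f x + pder i g x).
 exact: (is_deriveD (C1_is_derive i x hf) (C1_is_derive i x hg)).
have E i : pder i (fun x => f x + g x) = (fun x => pder i f x + pder i g x).
 by apply/funext => x; apply: pder_is.
case: hf => cf hf; case: hg => cg hg.
split; last by move=> i x; rewrite E.
split; first by move=> x; exact: (cvgD (cf x) (cg x)).
move=> i; split; first by move=> x; have [] := D i x.
rewrite E => x; have [_ cfi] := hf i; have [_ cgi] := hg i.
exact: (cvgD (cfi x) (cgi x)).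
Qed.

Lemma C1_cst (c : R) : C1 (fun=> c) /\ (forall i (x : pt), pder i (fun=> c) x = 0).
have D i (x : pt) : is_derive x (e_ i) (fun=> c) 0 by exact: is_derive_cst.
split; last by move=> i x; exact: pder_is.
split; first exact: cst_continuous.
move=> i; split; first by move=> x; have [] := D i x.
have -> : pder i (fun=> c) = fun=> 0 by apply/funext => x; exact: pder_is.
exact: cst_continuous.
Qed.

Lemma C1_sum I (r : seq I) (P : pred I) (F : I -> pt -> R) :
 (forall i, P i -> C1 (F i)) -> C1 (fun x => \sum_(i <- r | P i) F i x) /\
 (forall j x, pder j (fun x => \sum_(i <- r | P i) F i x) x =
   \sum_(i <- r | P i) pder j (F i) x).
move=> H; elim: r => [|i r [IH1 IH2]].
 under eq_fun do rewrite big_nil; have [? h] := C1_cst 0; split => // j x.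
 by rewrite h big_nil.
have [Pi|/negbTE Pi] := boolP (P i); last first.
 under eq_fun do rewrite big_cons Pi; split => // j x.
 by rewrite IH2 big_cons Pi.
under eq_fun do rewrite big_cons Pi; have [? h] := C1D (H i Pi) IH1; split => // j x.
by rewrite h IH2 big_cons Pi.
Qed.

Lemma coord_C1 (j : 'I_d) : C1 (fun x : pt => x 0 j) /\
 (forall i x, pder i (fun x : pt => x 0 j) x = (i == j)%:R).
have D i x : is_derive x (e_ i) (fun x : pt => x 0 j) (i == j)%:R.
 have := is_derive_line (fun x : pt => x 0 j) x (e_ i) 0 (i == j)%:R.
 rewrite scale0r addr0 => <-.
 rewrite (_ : (fun s => _) = (fun s : R => x 0 j + s * (i == j)%:R)); last first.
  by apply/funext => s; rewrite !mxE eqxx eq_sym.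
 by apply: is_derive_eq; rewrite /GRing.scale/=; ring.
split; last by move=> i x; exact: pder_is.
split; first exact: coord_continuous.
move=> i; split; first by move=> x; have [] := D i x.
have -> : pder i (fun x : pt => x 0 j) = fun=> (i == j)%:R.
 by apply/funext => x; exact: pder_is.
exact: cst_continuous.
Qed.

Lemma pder_near0 f i x : (\forall y \near x, f y = 0) -> pder i f x = 0.
move=> h; apply: pder_is.
have k : \forall y \near x, cst (0 : R) y = f y by near do apply/esym.
exact: (near_eq_is_derive k (is_derive_cst (0 : R) x (e_ i))).
Unshelve. all: by end_near. Qed.
Lemma bsupp_pder f i : bsupp f -> bsupp (pder i f).
move=> [M hM]; exists M => x Mx; apply: pder_near0; near=> y; apply: hM; near: y.
have : (fun x : pt => `|x|) @ x --> `|x| by exact: norm_continuous.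
move/cvgrPdist_lt => /(_ (`|x| - M)); rewrite subr_gt0 => /(_ Mx) h.
near=> y; have : `| `|x| - `|y| | < `|x| - M by near: y; exact: h.
by move=> /ltr_normlW; rewrite ltrD2l ltrN2.
Unshelve. all: by end_near. Qed.
Lemma row_normP (x : pt) M : 0 <= M -> (`|x| <= M) <-> (forall i, `|x 0 i| <= M).
move=> M0; rewrite /Num.Def.normr/= mx_normrE; split.
 by move=> /bigmax_leP[_ h] i; exact: (h (0, i)).
by move=> h; apply/bigmax_leP; split => // -[i j] _ /=; rewrite (ord1 i); exact: h.
Qed.

Lemma coord_le (x : pt) i : `|x 0 i| <= `|x|.
Proof. exact: (row_normP x (normr_ge0 _)).1. Qed.
Lemma compact_normball M : compact [set x : pt | `|x| <= M].
apply: bounded_closed_compact.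
 exists M; split; first exact: num_real.
 by move=> N MN x /= xM; apply: le_trans xM (ltW MN).
rewrite (_ : mkset _ = (fun x : pt => `|x|) @^-1` [set y : R | y <= M])//.
apply: closed_comp; last exact: closed_le.
by move=> x _; exact: norm_continuous.
Qed.

Lemma bounded_set_fin (A : set pt) M : measurable A -> (forall x, A x -> `|x| <= M) ->
 (mu A < +oo)%E.
move=> mA AM; pose N := `|M| + 1.
apply: (@le_lt_trans _ _ (mu (obox (const_mx (- N)) (const_mx N : pt)))).
 apply: le_measure; rewrite ?inE//; first exact: mobox.
 move=> x Ax i; rewrite !mxE -ltr_norml.
 have := coord_le x i; have := AM _ Ax; have := ler_norm M.
 by rewrite /N => *; lra.
rewrite leb_obox ?ltry// => i; rewrite !mxE /N; have := normr_ge0 M; lra.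
Qed.

Lemma cont_bdd_on f M : continuous f -> exists K, forall x : pt, `|x| <= M -> `|f x| <= K.
move=> cf; have [/nonemptyPn|/set0P ne] := eqVneq [set x : pt | `|x| <= M] set0.
 by move=> h; exists 0 => x xM; case: h; exists x.
have cc : compact (f @` [set x : pt | `|x| <= M]).
 by apply: continuous_compact; [exact: continuous_subspaceT|exact: compact_normball].
have [K [_ hK]] := compact_bounded cc.
exists (K + 1) => x xM; apply: (hK (K + 1)); first by rewrite ltrDl.
by exists x.
Qed.

Lemma bsupp_bounded f : continuous f -> bsupp f -> exists2 K, 0 <= K & forall x, `|f x| <= K.
move=> cf [M hM]; have [K hK] := cont_bdd_on M cf.
exists `|K| => // x; have [xM|xM] := leP `|x| M; last by rewrite hM// normr0.
exact: le_trans (hK _ xM) (ler_norm _).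
Qed.

Lemma mball M : measurable [set x : pt | `|x| <= M].
apply: closed_meas; apply: compact_closed; last exact: compact_normball.
exact: norm_hausdorff.
Qed.

Lemma bsupp_L2T f : continuous f -> bsupp f -> L2 setT f.
move=> cf bf; have [K K0 hK] := bsupp_bounded cf bf; have [M hM] := bf.
have mf := cont_meas cf.
have [_ iB] := @bounded_L2 _ _ [set x : pt | `|x| <= M] f K (mball M)
 (bounded_set_fin (mball M) (fun x h => h))
 (measurable_funTS mf) (fun x _ => hK x).
split => //; move: iB; rewrite integral_mkcond; congr (_ < _)%E.
apply: eq_integral => x _; rewrite patchE.
case: ifPn => // /negP xM; rewrite hM ?expr0n//.
by rewrite ltNge; apply/negP => h; apply: xM; rewrite inE.
Qed.

Lemma L2_indic (B : set pt) : measurable B -> (mu B < +oo)%E -> L2 setT (\1_B : pt -> R).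
move=> mB Boo; split; first exact: measurable_indic.
rewrite (eq_integral (fun x => (\1_B x)%:E)); last first.
 by move=> x _; rewrite indicE; case: (_ \in _); rewrite ?expr1n ?expr0n.
by rewrite integral_indic// setIT.
Qed.

Lemma bsupp_integrable f : continuous f -> bsupp f -> mu.-integrable setT (EFin \o f).
move=> cf bf; have [M hM] := bf.
have mB := mball M.
have B1 := L2_indic mB (bounded_set_fin mB (fun x h => h)).
have := L2_integrable measurableT (bsupp_L2T cf bf) B1.
congr (_.-integrable _ _); apply/funext => x /=; rewrite indicE.
case: (boolP (x \in _)) => [_|/negP xM]; first by rewrite mulr1.
by rewrite mulr0 hM// ltNge; apply/negP => h; apply: xM; rewrite inE.
Qed.

Lemma bspan_line (x v : pt) (t : R) : `|x| - `|t| * `|v| <= `|x + t *: v|.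
Proof. by have := lerB_normD x (t *: v); rewrite normrZ. Qed.
Lemma diff_quot_cvg f i x (t_ : R^nat) : C1 f -> (forall n, t_ n != 0) ->
 t_ @ \oo --> (0 : R) ->
 (fun n => (f (x + t_ n *: e_ i) - f x) / t_ n) @ \oo --> pder i f x.
move=> hf tn0 t0; have [dh dl] := C1_is_derive i x hf.
have h : (fun h : R => h^-1 *: ((f \o shift x) (h *: e_ i) - f x)) @ 0^' --> pder i f x.
 by rewrite -dl; exact: dh.
have t0' : t_ @ \oo `=>` (0 : R)^'.
 move=> A; rewrite /dnbhs /within /= => A0.
 apply: (@filterS _ _ _ (fun n => t_ n != 0 -> A (t_ n))); last exact: t0 _ A0.
 by move=> n; apply; exact: tn0.
have := cvg_comp _ _ t0' h; apply: cvg_trans; apply: near_eq_cvg.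
by apply: nearW => n /=; rewrite /GRing.scale/= mulrC; congr ((f _ - _) / _); exact: addrC.
Qed.

(** The mean value theorem bounds the quotients by the maximum of the derivative, and for increments
    up to 1 they vanish outside a ball one unit larger than the support. The bound is both
    integrable and square integrable, for the limits in [int_pder] and [nrm_diff_le]. *)
Lemma diff_quot_dominated f i : C1 f -> bsupp f -> exists2 g : pt -> R,
 L2 setT g /\ mu.-integrable setT (EFin \o g) &
 forall (t : R) x, t != 0 -> `|t| <= 1 -> `|(f (x + t *: e_ i) - f x) / t| <= g x.
move=> hf bf; have [M hM] := bf.
have [K K0 hK] := bsupp_bounded ((hf.2 i).2) (bsupp_pder i bf).
pose B := [set x : pt | `|x| <= M + 1].
have mB : measurable B by exact: mball.
have Boo : (mu B < +oo)%E by exact: bounded_set_fin mB (fun x h => h).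
have gE x : (K * \1_B x) = ((fun=> K) \_ B) x.
 by rewrite patchE indicE; case: (_ \in _); rewrite ?mulr1 ?mulr0.
exists (fun x => K * \1_B x).
 have B2 := L2_indic mB Boo; split; first exact: L2Z.
 have := L2_integrable measurableT (L2Z K measurableT B2) B2.
 congr (_.-integrable _ _); apply/funext => x /=; rewrite indicE.
 by case: (_ \in _); rewrite ?mulr1 ?mulr0.
move=> t x t0 t1.
have [xB|xB] := boolP (x \in B); rewrite indicE.
 rewrite xB mulr1; have [xi _ ->] := coord_MVT x t ((hf.2 i).1).
 by rewrite mulrAC divff// mul1r.
rewrite (negbTE xB) mulr0.
have Mx : M + 1 < `|x| by rewrite ltNge; apply: contra xB; rewrite inE.
have en : `|e_ i| <= 1.
 apply/row_normP => // j; rewrite mxE eqxx /=; case: eqP; rewrite ?normr1 ?normr0//.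
rewrite !hM ?subrr ?mul0r ?normr0//; first by rewrite (lt_trans _ Mx)// ltrDl.
have := bspan_line x (e_ i) t.
have : `|t| * `|e_ i| <= 1 by rewrite mulr_ile1.
lra.
Qed.

Lemma Rintegral_translate (y : pt) f : mu.-integrable setT (EFin \o f) ->
 \int[mu]_x f (y + x) = \int[mu]_x f x.
move=> fi.
have := @Rint_scale _ _ (fun x => y + x) 1 (mtranslate y) ler01.
rewrite -[RHS]mul1r => <-//; first by move=> A mA; rewrite mul1e leb_translate.
Qed.

Lemma L2T_translate (y : pt) f : L2 setT f -> L2 setT (fun x => f (x + y)).
move=> [mf fi].
have mt := mtranslate y.
have -> : (fun x => f (x + y)) = (fun x => f (y + x)).
 by apply/funext => x; rewrite addrC.
split; first exact: (measurableT_comp mf mt).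
rewrite (@ge0_integral_translate _ _ y (fun x => (f x ^+ 2)%:E))//.
 by apply/measurable_EFinP; exact: measurable_funX.
by move=> x; rewrite lee_fin sqr_ge0.
Qed.

Lemma nrmT_translate (y : pt) f : L2 setT f -> nrm setT (fun x => f (x + y)) = nrm setT f.
move=> fL; congr Num.sqrt.
rewrite /ip -(Rintegral_translate y (L2_integrable measurableT fL fL)).
by apply: eq_Rintegral => x _; rewrite addrC.
Qed.

Let tn n : R := n.+1%:R^-1.
Let tn_gt0 n : 0 < tn n. Proof. by rewrite invr_gt0. Qed.
Let tn_le1 n : tn n <= 1. Proof. by rewrite invf_le1// ler1n. Qed.
Let tn_diff_quot f i x : C1 f ->
 (fun n => (f (x + tn n *: e_ i) - f x) / tn n) @ \oo --> pder i f x.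
move=> hf; apply: diff_quot_cvg => //; first by move=> n; rewrite gt_eqF.
exact: cvg_harmonic.
Qed.

Lemma Rint_dominated (S : set pt) (q : nat -> pt -> R) (f g : pt -> R) :
 measurable S -> (forall n, measurable_fun S (q n)) -> measurable_fun S f ->
 (forall x, S x -> (fun n => q n x) @ \oo --> f x) ->
 mu.-integrable S (EFin \o g) ->
 (forall n x, S x -> `|q n x| <= g x) ->
 mu.-integrable S (EFin \o f) /\
 (fun n => \int[mu]_(x in S) q n x) @ \oo --> \int[mu]_(x in S) f x.
move=> mS mq mf qf gi qg.
have [||||fi _ h] := @dominated_convergence _ _ _ mu S mS
 (fun n => EFin \o q n) (EFin \o f) (EFin \o g) _ _ _ gi _.
- by move=> n; exact/measurable_EFinP.
- exact/measurable_EFinP.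
- by apply: aeW => x Sx; apply: cvg_EFin; [exact: nearW|exact: qf].
- by apply: aeW => x n Sx; rewrite /= lee_fin; exact: qg.
split => //; apply: fine_cvg.
by rewrite fineK//; exact: integrable_fin_num.
Qed.

(** By translation invariance each difference quotient has integral zero, and dominated convergence
    passes to the derivative. All integration by parts on the whole space rests on this. *)
Lemma int_pder f i : C1 f -> bsupp f -> \int[mu]_x pder i f x = 0.
move=> hf bf; have [g [_ gi] hg] := diff_quot_dominated i hf bf.
have fi := bsupp_integrable hf.1 bf.
pose q n x := (f (x + tn n *: e_ i) - f x) / tn n.
have mf : measurable_fun setT f := cont_meas hf.1.
have mq n : measurable_fun setT (q n).
 apply: measurable_funM => //; apply: measurable_funB => //.
 rewrite (_ : (fun x => _) = (fun x => f (tn n *: e_ i + x))).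
  exact: (measurableT_comp mf (mtranslate _)).
 by apply/funext => x; rewrite addrC.
have [|||_ h] := @Rint_dominated setT q (pder i f) g measurableT mq _ _ gi _.
- exact: cont_meas (hf.2 i).2.
- by move=> x _; exact: tn_diff_quot.
- by move=> n x _; apply: hg; rewrite ?gt_eqF// gtr0_norm.
have E n : \int[mu]_x q n x = 0.
 have ti : mu.-integrable setT (EFin \o (fun x => f (tn n *: e_ i + x))).
  have := @scale_integrable _ _ (fun x => tn n *: e_ i + x) 1
   (mtranslate _) ler01 _ setT (EFin \o f) measurableT fi.
  by apply => A mA; rewrite mul1e leb_translate.
 transitivity (\int[mu]_x ((f (tn n *: e_ i + x) - f x) * (tn n)^-1)).
  by apply: eq_Rintegral => x _; congr ((f _ - _) / _); exact: addrC.
 have bi : mu.-integrable setT (EFin \o (fun x => f (tn n *: e_ i + x) - f x)).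
  exact: (integrableB measurableT ti fi).
 rewrite (RintegralZr _ measurableT bi).
 by rewrite RintegralB// Rintegral_translate// subrr mul0r.
move: h; under eq_fun do rewrite E.
by move=> /cvg_lim <-//; rewrite lim_cst.
Qed.

(** Cutting a shift into m equal pieces gives N(t) <= m N(t/m) by the triangle inequality and
    translation invariance, and m N(t/m) tends to |t| times the norm of the derivative. This avoids
    Minkowski's inequality for integrals. *)
Lemma nrm_diff_le f i (t : R) : C1 f -> bsupp f ->
 nrm setT (fun x => f (x + t *: e_ i) - f x) <= `|t| * nrm setT (pder i f).
move=> hf bf; have [->|tn0] := eqVneq t 0.
 rewrite normr0 mul0r (@eq_nrm _ _ _ _ (fun=> 0)) ?nrm0// => x _.
 by rewrite scale0r addr0 subrr.
have fL := bsupp_L2T hf.1 bf.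
have fiL := bsupp_L2T ((hf.2 i).2) (bsupp_pder i bf).
pose N (s : R) := nrm setT (fun x => f (x + s *: e_ i) - f x).
have L s : L2 setT (fun x => f (x + s *: e_ i) - f x).
 by apply: L2B => //; exact: L2T_translate.
have Nk (s : R) k : N (k%:R * s) <= k%:R * N s.
 elim: k => [|k IH].
  rewrite /N !mul0r (@eq_nrm _ _ _ _ (fun=> 0)) ?nrm0// => x _.
  by rewrite scale0r addr0 subrr.
 have -> : k.+1%:R * N s = N s + k%:R * N s by rewrite -natr1; ring.
 apply: le_trans (lerD (lexx (N s)) IH).
 have <- : nrm setT (fun x => f (x + (k%:R * s) *: e_ i + s *: e_ i) - f (x + (k%:R * s) *: e_ i)) = N s.
  exact: (nrmT_translate ((k%:R * s) *: e_ i) (L s)).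
 have := nrmD measurableT (L2T_translate ((k%:R * s) *: e_ i) (L s)) (L (k%:R * s)).
 apply: le_trans; le_eq.
 apply: eq_nrm => x _; have -> : x + (k.+1%:R * s) *: e_ i = x + (k%:R * s) *: e_ i + s *: e_ i.
  by rewrite -addrA -scalerDl -natr1 mulrDl mul1r.
 by rewrite addrA subrK.
have [g [gL gi] hg] := diff_quot_dominated i hf bf.
(* The offset keeps |t / m n| <= 1, the range in which the dominating function is valid. *)
pose m n : R := (n + (Num.truncn `|t|).+1)%:R.
have mt n : `|t| <= m n.
 by rewrite (le_trans (ltW (truncnS_gt _)))// ler_nat leq_addl.
have m0 n : 0 < m n by rewrite ltr0n addnS.
have td0 n : t / m n != 0 by rewrite mulf_neq0// invr_eq0 gt_eqF.
have td1 n : `|t / m n| <= 1.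
 by rewrite normrM normfV (gtr0_norm (m0 n)) ler_pdivrMr// mul1r.
pose q n x := ((f (x + (t / m n) *: e_ i) - f x) / (t / m n)) ^+ 2.
have Lq n : L2 setT (fun x => (t / m n)^-1 * (f (x + (t / m n) *: e_ i) - f x)).
 exact: L2Z.
have qE n : \int[mu]_x q n x = (t / m n) ^- 2 * N (t / m n) ^+ 2.
 rewrite nrm_sq /ip -RintegralZl//; last exact: (L2_integrable measurableT (L _) (L _)).
 by apply: eq_Rintegral => x _; rewrite /q expr_div_n -expr2 mulrC.
have [|||||_ h] := @Rint_dominated setT q (fun x => pder i f x ^+ 2)
  (fun x => g x ^+ 2) measurableT _ _ _ _ _.
- by move=> n; apply: measurable_funX; have [+ _] := Lq n; under eq_fun do rewrite mulrC.
- by apply: measurable_funX; have [] := fiL.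
- move=> x _; rewrite /q expr2; under eq_fun do rewrite expr2.
 have c : (fun n => (f (x + (t / m n) *: e_ i) - f x) / (t / m n)) @ \oo --> pder i f x.
  apply: diff_quot_cvg => //.
  rewrite -[X in _ --> X](mulr0 t); apply: cvgMr.
  rewrite (_ : (fun n => _) = [sequence harmonic (n + Num.truncn `|t|)%N]_n :> R^nat).
   by rewrite cvg_shiftn; exact: cvg_harmonic.
  by apply/funext => n; rewrite /m addnS.
 exact: (cvgM c c).
- exact: L2_sq_integrable.
- move=> n x _; rewrite normrX ler_sqr ?nnegrE//; first exact: hg.
 exact: le_trans (normr_ge0 _) (hg _ x (td0 n) (td1 n)).
rewrite -(@ler_sqr _ (nrm _ _)) ?nnegrE ?nrm_ge0 ?mulr_ge0 ?nrm_ge0// exprMn.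
rewrite real_normK ?num_real// [in leRHS]nrm_sq.
have -> : ip setT (pder i f) (pder i f) = \int[mu]_x (pder i f x ^+ 2).
 by apply: eq_Rintegral => x _; rewrite expr2.
have h2 : (fun n => t ^+ 2 * \int[mu]_x q n x) @ \oo -->
  t ^+ 2 * \int[mu]_x pder i f x ^+ 2 by exact: cvgMr.
rewrite -(cvg_lim _ h2)//; apply: limr_ge; first by apply/cvg_ex; eexists; exact: h2.
apply: nearW => n /=; rewrite qE.
have -> : t ^+ 2 * ((t / m n) ^- 2 * N (t / m n) ^+ 2) = (m n * N (t / m n)) ^+ 2.
 by field; rewrite tn0 gt_eqF.
rewrite ler_sqr ?nnegrE ?nrm_ge0 ?mulr_ge0 ?nrm_ge0 ?(ltW (m0 n))//.
by have := Nk (t / m n) (n + (Num.truncn `|t|).+1)%N; rewrite mulrC divfK ?gt_eqF.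
Qed.

Lemma nrm_transl_le f (y : pt) : C1 f -> bsupp f ->
 nrm setT (fun x => f (x + y) - f x) <= \sum_i `|y 0 i| * nrm setT (pder i f).
move=> hf bf.
have -> : nrm setT (fun x => f (x + y) - f x) =
  nrm setT (fun x => f (x + \sum_j y 0 j *: e_ j) - f x) by rewrite -row_sum_delta.
have fL := bsupp_L2T hf.1 bf.
have L z : L2 setT (fun x => f (x + z) - f x).
 by apply: L2B => //; exact: L2T_translate.
elim: (index_enum _) => [|i r IH].
 rewrite !big_nil (@eq_nrm _ _ _ _ (fun=> 0)) ?nrm0// => x _.
 by rewrite addr0 subrr.
rewrite !big_cons; set z := \sum_(j <- r) _ in IH *.
apply: le_trans (lerD (nrm_diff_le i _ hf bf) IH).
rewrite -(nrmT_translate z (L (y 0 i *: e_ i))).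
apply: le_trans (nrmD measurableT (L2T_translate z (L (y 0 i *: e_ i))) (L z)).
le_eq; apply: eq_nrm => x _.
by rewrite [RHS]addrA subrK; congr (f _ - _); rewrite [_ + z]addrC addrA.
Qed.

End Partial.

(** * Test functions and the fundamental lemma of the calculus of variations *)

Section TestFun.
Context {R : realType} {d : nat}.
Local Notation pt := 'rV[R]_d.
Local Notation mu := (leb d).
Local Notation e_ i := (delta_mx 0 i : pt).
Implicit Types (f : pt -> R) (g : 'I_d -> R -> R).
Definition prodf g : pt -> R := fun x => \prod_i g i (x 0 i).
Lemma continuous_prodf g : (forall i, continuous (g i)) -> continuous (prodf g).
move=> cg; rewrite /prodf; elim: (index_enum _) => [|i r IH].
 under eq_fun do rewrite big_nil; exact: cst_continuous.
under eq_fun do rewrite big_cons; move=> x.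
have h : (fun x : pt => g i (x 0 i)) @ x --> g i (x 0 i).
 by apply: (@cvg_comp _ _ _ (fun x : pt => x 0 i) (g i)); [exact: coord_continuous|exact: cg].
exact: (cvgM h (IH x)).
Qed.

(** Differentiating a tensor product replaces one factor by its derivative. The class of tensor
    products is therefore stable under all partial derivatives, which proves smoothness without a
    calculus of higher derivatives in several variables. *)
Definition upd g (i : 'I_d) (h : R -> R) : 'I_d -> R -> R :=
 fun j => if j == i then h else g j.
Lemma is_derive_prodf g i x : (forall i, smooth1 (g i)) ->
 is_derive x (e_ i) (prodf g) (prodf (upd g i (derive1 (g i))) x).
move=> sg.
have := is_derive_line (prodf g) x (e_ i) 0 (prodf (upd g i (derive1 (g i))) x).
rewrite scale0r addr0 => <-.
pose c := \prod_(j | j != i) g j (x 0 j).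
rewrite (_ : (fun s => _) = (fun s : R => c * g i (1 * s + x 0 i))); last first.
 apply/funext => s; rewrite /prodf (bigD1 i)//= mulrC; congr (_ * _).
  by apply: eq_bigr => j ji; rewrite !mxE (negbTE ji) mulr0 addr0.
 by rewrite !mxE !eqxx mulr1 mul1r addrC.
have dg : is_derive (1 * 0 + x 0 i) 1 (g i) (derive1 (g i) (x 0 i)).
 by rewrite mulr0 add0r derive1E; apply/derivableP; exact: smooth1_derivable.
have da : is_derive (0 : R) 1 (fun s => 1 * s + x 0 i) 1.
 by apply: is_derive_eq; rewrite /GRing.scale/=; ring.
apply: is_derive_eq (@is_deriveZ _ _ _ (fun s : R => g i (1 * s + x 0 i)) c 0 1 _
 (@is_derive1_comp _ (g i) (fun s : R => 1 * s + x 0 i) _ _ _ dg da)) _.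
rewrite mulr1 /GRing.scale/=.
rewrite /prodf [RHS](bigD1 i)//= /upd eqxx mulrC; congr (_ * _).
by apply: eq_bigr => j ji; rewrite (negbTE ji).
Qed.

Lemma smooth_prodf g : (forall i, smooth1 (g i)) -> smooth (prodf g).
move=> sg s; suff [g' sg' ->] : exists2 g', (forall i, smooth1 (g' i)) &
  foldr pder (prodf g) s = prodf g'.
 split; first by apply: continuous_prodf => i; exact: smooth1_continuous.
 by move=> x i; have [] := is_derive_prodf i x sg'.
elim: s => [|i s [g' sg' IH]]; first by exists g.
exists (upd g' i (derive1 (g' i))).
 by move=> j; rewrite /upd; case: eqP => // _; exact: smooth1_derive.
by rewrite /= IH; apply/funext => x; apply: pder_is; exact: is_derive_prodf.
Qed.

Lemma pder_prodf g i x : (forall i, smooth1 (g i)) ->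
 pder i (prodf g) x = prodf (upd g i (derive1 (g i))) x.
Proof. by move=> sg; apply: pder_is; exact: is_derive_prodf. Qed.
Lemma foldr_pderD (f1 f2 : pt -> R) s : smooth f1 -> smooth f2 ->
 foldr pder (fun x => f1 x + f2 x) s = (fun x => foldr pder f1 s x + foldr pder f2 s x).
move=> s1 s2; elim: s => //= i s ->.
apply/funext => x; apply: pder_is.
have [_ /(_ x i)/derivableP d1] := s1 s; have [_ /(_ x i)/derivableP d2] := s2 s.
exact: is_deriveD.
Qed.

Lemma smoothD (f1 f2 : pt -> R) : smooth f1 -> smooth f2 -> smooth (fun x => f1 x + f2 x).
move=> s1 s2 s; rewrite /= foldr_pderD//.
have [c1 D1] := s1 s; have [c2 D2] := s2 s; split.
 by move=> x; exact: (cvgD (c1 x) (c2 x)).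
by move=> x i; exact: derivableD.
Qed.

Lemma foldr_pderZ (a : R) f s : smooth f ->
 foldr pder (fun x => a * f x) s = (fun x => a * foldr pder f s x).
move=> s1; elim: s => //= i s ->.
apply/funext => x; apply: pder_is.
by have [_ /(_ x i)/derivableP d1] := s1 s; exact: is_deriveZ.
Qed.

Lemma smoothZ (a : R) f : smooth f -> smooth (fun x => a * f x).
move=> s1 s; rewrite /= foldr_pderZ//; have [c1 D1] := s1 s; split.
 by move=> x; exact: (cvgM (@cst_continuous _ _ a x) (c1 x)).
by move=> x i; apply: derivableZ; exact: D1.
Qed.

Lemma smooth0 : smooth ((fun=> 0) : pt -> R).
move=> s; have -> : foldr pder ((fun=> 0) : pt -> R) s = ((fun=> 0) : pt -> R).
 elim: s => //= i s ->; apply/funext => x; apply: pder_is; exact: is_derive_cst.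
by split; [exact: cst_continuous|move=> x i; exact: derivable_cst].
Qed.

Lemma smooth_sum I (r : seq I) (P : pred I) (F : I -> pt -> R) :
 (forall i, P i -> smooth (F i)) -> smooth (fun x => \sum_(i <- r | P i) F i x).
move=> H; elim: r => [|i r IH].
 rewrite (_ : (fun x => _) = fun=> 0); first exact: smooth0.
 by apply/funext => x; rewrite big_nil.
have [Pi|/negbTE Pi] := boolP (P i).
 rewrite (_ : (fun x => _) = (fun x => F i x + \sum_(j <- r | P j) F j x)).
  by apply: smoothD => //; exact: H.
 by apply/funext => x; rewrite big_cons Pi.
rewrite (_ : (fun x => _) = (fun x => \sum_(j <- r | P j) F j x)) //.
by apply/funext => x; rewrite big_cons Pi.
Qed.

Lemma test_bsupp (W : set pt) f : test_fun W f -> bsupp f.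
move=> [_ [K [cK _ Kf]]]; have [M [_ hM]] := compact_bounded cK.
exists (M + 1) => x xM; apply: Kf => Kx.
by have := hM (M + 1); rewrite ltrDl ltr01 => /(_ isT x Kx) /=; rewrite leNgt xM.
Qed.

Lemma test_C1 (W : set pt) f : test_fun W f -> C1 f.
Proof. by case=> /smooth_C1. Qed.
Lemma test_out (W : set pt) f x : test_fun W f -> ~ W x -> f x = 0.
Proof. by move=> [_ [K [_ KW Kf]]] Wx; apply: Kf => /KW. Qed.
Lemma test_sub (W W' : set pt) f : W `<=` W' -> test_fun W f -> test_fun W' f.
Proof. by move=> WW' [sf [K [cK KW Kf]]]; split => //; exists K; split => // x /KW /WW'. Qed.
Lemma test_pder (W : set pt) f i : test_fun W f -> test_fun W (pder i f).
move=> [sf [K [cK KW Kf]]]; split; first exact: smooth_pder.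
exists K; split => // x Kx; apply: pder_near0.
have oK : open (~` K) by apply: closed_openC; apply: compact_closed => //; exact: norm_hausdorff.
by near=> y; apply: Kf; near: y; exact: open_nbhs_nbhs.
Unshelve. all: by end_near. Qed.
Lemma testD (W : set pt) f1 f2 : test_fun W f1 -> test_fun W f2 ->
 test_fun W (fun x => f1 x + f2 x).
move=> [s1 [K1 [cK1 KW1 Kf1]]] [s2 [K2 [cK2 KW2 Kf2]]]; split; first exact: smoothD.
exists (K1 `|` K2); split; first exact: compactU.
 by move=> x [/KW1|/KW2].
by move=> x /not_orP[k1 k2]; rewrite Kf1// Kf2// addr0.
Qed.

Lemma testZ (W : set pt) a f : test_fun W f -> test_fun W (fun x => a * f x).
move=> [s1 [K1 [cK1 KW1 Kf1]]]; split; first exact: smoothZ.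
by exists K1; split => // x /Kf1 ->; rewrite mulr0.
Qed.

Lemma testB (W : set pt) f1 f2 : test_fun W f1 -> test_fun W f2 ->
 test_fun W (fun x => f1 x - f2 x).
move=> t1 /(testZ (-1)) t2; have := testD t1 t2.
by congr (test_fun W); apply/funext => x; rewrite mulN1r.
Qed.

Lemma test0 (W : set pt) : test_fun W (fun=> 0).
Proof. by split; [exact: smooth0|exists set0; split => //; exact: compact0]. Qed.
Lemma test_sum (W : set pt) I (r : seq I) (P : pred I) (F : I -> pt -> R) :
 (forall i, P i -> test_fun W (F i)) -> test_fun W (fun x => \sum_(i <- r | P i) F i x).
move=> H; elim: r => [|i r IH].
 by under eq_fun do rewrite big_nil; exact: test0.
have [Pi|/negbTE Pi] := boolP (P i).
 by under eq_fun do rewrite big_cons Pi; apply: testD => //; exact: H.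
by under eq_fun do rewrite big_cons Pi.
Qed.

Lemma test_L2 (W S : set pt) f : measurable S -> test_fun W f -> L2 S f.
move=> mS tf; apply: (L2_sub mS measurableT) => //.
by apply: bsupp_L2T; [exact: (test_C1 tf).1|exact: test_bsupp tf].
Qed.

Definition cbox (a b : pt) : set pt := [set x | forall i, a 0 i <= x 0 i <= b 0 i].
Lemma obox_cbox a b : obox a b `<=` cbox a b.
Proof. by move=> x h i; have /andP[/ltW -> /ltW ->] := h i. Qed.
Lemma closed_cbox a b : closed (cbox a b).
have -> : cbox a b = \bigcap_(i : 'I_d) ((fun x : pt => x 0 i) @^-1` `[a 0 i, b 0 i]%classic).
 apply/seteqP; split => x h i; first by move=> _ /=; rewrite in_itv/=; exact: h.
 by have := h i I; rewrite /= in_itv.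
apply: closed_bigI => i _; apply: closed_comp; last exact: interval_closed.
by move=> x _; exact: coord_continuous.
Qed.

Lemma compact_cbox a b : compact (cbox a b).
apply: (@subclosed_compact _ (cbox a b) [set x : pt | `|x| <= `|a| + `|b|]).
- exact: closed_cbox.
- exact: compact_normball.
move=> x h /=.
apply/row_normP; first by rewrite addr_ge0.
move=> i; have /andP[h1 h2] := h i.
have := coord_le a i; have := coord_le b i.
have := ler_norm (b 0 i); have := ler_norm (- a 0 i); rewrite normrN.
have := normr_ge0 a; have := normr_ge0 b => *.
by rewrite ler_norml; apply/andP; split; lra.
Qed.

Lemma measurable_cbox a b : measurable (cbox a b).
Proof. exact: closed_meas (@closed_cbox a b). Qed.
(** Approximates the indicator of the open box from below as [n] grows, with support in the closed
    box for every [n]. *)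
Definition tbump (a b : pt) (n : R) : pt -> R :=
 prodf (fun i t => step (n * (t - a 0 i)) * step (n * (b 0 i - t))).
Lemma smooth1_tbump1 (a b n : R) : smooth1 (fun t => step (n * (t - a)) * step (n * (b - t))).
apply: smooth1M.
 rewrite (_ : (fun t => _) = (fun t => step (n * t + (- n * a)))).
  exact: smooth1_comp smooth1_step.
 by apply/funext => t; congr step; ring.
rewrite (_ : (fun t => _) = (fun t => step ((- n) * t + (n * b)))).
 exact: smooth1_comp smooth1_step.
by apply/funext => t; congr step; ring.
Qed.

Lemma tbump_test (W : set pt) a b n : 0 < n -> cbox a b `<=` W -> test_fun W (tbump a b n).
move=> n0 abW; split.
 by apply: smooth_prodf => i; exact: smooth1_tbump1.
exists (cbox a b); split => //; first exact: compact_cbox.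
move=> x; apply: contra_notP; rewrite /tbump /prodf => h i.
have : step (n * (x 0 i - a 0 i)) * step (n * (b 0 i - x 0 i)) != 0.
 by apply: contra_not_neq h => h; rewrite (bigD1 i)//= h mul0r.
rewrite mulf_eq0 negb_or => /andP[h1 h2]; apply/andP; split.
 by rewrite leNgt; apply: contra h1 => k; rewrite step0// pmulr_rle0// subr_le0 ltW.
by rewrite leNgt; apply: contra h2 => k; rewrite step0// pmulr_rle0// subr_le0 ltW.
Qed.

Lemma tbump_ge0 a b n x : 0 <= tbump a b n x.
Proof. by apply: prodr_ge0 => i _; rewrite mulr_ge0// step_ge0. Qed.
Lemma tbump_le1 a b n x : tbump a b n x <= 1.
by apply: prodr_ile1 => i _; rewrite mulr_ge0 ?step_ge0//= mulr_ile1 ?step_ge0 ?step_le1.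
Qed.

Lemma tbump_gt0 a b n x : 0 < n -> obox a b x -> 0 < tbump a b n x.
move=> n0 h; apply: prodr_gt0 => i _; have /andP[h1 h2] := h i.
by rewrite mulr_gt0// step_gt0// mulr_gt0// subr_gt0.
Qed.

Lemma tbump_cvg a b x : (fun n => tbump a b n.+1%:R x) @ \oo --> (\1_(obox a b) x : R).
have [/[dup] xab /set_mem h|xab] := boolP (x \in obox a b); rewrite indicE.
 rewrite xab; apply: cvg_near_cst.
 have D i : 0 < x 0 i - a 0 i /\ 0 < b 0 i - x 0 i.
  by have /andP[h1 h2] := h i; rewrite !subr_gt0.
 pose N := Num.truncn (\sum_i ((x 0 i - a 0 i)^-1 + (b 0 i - x 0 i)^-1)).
 near=> n; rewrite /tbump /prodf big1// => i _.
 have Nn : (N <= n)%N by near: n; exact: nbhs_infty_ge.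
 have := truncnS_gt (\sum_i ((x 0 i - a 0 i)^-1 + (b 0 i - x 0 i)^-1)).
 rewrite -/N (bigD1 i)//=; have [d1 d2] := D i.
 have d1' : 0 < (x 0 i - a 0 i)^-1 by rewrite invr_gt0.
 have d2' : 0 < (b 0 i - x 0 i)^-1 by rewrite invr_gt0.
 have s0 : 0 <= \sum_(j | j != i) ((x 0 j - a 0 j)^-1 + (b 0 j - x 0 j)^-1).
  by apply: sumr_ge0 => j _; have [/ltW h1 /ltW h2] := D j; rewrite addr_ge0 ?invr_ge0.
 have n1 : N.+1%:R <= n.+1%:R :> R by rewrite ler_nat.
 move=> hN; rewrite !step1 ?mulr1// -ler_pdivrMr// mul1r; lra.
rewrite (negbTE xab); apply: cvg_near_cst; apply: nearW => n.
apply/eqP; rewrite -[_ == _]negbK; apply: contra xab => h; rewrite inE.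
have h' : 0 < tbump a b n.+1%:R x by rewrite lt_neqAle eq_sym h tbump_ge0.
move=> i; move: h; rewrite /tbump /prodf (bigD1 i)//= mulf_eq0 negb_or => /andP[+ _].
rewrite mulf_eq0 negb_or => /andP[h1 h2]; apply/andP; split.
 by rewrite ltNge; apply: contra h1 => k; rewrite step0// pmulr_rle0// subr_le0.
by rewrite ltNge; apply: contra h2 => k; rewrite step0// pmulr_rle0// subr_le0.
Unshelve. all: by end_near. Qed.
Lemma rat_box (W : set pt) x : open W -> W x ->
 exists p q : 'rV[rat]_d, obox (map_mx ratr p) (map_mx ratr q) x /\
  cbox (map_mx ratr p) (map_mx ratr q) `<=` W.
move=> oW Wx; have := oW _ Wx; rewrite /interior => /nbhs_ballP[e /= e0 eW].
have lo i : exists q : rat, ratr q \in `]x 0 i - e / 2, x 0 i[.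
 by apply: rat_in_itvoo; lra.
have hi i : exists q : rat, ratr q \in `]x 0 i, x 0 i + e / 2[.
 by apply: rat_in_itvoo; lra.
have [p hp] := choice lo; have [q hq] := choice hi.
exists (\row_i p i), (\row_i q i); split => [i|y yb].
 rewrite !mxE; have := hp i; have := hq i.
 by rewrite !in_itv/= => /andP[-> _] /andP[_ ->].
apply: eW; rewrite mx_norm_ball /ball_/=.
apply: (@le_lt_trans _ _ (e / 2)); last lra.
apply/row_normP; first lra.
move=> i; rewrite !mxE; move: (yb i); rewrite !mxE.
have := hp i; have := hq i; rewrite !in_itv/= => /andP[_ h1] /andP[h2 _].
by move=> /andP[h3 h4]; rewrite ler_norml; apply/andP; split; lra.
Qed.

(** Null sets may be united only countably often, hence the boxes with rational corners. They are
    enumerated by [unpickle], and indices that code no pair of corners carry the property [True]. *)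
Lemma ae_open_cover (W : set pt) (P : pt -> Prop) : open W ->
 (forall a b : pt, cbox a b `<=` W -> {ae mu, forall x, obox a b x -> P x}) ->
 {ae mu, forall x, W x -> P x}.
move=> oW H.
pose Q (n : nat) (x : pt) := if unpickle n is Some (p, q) then
  (cbox (map_mx ratr p) (map_mx ratr q) `<=` W ->
  obox (map_mx ratr p) (map_mx ratr q) x -> P x) else True.
have : {ae mu, forall x, forall n, Q n x}.
 apply: ae_foralln => n; rewrite /Q; case: (unpickle n) => [[p q]|]; last exact: aeW.
 have [h|h] := pselect (cbox (map_mx ratr p : pt) (map_mx ratr q) `<=` W).
  by have := H _ _ h; apply: filterS => x hx _; exact: hx.
 by apply: aeW => x /h.
apply: filterS => x Qx Wx; have [p [q [h1 h2]]] := rat_box oW Wx.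
by have := Qx (pickle (p, q)); rewrite /Q pickleK; apply.
Qed.

Lemma L2_abs (S : set pt) f : L2 S f -> L2 S (fun x => `|f x|).
move=> [mf fi]; split; first exact: measurableT_comp.
by under eq_integral do rewrite real_normK ?num_real//.
Qed.

Lemma L2_indicS (S B : set pt) : measurable S -> measurable B -> (mu B < +oo)%E ->
 L2 S (\1_B : pt -> R).
Proof. by move=> mS mB Boo; apply: (L2_sub mS measurableT) => //; exact: L2_indic. Qed.
Lemma obox_fin (a b : pt) : (mu (obox a b) < +oo)%E.
apply: (@bounded_set_fin _ _ _ (`|a| + `|b|)); first exact: mobox.
move=> x h; apply/row_normP; first by rewrite addr_ge0.
move=> i; have /andP[h1 h2] := h i.
have := coord_le a i; have := coord_le b i.
have := ler_norm (b 0 i); have := ler_norm (- a 0 i); rewrite normrN.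
have := normr_ge0 a; have := normr_ge0 b => *.
by rewrite ler_norml; apply/andP; split; lra.
Qed.

(** The test functions are restricted to box bumps because [pder_comm_ae] applies the lemma at a
    point where derivatives are known to commute for tensor products only. *)
Lemma fundamental_tbump (W : set pt) f : open W -> L2 W f ->
 (forall a b n, 0 < n -> cbox a b `<=` W -> ip W f (tbump a b n) = 0) ->
 {ae mu, forall x, W x -> f x = 0}.
move=> oW fW H; have mW := open_meas oW.
have fi a b : cbox a b `<=` W -> mu.-integrable (obox a b) (EFin \o f).
 move=> abW; have mB := mobox a b; have Boo := obox_fin a b.
 have fB := L2_sub mB mW (subset_trans (@obox_cbox a b) abW) fW.
 have := L2_integrable mB fB (L2_indicS mB mB Boo).
 apply: eq_integrable => // x xB /=.
 by rewrite indicE xB mulr1.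
have S1 a b : cbox a b `<=` W -> \int[mu]_(x in obox a b) f x = 0.
 move=> abW; have mB := mobox a b; have Boo := obox_fin a b.
 have BW := subset_trans (@obox_cbox a b) abW.
 have -> : \int[mu]_(x in obox a b) f x = ip W f (\1_(obox a b)).
  rewrite -(@ip_mkcond _ _ (obox a b) W)//; last first.
   by move=> x _ xB; rewrite indicE memNset// mulr0.
  by apply: eq_Rintegral => x xB; rewrite indicE xB mulr1.
 have [|||||_ h] := @Rint_dominated _ _ W (fun n x => f x * tbump a b n.+1%:R x)
   (fun x => f x * \1_(obox a b) x) (fun x => `|f x| * \1_(cbox a b) x) mW.
 - move=> n; apply: measurable_funM; first by case: fW.
  by have [] := test_L2 mW (tbump_test (ltr0Sn R n) abW).
 - by apply: measurable_funM; [case: fW|exact: measurable_indic].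
 - by move=> x _; apply: cvgMr; exact: tbump_cvg.
 - apply: L2_integrable => //; first exact: L2_abs.
  apply: L2_indicS => //; first exact: measurable_cbox.
  have [M [_ hM]] := compact_bounded (@compact_cbox a b).
  apply: (@bounded_set_fin _ _ _ (M + 1)); first exact: measurable_cbox.
  by move=> x xab; apply: (hM (M + 1)) => //; rewrite ltrDl.
 - move=> n x _; rewrite normrM ler_wpM2l// indicE ger0_norm ?tbump_ge0//.
  have [_|xab] := boolP (x \in cbox a b); first exact: tbump_le1.
  have [_ [K [cK KW hK]]] := tbump_test (ltr0Sn R n) (@subset_refl _ (cbox a b)).
  by rewrite hK// => /KW h; move/negP: xab; apply; rewrite inE.
 have E n : \int[mu]_(x in W) (f x * tbump a b n.+1%:R x) = 0.
  by apply: H; rewrite ?ltr0Sn.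
 move: h; under eq_fun do rewrite E; move=> /cvg_lim h.
 by have := h (@Rhausdorff R); rewrite lim_cst// => ->.
apply: ae_open_cover => // a b abW.
have mB := mobox a b; have fB := fi _ _ abW.
have sub A : measurable A -> mu.-integrable (A `&` obox a b) (EFin \o f).
 by move=> mA; apply: integrableS fB => //; exact: measurableI.
(* The bumps give vanishing integrals over boxes; the pi-lambda theorem extends this to all
   measurable subsets of a fixed box, which forces the function to vanish almost everywhere in
   it. *)
have D : forall A, measurable A -> \int[mu]_(x in A `&` obox a b) f x = 0.
 move=> A; rewrite row_measurableE => sA.
 move: A sA; apply: (@dynkin_induction _ _ _ _ (row_measurableE d) (@setI_obox R d)).
 - by rewrite setTI; exact: S1.
 - move=> _ [a' [b' ->]].
  have -> : obox a' b' `&` obox a b =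
    obox (\row_i Num.max (a' 0 i) (a 0 i)) (\row_i Num.min (b' 0 i) (b 0 i)).
   apply/seteqP; split => x /=.
    case=> h1 h2 i; rewrite !mxE gt_max lt_min.
    by move: (h1 i) (h2 i) => /andP[-> ->] /andP[-> ->].
   move=> h; split => i; move: (h i);
    by rewrite !mxE gt_max lt_min => /andP[/andP[p1 p2] /andP[p3 p4]]; apply/andP.
  apply: S1; apply: subset_trans abW => x h i; move: (h i).
  by rewrite !mxE ge_max le_min => /andP[/andP[_ ->] /andP[_ ->]].
 - move=> A mA HA.
  have U : obox a b = (A `&` obox a b) `|` (~` A `&` obox a b).
   by rewrite -setIUl setUv setTI.
  have := S1 _ _ abW; rewrite {1}U Rintegral_setU ?HA ?add0r//.
  + exact: measurableI.
  + by apply: measurableI => //; exact: measurableC.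
  + by rewrite -setIUl setUv setTI.
  + by apply/disj_setPS => x [[Ax _] [Acx _]].
 - move=> F mF tF HF.
  rewrite setI_bigcupl /Rintegral integral_bigcup//.
  + rewrite eseries0// => i _ _.
   rewrite -[LHS](fineK (integrable_fin_num _ (sub _ (mF i)))); last exact: measurableI.
   by congr EFin; exact: HF.
  + exact: trivIset_setIr.
  + by move=> k; exact: measurableI.
  + by rewrite -setI_bigcupl; apply: sub; exact: bigcupT_measurable.
have := @integral_ae_eq _ _ _ mu (obox a b) mB (fun=> 0%E) (EFin \o f) fB
 (@measurable_cst _ _ _ _ _ _).
move=> h; have {}h : ae_eq mu (obox a b) (EFin \o f) (fun=> 0%E).
 apply: h => E EB mE; rewrite integral0.
 have := D E mE; rewrite (setIidl EB) => h.
 have iE : mu.-integrable E (EFin \o f) by apply: integrableS fB.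
 by rewrite -[LHS](fineK (integrable_fin_num mE iE)); congr EFin.
by apply: filterS h => x h xB; have := h xB => -[].
Qed.

Lemma fundamental_lemma (W : set pt) f : open W -> L2 W f ->
 (forall phi, test_fun W phi -> ip W f phi = 0) ->
 {ae mu, forall x, W x -> f x = 0}.
by move=> oW fW H; apply: fundamental_tbump => // a b n n0 abW; apply: H; exact: tbump_test.
Qed.

End TestFun.

(** * Weak derivatives and weak divergences *)

Section WeakDer.
Context {R : realType} {d : nat}.
Local Notation pt := 'rV[R]_d.
Local Notation mu := (leb d).
Implicit Types (u g f : pt -> R) (W : set pt) (al : 'I_d -> nat) (v : pt -> pt).
Definition unit_al (i : 'I_d) : 'I_d -> nat := fun j => (j == i)%N.
(** [mder] differentiates in the order of the enumeration of the indices, so either of the two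
    derivatives may come first; hence the disjunction. The other cases are needed for the induction
    over the list. *)
Lemma foldr_unit2 (phi : pt -> R) i j s : i != j -> uniq s ->
 let F := foldr (fun k psi => iter (unit_al i k + unit_al j k) (pder k) psi) phi s in
 [/\ i \in s -> j \in s -> F = pder i (pder j phi) \/ F = pder j (pder i phi),
   i \in s -> j \notin s -> F = pder i phi,
   i \notin s -> j \in s -> F = pder j phi &
   i \notin s -> j \notin s -> F = phi].
move=> ij; elim: s => [_|k s IH] /=; first by split.
case/andP=> ks /IH[]; set F := foldr _ _ _ => A B C D.
have ji : j != i by rewrite eq_sym.
rewrite !inE; have [ki|ik] := eqVneq i k.
 rewrite /unit_al -ki eqxx (negbTE ij) (negbTE ji)/=.
 rewrite -ki in ks; split => //.
 - by move=> _ js; left; rewrite C.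
 - by move=> _ js; rewrite D.
have [kj|jk] := eqVneq j k.
 rewrite /unit_al -kj eqxx (negbTE ji)/=.
 rewrite -kj in ks; split => //.
 - by move=> is_ _; right; rewrite B.
 - by move=> is_ _; rewrite D.
rewrite /unit_al !(eq_sym k) (negbTE ik) (negbTE jk) /=.
by split.
Qed.

Lemma foldr_unit (phi : pt -> R) i s : uniq s ->
 let F := foldr (fun k psi => iter (unit_al i k) (pder k) psi) phi s in
 (i \in s -> F = pder i phi) /\ (i \notin s -> F = phi).
elim: s => [_|k s IH] /=; first by split.
case/andP=> ks /IH[]; set F := foldr _ _ _ => A B.
rewrite !inE; have [ki|ik] := eqVneq i k.
 by rewrite /unit_al -ki eqxx/= B// ki.
by rewrite /unit_al (eq_sym k) (negbTE ik) /=.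
Qed.

Lemma mder_unit (phi : pt -> R) i : mder (unit_al i) phi = pder i phi.
Proof. by have [h _] := foldr_unit phi i (enum_uniq 'I_d); apply: h; rewrite mem_enum. Qed.
Lemma sum_unit_al i : (\sum_j unit_al i j)%N = 1%N.
rewrite (bigD1 i)//= /unit_al eqxx big1 ?addn0// => j /negbTE ->.
by [].
Qed.

Lemma mder_unit2 (phi : pt -> R) i j : i != j ->
 mder (fun k => unit_al i k + unit_al j k)%N phi = pder i (pder j phi) \/
 mder (fun k => unit_al i k + unit_al j k)%N phi = pder j (pder i phi).
move=> ij; have [h _ _ _] := foldr_unit2 phi ij (enum_uniq 'I_d).
by apply: h; rewrite mem_enum.
Qed.

Lemma mder_unit2_diag (phi : pt -> R) i :
 mder (fun k => unit_al i k + unit_al i k)%N phi = pder i (pder i phi).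
suff h s : uniq s ->
  let F := foldr (fun k psi => iter (unit_al i k + unit_al i k) (pder k) psi) phi s in
  (i \in s -> F = pder i (pder i phi)) /\ (i \notin s -> F = phi).
 by have [hh _] := h _ (enum_uniq 'I_d); apply: hh; rewrite mem_enum.
elim: s => [_|k s IH] /=; first by split.
case/andP=> ks /IH[]; set F := foldr _ _ _ => A B.
rewrite !inE; have [ki|ik] := eqVneq i k.
 by rewrite /unit_al -ki eqxx/= B// ki.
by rewrite /unit_al (eq_sym k) (negbTE ik) /=.
Qed.

Lemma test_mder W phi al : test_fun W phi -> test_fun W (mder al phi).
move=> tphi; rewrite /mder; elim: (enum _) => //= i s IH.
by elim: (al i) => //= n IHn; exact: test_pder.
Qed.

Lemma ip_test_sub W W' u (phi : pt -> R) : W' `<=` W -> test_fun W' phi ->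
 ip W' u phi = ip W u phi.
move=> W'W tphi; apply: ip_mkcond => // x _ xW'.
by rewrite (test_out tphi)// mulr0.
Qed.

Lemma ae_eq_of_test W u1 u2 : open W -> L2 W u1 -> L2 W u2 ->
 (forall phi, test_fun W phi -> ip W u1 phi = ip W u2 phi) ->
 {ae mu, forall x, W x -> u1 x = u2 x}.
move=> oW u1W u2W H; have mW := open_meas oW.
have := fundamental_lemma oW (L2B mW u1W u2W).
move=> h; have {}h : {ae mu, forall x, W x -> u1 x - u2 x = 0}.
 by apply: h => phi tphi; rewrite ipBl// ?H ?subrr//; exact: test_L2 tphi.
by apply: filterS h => x hx Wx; apply/eqP; rewrite -subr_eq0 hx.
Qed.

Lemma is_wder_uniq W al u g1 g2 : open W -> is_wder W al u g1 -> is_wder W al u g2 ->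
 {ae mu, forall x, W x -> g1 x = g2 x}.
move=> oW [L1 h1] [L2_ h2]; apply: ae_eq_of_test => // phi tphi.
have s0 : (-1) ^+ (\sum_i al i)%N != 0 :> R by rewrite signr_eq0.
by apply: (mulfI s0); rewrite -h1// -h2.
Qed.

Lemma wderP W al u : (exists g, is_wder W al u g) -> is_wder W al u (wder W al u).
Proof. by move=> h; exact: (@xgetPex _ (fun=> 0) _ h). Qed.
Lemma wder_ae W al u g : open W -> is_wder W al u g ->
 {ae mu, forall x, W x -> wder W al u x = g x}.
Proof. by move=> oW h; apply: (is_wder_uniq oW _ h); apply: wderP; exists g. Qed.
Lemma nrm_wder W al u g : open W -> is_wder W al u g -> nrm W (wder W al u) = nrm W g.
move=> oW h; have mW := open_meas oW.
apply: eq_nrm_ae => //; last exact: wder_ae.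
 by have [] : is_wder W al u (wder W al u) by apply: wderP; exists g.
by case: h.
Qed.

Lemma is_wder_sub W W' al u g : open W -> open W' -> W' `<=` W ->
 is_wder W al u g -> is_wder W' al u g.
move=> oW oW' W'W [Lg h]; split.
 exact: L2_sub (open_meas oW') (open_meas oW) W'W Lg.
move=> phi tphi; rewrite !(ip_test_sub _ W'W)//; last exact: test_mder.
by apply: h; exact: test_sub tphi.
Qed.

Lemma is_wder0 W al : is_wder W al (fun=> 0) (fun=> 0).
Proof. by split; [exact: L20|move=> phi tphi; rewrite !ip0l mulr0]. Qed.
Lemma is_wderD W al u1 u2 g1 g2 : open W -> L2 W u1 -> L2 W u2 ->
 is_wder W al u1 g1 -> is_wder W al u2 g2 ->
 is_wder W al (fun x => u1 x + u2 x) (fun x => g1 x + g2 x).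
move=> oW U1 U2 [L1 h1] [L2_ h2]; have mW := open_meas oW.
split; first exact: L2D.
move=> phi tphi; have tL := test_L2 mW tphi; have tmL := test_L2 mW (test_mder al tphi).
by rewrite !ipDl// h1// h2// mulrDr.
Qed.

Lemma is_wderZ W al a u g : open W -> L2 W u ->
 is_wder W al u g -> is_wder W al (fun x => a * u x) (fun x => a * g x).
move=> oW U [L1 h1]; have mW := open_meas oW.
split; first exact: L2Z.
move=> phi tphi; have tL := test_L2 mW tphi; have tmL := test_L2 mW (test_mder al tphi).
by rewrite !ipZl// h1// mulrCA.
Qed.

Lemma is_wderB W al u1 u2 g1 g2 : open W -> L2 W u1 -> L2 W u2 ->
 is_wder W al u1 g1 -> is_wder W al u2 g2 ->
 is_wder W al (fun x => u1 x - u2 x) (fun x => g1 x - g2 x).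
move=> oW U1 U2 h1 /(is_wderZ (-1) oW U2) h2; have mW := open_meas oW.
have := is_wderD oW U1 (L2Z (-1) mW U2) h1 h2.
by congr (is_wder _ _ _ _); apply/funext => x; rewrite mulN1r.
Qed.

Lemma ip_pder (f g : pt -> R) i : C1 f -> C1 g -> bsupp f ->
 ip setT (pder i f) g = - ip setT f (pder i g).
move=> hf hg [M hM]; have [hfg Dfg] := C1M hf hg.
have bfg : bsupp (fun x => f x * g x) by exists M => x /hM ->; rewrite mul0r.
have bfi : bsupp (pder i f) by apply: bsupp_pder; exists M.
have := int_pder i hfg bfg.
rewrite (_ : pder i (fun x => f x * g x) = fun x => pder i f x * g x + f x * pder i g x); last first.
 by apply/funext => x; exact: Dfg.
have [cf hf'] := hf; have [cg hg'] := hg; have [_ cfi] := hf' i; have [_ cgi] := hg' i.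
rewrite RintegralD//; first by rewrite /ip; lra.
- apply: bsupp_integrable; first by move=> x; exact: (cvgM (cfi x) (cg x)).
 by have [N hN] := bfi; exists N => x /hN ->; rewrite mul0r.
- apply: bsupp_integrable; first by move=> x; exact: (cvgM (cf x) (cgi x)).
 by exists M => x /hM ->; rewrite mul0r.
Qed.

Lemma is_wder_C1 W u i : open W -> C1 u -> L2 W (pder i u) ->
 is_wder W (unit_al i) u (pder i u).
move=> oW hu Lu; split => // phi tphi.
rewrite mder_unit sum_unit_al expr1 mulN1r.
rewrite (ip_test_sub _ (@subsetT _ W) (test_pder i tphi)) (ip_test_sub _ (@subsetT _ W) tphi).
rewrite ipC (ip_pder _ (test_C1 tphi) hu (test_bsupp tphi)) ipC.
by [].
Qed.

Lemma pder_prodfC (g : 'I_d -> R -> R) i j : (forall i, smooth1 (g i)) ->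
 pder i (pder j (prodf g)) = pder j (pder i (prodf g)).
move=> sg; have [->//|ij] := eqVneq i j.
have E k : pder k (prodf g) = prodf (upd g k (derive1 (g k))).
 by apply/funext => x; exact: pder_prodf.
have su k l : smooth1 (upd g k (derive1 (g k)) l).
 by rewrite /upd; case: eqP => // _; exact: smooth1_derive.
rewrite !E; apply/funext => x.
rewrite (pder_prodf i x (su j)) (pder_prodf j x (su i)); congr (prodf _ x).
rewrite /upd (negbTE ij) eq_sym (negbTE ij); apply/funext => k.
by case: eqP => // ->; rewrite (negbTE ij).
Qed.

Lemma pder_tbumpC i j (a b : pt) n : 0 < n ->
 pder i (pder j (tbump a b n)) = pder j (pder i (tbump a b n)).
Proof. by move=> n0; apply: pder_prodfC => k; exact: smooth1_tbump1. Qed.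
(** Tested against a box bump, both derivatives are moved onto the bump, where they commute.
    Equality almost everywhere is enough, since it is applied under an integral. *)
Lemma pder_comm_ae i j (phi : pt -> R) : smooth phi -> bsupp phi ->
 {ae mu, forall x, pder i (pder j phi) x = pder j (pder i phi) x}.
move=> sphi bphi.
have C s : C1 (foldr pder phi s).
 by apply: smooth_C1; elim: s => //= k s; exact: smooth_pder.
have B s : bsupp (foldr pder phi s) by elim: s => //= k s; exact: bsupp_pder.
have L s : L2 setT (foldr pder phi s) by apply: bsupp_L2T; [exact: (C s).1|exact: B].
have h : {ae mu, forall x, setT x -> pder i (pder j phi) x - pder j (pder i phi) x = 0}.
 apply: (@fundamental_tbump _ _ setT (fun x => pder i (pder j phi) x - pder j (pder i phi) x)).
 - exact: openT.
 - by apply: L2B => //; [exact: (L [:: i; j])|exact: (L [:: j; i])].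
 - move=> a b n n0 _.
  have tb := tbump_test n0 (@subsetT _ (cbox a b)).
  have cb := test_C1 tb; have bb := test_bsupp tb.
  have cbi k := test_C1 (test_pder k tb); have bbi k := test_bsupp (test_pder k tb).
  have Lb := test_L2 measurableT tb.
  rewrite ipBl//; [|exact: (L [:: i; j])|exact: (L [:: j; i])].
  have E k l : ip setT (pder k (pder l phi)) (tbump a b n) =
    ip setT phi (pder l (pder k (tbump a b n))).
   transitivity (- ip setT (pder l phi) (pder k (tbump a b n))).
    exact: (ip_pder _ (C [:: l]) cb (B [:: l])).
   apply/eqP; rewrite eqr_oppLR; apply/eqP.
   exact: (ip_pder _ (C [::]) (cbi k) (B [::])).
  have EQ : ip setT (pder j (pder i phi)) (tbump a b n) =
       ip setT (pder i (pder j phi)) (tbump a b n).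
   transitivity (ip setT phi (pder i (pder j (tbump a b n)))); first exact: (E j i).
   transitivity (ip setT phi (pder j (pder i (tbump a b n)))); last exact/esym/(E i j).
   exact: (congr1 (ip setT phi) (pder_tbumpC i j a b n0)).
  exact: (etrans (congr1 (fun t => _ - t) EQ) (subrr _)).
apply: filterS h => x h; apply/eqP; rewrite -subr_eq0; apply/eqP; exact: h.
Qed.

(** A weak derivative of order two is defined directly by its multi-index. Testing the first
    derivative with the derivative of a test function shows that it is also an iterated one, so that
    gradients of H^2 functions are H^1 fields. *)
Lemma is_wder_comp W u i j vi g : open W -> L2 W u ->
 is_wder W (unit_al i) u vi -> is_wder W (fun k => unit_al i k + unit_al j k)%N u g ->
 is_wder W (unit_al j) vi g.
move=> oW Lu [Lv hv] [Lg hg]; split => // phi tphi; have mW := open_meas oW.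
have tj := test_pder j tphi; have ti := test_pder i tphi.
rewrite mder_unit sum_unit_al expr1 mulN1r.
have := hv _ tj; rewrite mder_unit sum_unit_al expr1 mulN1r => h1.
have := hg _ tphi; rewrite big_split/= !sum_unit_al sqrrN expr1n mul1r => h2.
have : ip W u (pder i (pder j phi)) = ip W g phi.
 rewrite -h2; have [ij|ij] := eqVneq i j; first by rewrite ij mder_unit2_diag.
 have [->//|->] := mder_unit2 phi ij.
 have [sphi _] := tphi.
 transitivity (ip W (pder i (pder j phi)) u); first exact: ipC.
 transitivity (ip W (pder j (pder i phi)) u); last exact: ipC.
 apply: (eq_ip_ae mW _ _ Lu).
 - exact: test_L2 (test_pder i tj).
 - exact: test_L2 (test_pder j ti).
 - by apply: filterS (pder_comm_ae i j sphi (test_bsupp tphi)) => x hx _.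
by move=> <-; rewrite h1 opprK.
Qed.

Lemma is_wdiv_uniq W v g1 g2 : open W -> is_wdiv W v g1 -> is_wdiv W v g2 ->
 {ae mu, forall x, W x -> g1 x = g2 x}.
move=> oW [L1 h1] [L2_ h2]; apply: ae_eq_of_test => // phi tphi.
by apply: oppr_inj; rewrite -h1// -h2.
Qed.

Lemma wdivP W v : (exists g, is_wdiv W v g) -> is_wdiv W v (wdiv W v).
Proof. by move=> h; exact: (@xgetPex _ (fun=> 0) _ h). Qed.
Lemma wdiv_ae W v g : open W -> is_wdiv W v g ->
 {ae mu, forall x, W x -> wdiv W v x = g x}.
Proof. by move=> oW h; apply: (is_wdiv_uniq oW _ h); apply: wdivP; exists g. Qed.
Lemma HdivP W v : Hdiv W v -> [/\ L2v W v, is_wdiv W v (wdiv W v) & L2 W (wdiv W v)].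
Proof. by move=> [Lv h]; have [] := wdivP h. Qed.
Definition grad (phi : pt -> R) : pt -> pt := fun x => \row_i pder i phi x.
Lemma vcoord_grad phi i : vcoord (grad phi) i = pder i phi.
Proof. by apply/funext => x; rewrite /vcoord mxE. Qed.
Lemma grad_L2v W S phi : measurable S -> test_fun W phi -> L2v S (grad phi).
Proof. by move=> mS tphi i; rewrite vcoord_grad; exact: test_L2 (test_pder i tphi). Qed.
Lemma is_wdiv_sub W W' v g : open W -> open W' -> W' `<=` W ->
 is_wdiv W v g -> is_wdiv W' v g.
move=> oW oW' W'W [Lg h]; split.
 exact: L2_sub (open_meas oW') (open_meas oW) W'W Lg.
move=> phi tphi; rewrite (ip_test_sub _ W'W)// -h; last exact: test_sub tphi.
apply: eq_bigr => i _; rewrite (vcoord_grad phi i) (ip_test_sub _ W'W)//; exact: test_pder.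
Qed.

Lemma Hdiv_sub W W' v : open W -> open W' -> W' `<=` W -> Hdiv W v -> Hdiv W' v.
move=> oW oW' W'W [Lv [g hg]]; split.
 exact: L2v_sub (open_meas oW') (open_meas oW) W'W Lv.
by exists g; exact: is_wdiv_sub hg.
Qed.

Lemma is_wdivD W v1 v2 g1 g2 : open W -> L2v W v1 -> L2v W v2 ->
 is_wdiv W v1 g1 -> is_wdiv W v2 g2 ->
 is_wdiv W (fun x => v1 x + v2 x) (fun x => g1 x + g2 x).
move=> oW V1 V2 [L1 h1] [L2_ h2]; have mW := open_meas oW.
split; first exact: L2D.
move=> phi tphi; have tL := test_L2 mW tphi; have tg := grad_L2v mW tphi.
by rewrite ipvDl// ipDl// h1// h2// opprD.
Qed.

Lemma is_wdivZ W a v g : open W -> L2v W v ->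
 is_wdiv W v g -> is_wdiv W (fun x => a *: v x) (fun x => a * g x).
move=> oW V [L1 h1]; have mW := open_meas oW.
split; first exact: L2Z.
move=> phi tphi; have tL := test_L2 mW tphi; have tg := grad_L2v mW tphi.
by rewrite ipvZl// ipZl// h1// mulrN.
Qed.

Lemma is_wdivB W v1 v2 g1 g2 : open W -> L2v W v1 -> L2v W v2 ->
 is_wdiv W v1 g1 -> is_wdiv W v2 g2 ->
 is_wdiv W (fun x => v1 x - v2 x) (fun x => g1 x - g2 x).
move=> oW V1 V2 h1 /(is_wdivZ (-1) oW V2) h2; have mW := open_meas oW.
have := is_wdivD oW V1 (L2vZ (-1) mW V2) h1 h2.
by congr (is_wdiv _ _ _); apply/funext => x; rewrite ?scaleN1r ?mulN1r.
Qed.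

Lemma HdivD W v1 v2 : open W -> Hdiv W v1 -> Hdiv W v2 -> Hdiv W (fun x => v1 x + v2 x).
move=> oW [V1 [g1 h1]] [V2 [g2 h2]]; split.
 by apply: L2vD => //; exact: open_meas.
by eexists; exact: is_wdivD h1 h2.
Qed.

Lemma HdivZ W a v : open W -> Hdiv W v -> Hdiv W (fun x => a *: v x).
move=> oW [V1 [g1 h1]]; split.
 by apply: L2vZ => //; exact: open_meas.
by eexists; exact: is_wdivZ h1.
Qed.

Lemma HdivB W v1 v2 : open W -> Hdiv W v1 -> Hdiv W v2 -> Hdiv W (fun x => v1 x - v2 x).
move=> oW [V1 [g1 h1]] [V2 [g2 h2]]; split.
 by apply: L2vB => //; exact: open_meas.
by eexists; exact: is_wdivB h1 h2.
Qed.

Lemma is_wdiv_of_wder W v (g : 'I_d -> pt -> R) : open W ->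
 (forall i, is_wder W (unit_al i) (vcoord v i) (g i)) ->
 is_wdiv W v (fun x => \sum_i g i x).
move=> oW H; have mW := open_meas oW; split.
 by apply: L2_sum => // i _; case: (H i).
move=> phi tphi; rewrite ip_suml//; last 2 first.
- by move=> i _; case: (H i).
- exact: test_L2 tphi.
rewrite -sumrN; apply: eq_bigr => i _; have [_ h] := H i.
by have := h _ tphi; rewrite mder_unit sum_unit_al expr1 mulN1r (vcoord_grad phi).
Qed.

Lemma wdivB_ae W v1 v2 : open W -> Hdiv W v1 -> Hdiv W v2 ->
 {ae mu, forall x, W x -> wdiv W (fun x => v1 x - v2 x) x = wdiv W v1 x - wdiv W v2 x}.
move=> oW h1 h2; apply: wdiv_ae => //.
have [V1 d1 _] := HdivP h1; have [V2 d2 _] := HdivP h2.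
exact: is_wdivB.
Qed.

Lemma wdiv_sub_ae W W' v : open W -> open W' -> W' `<=` W -> Hdiv W v ->
 {ae mu, forall x, W' x -> wdiv W' v x = wdiv W v x}.
move=> oW oW' W'W h; apply: wdiv_ae => //.
by have [_ d1 _] := HdivP h; exact: is_wdiv_sub d1.
Qed.

End WeakDer.

(** * Sobolev norms, functions vanishing on the boundary and zero extension *)

Section Sobolev.
Context {R : realType} {d : nat}.
Local Notation pt := 'rV[R]_d.
Local Notation e_ i := (delta_mx 0 i : pt).
Implicit Types (u g f z : pt -> R) (W : set pt) (al : 'I_d -> nat) (v : pt -> pt).
Lemma le_eps0 (x K : R) : 0 <= K -> (forall eps, 0 < eps -> x <= K * eps) -> x <= 0.
move=> K0 H; rewrite leNgt; apply/negP => x0.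
have := H (x / (2 * (K + 1))); rewrite divr_gt0//; last lra.
move=> /(_ isT); rewrite leNgt => /negP; apply.
by rewrite mulrA ltr_pdivrMr; [nra|lra].
Qed.

Lemma le_nrmv_sum S v : nrmv S v <= \sum_i nrm S (vcoord v i).
have s0 : 0 <= \sum_i nrm S (vcoord v i) by apply: sumr_ge0 => i _; exact: nrm_ge0.
rewrite -(@ler_pXn2r _ 2)// ?nnegrE ?nrmv_ge0// nrmv_sqE expr2 mulr_suml.
apply: ler_sum => i _; rewrite expr2 ler_wpM2l ?nrm_ge0//.
by rewrite (bigD1 i)//= lerDl sumr_ge0// => j _; exact: nrm_ge0.
Qed.

Lemma sqrt_sum_le (I : finType) (P : pred I) (x : I -> R) B : 0 <= B ->
 (forall i, P i -> 0 <= x i <= B) -> Num.sqrt (\sum_(i | P i) x i ^+ 2) <= #|I|%:R * B.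
move=> B0 H; have [i0 Pi0|P0] := pickP P.
 have I0 : 1 <= #|I|%:R :> R by rewrite ler1n; apply/card_gt0P; exists i0.
 rewrite -(@ler_pXn2r _ 2)// ?nnegrE ?sqrtr_ge0// ?mulr_ge0//.
 rewrite sqr_sqrtr ?sumr_ge0// => [|i _]; last exact: sqr_ge0.
 apply: (@le_trans _ _ (\sum_(i | P i) B ^+ 2)).
  by apply: ler_sum => i /H /andP[? ?]; rewrite lerXn2r// nnegrE.
 rewrite sumr_const -[leLHS]mulr_natl [leRHS]exprMn ler_wpM2r ?sqr_ge0//.
 apply: (@le_trans _ _ #|I|%:R); first by rewrite ler_nat max_card.
 by rewrite expr2 ler_peMr.
by rewrite big_pred0// sqrtr0 mulr_ge0.
Qed.

Lemma mder_foldr al : exists s, size s = (\sum_i al i)%N /\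
 forall phi : pt -> R, mder al phi = foldr pder phi s.
exists (flatten [seq nseq (al i) i | i <- enum 'I_d]); split.
 rewrite size_flatten /shape -map_comp sumnE big_map big_enum /=.
 by apply: eq_bigr => i _; rewrite size_nseq.
move=> phi; rewrite /mder; elim: (enum _) => //= i s IH.
by rewrite foldr_cat -IH; elim: (al i) => //= n ->.
Qed.

Lemma ip_pder_test W phi psi i : C1 phi -> test_fun W psi ->
 ip W phi (pder i psi) = - ip W (pder i phi) psi.
move=> hphi tpsi.
rewrite (ip_test_sub _ (@subsetT _ W) (test_pder i tpsi)) (ip_test_sub _ (@subsetT _ W) tpsi).
by rewrite ipC (ip_pder _ (test_C1 tpsi) hphi (test_bsupp tpsi)) ipC.
Qed.

Lemma is_wder_test W al phi : measurable W -> test_fun setT phi ->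
 exists g, is_wder W al phi g /\ test_fun setT g.
move=> mW; have [s [sz sE]] := mder_foldr al.
move=> tphi; exists (foldr pder phi (rev s)).
have tg : test_fun setT (foldr pder phi (rev s)).
 by elim: (rev s) => //= i t; exact: test_pder.
do 2!split => //; first exact: test_L2 tg.
move=> psi tpsi; rewrite sE -sz => {sE tg sz}.
elim: s phi tphi => [|i s IH] phi tphi /=; first by rewrite expr0 mul1r.
rewrite ip_pder_test; [|exact: test_C1 tphi|]; last first.
 by elim: s {IH} => //= j s; exact: test_pder.
by rewrite IH; [rewrite rev_cons foldr_rcons exprS mulN1r mulNr|exact: test_pder].
Qed.

Lemma mder_al0 (phi : pt -> R) : mder (fun=> 0%N) phi = phi.
Proof. by rewrite /mder; elim: (enum _) => //= i s ->. Qed.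
Lemma is_wder_al0 W u : L2 W u -> is_wder W (fun=> 0%N) u u.
Proof. by move=> Lu; split => // phi tphi; rewrite mder_al0 big1// expr0 mul1r. Qed.
Lemma al_le1 al : (\sum_i al i <= 1)%N -> al = (fun=> 0%N) \/ exists i, al = unit_al i.
move=> h; have [i hi|h0] := pickP (fun i => al i != 0%N); last first.
 by left; apply/funext => i; apply/eqP; have := h0 i => /negbFE.
right; exists i; apply/funext => j; rewrite /unit_al.
rewrite (bigD1 i)//= in h; have [->|ji] := eqVneq j i.
 by move: h hi; lia.
by rewrite (bigD1 j)//= in h; move: h hi; lia.
Qed.

Lemma Hm1P W u : L2 W u -> (forall i, exists g, is_wder W (unit_al i) u g) -> Hm W 1 u.
move=> Lu H; split => // al /al_le1[->|[i ->]]; last exact: H.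
by exists u; exact: is_wder_al0.
Qed.

Lemma Hm_le W m n u : (n <= m)%N -> Hm W m u -> Hm W n u.
Proof. by move=> nm [Lu H]; split => // al aln; apply: H; exact: leq_trans nm. Qed.
Lemma Hm_wder W u i m : Hm W m.+1 u -> is_wder W (unit_al i) u (wder W (unit_al i) u).
Proof. by move=> [_ H]; apply: wderP; apply: H; rewrite sum_unit_al. Qed.
Lemma Hm_test W m phi : measurable W -> test_fun setT phi -> Hm W m phi.
move=> mW tphi; split => [|al _]; first exact: test_L2 tphi.
by have [g []] := is_wder_test al mW tphi; exists g.
Qed.

Lemma ffun_al al m : (\sum_i al i <= m)%N ->
 exists a : {ffun 'I_d -> 'I_m.+1}, (fun i => a i : nat) = al.
move=> h; exists [ffun i => inord (al i)]; apply/funext => i; rewrite ffunE inordK// ltnS.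
by apply: leq_trans h; rewrite (bigD1 i)//= leq_addr.
Qed.

Lemma wder_hnorm W al m u : (\sum_i al i <= m)%N ->
 nrm W (wder W al u) <= hnorm W m u.
move=> h; have [a aE] := ffun_al h.
have e : (\sum_i (a i : nat) <= m)%N by have := congr1 (fun f : 'I_d -> nat => (\sum_i f i)%N) aE => /= ->.
rewrite /hnorm (bigD1 a)//= aE -[leLHS]ger0_norm ?nrm_ge0// -sqrtr_sqr ler_sqrt.
 by rewrite lerDl sumr_ge0// => *; exact: sqr_ge0.
by rewrite addr_ge0 ?sqr_ge0 ?sumr_ge0// => *; exact: sqr_ge0.
Qed.

Lemma hnorm_ge0 W m u : 0 <= hnorm W m u. Proof. exact: sqrtr_ge0. Qed.
Lemma hsemi_ge0 W m u : 0 <= hsemi W m u. Proof. exact: sqrtr_ge0. Qed.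
Lemma hnormv_ge0 W m v : 0 <= hnormv W m v. Proof. exact: sqrtr_ge0. Qed.
Lemma hsemiv_ge0 W m v : 0 <= hsemiv W m v. Proof. exact: sqrtr_ge0. Qed.
(** A crude count of the terms in [hsemi] and [hnorm]: all maps into 0, ..., m, whether or not their
    sum is admissible. *)
Definition nal m : R := #|{ffun 'I_d -> 'I_m.+1}|%:R.
Lemma nal_ge0 m : 0 <= nal m. Proof. exact: ler0n. Qed.
Lemma hsemi_le W m u B : 0 <= B ->
 (forall al, (\sum_i al i = m)%N -> nrm W (wder W al u) <= B) -> hsemi W m u <= nal m * B.
by move=> B0 H; apply: sqrt_sum_le => // a /eqP /H ->; rewrite nrm_ge0.
Qed.

Lemma hsemi_hnorm W m n u : (m <= n)%N -> hsemi W m u <= nal m * hnorm W n u.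
move=> mn; apply: hsemi_le; first exact: hnorm_ge0.
by move=> al alm; apply: wder_hnorm; rewrite alm.
Qed.

Lemma hsemiv_hnormv W m n v : (m <= n)%N ->
 hsemiv W m v <= d%:R * (nal m * hnormv W n v).
move=> mn; rewrite -[X in X%:R]card_ord; apply: sqrt_sum_le => [|i _].
 by rewrite mulr_ge0 ?nal_ge0 ?hnormv_ge0.
rewrite hsemi_ge0/=; apply: le_trans (hsemi_hnorm _ _ mn) _.
rewrite ler_wpM2l ?nal_ge0// /hnormv (bigD1 i)//=.
rewrite -[leLHS]ger0_norm ?hnorm_ge0// -sqrtr_sqr ler_sqrt.
 by rewrite lerDl sumr_ge0// => *; exact: sqr_ge0.
by rewrite addr_ge0 ?sqr_ge0 ?sumr_ge0// => *; exact: sqr_ge0.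
Qed.

Lemma nrm_wder_sub W W' al u : open W -> open W' -> W' `<=` W ->
 (exists g, is_wder W al u g) -> nrm W' (wder W' al u) <= nrm W (wder W al u).
move=> oW oW' W'W /wderP h; have h' := is_wder_sub oW oW' W'W h.
rewrite (nrm_wder oW' h').
by apply: nrm_sub => //; [exact: open_meas|exact: open_meas|case: h].
Qed.

Lemma hsemi_sub W W' m u : open W -> open W' -> W' `<=` W -> Hm W m u ->
 hsemi W' m u <= hsemi W m u.
move=> oW oW' W'W [_ H]; rewrite ler_sqrt ?sumr_ge0// => *; last exact: sqr_ge0.
apply: ler_sum => a /eqP am; rewrite lerXn2r ?nnegrE ?nrm_ge0//.
by apply: nrm_wder_sub => //; apply: H; rewrite am.
Qed.

Lemma hsemiv_sub W W' m v : open W -> open W' -> W' `<=` W -> Hmv W m v ->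
 hsemiv W' m v <= hsemiv W m v.
move=> oW oW' W'W H; rewrite ler_sqrt ?sumr_ge0// => *; last exact: sqr_ge0.
apply: ler_sum => a _; rewrite lerXn2r ?nnegrE ?hsemi_ge0//.
exact: hsemi_sub.
Qed.

Lemma vcoord_wgrad W u i : vcoord (wgrad W u) i = wder W (unit_al i) u.
Proof. by apply/funext => x; rewrite /vcoord mxE. Qed.
Lemma wgrad_L2v W u : Hm W 1 u -> L2v W (wgrad W u).
Proof. by move=> h i; rewrite vcoord_wgrad; case: (Hm_wder i h). Qed.
Lemma Hm2_wder W u i j : open W -> Hm W 2 u ->
 is_wder W (unit_al j) (wder W (unit_al i) u) (wder W (fun k => unit_al i k + unit_al j k)%N u).
move=> oW h; have [Lu H] := h.
apply: (is_wder_comp oW Lu (Hm_wder i h)); apply: wderP; apply: H.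
by rewrite big_split/= !sum_unit_al.
Qed.

Lemma Hmv_wgrad W u : open W -> Hm W 2 u -> Hmv W 1 (wgrad W u).
move=> oW h i; rewrite vcoord_wgrad; apply: Hm1P; first by case: (Hm_wder i h).
by move=> j; eexists; exact: Hm2_wder.
Qed.

Lemma hsemiv_wgrad W u : open W -> Hm W 2 u ->
 hsemiv W 1 (wgrad W u) <= d%:R * (nal 1 * hnorm W 2 u).
move=> oW h; rewrite -[X in X%:R]card_ord; apply: sqrt_sum_le => [|i _].
 by rewrite mulr_ge0 ?nal_ge0 ?hnorm_ge0.
rewrite hsemi_ge0/=; apply: hsemi_le; first exact: hnorm_ge0.
move=> al al1; have /al_le1[al0|[j ->]] : (\sum_i al i <= 1)%N by rewrite al1.
 by move: al1; rewrite al0 big1.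
rewrite vcoord_wgrad (nrm_wder oW (Hm2_wder i j oW h)).
by apply: wder_hnorm; rewrite big_split/= !sum_unit_al.
Qed.

Lemma Hmv_is_wdiv W v : open W -> Hmv W 1 v ->
 is_wdiv W v (fun x => \sum_i wder W (unit_al i) (vcoord v i) x).
Proof. by move=> oW h; apply: is_wdiv_of_wder => // i; exact: Hm_wder (h i). Qed.
Lemma Hmv_Hdiv W m v : open W -> Hmv W m.+1 v -> Hdiv W v.
move=> oW h; have h1 : Hmv W 1 v by move=> i; apply: Hm_le (h i).
by split; [move=> i; have [] := h i|eexists; exact: Hmv_is_wdiv h1].
Qed.

Lemma nrm_wdiv W v g : open W -> is_wdiv W v g -> nrm W (wdiv W v) = nrm W g.
move=> oW h; have mW := open_meas oW.
apply: eq_nrm_ae => //; last exact: wdiv_ae.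
 by have [] : is_wdiv W v (wdiv W v) by apply: wdivP; exists g.
by case: h.
Qed.

Lemma nrm_sum W I (r : seq I) (F : I -> pt -> R) : measurable W ->
 (forall i, L2 W (F i)) ->
 nrm W (fun x => \sum_(i <- r) F i x) <= \sum_(i <- r) nrm W (F i).
move=> mW H; elim: r => [|i r IH].
 by rewrite big_nil (@eq_nrm _ _ _ _ (fun=> 0)) ?nrm0// => x _; rewrite big_nil.
rewrite big_cons; apply: le_trans (lerD (lexx _) IH).
rewrite (@eq_nrm _ _ _ _ (fun x => F i x + \sum_(j <- r) F j x)); last first.
 by move=> x _; rewrite big_cons.
by apply: nrmD => //; exact: L2_sum.
Qed.

Lemma nrm_wdiv_wgrad W u : open W -> Hm W 2 u ->
 nrm W (wdiv W (wgrad W u)) <= d%:R * hnorm W 2 u.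
move=> oW h; have mW := open_meas oW.
have D := @is_wdiv_of_wder _ _ W (wgrad W u)
 (fun i => wder W (fun k => unit_al i k + unit_al i k)%N u) oW.
rewrite (nrm_wdiv oW (D _)); last first.
 by move=> i; rewrite vcoord_wgrad; exact: Hm2_wder.
apply: le_trans (nrm_sum _ mW _) _.
 by move=> i; case: (Hm2_wder i i oW h).
rewrite mulr_natl -[X in _ *+ X]card_ord -sumr_const; apply: ler_sum => i _.
by rewrite wder_hnorm// big_split/= !sum_unit_al.
Qed.

Lemma Hm_cst0 W m : Hm W m (fun=> 0).
Proof. by split; [exact: L20|move=> al _; exists (fun=> 0); exact: is_wder0]. Qed.
Lemma hsemi_cst0 W m : open W -> hsemi W m (fun=> 0) = 0.
move=> oW; rewrite /hsemi big1 ?sqrtr0// => a _.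
by rewrite (nrm_wder oW (is_wder0 W _)) nrm0 expr0n.
Qed.

(** Turns a scalar into a vector field, both to feed scalars to the interpolation operator of the
    ghost penalty, which acts on vector fields, and to test the first equation of the mixed problem
    in one component. *)
Definition axis (i : 'I_d) u : pt -> pt := fun x => u x *: e_ i.
Lemma vcoord_axis i u j : vcoord (axis i u) j = if j == i then u else (fun=> 0).
apply/funext => x; rewrite /vcoord /axis !mxE eqxx /=.
by case: eqP => _; rewrite ?mulr1 ?mulr0.
Qed.

Lemma Hmv_axis W m i u : Hm W m u -> Hmv W m (axis i u).
Proof. by move=> h j; rewrite vcoord_axis; case: eqP => // _; exact: Hm_cst0. Qed.
Lemma hsemiv_axis W m i u : open W -> hsemiv W m (axis i u) = hsemi W m u.
move=> oW; rewrite /hsemiv (bigD1 i)//= big1 => [|j ji]; last first.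
 by rewrite vcoord_axis (negbTE ji) hsemi_cst0// expr0n.
by rewrite vcoord_axis eqxx addr0 sqrtr_sqr ger0_norm// hsemi_ge0.
Qed.

Lemma H10_approx W z eps : open W -> H10 W z -> 0 < eps ->
 exists phi, [/\ test_fun W phi, nrm W (fun x => z x - phi x) < eps &
  forall i, nrm W (fun x => wder W (unit_al i) z x - pder i phi x) < eps].
move=> oW [hz H] /H[phi [tphi lt]]; have mW := open_meas oW.
exists phi; split => //.
 have := @wder_hnorm W (fun=> 0%N) 1 (z \- phi); rewrite big1// => /(_ isT).
 rewrite (nrm_wder oW (@is_wder_al0 W _ _)); first by move=> h; exact: le_lt_trans h lt.
 by apply: L2B => //; [case: hz|exact: test_L2 tphi].
move=> i; apply: le_lt_trans lt.
have := @wder_hnorm W (unit_al i) 1 (z \- phi); rewrite sum_unit_al => /(_ isT).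
rewrite (@nrm_wder _ _ W _ (z \- phi) (fun x => wder W (unit_al i) z x - pder i phi x) oW)//.
apply: is_wderB => //; [by case: hz|exact: test_L2 tphi|exact: Hm_wder hz|].
by apply: is_wder_C1 => //; [exact: test_C1 tphi|exact: test_L2 (test_pder i tphi)].
Qed.

(** For test functions this is the definition of the weak divergence, and both sides are continuous
    in the H^1 norm. *)
Lemma H10_green W z v : open W -> H10 W z -> Hdiv W v ->
 ipv W v (wgrad W z) = - ip W (wdiv W v) z.
move=> oW hz hv; have mW := open_meas oW.
have [Lv [Ld hdiv] _] := HdivP hv; have [[Lz _] _] := hz.
apply/eqP; rewrite -subr_eq0 opprK -normr_le0; apply/eqP; rewrite -[X in X <= _]normr_id.
apply/eqP.
pose K := \sum_i nrm W (vcoord v i) + nrm W (wdiv W v).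
have K0 : 0 <= K by rewrite addr_ge0 ?nrm_ge0// sumr_ge0// => i _; exact: nrm_ge0.
rewrite normr_id; apply: (@le_eps0 _ K) => // eps e0.
have [phi [tphi n1 n2]] := H10_approx oW hz e0.
have Lphi := test_L2 mW tphi; have Lg := grad_L2v mW tphi.
have Lwg : L2v W (wgrad W z) by apply: wgrad_L2v; case: hz.
have -> : ipv W v (wgrad W z) + ip W (wdiv W v) z =
  ipv W v (fun x => wgrad W z x - grad phi x) + ip W (wdiv W v) (fun x => z x - phi x).
 by rewrite ipvBr// ipBr// (hdiv _ tphi); ring.
apply: le_trans (ler_normD _ _) _; rewrite mulrDl lerD//; last first.
 apply: le_trans (ip_CS mW Ld (L2B mW Lz Lphi)) _.
 by rewrite ler_wpM2l ?nrm_ge0// ltW.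
apply: le_trans (ler_norm_sum _ _ _) _; rewrite mulr_suml; apply: ler_sum => i _.
have E : vcoord (fun x => wgrad W z x - grad phi x) i =
  (fun x => wder W (unit_al i) z x - pder i phi x).
 by apply/funext => x; rewrite /vcoord !mxE.
rewrite E; apply: le_trans (ip_CS mW (Lv i) _) _.
 by apply: L2B => //; [rewrite -vcoord_wgrad; exact: Lwg|rewrite -vcoord_grad; exact: Lg].
by rewrite ler_wpM2l ?nrm_ge0// ltW.
Qed.

Definition zext W z : pt -> R := z \_ W.
Lemma zextE W z x : W x -> zext W z x = z x.
Proof. by move=> Wx; rewrite /zext patchE mem_set. Qed.
Lemma zext_out W z x : ~ W x -> zext W z x = 0.
Proof. by move=> Wx; rewrite /zext patchE memNset. Qed.
Lemma L2_zext W S z : measurable W -> measurable S -> L2 W z -> L2 S (zext W z).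
move=> mW mS [mz iz]; apply: (L2_sub mS measurableT (@subsetT _ S)); split.
 exact/(measurable_restrictT z mW).
apply: le_lt_trans iz; rewrite [leRHS]integral_mkcond; le_eq.
apply: eq_integral => x _; rewrite /zext !patchE; case: ifP => // _.
by rewrite expr0n.
Qed.

Lemma ip_zext W S z g : W `<=` S -> ip S (zext W z) g = ip W z g.
move=> WS; rewrite -(@ip_mkcond _ _ W S (zext W z) g WS).
 by apply: eq_ip => // x Wx; rewrite zextE.
by move=> x _ nW; rewrite zext_out// mul0r.
Qed.

Lemma nrm_zext W S z : W `<=` S -> nrm S (zext W z) = nrm W z.
move=> WS; rewrite /nrm ip_zext// ipC -(@ip_zext W W z z)//.
Qed.

(** Approximating test functions are already zero near the boundary of [W], so the zero extension
    acquires no jump. The dual solution is extended in this way in order to be approximated on the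
    whole active domain. *)
Lemma is_wder_zext W S z i : open W -> open S -> W `<=` S -> H10 W z ->
 is_wder S (unit_al i) (zext W z) (zext W (wder W (unit_al i) z)).
move=> oW oS WS hz; have mW := open_meas oW; have mS := open_meas oS.
have [[Lz _] _] := hz; have [hz1 _] := hz.
have [Lw _] := Hm_wder i hz1.
split; first exact: L2_zext.
move=> psi tpsi; rewrite mder_unit sum_unit_al expr1 mulN1r !ip_zext//.
have Lp := test_L2 mW tpsi; have Lpi := test_L2 mW (test_pder i tpsi).
apply/eqP; rewrite -subr_eq0 opprK -normr_le0.
pose K := nrm W (pder i psi) + nrm W psi.
have K0 : 0 <= K by rewrite addr_ge0 ?nrm_ge0.
apply: (@le_eps0 _ K) => // eps e0.
have [phi [tphi n1 n2]] := H10_approx oW hz e0.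
have Lphi := test_L2 mW tphi; have Lphii := test_L2 mW (test_pder i tphi).
have E0 : ip W phi (pder i psi) = - ip W (pder i phi) psi.
 have := ip_pder_test i (test_C1 tpsi) tphi.
 by rewrite ipC => ->; rewrite opprK ipC.
have -> : ip W z (pder i psi) + ip W (wder W (unit_al i) z) psi =
  ip W (fun x => z x - phi x) (pder i psi) +
  ip W (fun x => wder W (unit_al i) z x - pder i phi x) psi.
 by rewrite !ipBl// E0; ring.
apply: le_trans (ler_normD _ _) _; rewrite mulrDl lerD//.
 apply: le_trans (ip_CS mW (L2B mW Lz Lphi) Lpi) _.
 by rewrite mulrC ler_wpM2l ?nrm_ge0// ltW.
apply: le_trans (ip_CS mW (L2B mW Lw Lphii) Lp) _.
by rewrite mulrC ler_wpM2l ?nrm_ge0// ltW.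
Qed.

Lemma Hm_zext W S z : open W -> open S -> W `<=` S -> H10 W z -> Hm S 1 (zext W z).
move=> oW oS WS hz; apply: Hm1P; last by move=> i; eexists; exact: is_wder_zext.
by apply: L2_zext; [exact: open_meas|exact: open_meas|case: hz => -[]].
Qed.

Lemma hsemi_zext W S z m : open W -> open S -> W `<=` S -> H10 W z ->
 hsemi S 1 (zext W z) <= nal 1 * hnorm W m.+1 z.
move=> oW oS WS hz; apply: hsemi_le; first exact: hnorm_ge0.
move=> al al1; have /al_le1[al0|[i ->]] : (\sum_i al i <= 1)%N by rewrite al1.
 by move: al1; rewrite al0 big1.
rewrite (nrm_wder oS (is_wder_zext i oW oS WS hz)) nrm_zext//.
by apply: wder_hnorm; rewrite sum_unit_al.
Qed.

Lemma H10_test W phi : open W -> test_fun W phi -> H10 W phi.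
move=> oW tphi; have mW := open_meas oW.
have tT := test_sub (@subsetT _ W) tphi; split; first exact: Hm_test.
move=> eps e0; exists phi; split => //; apply: le_lt_trans e0.
rewrite (_ : phi \- phi = fun=> 0); last by apply/funext => x; rewrite /= subrr.
rewrite /hnorm big1 ?sqrtr0// => a _.
by rewrite (nrm_wder oW (is_wder0 W _)) nrm0 expr0n.
Qed.

End Sobolev.

(** * Completeness of L^2, the Poincare inequality and the Dirichlet problem *)

Section Poisson.
Context {R : realType} {d : nat}.
Local Notation pt := 'rV[R]_d.
Local Notation mu := (leb d).
Local Notation e_ i := (delta_mx 0 i : pt).
Implicit Types (u g f z : pt -> R) (W S : set pt).
Lemma integral_sq_nrm S u : measurable S -> L2 S u ->
 (\int[mu]_(x in S) (u x ^+ 2)%:E = (nrm S u ^+ 2)%:E)%E.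
move=> mS Lu; rewrite nrm_sq /ip /Rintegral fineK.
 by apply: eq_integral => x _; rewrite expr2.
by apply: integrable_fin_num => //; exact: L2_integrable.
Qed.

Lemma L2_fatou S (q : nat -> pt -> R) f (B : R) : measurable S -> 0 <= B ->
 (forall n, L2 S (q n)) -> (forall x, S x -> (fun n => q n x) @ \oo --> f x) ->
 (forall n, nrm S (q n) <= B) -> L2 S f /\ nrm S f <= B.
move=> mS B0 Lq qf qB.
have mf : measurable_fun S f by apply: measurable_fun_cvg qf => n; case: (Lq n).
have H : (\int[mu]_(x in S) (f x ^+ 2)%:E <= (B ^+ 2)%:E)%E.
 have := @fatou _ _ R mu S mS (fun n x => (q n x ^+ 2)%:E) _ _.
 have -> : (\int[mu]_(x in S) limn_einf (fun n => (q n x ^+ 2)%:E) =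
       \int[mu]_(x in S) (f x ^+ 2)%:E)%E.
  apply: eq_integral => x /set_mem Sx.
  have h : (fun n => (q n x ^+ 2)%:E) @ \oo --> (f x ^+ 2)%:E.
   apply: cvg_EFin; first exact: nearW.
   by rewrite expr2; under eq_fun do rewrite /= expr2; apply: cvgM; exact: qf.
  by have [-> _] := cvg_limn_einf_sup h.
 move=> h; apply: (le_trans (h _ _)).
 - move=> n; apply/measurable_EFinP; apply: measurable_funX; by case: (Lq n).
 - by move=> n x _; rewrite lee_fin sqr_ge0.
 rewrite limn_einf_lim; apply: lime_le; first exact: is_cvg_einfs.
 apply: nearW => n; apply: (@le_trans _ _ (\int[mu]_(x in S) (q n x ^+ 2)%:E)%E).
  by apply: ereal_inf_lbound; exists n => /=.
 by rewrite integral_sq_nrm// lee_fin lerXn2r// nnegrE ?nrm_ge0.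
have Lf : L2 S f by split => //; apply: le_lt_trans H _; rewrite ltry.
split => //; rewrite -(@ler_pXn2r _ 2)// ?nnegrE ?nrm_ge0//.
by rewrite -lee_fin -integral_sq_nrm.
Qed.

Lemma integral_abs_le S u : measurable S -> (mu S < +oo)%E -> L2 S u ->
 (\int[mu]_(x in S) `|u x|%:E <= (Num.sqrt (fine (mu S)) * nrm S u)%:E)%E.
move=> mS Soo Lu.
have L1 : L2 S (fun=> 1 : R).
 by apply: (@bounded_L2 _ _ _ _ 1) => // x _; rewrite normr1.
have La := L2_abs Lu.
have -> : (\int[mu]_(x in S) `|u x|%:E = (ip S (fun=> 1) (fun x => `|u x|))%:E)%E.
 rewrite /ip /Rintegral fineK.
  by apply: eq_integral => x _; rewrite mul1r.
 by apply: integrable_fin_num => //; exact: L2_integrable.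
rewrite lee_fin; apply: le_trans (ler_norm _) _; apply: le_trans (ip_CS mS L1 La) _.
le_eq; congr (_ * _).
 congr Num.sqrt; rewrite /ip (@eq_Rintegral _ _ _ mu S (fun=> 1)) ?Rintegral_cst ?mul1r//.
congr Num.sqrt; apply: eq_Rintegral => x _.
by rewrite -normrM -expr2 ger0_norm ?sqr_ge0// expr2.
Qed.

Lemma series_geo_lt (C : R) : 0 <= C ->
 (\sum_(0 <= n <oo) (C * 2^-1 ^+ n)%:E < +oo)%E.
move=> C0; have h : cvgn (series (geometric C (2^-1 : R))).
 by apply: is_cvg_geometric_series; rewrite ger0_norm; lra.
rewrite (_ : (fun _ => _) = EFin \o series (geometric C (2^-1 : R))); last first.
 by apply/funext => n /=; rewrite sumEFin.
by rewrite EFin_lim// ltry.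
Qed.

(** Riesz-Fischer for increments that decay geometrically: finite measure turns their L^2 bounds
    into a convergent series of L^1 norms, hence convergence almost everywhere, and Fatou's lemma
    preserves the rate. *)
Lemma L2_complete S (q : nat -> pt -> R) (C : R) : measurable S -> (mu S < +oo)%E -> 0 <= C ->
 (forall n, L2 S (q n)) ->
 (forall n, nrm S (fun x => q n.+1 x - q n x) <= C * 2^-1 ^+ n) ->
 exists f, L2 S f /\ forall n, nrm S (fun x => f x - q n x) <= C * 2 * 2^-1 ^+ n.
move=> mS Soo C0 Lq H.
have Ld n : L2 S (fun x => q n.+1 x - q n x) by exact: L2B.
pose G (x : pt) := (\sum_(0 <= n <oo) `|q n.+1 x - q n x|%:E)%E.
have mh n : measurable_fun S (fun x => `|q n.+1 x - q n x|%:E).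
 by apply/measurable_EFinP; apply: measurableT_comp => //; case: (Ld n).
have mG : measurable_fun S G by apply: ge0_emeasurable_sum => // k x _; rewrite lee_fin.
have G0 x : (0 <= G x)%E by apply: nneseries_ge0 => n _ _; rewrite lee_fin.
have Gfin : (\int[mu]_(x in S) G x < +oo)%E.
 rewrite integral_nneseries//.
 pose A := Num.sqrt (fine (mu S)) * C.
 have A0 : 0 <= A by rewrite mulr_ge0// sqrtr_ge0.
 apply: le_lt_trans (series_geo_lt A0); apply: lee_nneseries => n _.
  by move=> _; apply: integral_ge0 => x _; rewrite lee_fin.
 apply: le_trans (integral_abs_le mS Soo (Ld n)) _; rewrite lee_fin -mulrA.
 by rewrite ler_wpM2l ?sqrtr_ge0.
have iG : mu.-integrable S G.
 by apply/integrableP; split => //; under eq_integral do rewrite gee0_abs//.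
pose S0 := S `&` [set x | (G x < +oo)%E].
have mS0 : measurable S0.
 by rewrite /S0; exact: emeasurable_fun_infty_o.
have aeS0 : {ae mu, forall x, S x -> S0 x}.
 have := integrable_ae mS iG; apply: filterS => x h Sx; split => //=.
 by have := h Sx; rewrite fin_numE => /andP[_]; rewrite ltey.
have S0S : S0 `<=` S by move=> x [].
have cv x : S0 x -> cvgn (fun n => q n x).
 move=> [Sx Gx].
 have h : cvgn [series `|q n.+1 x - q n x| ]_n.
  by apply: nnseries_is_cvg; [move=> n; exact: normr_ge0|exact: Gx].
 have /normed_cvg := h; rewrite /telescope => h2.
 have E : (fun n => q n x) = (fun n => [series q k.+1 x - q k x]_k n + q 0%N x).
  by apply/funext => n; rewrite /series /= (telescope_sumr (fun k => q k x))// subrK.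
 rewrite E; apply: is_cvgD; [exact: h2|exact: is_cvg_cst].
(* Replacing the sequence by 0 where it might diverge makes the limit exist at every point, as
   [L2_fatou] demands. *)
pose q0 n x := if `[< S0 x >] then q n x else 0.
pose f x := limn (fun n => q0 n x).
have q0f x : S x -> (fun n => q0 n x) @ \oo --> f x.
 move=> _; rewrite /f /q0; case: asboolP => [/cv h|_]; first exact: h.
 by apply: cvgP; exact: cvg_cst.
have aeq n : {ae mu, forall x, S x -> q0 n x = q n x}.
 by apply: filterS aeS0 => x h /h h'; rewrite /q0 asboolT.
have Lq0 n : L2 S (q0 n).
 rewrite (_ : q0 n = zext S0 (q n)).
  by apply: L2_zext => //; exact: L2_sub S0S _.
 by apply/funext => x; rewrite /q0; case: asboolP => h; [rewrite zextE|rewrite zext_out].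
have aeN n m : nrm S (fun x => q0 n x - q0 m x) = nrm S (fun x => q n x - q m x).
 apply: eq_nrm_ae => //; [exact: L2B|exact: L2B|].
 by apply: filterS2 (aeq n) (aeq m) => x h1 h2 Sx; rewrite h1// h2.
have tele n k : nrm S (fun x => q (n + k)%N x - q n x) <= C * 2 * (2^-1 ^+ n - 2^-1 ^+ (n + k)).
 elim: k => [|k IH].
  rewrite addn0 subrr mulr0 (@eq_nrm _ _ _ _ (fun=> 0)) ?nrm0// => x _.
  by rewrite subrr.
 rewrite (@eq_nrm _ _ _ _ (fun x => (q (n + k).+1 x - q (n + k)%N x) + (q (n + k)%N x - q n x))).
  apply: le_trans (nrmD mS (Ld _) (L2B mS (Lq _) (Lq _))) _.
  apply: le_trans (lerD (H _) IH) _; rewrite addnS exprS; lra.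
 by move=> x _; rewrite addnS; ring.
have key n : L2 S (fun x => f x - q0 n x) /\ nrm S (fun x => f x - q0 n x) <= C * 2 * 2^-1 ^+ n.
 have B0 : 0 <= C * 2 * 2^-1 ^+ n by rewrite !mulr_ge0// exprn_ge0.
 apply: (@L2_fatou S (fun k x => q0 (n + k)%N x - q0 n x)) => //.
 - by move=> k; exact: L2B.
 - move=> x Sx; apply: cvgB; last exact: cvg_cst.
  by have := q0f x Sx; rewrite -(cvg_shiftn n); under eq_fun do rewrite addnC.
 - move=> k; rewrite aeN; apply: le_trans (tele n k) _.
  rewrite ler_wpM2l ?mulr_ge0// lerBlDr lerDl exprn_ge0//.
exists f; split.
 have [h _] := key 0%N; have := L2D mS h (Lq0 0%N).
 by apply: L2_eq => x _; rewrite subrK.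
move=> n; have [h1 h2] := key n; have Lf : L2 S f.
 by have := L2D mS h1 (Lq0 n); apply: L2_eq => x _; rewrite subrK.
rewrite (@eq_nrm_ae _ _ _ _ (fun x => f x - q0 n x))//; first exact: L2B.
by apply: filterS (aeq n) => x h Sx; rewrite h.
Qed.

(** On [S] the function is minus its own increment, because the shifted point lies outside the
    support. A shift longer than the diameter gives the Poincare inequality, a shift of order [h]
    the strip estimate. *)
Lemma test_transl_le W S phi (y : pt) : measurable S -> test_fun W phi ->
 (forall x, S x -> ~ W (x + y)) ->
 nrm S phi <= \sum_i `|y 0 i| * nrm W (pder i phi).
move=> mS tphi Sy; have hphi := test_C1 tphi; have bphi := test_bsupp tphi.
have LT := bsupp_L2T hphi.1 bphi.
have LD : L2 setT (fun x => phi (x + y) - phi x).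
 by apply: L2B => //; exact: L2T_translate.
have -> : nrm S phi = nrm S (fun x => phi (x + y) - phi x).
 by rewrite -nrmN; apply: eq_nrm => x Sx; rewrite (test_out tphi (Sy x Sx)) sub0r.
apply: le_trans (nrm_sub mS measurableT (@subsetT _ S) LD) _.
apply: le_trans (nrm_transl_le y hphi bphi) _.
apply: ler_sum => i _; rewrite ler_wpM2l//.
have ti := test_pder i tphi.
le_eq; congr Num.sqrt.
by apply/esym/ip_mkcond => // x _ nW; rewrite (test_out ti)// mulr0.
Qed.

Lemma poincare_test W (M : R) : (0 < d)%N -> open W -> 0 < M -> (forall x, W x -> `|x| <= M) ->
 forall phi, test_fun W phi -> nrm W phi <= 3 * M * \sum_i nrm W (pder i phi).
move=> d0 oW M0 WM phi tphi; have mW := open_meas oW.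
pose i0 := Ordinal d0.
(* A shift of length 3M carries the ball of radius M outside itself. *)
pose y : pt := (3 * M) *: e_ i0.
have h x : W x -> ~ W (x + y).
 move=> Wx /WM; apply/negP; rewrite -ltNge.
 have yn : 3 * M <= `|y|.
  apply: le_trans (coord_le y i0); rewrite !mxE !eqxx mulr1 ger0_norm//.
  by rewrite mulr_ge0// ltW.
 have := WM _ Wx; have := lerB_normD y x; rewrite (addrC y x); lra.
apply: le_trans (test_transl_le mW tphi h) _.
rewrite mulr_sumr; apply: ler_sum => i _.
rewrite ler_wpM2r ?nrm_ge0// /y !mxE eqxx /=.
case: eqP => _; rewrite ?mulr1 ?mulr0 ?normr0 ?mulr_ge0// ?(ltW M0)//.
by rewrite ger0_norm ?mulr_ge0// ltW.
Qed.

Lemma le_geo0 (x K : R) : 0 <= K -> (forall n, x <= K * 2^-1 ^+ n) -> x <= 0.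
move=> K0 H; rewrite leNgt; apply/negP => x0.
have h : (fun n => geometric K (2^-1 : R) n) @ \oo --> (0 : R).
 by apply: cvg_geometric; rewrite ger0_norm; lra.
have h2 : \forall n \near \oo, geometric K (2^-1 : R) n < x by exact: (cvgr_lt _ h).
have [n] := filter_ex h2.
by rewrite /= ltNge H.
Qed.

Lemma geo_small (K eps : R) : 0 <= K -> 0 < eps -> exists n, K * 2^-1 ^+ n < eps.
move=> K0 e0.
have h : (fun n => geometric K (2^-1 : R) n) @ \oo --> (0 : R).
 by apply: cvg_geometric; rewrite ger0_norm; lra.
have h2 : \forall n \near \oo, geometric K (2^-1 : R) n < eps by exact: (cvgr_lt _ h).
by have [n] := filter_ex h2; exists n.
Qed.

Lemma gradDZ W W' phi psi t : test_fun W phi -> test_fun W' psi ->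
 grad (fun x => phi x + t * psi x) = (fun x => grad phi x + t *: grad psi x).
move=> [s1 _] [s2 _]; apply/funext => x; apply/rowP => i; rewrite !mxE.
have := congr1 (fun f => f x) (foldr_pderD [:: i] s1 (smoothZ t s2)).
rewrite /= => ->; congr (_ + _).
exact: (congr1 (fun f => f x) (foldr_pderZ t [:: i] s2)).
Qed.

Definition energy W g phi : R := ipv W (grad phi) (grad phi) / 2 - ip W g phi.
Lemma energyDZ W g phi psi t : measurable W -> L2 W g -> test_fun W phi -> test_fun W psi ->
 energy W g (fun x => phi x + t * psi x) = energy W g phi +
  t * (ipv W (grad phi) (grad psi) - ip W g psi) + t ^+ 2 / 2 * ipv W (grad psi) (grad psi).
move=> mW Lg t1 t2; rewrite /energy (gradDZ t t1 t2).
have L1 := test_L2 mW t1; have L2' := test_L2 mW t2.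
have G1 := grad_L2v mW t1; have G2 := grad_L2v mW t2.
have tG2 := L2vZ t mW G2; have tL2 := L2Z t mW L2'.
rewrite ipvDl//; last exact: L2vD.
rewrite !ipvDr// !ipvZl// !ipvZr// ipDr// ipZr// (ipvC W (grad psi) (grad phi)).
move: (ipv W (grad phi) (grad phi)) (ipv W (grad phi) (grad psi)) (ipv W (grad psi) (grad psi)).
by move: (ip W g phi) (ip W g psi) => a b c e f; field.
Qed.

(** Existence must be proved because [L2_H2_regular] speaks only about functions already known to be
    solutions. The direct method is used: a minimising sequence of test functions for the Dirichlet
    energy, with energy gaps 4^-n. *)
Lemma poisson_exists W (M : R) g : (0 < d)%N -> open W -> 0 < M -> (forall x, W x -> `|x| <= M) ->
 L2 W g -> exists z, poisson_solution W g z.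
move=> d0 oW M0 WM Lg; have mW := open_meas oW.
have Woo : (mu W < +oo)%E by exact: bounded_set_fin WM.
pose K := 3 * M * d%:R; have K0 : 0 <= K by rewrite !mulr_ge0// ltW.
have PK phi : test_fun W phi -> nrm W phi <= K * nrmv W (grad phi).
 move=> tphi; apply: le_trans (poincare_test d0 oW M0 WM tphi) _.
 rewrite /K -[leRHS]mulrA ler_wpM2l//; first by rewrite mulr_ge0// ltW.
 rewrite mulr_natl -[X in _ *+ X]card_ord -sumr_const; apply: ler_sum => i _.
 by rewrite -vcoord_grad nrm_vcoord.
pose E := [set energy W g phi | phi in test_fun W].
have Elb : lbound E (- (nrm W g * K) ^+ 2).
 move=> _ [phi tphi <-]; rewrite /energy -nrmv_sq.
 have h1 : ip W g phi <= nrm W g * (K * nrmv W (grad phi)).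
  apply: le_trans (ler_norm _) _; apply: le_trans (ip_CS mW Lg (test_L2 mW tphi)) _.
  by rewrite ler_wpM2l ?nrm_ge0// PK.
 have := sqr_ge0 (nrmv W (grad phi) - nrm W g * K); have := sqr_ge0 (nrm W g * K).
 by move: h1; rewrite mulrA; set a := nrm W g * K; set b := nrmv _ _; nra.
have hE : has_inf E.
 by split; [exists (energy W g (fun=> 0)), (fun=> 0) => //; exact: test0|eexists; exact: Elb].
pose m := inf E.
have mle phi : test_fun W phi -> m <= energy W g phi.
 by move=> tphi; apply: (ge_inf hE.2); exists phi.
have /choice[ph Hph] : forall n : nat, exists f,
  test_fun W f /\ energy W g f < m + (2^-1 ^+ n) ^+ 2.
 move=> n; have e0 : 0 < (2^-1 ^+ n : R) ^+ 2 by rewrite !exprn_gt0.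
 by have [_ [phi tphi <-] lt] := inf_adherent e0 hE; exists phi.
have tph n : test_fun W (ph n) by case: (Hph n).
have dE n : test_fun W (fun x => ph n.+1 x - ph n x) by exact: testB.
have gradB n : grad (fun x => ph n.+1 x - ph n x) = (fun x => grad (ph n.+1) x - grad (ph n) x).
 have := gradDZ (-1) (tph n.+1) (tph n).
 rewrite (_ : (fun x => _ + -1 * _) = (fun x => ph n.+1 x - ph n x)).
  by move=> ->; apply/funext => x; rewrite scaleN1r.
 by apply/funext => x; rewrite mulN1r.
have step n : nrmv W (grad (fun x => ph n.+1 x - ph n x)) <= 3 * 2^-1 ^+ n.
 set psi := fun x => _.
 (* The parameters 1 and 1/2 give the energies of the next iterate and of the midpoint. As the
    latter is at least [m], a quarter of the squared gradient difference is at most the sum of the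
    two gaps; this gives the factor 5, rounded up to 3^2. *)
 have e1 := energyDZ 1 mW Lg (tph n) (dE n); have e2 := energyDZ 2^-1 mW Lg (tph n) (dE n).
 have := mle _ (testD (tph n) (testZ 2^-1 (dE n))); rewrite e2 => {e2}.
 have E1 : (fun x => ph n x + 1 * psi x) = ph n.+1.
  by apply/funext => x; rewrite mul1r /psi addrC subrK.
 move: e1; rewrite -/psi E1 -nrmv_sq.
 have [_] := Hph n; have [_] := Hph n.+1; rewrite (exprS 2^-1 n).
 set s := 2^-1 ^+ n; have s0 : 0 <= s by rewrite exprn_ge0.
 move=> h1 h2 h3 h4.
 rewrite -(@ler_pXn2r _ 2)// ?nnegrE ?nrmv_ge0 ?mulr_ge0//.
 move: h1 h2 h3 h4; set D := ipv _ _ _ - _; set Q := nrmv _ _ ^+ 2.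
 have := sqr_ge0 s; rewrite expr1n !exprMn !(expr2 2^-1) (expr2 3); move: (s ^+ 2) => s2; lra.
have c1 n : nrm W (fun x => ph n.+1 x - ph n x) <= K * 3 * 2^-1 ^+ n.
 by apply: le_trans (PK _ (dE n)) _; rewrite -mulrA ler_wpM2l.
have [z [Lz zc]] := @L2_complete W ph (K * 3) mW Woo (mulr_ge0 K0 (ler0n _ 3))
 (fun n => test_L2 mW (tph n)) c1.
have Hi i : exists gi, L2 W gi /\ forall n, nrm W (fun x => gi x - pder i (ph n) x) <= 3 * 2 * 2^-1 ^+ n.
 apply: L2_complete => //; first by move=> n; exact: test_L2 (test_pder i (tph n)).
 move=> n; apply: le_trans (step n); rewrite gradB.
 have := nrm_vcoord W (fun x => grad (ph n.+1) x - grad (ph n) x) i.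
 apply: le_trans; le_eq.
 by apply: eq_nrm => x _; rewrite /vcoord !mxE.
have [G HG] := choice Hi.
have zw i : is_wder W (unit_al i) z (G i).
 have [LG Gc] := HG i; split => // psi tpsi.
 rewrite mder_unit sum_unit_al expr1 mulN1r.
 have Lp := test_L2 mW tpsi; have Lpi := test_L2 mW (test_pder i tpsi).
 apply/eqP; rewrite -subr_eq0 opprK -normr_le0.
 apply: (@le_geo0 _ (K * 3 * 2 * nrm W (pder i psi) + 3 * 2 * nrm W psi)).
  have h1 : 0 <= K * 3 * 2 by lra.
  have h2 : 0 <= 3 * 2 :> R by lra.
  exact: (addr_ge0 (mulr_ge0 h1 (nrm_ge0 _ _)) (mulr_ge0 h2 (nrm_ge0 _ _))).
 move=> n; have Ln := test_L2 mW (tph n); have Lni := test_L2 mW (test_pder i (tph n)).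
 have E0 := ip_pder_test i (test_C1 (tph n)) tpsi.
 have -> : ip W z (pder i psi) + ip W (G i) psi =
   ip W (fun x => z x - ph n x) (pder i psi) + ip W (fun x => G i x - pder i (ph n) x) psi.
  by rewrite !ipBl// E0; ring.
 apply: le_trans (ler_normD _ _) _; rewrite mulrDl lerD//.
  apply: le_trans (ip_CS mW (L2B mW Lz Ln) Lpi) _.
  by rewrite mulrAC ler_wpM2r ?nrm_ge0.
 apply: le_trans (ip_CS mW (L2B mW LG Lni) Lp) _.
 by rewrite mulrAC ler_wpM2r ?nrm_ge0.
have hz1 : Hm W 1 z by apply: Hm1P => // i; exists (G i).
have hz : H10 W z.
 split => // eps e0.
 pose B := K * 3 * 2 + 3 * 2; have B0 : 0 <= B by rewrite /B; lra.
 have [n nlt] := geo_small (mulr_ge0 (@nal_ge0 R d 1) B0) e0.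
 exists (ph n); split => //; apply: le_lt_trans nlt; rewrite -mulrA.
 have s0 : 0 <= 2^-1 ^+ n :> R by rewrite exprn_ge0.
 have Ln := test_L2 mW (tph n).
 apply: sqrt_sum_le => [|a]; first by rewrite mulr_ge0.
 move=> /al_le1[->|[i ->]]; rewrite nrm_ge0/=.
  rewrite (nrm_wder oW (is_wder_al0 (L2B mW Lz Ln))).
  by apply: le_trans (zc n) _; rewrite ler_wpM2r// lerDl; lra.
 have Lni := test_L2 mW (test_pder i (tph n)).
 rewrite (nrm_wder oW (is_wderB oW Lz Ln (zw i) (is_wder_C1 oW (test_C1 (tph n)) Lni))).
 apply: le_trans ((HG i).2 n) _; by rewrite ler_wpM2r// lerDr; lra.
have test_eq psi : test_fun W psi -> ipv W (wgrad W z) (grad psi) = ip W g psi.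
 move=> tpsi; have Gp := grad_L2v mW tpsi; have Lp := test_L2 mW tpsi.
 apply/eqP; rewrite -subr_eq0 -normr_le0.
 pose B := \sum_i (3 * 2 * nrm W (pder i psi)) + (1 + ipv W (grad psi) (grad psi) / 2).
 have B0 : 0 <= B.
  rewrite !addr_ge0 ?divr_ge0 ?ipv_ge0// sumr_ge0// => i _.
  by rewrite mulr_ge0 ?nrm_ge0//; lra.
 apply: (@le_geo0 _ B) => // n.
 have Gn := grad_L2v mW (tph n); have Lw := wgrad_L2v hz1.
 have -> : ipv W (wgrad W z) (grad psi) - ip W g psi =
   ipv W (fun x => wgrad W z x - grad (ph n) x) (grad psi) +
   (ipv W (grad (ph n)) (grad psi) - ip W g psi).
  by rewrite ipvBl//; ring.
 apply: le_trans (ler_normD _ _) _; rewrite mulrDl lerD//.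
  apply: le_trans (ler_norm_sum _ _ _) _; rewrite mulr_suml; apply: ler_sum => i _.
  have Lni := test_L2 mW (test_pder i (tph n)); have Lpi := test_L2 mW (test_pder i tpsi).
  have E0 : vcoord (fun x => wgrad W z x - grad (ph n) x) i =
    (fun x => wder W (unit_al i) z x - pder i (ph n) x).
   by apply/funext => x; rewrite /vcoord !mxE.
  have Lwi : L2 W (wder W (unit_al i) z) by rewrite -vcoord_wgrad; exact: Lw.
  rewrite E0 vcoord_grad; apply: le_trans (ip_CS mW (L2B mW Lwi Lni) Lpi) _.
  rewrite mulrAC ler_wpM2r ?nrm_ge0//; apply: le_trans _ ((HG i).2 n).
  le_eq; apply: eq_nrm_ae => //.
  - exact: L2B.
  - by apply: L2B => //; case: (HG i).
  - by apply: filterS (wder_ae oW (zw i)) => x h Wx; rewrite h.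
 (* The step length [s] is the square root of the energy gap; perturbations by plus and minus [s]
    times [psi] bound the defect by a multiple of [s]. *)
 set s := 2^-1 ^+ n; have s0 : 0 < s by rewrite exprn_gt0.
 have := (Hph n).2; rewrite -/s.
 have := mle _ (testD (tph n) (testZ s tpsi)); rewrite (energyDZ s mW Lg (tph n) tpsi).
 have := mle _ (testD (tph n) (testZ (- s) tpsi)); rewrite (energyDZ (- s) mW Lg (tph n) tpsi).
 set D := ipv _ _ _ - _; set Q := ipv _ _ _; move=> h1 h2 h3.
 have h4 : s * D <= s * ((1 + Q / 2) * s) by nra.
 have h5 : s * (- D) <= s * ((1 + Q / 2) * s) by nra.
 by rewrite ler_norml lerNl; move: h4 h5; rewrite !ler_pM2l// => -> ->.
exists z; split => // w hw.
apply/eqP; rewrite -subr_eq0 -normr_le0.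
have Lw : L2 W w by case: hw => -[].
have Lwz := wgrad_L2v hz1; have Lww : L2v W (wgrad W w) by apply: wgrad_L2v; case: hw.
pose B := \sum_i nrm W (vcoord (wgrad W z) i) + nrm W g.
have B0 : 0 <= B by rewrite addr_ge0 ?nrm_ge0// sumr_ge0// => i _; exact: nrm_ge0.
apply: (@le_eps0 _ _ B) => // eps e0.
have [phi [tphi n1 n2]] := H10_approx oW hw e0.
have Gp := grad_L2v mW tphi; have Lp := test_L2 mW tphi.
have -> : ipv W (wgrad W z) (wgrad W w) - ip W g w =
  ipv W (wgrad W z) (fun x => wgrad W w x - grad phi x) - ip W g (fun x => w x - phi x).
 by rewrite ipvBr// ipBr// test_eq//; ring.
apply: le_trans (ler_normB _ _) _; rewrite mulrDl lerD//; last first.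
 apply: le_trans (ip_CS mW Lg (L2B mW Lw Lp)) _.
 by rewrite ler_wpM2l ?nrm_ge0// ltW.
apply: le_trans (ler_norm_sum _ _ _) _; rewrite mulr_suml; apply: ler_sum => i _.
have E0 : vcoord (fun x => wgrad W w x - grad phi x) i =
  (fun x => wder W (unit_al i) w x - pder i phi x).
 by apply/funext => x; rewrite /vcoord !mxE.
rewrite E0; apply: le_trans (ip_CS mW (Lwz i) _) _.
 by apply: L2B => //; [rewrite -vcoord_wgrad; exact: Lww|rewrite -vcoord_grad; exact: Gp].
by rewrite ler_wpM2l ?nrm_ge0// ltW.
Qed.

End Poisson.

(** * Polynomials, their dual functionals and scaled inverse inequalities *)

Section Poly.
Context {R : realType} {d : nat}.
Local Notation pt := 'rV[R]_d.
Local Notation mu := (leb d).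
Local Notation e_ i := (delta_mx 0 i : pt).
Implicit Types (p q f g : pt -> R) (al be : 'I_d -> nat).
Definition mon al : pt -> R := prodf (fun i t => t ^+ al i).
Lemma smooth1_pow n : smooth1 (fun t : R => t ^+ n).
Proof. exact: smooth1X smooth1_id. Qed.
Lemma smooth_mon al : smooth (mon al).
Proof. by apply: smooth_prodf => i; exact: smooth1_pow. Qed.
Lemma monD al be x : mon (fun i => al i + be i)%N x = mon al x * mon be x.
Proof. by rewrite /mon /prodf -big_split; apply: eq_bigr => i _; rewrite exprD. Qed.
Lemma polyE n p : poly_fun n p <-> exists c : {ffun 'I_d -> 'I_n.+1} -> R,
 p = fun x => \sum_(a : {ffun 'I_d -> 'I_n.+1} | (\sum_i a i <= n)%N) c a * mon (fun i => a i) x.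
Proof. by split=> -[c cE]; exists c; [apply/funext|rewrite cE]. Qed.
Lemma poly0 n : poly_fun n ((fun=> 0) : pt -> R).
Proof. by exists (fun=> 0) => x; rewrite big1// => a _; rewrite mul0r. Qed.
Lemma polyD n p q : poly_fun n p -> poly_fun n q -> poly_fun n (fun x => p x + q x).
move=> [c cE] [c' cE']; exists (fun a => c a + c' a) => x; rewrite cE cE' -big_split.
by apply: eq_bigr => a _; rewrite mulrDl.
Qed.

Lemma polyZ n (t : R) p : poly_fun n p -> poly_fun n (fun x => t * p x).
move=> [c cE]; exists (fun a => t * c a) => x; rewrite cE mulr_sumr.
by apply: eq_bigr => a _; rewrite mulrA.
Qed.

Lemma polyB n p q : poly_fun n p -> poly_fun n q -> poly_fun n (fun x => p x - q x).
move=> hp /(polyZ (-1)) hq; have := polyD hp hq; congr (poly_fun _ _).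
by apply/funext => x; rewrite mulN1r.
Qed.

Lemma poly_sum n I (r : seq I) (P : pred I) (F : I -> pt -> R) :
 (forall i, P i -> poly_fun n (F i)) -> poly_fun n (fun x => \sum_(i <- r | P i) F i x).
move=> H; elim: r => [|i r IH].
 by rewrite (_ : (fun x => _) = fun=> 0); [exact: poly0|apply/funext => x; rewrite big_nil].
have [Pi|nPi] := boolP (P i).
 rewrite (_ : (fun x => _) = fun x => F i x + \sum_(j <- r | P j) F j x).
  by apply: polyD => //; exact: H.
 by apply/funext => x; rewrite big_cons Pi.
by rewrite (_ : (fun x => _) = fun x => \sum_(j <- r | P j) F j x)//; apply/funext => x;
 rewrite big_cons (negbTE nPi).
Qed.

Lemma poly_mon n al : (\sum_i al i <= n)%N -> poly_fun n (mon al).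
move=> h; have [a aE] := ffun_al h; subst al.
exists (fun b => (b == a)%:R) => x.
rewrite (bigD1 a)//= eqxx mul1r [X in _ = _ + X]big1 ?addr0// => b /andP[_ /negbTE ->].
by rewrite mul0r.
Qed.

Lemma poly_le m n p : (m <= n)%N -> poly_fun m p -> poly_fun n p.
move=> mn /polyE[c ->]; apply: poly_sum => a am; apply: polyZ; apply: poly_mon.
exact: leq_trans mn.
Qed.

Lemma polyM m n p q : poly_fun m p -> poly_fun n q -> poly_fun (m + n) (fun x => p x * q x).
move=> /polyE[c ->] /polyE[c' ->].
rewrite (_ : (fun x => _) = fun x => \sum_(a : {ffun 'I_d -> 'I_m.+1} | (\sum_i a i <= m)%N)
 \sum_(b : {ffun 'I_d -> 'I_n.+1} | (\sum_i b i <= n)%N)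
   (c a * c' b) * mon (fun i => a i + b i)%N x); last first.
 apply/funext => x; rewrite mulr_suml; apply: eq_bigr => a _.
 by rewrite mulr_sumr; apply: eq_bigr => b _; rewrite monD; ring.
apply: poly_sum => a am; apply: poly_sum => b bn; apply: polyZ; apply: poly_mon.
by rewrite big_split leq_add.
Qed.

Lemma poly_cst n (t : R) : poly_fun n ((fun=> t) : pt -> R).
apply: (@poly_le 0) => //.
rewrite (_ : (fun=> t) = fun x => t * mon (fun=> 0%N) x).
 by apply: polyZ; apply: poly_mon; rewrite big1.
by apply/funext => x; rewrite /mon /prodf big1 ?mulr1// => i _; rewrite expr0.
Qed.

Lemma mon_unit i (x : pt) : mon (unit_al i) x = x 0 i.
rewrite /mon /prodf (bigD1 i)//= /unit_al eqxx expr1 big1 ?mulr1//.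
by move=> j /negbTE ->; rewrite expr0.
Qed.

Lemma poly_coord i : poly_fun 1 (fun x : pt => x 0 i).
Proof. by rewrite -(funext (mon_unit i)); apply: poly_mon; rewrite sum_unit_al. Qed.
Lemma poly_prod I (r : seq I) (n : I -> nat) (F : I -> pt -> R) :
 (forall i, poly_fun (n i) (F i)) ->
 poly_fun (\sum_(i <- r) n i) (fun x => \prod_(i <- r) F i x).
move=> H; elim: r => [|i r IH].
 rewrite big_nil (_ : (fun x => _) = fun=> 1); first exact: poly_cst.
 by apply/funext => x; rewrite big_nil.
rewrite big_cons (_ : (fun x => _) = fun x => F i x * \prod_(j <- r) F j x).
 exact: polyM.
by apply/funext => x; rewrite big_cons.
Qed.

Lemma polyX n m p : poly_fun n p -> poly_fun (m * n) (fun x => p x ^+ m).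
move=> hp; elim: m => [|m IH].
 by rewrite mul0n (_ : (fun x => _) = fun=> 1); [exact: poly_cst|apply/funext => x].
rewrite mulSn (_ : (fun x => _) = fun x => p x * p x ^+ m); first exact: polyM.
by apply/funext => x; rewrite exprS.
Qed.

Lemma poly_affine n (x0 : pt) (h : R) p : poly_fun n p -> poly_fun n (fun y => p (x0 + h *: y)).
move=> /polyE[c ->]; apply: poly_sum => a am; apply: polyZ; apply: (poly_le am).
rewrite /mon /prodf; apply: poly_prod => i; rewrite -[X in poly_fun X]muln1.
apply: polyX; rewrite (_ : (fun y : pt => _) = fun y => x0 0 i + h * y 0 i).
 by apply: polyD; [exact: poly_cst|apply: polyZ; exact: poly_coord].
by apply/funext => y; rewrite !mxE.
Qed.

Lemma poly_smooth n p : poly_fun n p -> smooth p.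
by move=> /polyE[c ->]; apply: smooth_sum => a _; apply: smoothZ; exact: smooth_mon.
Qed.

Lemma poly_C1 n p : poly_fun n p -> C1 p.
Proof. by move=> /poly_smooth; exact: smooth_C1. Qed.
Lemma derive1_pow n (t : R) : derive1 (fun s : R => s ^+ n) t = n%:R * t ^+ n.-1.
by rewrite derive1E; have := @exp_derive R n t 1 => ->; rewrite /GRing.scale/= mulr1.
Qed.

Lemma pder_mon j al x : pder j (mon al) x =
 (al j)%:R * mon (fun k => if k == j then (al j).-1 else al k) x.
rewrite /mon pder_prodf; last by move=> i; exact: smooth1_pow.
rewrite /prodf (bigD1 j)//= [in RHS](bigD1 j)//= /upd eqxx derive1_pow mulrA; congr (_ * _).
by apply: eq_bigr => i ij; rewrite (negbTE ij).
Qed.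

Lemma pderD j f g x : C1 f -> C1 g -> pder j (fun x => f x + g x) x = pder j f x + pder j g x.
Proof. by move=> hf hg; have [_ ->] := C1D hf hg. Qed.
Lemma pderM j f g x : C1 f -> C1 g ->
 pder j (fun x => f x * g x) x = pder j f x * g x + f x * pder j g x.
Proof. by move=> hf hg; have [_ ->] := C1M hf hg. Qed.
Lemma C1Z (t : R) f : C1 f -> C1 (fun x => t * f x).
Proof. by move=> hf; have [h _] := C1M (C1_cst t).1 hf. Qed.
Lemma pderZ j (t : R) f x : C1 f -> pder j (fun x => t * f x) x = t * pder j f x.
Proof. by move=> hf; rewrite (pderM _ _ (C1_cst t).1 hf) (C1_cst t).2 mul0r add0r. Qed.
Lemma C1B f g : C1 f -> C1 g -> C1 (fun x => f x - g x).
move=> hf /(C1Z (-1)) hg; have [h _] := C1D hf hg.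
by rewrite (_ : (fun x => _) = fun x => f x + -1 * g x)//; apply/funext => x; rewrite mulN1r.
Qed.

Lemma pderB j f g x : C1 f -> C1 g -> pder j (fun x => f x - g x) x = pder j f x - pder j g x.
move=> hf hg; rewrite (_ : (fun x => _) = fun x => f x + -1 * g x).
 by rewrite pderD ?pderZ ?mulN1r//; exact: C1Z.
by apply/funext => y; rewrite mulN1r.
Qed.

Lemma poly_pder n j p : poly_fun n p ->
 poly_fun n.-1 (pder j p) /\ (n = 0%N -> forall x, pder j p x = 0).
move=> /polyE[c cE]; have E x : pder j p x =
  \sum_(a : {ffun 'I_d -> 'I_n.+1} | (\sum_i a i <= n)%N) c a * pder j (mon (fun i => a i)) x.
 rewrite cE; have [|_ ->] := @C1_sum _ _ _ (index_enum {ffun 'I_d -> 'I_n.+1})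
  (fun a => (\sum_i a i <= n)%N) (fun a x => c a * mon (fun i => a i) x).
  by move=> a _; apply: C1Z; apply: smooth_C1; exact: smooth_mon.
 by apply: eq_bigr => a _; rewrite pderZ//; apply: smooth_C1; exact: smooth_mon.
split; last first.
 move=> n0 x; rewrite E big1// => a _; rewrite pder_mon.
 have -> : (a j : nat) = 0%N.
  apply/eqP; rewrite -leqn0 -ltnS; have := ltn_ord (a j).
  by move: (nat_of_ord _) => k; rewrite n0.
 by rewrite mul0r mulr0.
rewrite (funext E); apply: poly_sum => a an; apply: polyZ.
rewrite (funext (pder_mon j _)); have [->|aj] := eqVneq (a j : nat) 0%N.
 by rewrite (_ : (fun x => _) = fun=> 0); [exact: poly0|apply/funext => x; rewrite mul0r].
apply: polyZ; apply: poly_mon; rewrite (bigD1 j)//= eqxx.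
rewrite (eq_bigr (fun i => a i : nat)) => [|i /negbTE -> //].
move: an aj; rewrite (bigD1 j)//=.
by move: (nat_of_ord (a j)) (\sum_(i < d | i != j) _)%N => k s; lia.
Qed.

Lemma pder_scale j f (x0 y : pt) (h : R) : C1 f ->
 pder j (fun y => f (x0 + h *: y)) y = h * pder j f (x0 + h *: y).
move=> hf; apply: pder_is.
have := is_derive_line (fun y => f (x0 + h *: y)) y (e_ j) 0 (h * pder j f (x0 + h *: y)).
rewrite scale0r addr0 => <-.
rewrite (_ : (fun s => _) = (fun s : R => (fun t : R => f ((x0 + h *: y) + t *: e_ j)) (h * s))).
 have d1 : is_derive (h * 0) 1 (fun t : R => f ((x0 + h *: y) + t *: e_ j)) (pder j f (x0 + h *: y)).
  rewrite mulr0; apply/(is_derive_line f (x0 + h *: y) (e_ j) 0).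
  by rewrite scale0r addr0; exact: C1_is_derive.
 have d2 : is_derive (0 : R) 1 (fun s => h * s) h.
  by apply: is_derive_eq; rewrite /GRing.scale/=; ring.
 apply: is_derive_eq (@is_derive1_comp _ (fun t : R => f ((x0 + h *: y) + t *: e_ j))
  (fun s : R => h * s) _ _ _ d1 d2) _.
 by rewrite mulrC.
by apply/funext => s; congr f; rewrite scalerDr addrA scalerA.
Qed.

Lemma cont_ae0 (W : set pt) f : open W -> continuous f ->
 {ae mu, forall x, W x -> f x = 0} -> forall x, W x -> f x = 0.
move=> oW cf [N [mN N0 sub]] x Wx; apply/eqP/negPn/negP => fx.
have oV : open (W `&` [set y | f y != 0]).
 apply: openI => //; rewrite (_ : [set y | f y != 0] = f @^-1` (~` [set 0])); last first.
  by apply/seteqP; split => y /= /eqP.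
 apply: open_comp; first by move=> y _; exact: cf.
 by apply: closed_openC; exact: (@accessible_closed_set1 _ (hausdorff_accessible (@Rhausdorff R))).
have [p [q [bx bV]]] := rat_box oV (conj Wx fx).
have bN : obox (map_mx ratr p) (map_mx ratr q) `<=` N.
 move=> y /obox_cbox /bV [Wy /= fy]; apply: sub => /= /(_ Wy) h.
 by rewrite h eqxx in fy.
have : (0 < mu (obox (map_mx ratr p : pt) (map_mx ratr q)))%E.
 rewrite leb_obox => [|i]; last by have /andP[h1 h2] := bx i; rewrite ltW// (lt_trans h1 h2).
 rewrite lte_fin; apply: prodr_gt0 => i _; rewrite subr_gt0.
 by have /andP[h1 h2] := bx i; rewrite (lt_trans h1 h2).
apply/negP; rewrite -leNgt -N0; apply: le_measure => //; rewrite inE//.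
exact: mobox.
Qed.

(** The slope parameter is tied to the radius so that the shape is invariant under dilations; norms
    weighted with it then scale exactly. *)
Definition cbump (x0 : pt) (r : R) : pt -> R :=
 tbump (x0 - const_mx r) (x0 + const_mx r) r^-1.
Lemma cbox_ball (x0 : pt) (r : R) x : 0 <= r ->
 cbox (x0 - const_mx r) (x0 + const_mx r) x <-> `|x - x0| <= r.
move=> r0; rewrite row_normP//; split=> h i; have := h i; rewrite !mxE ler_norml.
 by move=> /andP[? ?]; apply/andP; split; lra.
by move=> /andP[? ?]; apply/andP; split; lra.
Qed.

Lemma cbump_out (x0 : pt) (r : R) x : 0 < r -> r < `|x - x0| -> cbump x0 r x = 0.
move=> r0; rewrite ltNge => /negP h.
have tb := @tbump_test _ _ (cbox (x0 - const_mx r) (x0 + const_mx r)) _ _ r^-1 _ (@subset_refl _ _).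
apply: (test_out (tb _)); first by rewrite invr_gt0.
by move=> /(cbox_ball _ _ (ltW r0)).
Qed.

Lemma cbump_ge0 (x0 : pt) r x : 0 <= cbump x0 r x. Proof. exact: tbump_ge0. Qed.
Lemma cbump_le1 (x0 : pt) r x : cbump x0 r x <= 1. Proof. exact: tbump_le1. Qed.
Lemma cbump_gt0 (x0 : pt) (r : R) x : 0 < r -> `|x - x0| < r -> 0 < cbump x0 r x.
move=> r0 h; apply: tbump_gt0; first by rewrite invr_gt0.
move=> i; have := le_lt_trans (coord_le (x - x0) i) h.
by rewrite !mxE ltr_norml => /andP[? ?]; apply/andP; split; lra.
Qed.

Lemma cbump_scale (x0 y : pt) (h r : R) : 0 < h -> 0 < r ->
 cbump x0 (r * h) (x0 + h *: y) = cbump 0 r y.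
move=> h0 r0; rewrite /cbump /tbump /prodf; apply: eq_bigr => i _; rewrite !mxE.
by congr (step _ * step _); field; rewrite !gt_eqF.
Qed.

Lemma smooth_eta_mon (x0 : pt) r m al : smooth (fun x => cbump x0 r x ^+ m * mon al x).
rewrite (_ : (fun x => _) = prodf (fun i t =>
  (step (r^-1 * (t - (x0 - const_mx r) 0 i)) * step (r^-1 * ((x0 + const_mx r) 0 i - t))) ^+ m
   * t ^+ al i)).
 apply: smooth_prodf => i; apply: smooth1M; last exact: smooth1_pow.
 by apply: smooth1X; exact: smooth1_tbump1.
apply/funext => x; rewrite /cbump /tbump /mon /prodf -prodrXl -big_split.
by apply: eq_bigr => i _.
Qed.

Lemma test_cbump (W : set pt) (x0 : pt) r m n p : 0 < r -> poly_fun n p ->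
 (forall x, `|x - x0| <= r -> W x) -> test_fun W (fun x => cbump x0 r x ^+ m.+1 * p x).
move=> r0 /polyE[c ->] sub; split; last first.
 exists (cbox (x0 - const_mx r) (x0 + const_mx r)); split; first exact: compact_cbox.
  by move=> x /(cbox_ball _ _ (ltW r0)); exact: sub.
 move=> x nx; rewrite cbump_out ?expr0n ?mul0r// ltNge; apply/negP => h; apply: nx.
 by apply/(cbox_ball _ _ (ltW r0)).
rewrite (_ : (fun x => _) = fun x => \sum_(a : {ffun 'I_d -> 'I_n.+1} | (\sum_i a i <= n)%N)
  c a * (cbump x0 r x ^+ m.+1 * mon (fun i => a i) x)).
 by apply: smooth_sum => a _; apply: smoothZ; exact: smooth_eta_mon.
by apply/funext => x; rewrite mulr_sumr; apply: eq_bigr => a _; ring.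
Qed.

Lemma Rintegral_scale (x0 : pt) (h : R) f : 0 < h -> mu.-integrable setT (EFin \o f) ->
 \int[mu]_x f (x0 + h *: x) = h ^- d * \int[mu]_x f x.
move=> h0 fi.
have c0 : 0 <= h ^- d by rewrite invr_ge0 exprn_ge0// ltW.
have := @Rint_scale R d (fun x => x0 + h *: x) (h ^- d) (maffine x0 h) c0.
by move=> /(_ (fun A mA => leb_affine x0 h0 mA) setT f measurableT fi); rewrite preimage_setT.
Qed.

(** Distinct nodes make the Vandermonde matrix invertible, and its inverse reads off coefficients
    from point values. Nodes in the unit interval can be shrunk into any ball. *)
Lemma grid_coef n : exists (t : 'I_n.+1 -> R) (V : 'I_n.+1 -> 'I_n.+1 -> R),
 (forall s, 0 < t s < 1) /\
 forall a b : 'I_n.+1, \sum_s t s ^+ a * V s b = (a == b)%:R.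
pose t (s : 'I_n.+1) : R := s.+1%:R / n.+2%:R.
pose T := \row_s t s; pose A := Vandermonde n.+1 T.
have uA : A \in unitmx.
 rewrite unitmxE det_Vandermonde unitfE; apply/prodf_neq0 => i _; apply/prodf_neq0 => j ij.
 rewrite !mxE /t -mulrBl mulf_neq0 ?invr_neq0 ?pnatr_eq0// subr_eq0 eqr_nat eqSS.
 by rewrite neq_ltn ij orbT.
exists t, (fun s b => invmx A s b); split.
 move=> s; rewrite divr_gt0//= ltr_pdivrMr// mul1r ltr_nat ltnS.
 exact: ltn_ord.
move=> a b; have /matrixP/(_ a b) := mulmxV uA; rewrite !mxE => <-.
by apply: eq_bigr => s _; rewrite !mxE.
Qed.

(** The tensor product of the one-variable functionals of [grid_coef], on a grid scaled by r/2 into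
    the ball, isolates one coefficient. *)
Lemma mon_indep n (r : R) (c : {ffun 'I_d -> 'I_n.+1} -> R) : 0 < r ->
 (forall x : pt, `|x| < r -> \sum_a c a * mon (fun i => a i) x = 0) -> forall a, c a = 0.
move=> r0 H a0; have [t [V [t01 VE]]] := grid_coef n.
pose X (s : {ffun 'I_d -> 'I_n.+1}) : pt := \row_i (r / 2 * t (s i)).
have Xr s : `|X s| < r.
 apply: (@le_lt_trans _ _ (r / 2)); last by lra.
 apply/row_normP; first by lra.
 move=> i; have /andP[h1 h2] := t01 (s i).
 rewrite !mxE ger0_norm ?mulr_ge0 ?divr_ge0 ?ltW//.
 by rewrite gtr_pMr// divr_gt0.
have r20 : r / 2 != 0 by rewrite mulf_neq0 ?gt_eqF.
have : \sum_(s : {ffun 'I_d -> 'I_n.+1}) (\prod_i V (s i) (a0 i)) *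
  (\sum_a c a * mon (fun i => a i) (X s)) = 0.
 by rewrite big1// => s _; rewrite H ?mulr0.
under eq_bigr do rewrite mulr_sumr.
have E a : \sum_(s : {ffun 'I_d -> 'I_n.+1}) (\prod_i V (s i) (a0 i)) *
  (c a * mon (fun i => a i) (X s)) = c a * \prod_i ((r / 2) ^+ a i * (a i == a0 i)%:R).
 transitivity (\sum_(s : {ffun 'I_d -> 'I_n.+1}) c a * \prod_i (V (s i) (a0 i) * X s 0 i ^+ a i)).
  by apply: eq_bigr => s _; rewrite mulrCA -big_split.
 rewrite -mulr_sumr; congr (_ * _).
 pose F i s := V s (a0 i) * (r / 2 * t s) ^+ a i.
 transitivity (\sum_(f : {ffun 'I_d -> 'I_n.+1}) \prod_i F i (f i)).
  by apply: eq_bigr => f _; apply: eq_bigr => i _; rewrite !mxE.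
 rewrite -(bigA_distr_bigA F); apply: eq_bigr => i _; rewrite -(VE (a i) (a0 i)) mulr_sumr.
 by apply: eq_bigr => s _; rewrite /F exprMn; ring.
rewrite exchange_big /=; under eq_bigr do rewrite E.
rewrite (bigD1 a0)//= [X in _ + X]big1 ?addr0 => [|a aa0].
 move/eqP; rewrite mulf_eq0 => /orP[/eqP //|].
 move=> /prodf_eq0[i _]; rewrite eqxx mulr1.
 by rewrite expf_eq0 (negbTE r20) andbF.
have /existsP[i ai] : [exists i, a i != a0 i].
 by apply: contraNT aa0 => /existsPn h; apply/eqP/ffunP => i; have := h i => /negPn/eqP.
by rewrite (bigD1 i)//= (negbTE ai) mulr0 mul0r mulr0.
Qed.

Local Notation mi n := {ffun 'I_d -> 'I_n.+1}.
Definition emon (r : R) n (a : mi n) : pt -> R := fun x => cbump 0 r x * mon (fun i => a i) x.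
Lemma test_emon (r : R) n (a : mi n) : 0 < r -> test_fun setT (emon r a).
move=> r0.
have : test_fun setT (fun x => cbump 0 r x ^+ 1 * mon (fun i => a i) x).
 by apply: (@test_cbump _ _ _ _ (\sum_i a i)%N) => //; exact: poly_mon.
by congr (test_fun _ _); apply/funext => x; rewrite expr1.
Qed.

Lemma L2_emon (r : R) n (a : mi n) : 0 < r -> L2 setT (emon r a).
Proof. by move=> r0; exact: test_L2 (test_emon a r0). Qed.
(** [B] is the inverse of the Gram matrix of the bump-weighted monomials: a vanishing combination of
    them is a polynomial that is zero where the bump is positive. The weight makes each coefficient
    depend only on values in one small ball. *)
Lemma dual_mon n (r : R) : 0 < r ->
 exists B : mi n -> mi n -> R, forall a b,
 \sum_e B a e * ip setT (emon r e) (emon r b) = (a == b)%:R.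
move=> r0.
pose G : 'M[R]_#|{: mi n}| := \matrix_(i, j) ip setT (emon r (enum_val i)) (emon r (enum_val j)).
have uG : G \in unitmx.
 rewrite -row_free_unit -kermx_eq0; apply/eqP/row_matrixP => k; rewrite row0.
 set v := row _ _; have vG : v *m G = 0 by rewrite /v -row_mul mulmx_ker row0.
 pose Q x := \sum_i v 0 i * emon r (enum_val i) x.
 have Lv i : L2 setT (fun x => v 0 i * emon r (enum_val i) x).
  by apply: L2Z => //; exact: L2_emon.
 have LQ : L2 setT Q by exact: L2_sum.
 have Qm (j : 'I_#|{: mi n}|) : ip setT Q (emon r (@enum_val _ predT j)) = 0.
  have /matrixP/(_ 0 j) := vG; rewrite !mxE => <-.
  rewrite ip_suml//; last exact: L2_emon.
  by apply: eq_bigr => i _; rewrite ipZl ?mxE//; exact: L2_emon.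
 have Q0 : nrm setT Q = 0.
  rewrite /nrm [X in Num.sqrt X](_ : _ = 0) ?sqrtr0// {1}/Q ip_suml//.
  rewrite big1// => i _; rewrite ipZl//; last exact: L2_emon.
  by rewrite ipC Qm mulr0.
 have cQ : continuous Q.
  have [] := @C1_sum R d _ (index_enum _) predT
   (fun i x => v 0 i * emon r (enum_val i) x); last by case.
  by move=> i _; apply: C1Z; exact: test_C1 (test_emon _ r0).
 have Qz x : Q x = 0.
  by apply: (cont_ae0 openT cQ (nrm0_ae measurableT LQ Q0)).
 suff vz : forall a : mi n, v 0 (enum_rank a) = 0.
  by apply/rowP => i; have := vz (enum_val i); rewrite enum_valK => ->; rewrite mxE.
 apply: (mon_indep r0) => x xr; have := Qz x; rewrite /Q /emon.
 under eq_bigr do rewrite mulrCA.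
 rewrite -mulr_sumr => /eqP; rewrite mulf_eq0 gt_eqF/=; last by apply: cbump_gt0; rewrite ?subr0.
 move=> /eqP h; rewrite -[RHS]h (reindex (fun i : 'I_#|{: mi n}| => enum_val i))/=; last first.
  by apply: onW_bij; exact: enum_val_bij.
 by apply: eq_bigr => i _; rewrite enum_valK.
exists (fun a e => invmx G (enum_rank a) (enum_rank e)) => a b.
have /matrixP/(_ (enum_rank a) (enum_rank b)) := mulVmx uG; rewrite !mxE.
rewrite (inj_eq enum_rank_inj) => <-.
rewrite (reindex (fun i : 'I_#|{: mi n}| => enum_val i))/=; last by apply: onW_bij; exact: enum_val_bij.
by apply: eq_bigr => i _; rewrite !mxE enum_valK enum_rankK.
Qed.

(* The dual functional of the monomial a: it reads off the coefficient of a in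
  the rescaled variable (x - x0) / h. *)
Definition coef_fun n r (B : mi n -> mi n -> R) (a : mi n) (q : pt -> R) : R :=
 \sum_e B a e * ip setT (emon r e) (fun x => cbump 0 r x * q x).
Lemma L2_cbump (x0 : pt) (r : R) n p : 0 < r -> poly_fun n p ->
 L2 setT (fun x => cbump x0 r x * p x).
move=> r0 hp; have tt := @test_cbump setT x0 r 0 n p r0 hp (fun _ _ => I).
by have := test_L2 measurableT tt; congr (L2 _ _); apply/funext => x; rewrite expr1.
Qed.

Lemma coef_funD n m r (B : mi n -> mi n -> R) a p q : 0 < r -> poly_fun m p -> poly_fun m q ->
 coef_fun r B a (fun x => p x + q x) = coef_fun r B a p + coef_fun r B a q.
move=> r0 hp hq; rewrite /coef_fun -big_split; apply: eq_bigr => e _ /=.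
rewrite -mulrDr -ipDr//; [|exact: L2_cbump hp|exact: L2_cbump hq|exact: L2_emon].
by congr (_ * _); apply: eq_ip => // x _; rewrite mulrDr.
Qed.

Lemma coef_funZ n m r (B : mi n -> mi n -> R) a t p : 0 < r -> poly_fun m p ->
 coef_fun r B a (fun x => t * p x) = t * coef_fun r B a p.
move=> r0 hp; rewrite /coef_fun mulr_sumr; apply: eq_bigr => e _ /=.
rewrite mulrCA -(ipZr t)//; [|exact: L2_cbump hp|exact: L2_emon].
by congr (_ * _); apply: eq_ip => // x _; rewrite mulrCA.
Qed.

Lemma coef_fun_sum n m r (B : mi n -> mi n -> R) a I (s : seq I) (P : pred I) (F : I -> pt -> R) :
 0 < r -> (forall i, P i -> poly_fun m (F i)) ->
 coef_fun r B a (fun x => \sum_(i <- s | P i) F i x) = \sum_(i <- s | P i) coef_fun r B a (F i).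
move=> r0 H; elim: s => [|i s IH].
 rewrite big_nil /coef_fun big1// => e _; rewrite -[RHS](mulr0 (B a e)); congr (_ * _).
 by rewrite -[RHS](ip0r setT (emon r e)); apply: eq_ip => // x _; rewrite big_nil mulr0.
rewrite big_cons; case: ifP => Pi; last first.
 by rewrite -IH; congr coef_fun; apply/funext => x; rewrite big_cons Pi.
rewrite -IH -(@coef_funD n m)//; [|exact: H|exact: poly_sum].
by congr coef_fun; apply/funext => x; rewrite big_cons Pi.
Qed.

Lemma coef_fun_mon n r (B : mi n -> mi n -> R) (al : 'I_d -> nat) (a : mi n) :
 (forall a b, \sum_e B a e * ip setT (emon r e) (emon r b) = (a == b)%:R) ->
 (\sum_i al i <= n)%N ->
 coef_fun r B a (mon al) = [forall i, a i == al i :> nat]%:R.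
move=> BE h; have [b bE] := ffun_al h; subst al.
rewrite (_ : [forall i, _] = (a == b)); first exact: BE.
apply/forallP/eqP => [e|-> //]; apply/ffunP => i; apply/val_inj/eqP; exact: e.
Qed.

Lemma poly_expand n r (B : mi n -> mi n -> R) q :
 (forall a b, \sum_e B a e * ip setT (emon r e) (emon r b) = (a == b)%:R) -> 0 < r ->
 poly_fun n q -> q = fun x => \sum_(a : mi n | (\sum_i a i <= n)%N) coef_fun r B a q * mon (fun i => a i) x.
move=> BE r0 /polyE[c qE]; rewrite [LHS]qE; apply/funext => x; apply: eq_bigr => a an.
congr (_ * _); rewrite qE (@coef_fun_sum n n)//; last first.
 by move=> b bn; apply: polyZ; exact: poly_mon.
rewrite (bigD1 a)//= (@coef_funZ n n)//; last exact: poly_mon.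
rewrite coef_fun_mon// big1 ?addr0; first by rewrite (introT forallP) ?mulr1.
move=> b /andP[bn ba]; rewrite (@coef_funZ n n)//; last exact: poly_mon.
rewrite coef_fun_mon// (_ : [forall i, _] = false) ?mulr0//.
by apply: contra_neqF ba => /forallP e; apply/ffunP => i; apply/val_inj/eqP; rewrite eq_sym e.
Qed.

Lemma coef_fun_low n m r (B : mi n -> mi n -> R) (b : mi n) q :
 (forall a b, \sum_e B a e * ip setT (emon r e) (emon r b) = (a == b)%:R) -> 0 < r ->
 poly_fun m q -> (m < \sum_i b i)%N -> (m <= n)%N -> coef_fun r B b q = 0.
move=> BE r0 /polyE[c ->] mb mn; rewrite (@coef_fun_sum n m)//; last first.
 by move=> a am; apply: polyZ; exact: poly_mon.
rewrite big1// => a am; rewrite (@coef_funZ n m)//; last exact: poly_mon.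
rewrite coef_fun_mon//; last exact: leq_trans mn.
rewrite (_ : [forall i, _] = false) ?mulr0//; apply/negbTE/negP => /forallP e.
by move: mb; rewrite (eq_bigr _ (fun i _ => eqP (e i))) ltnNge am.
Qed.

Lemma coef_fun_bound n r (B : mi n -> mi n -> R) : 0 < r -> exists2 K, 0 <= K &
 forall a m q, poly_fun m q -> `|coef_fun r B a q| <= K * nrm setT (fun x => cbump 0 r x * q x).
move=> r0; exists (\sum_a \sum_e `|B a e| * nrm setT (emon r e)).
 by apply: sumr_ge0 => a _; apply: sumr_ge0 => e _; rewrite mulr_ge0 ?nrm_ge0.
move=> a m q hq; apply: (@le_trans _ _ ((\sum_e `|B a e| * nrm setT (emon r e)) *
  nrm setT (fun x => cbump 0 r x * q x))).
 rewrite mulr_suml; apply: le_trans (ler_norm_sum _ _ _) _; apply: ler_sum => e _.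
 rewrite normrM -mulrA ler_wpM2l//.
 by apply: ip_CS => //; [exact: L2_emon|exact: L2_cbump hq].
rewrite ler_wpM2r ?nrm_ge0// [leRHS](bigD1 a)//= lerDl; apply: sumr_ge0 => b _.
by apply: sumr_ge0 => e _; rewrite mulr_ge0 ?nrm_ge0.
Qed.

Lemma nrm_eta_scale (x0 : pt) (h r : R) n p : 0 < h -> 0 < r -> poly_fun n p ->
 nrm setT (fun y => cbump 0 r y * p (x0 + h *: y)) ^+ 2 =
 h ^- d * nrm setT (fun x => cbump x0 (r * h) x * p x) ^+ 2.
move=> h0 r0 hp; have Lp := L2_cbump x0 (mulr_gt0 r0 h0) hp.
have E := Rintegral_scale x0 h0 (L2_integrable measurableT Lp Lp).
rewrite !nrm_sq; transitivity (\int[mu]_y ((cbump x0 (r * h) (x0 + h *: y) * p (x0 + h *: y)) *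
  (cbump x0 (r * h) (x0 + h *: y) * p (x0 + h *: y)))); last exact: E.
by apply: eq_Rintegral => y _; rewrite cbump_scale.
Qed.

Lemma mon_bounded n (c : R) : exists2 K, 0 <= K &
 forall (a : mi n) (y : pt), `|y| <= c -> `|mon (fun i => a i) y| <= K /\
  forall i, `|pder i (mon (fun i => a i)) y| <= K.
have H (a : mi n) : exists K, forall y : pt, `|y| <= c -> `|mon (fun i => a i) y| <= K /\
  forall i, `|pder i (mon (fun i => a i)) y| <= K.
 have ca : C1 (mon (fun i => a i)) by apply: smooth_C1; exact: smooth_mon.
 have [K0 hK0] := cont_bdd_on c ca.1.
 have /choice[K hK] : forall i : 'I_d, exists K, forall y : pt, `|y| <= c ->
   `|pder i (mon (fun i => a i)) y| <= K.
  by move=> i; exact: cont_bdd_on (ca.2 i).2.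
 exists (`|K0| + \sum_i `|K i|) => y yc; split.
  apply: le_trans (hK0 _ yc) _; apply: le_trans (ler_norm _) _.
  by rewrite lerDl sumr_ge0.
 move=> i; apply: le_trans (hK i _ yc) _; apply: le_trans (ler_norm _) _.
 by rewrite (bigD1 i)//= addrCA lerDl addr_ge0// sumr_ge0.
have [K hK] := choice H; exists (\sum_a `|K a|) => [|a y yc]; first exact: sumr_ge0.
have Ka : K a <= \sum_a `|K a|.
 by apply: le_trans (ler_norm _) _; rewrite (bigD1 a)//= lerDl sumr_ge0.
by have [h1 h2] := hK a y yc; split => [|i]; apply: le_trans Ka.
Qed.

(** After rescaling, the coefficients are bounded by the weighted norm on a ball of radius r h, and
    the monomials are bounded on the larger ball of radius c h. This is how the cube inside a cell
    controls the whole cell. *)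
Lemma poly_sup n (r c : R) : 0 < r -> exists2 C, 0 <= C & forall (x0 x : pt) (h : R) p,
 0 < h -> poly_fun n p -> `|x - x0| <= c * h ->
 p x ^+ 2 <= C * h ^- d * nrm setT (fun x => cbump x0 (r * h) x * p x) ^+ 2 /\
 forall i, (h * pder i p x) ^+ 2 <= C * h ^- d * nrm setT (fun x => cbump x0 (r * h) x * p x) ^+ 2.
move=> r0; have [B BE] := dual_mon n r0; have [K1 K10 hK1] := coef_fun_bound B r0.
have [K2 K20 hK2] := mon_bounded n c.
pose N : R := \sum_(a : mi n | (\sum_i a i <= n)%N) K1 * K2.
have N0 : 0 <= N by apply: sumr_ge0 => a _; exact: mulr_ge0.
exists (N ^+ 2); first exact: sqr_ge0.
move=> x0 x h p h0 hp xc.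
pose y := h^-1 *: (x - x0); have xE : x = x0 + h *: y.
 by rewrite /y scalerA divff ?gt_eqF// scale1r addrC subrK.
have yc : `|y| <= c.
 by rewrite /y normrZ gtr0_norm ?invr_gt0// mulrC ler_pdivrMr.
pose q y := p (x0 + h *: y).
have hq : poly_fun n q by exact: poly_affine.
have qE := poly_expand BE r0 hq.
have qE' z := congr1 (fun f => f z) qE.
pose S := nrm setT (fun y => cbump 0 r y * q y); have S0 : 0 <= S by exact: nrm_ge0.
have -> : N ^+ 2 * h ^- d * nrm setT (fun x => cbump x0 (r * h) x * p x) ^+ 2 = (N * S) ^+ 2.
 have SE : S ^+ 2 = _ := nrm_eta_scale x0 h0 r0 hp.
 by rewrite -mulrA -SE exprMn.
have SE a : `|coef_fun r B a q| <= K1 * S by exact: hK1 hq.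
have key z (F : mi n -> R) : (forall a, `|F a| <= K2) ->
  z = \sum_(a : mi n | (\sum_i a i <= n)%N) coef_fun r B a q * F a -> z ^+ 2 <= (N * S) ^+ 2.
 move=> HF ->; rewrite -[leLHS]ger0_norm ?sqr_ge0// normrX lerXn2r ?nnegrE ?mulr_ge0//.
 apply: le_trans (ler_norm_sum _ _ _) _; rewrite /N mulr_suml; apply: ler_sum => a _.
 by rewrite normrM mulrAC; apply: ler_pM.
split.
 apply: (key _ (fun a => mon (fun i => a i) y)); first by move=> a; case: (hK2 a y yc).
 by rewrite {1}xE; exact: qE'.
move=> i; apply: (key _ (fun a => pder i (mon (fun i => a i)) y)).
 by move=> a; case: (hK2 a y yc).
rewrite {1}xE -(pder_scale i x0 y h (poly_C1 hp)).
transitivity (pder i (fun x => \sum_(a : mi n | (\sum_i a i <= n)%N)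
  coef_fun r B a q * mon (fun i => a i) x) y); first by rewrite -qE.
have [|_ ->] := @C1_sum R d _ (index_enum (mi n)) (fun a : mi n => (\sum_i a i <= n)%N)
 (fun a x => coef_fun r B a q * mon (fun i => a i) x).
 by move=> a _; apply: C1Z; apply: smooth_C1; exact: smooth_mon.
by apply: eq_bigr => a _; rewrite pderZ//; apply: smooth_C1; exact: smooth_mon.
Qed.

(* The top-degree part of s in w + s x is visible in every component, so
  it can be removed from component i at a cost controlled by component j. *)
Lemma RT_project k (r c : R) i j : i != j -> 0 < r -> exists2 C, 0 <= C &
 forall (x0 : pt) (h : R) v, 0 < h -> RTpoly k v -> exists g, poly_fun k g /\
 forall x, `|x - x0| <= c * h -> (v x 0 i - g x) ^+ 2 <=
  C * h ^- d * nrm setT (fun x => cbump x0 (r * h) x * v x 0 j) ^+ 2.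
move=> ij r0; have [B BE] := dual_mon k r0; have [B' BE'] := dual_mon k.+1 r0.
have [K1 K10 hK1] := coef_fun_bound B' r0.
have [K2 K20 hK2] := mon_bounded k c.
pose N : R := \sum_(a : mi k | (\sum_i a i == k)%N) K1 * (K2 * `|c|).
have N0 : 0 <= N by apply: sumr_ge0 => a _; rewrite !mulr_ge0.
exists (N ^+ 2); first exact: sqr_ge0.
move=> x0 h v h0 [w [s [hw hs vE]]].
pose Y x := h^-1 *: (x - x0); have YE x : x = x0 + h *: Y x.
 by rewrite /Y scalerA divff ?gt_eqF// scale1r addrC subrK.
pose sq y := s (x0 + h *: y); have hsq : poly_fun k sq by exact: poly_affine.
pose sg := fun a => coef_fun r B a sq.
have sqE := poly_expand BE r0 hsq.
have vl l x : v x 0 l = (w x 0 l + s x * x0 0 l) +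
  h * \sum_(a : mi k | (\sum_i a i <= k)%N) sg a * (mon (fun i => a i) (Y x) * Y x 0 l).
 have -> : \sum_(a : mi k | (\sum_i a i <= k)%N) sg a * (mon (fun i => a i) (Y x) * Y x 0 l) =
   s x * Y x 0 l.
  transitivity (sq (Y x) * Y x 0 l); last by rewrite /sq -YE.
  rewrite (congr1 (fun f => f (Y x)) sqE) mulr_suml.
  by apply: eq_bigr => a _; rewrite mulrA.
 by rewrite vE !mxE; field; rewrite gt_eqF.
(* The part of degree k + 1 of component l in the rescaled variable; it is subtracted from component
   i. *)
pose T l x := h * \sum_(a : mi k | (\sum_i a i == k)%N) sg a * (mon (fun i => a i) (Y x) * Y x 0 l).
have Ypoly l : poly_fun 1 (fun x => Y x 0 l).
 rewrite (_ : (fun x : pt => Y x 0 l) = fun x : pt => h^-1 * (x 0 l - x0 0 l)).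
  by apply: polyZ; apply: polyB; [exact: poly_coord|exact: poly_cst].
 by apply/funext => x; rewrite !mxE.
have Ymon (a : mi k) : poly_fun (\sum_i a i) (fun x => mon (fun i => a i) (Y x)).
 have := @poly_affine _ (- h^-1 *: x0) h^-1 _ (@poly_mon _ (fun i => a i) (leqnn _)).
 by congr (poly_fun _ _); apply/funext => x; rewrite /Y scalerBr addrC scaleNr.
exists (fun x => v x 0 i - T i x); split.
 rewrite (_ : (fun x => _) = fun x => (w x 0 i + s x * x0 0 i) +
  h * \sum_(a : mi k | (\sum_i a i < k)%N) sg a * (mon (fun i => a i) (Y x) * Y x 0 i)).
  apply: polyD; last first.
   apply: polyZ; apply: poly_sum => a ak; apply: polyZ; apply: (@poly_le (\sum_i a i + 1)).
    by rewrite addn1.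
   exact: polyM.
  apply: polyD; first exact: hw.
  rewrite (_ : (fun x => _) = fun x => x0 0 i * s x); first exact: polyZ.
  by apply/funext => x; rewrite mulrC.
 apply/funext => x; rewrite vl /T -!addrA; congr (_ + (_ + _)).
 rewrite -mulrBr; congr (_ * _); apply/eqP; rewrite subr_eq; apply/eqP.
 rewrite (bigID (fun a : mi k => (\sum_i a i == k)%N))/= addrC; congr (_ + _).
  by apply: eq_bigl => a; rewrite ltn_neqAle andbC.
 by apply: eq_bigl => a; rewrite andb_idl// => /eqP ->.
move=> x xc; rewrite opprB addrCA subrr addr0.
have yc : `|Y x| <= c by rewrite /Y normrZ gtr0_norm ?invr_gt0// mulrC ler_pdivrMr.
have yl : `|Y x 0 i| <= `|c|.
 by apply: le_trans (coord_le _ _) _; apply: le_trans yc (ler_norm _).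
have hvj : poly_fun k.+1 (fun x => v x 0 j).
 rewrite (_ : (fun x => _) = fun x => w x 0 j + s x * x 0 j).
  apply: polyD; first exact: poly_le (leqnSn _) (hw j).
  by rewrite -addn1; apply: polyM => //; exact: poly_coord.
 by apply/funext => z; rewrite vE !mxE.
(* Up to the factor [h], the coefficient of a top-degree monomial of [s] is that of its product with
   the variable of index j in component j; the other terms there do not contain this monomial of
   degree k + 1. *)
have sgE (a : mi k) : (\sum_i a i == k)%N ->
  h * sg a = coef_fun r B' [ffun l => inord (a l + (l == j))%N] (fun y => v (x0 + h *: y) 0 j).
 move=> /eqP ak; set b := finfun _.
 have bE l : (b l : nat) = (a l + (l == j))%N.
  rewrite ffunE inordK//; have := ltn_ord (a l); have := leq_b1 (l == j).
  by move: (nat_of_ord (a l)) (nat_of_bool _) => u1 u2; lia.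
 have bk : (\sum_i b i)%N = k.+1.
  by rewrite (eq_bigr _ (fun l _ => bE l)) big_split /= ak (sum_unit_al j) addn1.
 have vjE y : v (x0 + h *: y) 0 j = (w (x0 + h *: y) 0 j + x0 0 j * sq y) +
   \sum_(a : mi k | (\sum_i a i <= k)%N) (h * sg a) * mon (fun l => a l + (l == j))%N y.
  have YY : Y (x0 + h *: y) = y.
   by rewrite /Y addrC addKr scalerA mulVf ?gt_eqF// scale1r.
  rewrite vl YY mulr_sumr /sq (mulrC (s _)); congr (_ + _); apply: eq_bigr => a' _.
  by rewrite mulrA (monD _ (unit_al j)) mon_unit.
 have mk (a' : mi k) : (\sum_i a' i <= k)%N -> poly_fun k.+1 (mon (fun l => a' l + (l == j))%N).
  move=> a'k; apply: poly_mon; rewrite big_split /= (sum_unit_al j) addn1.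
  by rewrite ltnS.
 have p1 : poly_fun k (fun y => w (x0 + h *: y) 0 j + x0 0 j * sq y).
  by apply: polyD; [exact: (poly_affine _ _ (hw j))|exact: polyZ].
 rewrite (funext vjE) (@coef_funD k.+1 k.+1)//; first last.
 - by apply: poly_sum => a' a'k; apply: polyZ; exact: mk.
 - exact: poly_le (leqnSn _) p1.
 rewrite (coef_fun_low BE' r0 p1) ?bk// add0r.
 rewrite (@coef_fun_sum k.+1 k.+1)//; last by move=> a' a'k; apply: polyZ; exact: mk.
 have C (a' : mi k) : (\sum_i a' i <= k)%N -> coef_fun r B' b
   (fun y => h * sg a' * mon (fun l => a' l + (l == j))%N y) = h * sg a' * (a' == a)%:R.
  move=> a'k; rewrite (@coef_funZ k.+1 k.+1)//; last exact: mk.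
  rewrite coef_fun_mon//; last by rewrite big_split /= (sum_unit_al j) addn1 ltnS.
  congr (_ * _%:R); congr (nat_of_bool _); apply/forallP/eqP => [e|-> l]; last by rewrite bE.
  by apply/ffunP => l; apply/val_inj/eqP; rewrite eq_sym; have := e l; rewrite bE eqn_add2r.
 rewrite (eq_bigr _ C) (bigD1 a) ?ak//= eqxx mulr1 big1 ?addr0//.
 by move=> a' /andP[_ /negbTE ->]; rewrite mulr0.
pose S := nrm setT (fun y => cbump 0 r y * v (x0 + h *: y) 0 j).
have S0 : 0 <= S by exact: nrm_ge0.
have -> : N ^+ 2 * h ^- d * nrm setT (fun x => cbump x0 (r * h) x * v x 0 j) ^+ 2 = (N * S) ^+ 2.
 have SE : S ^+ 2 = _ := nrm_eta_scale x0 h0 r0 hvj.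
 by rewrite -mulrA -SE exprMn.
rewrite -[leLHS]ger0_norm ?sqr_ge0// normrX lerXn2r ?nnegrE ?mulr_ge0//.
rewrite /T mulr_sumr /N mulr_suml; apply: le_trans (ler_norm_sum _ _ _) _; apply: ler_sum => a ak.
rewrite mulrA normrM mulrAC; apply: ler_pM => //.
 by rewrite sgE//; exact: hK1 (poly_affine _ _ hvj).
rewrite normrM; apply: ler_pM => //.
by case: (hK2 a (Y x) yc).
Qed.

End Poly.

(** * Derivatives along arbitrary vectors *)

Section Directional.
Context {R : realType} {d : nat}.
Local Notation pt := 'rV[R]_d.
Local Notation e_ i := (delta_mx 0 i : pt).
Implicit Types (f g : pt -> R).
Definition dder (v : pt) f : pt -> R := fun x => \sum_i v 0 i * pder i f x.
(** The displacement is split into coordinate steps, each treated by the mean value theorem and the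
    continuity of one partial derivative; the error is shared among the steps by halving. *)
Lemma C1_dir_small f (x v : pt) (e : R) : C1 f -> 0 < e -> exists2 del, 0 < del &
 forall s, `|s| < del -> `|f (x + s *: v) - f x - s * dder v f x| <= e * `|s|.
move=> hf e0.
rewrite /dder.
suff H (r : seq 'I_d) e' : 0 < e' -> exists2 del, 0 < del &
  forall s, `|s| < del -> `|f (x + s *: (\sum_(j <- r) v 0 j *: e_ j)) - f x
    - s * \sum_(j <- r) v 0 j * pder j f x| <= e' * `|s|.
 have [del d0 hd] := H (index_enum 'I_d) e e0; exists del => // s sd.
 by have := hd s sd; rewrite -row_sum_delta.
elim: r e' => [|i r IH] e' e'0.
 by exists 1 => // s _; rewrite !big_nil scaler0 addr0 mulr0 subrr subr0 normr0 mulr_ge0// ltW.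
have e20 : 0 < e' / 2 by lra.
have [d1 d10 h1] := IH _ e20.
set z := \sum_(j <- r) v 0 j *: e_ j in h1.
pose M := `|z| + `|v 0 i| + 1; have M0 : 0 < M by rewrite /M; have := normr_ge0 z; have := normr_ge0 (v 0 i); lra.
pose e1 := e' / (2 * M); have e10 : 0 < e1 by rewrite divr_gt0// mulr_gt0.
have [d2 d20 h2] : exists2 d2, 0 < d2 & forall y : pt, `|y - x| < d2 -> `|pder i f y - pder i f x| < e1.
 have [_ ci] := hf.2 i; have /cvgrPdist_lt/(_ _ e10)/nbhs_ballP[d2 d20 hd2] := ci x.
 exists d2 => // y yd; rewrite distrC; apply: hd2.
 by rewrite mx_norm_ball /ball_/= distrC.
exists (Num.min d1 (d2 / M)); first by rewrite lt_min d10 divr_gt0.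
move=> s; rewrite lt_min => /andP[sd1 sd2].
have {}sd2 : `|s| * M < d2 by rewrite -ltr_pdivlMr.
have [df _] := hf.2 i.
have [xi xis xiE] := @coord_MVT R d f i (x + s *: z) (s * v 0 i) df.
rewrite !big_cons -/z.
have -> : x + s *: (v 0 i *: e_ i + z) = x + s *: z + (s * v 0 i) *: e_ i.
 by rewrite scalerDr scalerA [_ *: _ + s *: z]addrC addrA.
set y := x + s *: z + xi *: e_ i in xiE.
have yx : `|y - x| < d2.
 apply: le_lt_trans sd2; rewrite /y (_ : x + s *: z + xi *: e_ i - x = s *: z + xi *: e_ i).
  apply: le_trans (ler_normD _ _) _; rewrite !normrZ.
  have ne : `|e_ i| <= 1.
   apply/row_normP => // j; rewrite !mxE eqxx /=; case: eqP => _; by rewrite ?normr1 ?normr0.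
  have h3 : `|xi| * `|e_ i| <= `|s| * `|v 0 i|.
   by rewrite -normrM -[leRHS]mulr1; apply: ler_pM.
  by rewrite /M !mulrDr; have := normr_ge0 s; lra.
 by rewrite addrAC (addrAC x) subrr add0r.
have := h2 y yx; have := h1 s sd1.
have -> : f (x + s *: z + (s * v 0 i) *: e_ i) = f (x + s *: z) + s * v 0 i * pder i f y.
 by rewrite -xiE [RHS]addrC subrK.
set A := f _ - f x; move=> H1 H2.
have -> : f (x + s *: z) + s * v 0 i * pder i f y - f x -
  s * (v 0 i * pder i f x + \sum_(j <- r) v 0 j * pder j f x) =
 (f (x + s *: z) - f x - s * \sum_(j <- r) v 0 j * pder j f x) +
  s * (v 0 i * (pder i f y - pder i f x)) by ring.
apply: le_trans (ler_normD _ _) _; apply: le_trans (lerD H1 (lexx _)) _.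
rewrite !normrM.
have H3 : `|v 0 i| * `|pder i f y - pder i f x| <= e' / 2.
 have -> : e' / 2 = M * e1 by rewrite /e1; field; rewrite gt_eqF.
 by apply: ler_pM => //; [rewrite /M; have := normr_ge0 z; lra|exact: ltW].
have := ler_wpM2l (normr_ge0 s) H3; lra.
Qed.

Lemma is_derive_dder f (x v : pt) : C1 f -> is_derive x v f (dder v f x).
move=> hf; have := is_derive_line f x v 0 (dder v f x); rewrite scale0r addr0 => <-.
have h : (fun s : R => s^-1 *: (((fun t : R => f (x + t *: v)) \o shift 0) (s *: (1 : R))
   - f (x + 0 *: v))) @ 0^' --> dder v f x.
 apply/cvgrPdist_le => e e0; have [del d0 hd] := C1_dir_small x v hf e0.
 near=> s; have s0 : s != 0 by near: s; exact: nbhs_dnbhs_neq.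
 have sd : `|s| < del.
  near: s; apply: dnbhs0_lt => //.
 have H := hd s sd.
 rewrite [X in X <= _](_ : _ = `|s|^-1 * `|f (x + s *: v) - f x - s * dder v f x|).
  by rewrite mulrC ler_pdivrMr ?normr_gt0.
 rewrite -normfV -normrM distrC; congr `|_|; rewrite /= scale0r !addr0 /GRing.scale/= mulr1.
 by field.
apply: DeriveDef; first by apply/cvg_ex; eexists; exact: h.
exact: (cvg_lim (@Rhausdorff R) h).
Unshelve. all: by end_near.
Qed.

Lemma dder_is f (x v : pt) l : C1 f -> is_derive x v f l -> dder v f x = l.
by move=> hf h; have := is_derive_dder x v hf; move=> [_ <-]; case: h.
Qed.

Lemma C1_segment_MVT f (x v : pt) : C1 f -> exists2 s : R, 0 <= s <= 1 &
 f (x + v) - f x = dder v f (x + s *: v).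
move=> hf.
have D (t : R) : is_derive t 1 (fun s : R => f (x + s *: v)) (dder v f (x + t *: v)).
 by apply/is_derive_line; exact: is_derive_dder.
have C (A : set R) : {within A, continuous (fun s : R => f (x + s *: v))}.
 apply: continuous_subspaceT => s.
 by have [h _] := D s; apply: differentiable_continuous; exact/derivable1_diffP.
have [s] := @MVT_segment R (fun s : R => f (x + s *: v)) (fun t => dder v f (x + t *: v)) 0 1 ler01
 (fun t _ => D t) (C _).
rewrite in_itv/= => s01; rewrite scale1r scale0r addr0 subr0 mulr1 => ->.
by exists s.
Qed.

Lemma C1_affine f (phi : pt -> pt) (L : pt -> pt) : C1 f -> continuous phi ->
 (forall x v s, phi (x + s *: v) = phi x + s *: L v) ->
 C1 (fun x => f (phi x)) /\ forall x v, dder v (fun x => f (phi x)) x = dder (L v) f (phi x).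
move=> hf cphi H.
have D x v : is_derive x v (fun x => f (phi x)) (dder (L v) f (phi x)).
 have := is_derive_line (fun x => f (phi x)) x v 0 (dder (L v) f (phi x)).
 rewrite scale0r addr0 => <-.
 rewrite (_ : (fun s => _) = (fun s : R => f (phi x + s *: L v))); last first.
  by apply/funext => s; rewrite H.
 by apply/(is_derive_line f (phi x) (L v) 0); rewrite scale0r addr0; exact: is_derive_dder.
have c1 : C1 (fun x => f (phi x)).
 split; first by move=> x; apply: continuous_comp; [exact: cphi|exact: hf.1].
 move=> i; split; first by move=> x; case: (D x (e_ i)).
 rewrite (_ : pder i _ = fun x => dder (L (e_ i)) f (phi x)); last first.
  by apply/funext => x; exact: pder_is.
 move=> x; rewrite /dder; elim: (index_enum _) => [|j r IH].
  by under eq_fun do rewrite big_nil; exact: cst_continuous.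
 rewrite (_ : (fun x => _) = fun x => L (e_ i) 0 j * pder j f (phi x) +
   \sum_(k <- r) L (e_ i) 0 k * pder k f (phi x)); last first.
  by apply/funext => y; rewrite big_cons.
 have hj : (fun y => pder j f (phi y)) @ x --> pder j f (phi x).
  by apply: continuous_comp; [exact: cphi|have [_ h] := hf.2 j; exact: h].
 exact: (cvgD (cvgM (@cst_continuous _ _ _ x) hj) IH).
by split => // x v; apply: dder_is.
Qed.

Lemma dderB v f g x : C1 f -> C1 g -> dder v (fun x => f x - g x) x = dder v f x - dder v g x.
move=> hf hg; rewrite /dder -sumrB; apply: eq_bigr => i _.
by rewrite pderB// mulrBr.
Qed.

Lemma dderM v f g x : C1 f -> C1 g ->
 dder v (fun x => f x * g x) x = dder v f x * g x + f x * dder v g x.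
move=> hf hg; rewrite /dder mulr_suml mulr_sumr -big_split; apply: eq_bigr => i _ /=.
by rewrite pderM//; ring.
Qed.

Lemma dder_bound v f x K : (forall i, `|pder i f x| <= K) -> `|dder v f x| <= d%:R * (`|v| * K).
move=> H; apply: le_trans (ler_norm_sum _ _ _) _.
rewrite mulr_natl -[X in _ *+ X]card_ord -sumr_const; apply: ler_sum => i _.
by rewrite normrM; apply: ler_pM => //; exact: coord_le.
Qed.

Lemma C1_pder_bounded f (M : R) : C1 f -> exists2 K, 0 <= K &
 forall x : pt, `|x| <= M -> forall i, `|pder i f x| <= K.
move=> hf; have /choice[K hK] : forall i : 'I_d, exists K, forall y : pt, `|y| <= M ->
  `|pder i f y| <= K by move=> i; exact: cont_bdd_on (hf.2 i).2.
exists (\sum_i `|K i|) => [|x xM i]; first exact: sumr_ge0.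
apply: le_trans (hK i _ xM) _; apply: le_trans (ler_norm _) _.
by rewrite (bigD1 i)//= lerDl sumr_ge0.
Qed.

End Directional.

(** * Barycentric coordinates *)

Section Simplex.
Context {R : realType} {d : nat}.
Local Notation pt := 'rV[R]_d.
Local Notation mu := (leb d).
Local Notation e_ i := (delta_mx 0 i : pt).
Implicit Types (f g : pt -> R) (a : 'I_d.+1 -> pt).
Definition edges a : 'M[R]_d := \matrix_(i < d) (a (lift ord0 i) - a ord0).
Definition bary a (i : 'I_d.+1) (x : pt) : R :=
 oapp (fun j => ((x - a ord0) *m invmx (edges a)) 0 j)
  (1 - \sum_j ((x - a ord0) *m invmx (edges a)) 0 j) (unlift ord0 i).
Lemma bary0 a x : bary a ord0 x = 1 - \sum_j bary a (lift ord0 j) x.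
Proof. by rewrite {1}/bary unlift_none /=; congr (1 - _); apply: eq_bigr => j _; rewrite /bary liftK. Qed.
Lemma bary_sum a x : \sum_i bary a i x = 1.
Proof. by rewrite big_ord_recl bary0 subrK. Qed.
Lemma edges_mul a (c : 'I_d.+1 -> R) : \sum_i c i = 1 ->
 \sum_i c i *: a i - a ord0 = (\row_j c (lift ord0 j)) *m edges a.
move=> c1; rewrite mulmx_sum_row big_ord_recl.
have -> : c ord0 = 1 - \sum_j c (lift ord0 j) by rewrite -c1 big_ord_recl addrK.
rewrite scalerBl scale1r addrAC (addrAC (a ord0)) subrr sub0r scaler_suml addrC -sumrB.
by apply: eq_bigr => j _; rewrite rowK mxE scalerBr.
Qed.

Section Unit.
Context (a : 'I_d.+1 -> pt) (ua : edges a \in unitmx).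
Lemma bary_uniq (c : 'I_d.+1 -> R) : \sum_i c i = 1 ->
 forall i, bary a i (\sum_i c i *: a i) = c i.
move=> c1; have H j : bary a (lift ord0 j) (\sum_i c i *: a i) = c (lift ord0 j).
 by rewrite /bary liftK /= edges_mul// mulmxK// mxE.
move=> i; case: (unliftP ord0 i) => [j ->|->]; first exact: H.
by rewrite bary0 (eq_bigr _ (fun j _ => H j)) -c1 big_ord_recl addrK.
Qed.

Lemma bary_comb x : \sum_i bary a i x *: a i = x.
apply/eqP; rewrite -(inj_eq (addIr (- a ord0))); apply/eqP.
rewrite edges_mul ?bary_sum// -[RHS](mulmxKV ua); congr (_ *m _).
by apply/rowP => j; rewrite mxE /bary liftK.
Qed.

Lemma bary_node i j : bary a i (a j) = (i == j)%:R.
have S1 : \sum_(k < d.+1) (k == j)%:R = 1 :> R.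
 by rewrite (bigD1 j)//= eqxx big1 ?addr0// => k /negbTE ->.
have S : \sum_(k < d.+1) (k == j)%:R *: a k = a j.
 by rewrite (bigD1 j)//= eqxx scale1r big1 ?addr0// => k /negbTE ->; rewrite scale0r.
by have := bary_uniq S1 i; rewrite S.
Qed.

(** The linear part of the affine function [bary a i]. *)
Definition dbary i (v : pt) : R := bary a i v - bary a i 0.
Lemma bary_line i x (v : pt) (s : R) : bary a i (x + s *: v) = bary a i x + s * dbary i v.
rewrite /dbary.
have H j : bary a (lift ord0 j) (x + s *: v) = bary a (lift ord0 j) x +
  s * (bary a (lift ord0 j) v - bary a (lift ord0 j) 0).
 rewrite /bary liftK /=; pose l (w : pt) := (w *m invmx (edges a)) 0 j.
 have lD u w : l (u + w) = l u + l w by rewrite /l mulmxDl mxE.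
 have lZ t w : l (t *: w) = t * l w by rewrite /l -scalemxAl mxE.
 have lN w : l (- w) = - l w by rewrite /l mulNmx mxE.
 have l0 : l 0 = 0 by rewrite /l mul0mx mxE.
 rewrite -!/(l _) !lD lZ !lN l0; ring.
case: (unliftP ord0 i) => [j ->|->]; first exact: H.
rewrite !bary0 (eq_bigr _ (fun j _ => H j)) big_split /= -mulr_sumr sumrB; ring.
Qed.

Lemma bary_poly i : poly_fun 1 (bary a i).
rewrite (_ : bary a i = fun x => bary a i 0 + \sum_j dbary i (e_ j) * x 0 j).
 by apply: polyD; [exact: poly_cst|apply: poly_sum => j _; apply: polyZ; exact: poly_coord].
apply/funext => x; rewrite {1}(row_sum_delta x).
elim: (index_enum _) => [|j r IH]; first by rewrite !big_nil addr0.
by rewrite !big_cons addrC bary_line IH; ring.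
Qed.

Lemma bary_C1 i : C1 (bary a i). Proof. exact: poly_C1 (bary_poly i). Qed.
Lemma bary_cont i : continuous (bary a i). Proof. exact: (bary_C1 i).1. Qed.
Lemma baryB i x y : bary a i x - bary a i y = dbary i (x - y).
have := bary_line i y (x - y) 1; rewrite scale1r addrC subrK mul1r => ->.
by rewrite addrC addKr.
Qed.

Lemma bary_conv i x y (t : R) :
 bary a i (x + t *: (y - x)) = (1 - t) * bary a i x + t * bary a i y.
Proof. by rewrite bary_line -baryB; ring. Qed.
Lemma hullP (P : {set 'I_d.+1}) x : hull P a x <->
 (forall i, 0 <= bary a i x) /\ (forall i, i \notin P -> bary a i x = 0).
split=> [[c [c0 cP c1 ->]]|[h1 h2]].
 by split => i; rewrite bary_uniq//; exact: cP.
by exists (fun i => bary a i x); split => //; rewrite ?bary_sum ?bary_comb.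
Qed.

Lemma simplexP x : hull [set: 'I_d.+1]%SET a x <-> forall i, 0 <= bary a i x.
Proof. by rewrite hullP; split => [[]//|h]; split => // i; rewrite inE. Qed.
Let T := hull [set: 'I_d.+1]%SET a.
Lemma simplex_closed : closed T.
have -> : T = \bigcap_(i in [set: 'I_d.+1]) (bary a i @^-1` [set y | 0 <= y]).
 apply/seteqP; split => x; first by move/simplexP => h i _; exact: h.
 by move=> h; apply/simplexP => i; exact: h.
apply: closed_bigI => i _; apply: closed_comp; last exact: closed_ge.
by move=> x _; exact: bary_cont.
Qed.

Lemma msimplex : measurable T.
Proof. exact: closed_meas simplex_closed. Qed.
Lemma bary_le1 i x : T x -> bary a i x <= 1.
move=> /simplexP h; rewrite -(bary_sum a x) (bigD1 i)//= lerDl.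
by apply: sumr_ge0.
Qed.

Lemma simplex_bdd : exists M, forall x, T x -> `|x| <= M.
exists (\sum_i `|a i|) => x Tx; rewrite -(bary_comb x).
apply: le_trans (ler_norm_sum _ _ _) _; apply: ler_sum => i _.
rewrite normrZ ger0_norm; last by move/simplexP: Tx.
by rewrite ler_piMl// bary_le1.
Qed.

Lemma simplex_fin : (mu T < +oo)%E.
Proof. have [M hM] := simplex_bdd; exact: bounded_set_fin msimplex hM. Qed.
Lemma simplex_conv x y (t : R) : 0 <= t <= 1 -> T x -> T y -> T (x + t *: (y - x)).
move=> /andP[t0 t1] /simplexP h1 /simplexP h2; apply/simplexP => i; rewrite bary_conv.
by rewrite addr_ge0// mulr_ge0// subr_ge0.
Qed.

Lemma simplex_node i : T (a i).
Proof. by apply/simplexP => j; rewrite bary_node; case: eqP. Qed.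
Lemma open_bary_pos : open [set x | forall i, 0 < bary a i x].
have -> : [set x | forall i, 0 < bary a i x] =
  \big[setI/setT]_(i < d.+1) (bary a i @^-1` [set y | 0 < y]).
 apply/seteqP; split => x /=.
  by move=> h; rewrite -bigcap_seq => i _; exact: h.
 by rewrite -bigcap_seq => h i; apply: h; rewrite /= mem_index_enum.
elim/big_ind: _ => [|A B|i _]; [exact: openT|exact: openI|].
apply: open_comp; last exact: open_gt.
by move=> x _; exact: bary_cont.
Qed.

(** If a coordinate vanishes, a small step away from the corresponding vertex makes it negative and
    leaves the simplex. *)
Lemma simplex_interior x : interior T x <-> forall i, 0 < bary a i x.
split=> [Tx i|h]; last first.
 have : open_nbhs x [set x | forall i, 0 < bary a i x] by split => //; exact: open_bary_pos.
 by move=> /open_nbhs_nbhs; apply: filterS => y hy; apply/simplexP => i; exact: ltW.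
rewrite lt_neqAle; have /simplexP h := interior_subset Tx; rewrite h andbT eq_sym.
apply/negP => /eqP b0.
have /nbhs_ballP[e /= e0 he] := Tx.
pose v := x - a i; pose s := e / (2 * (`|v| + 1)).
have v1 : 0 < `|v| + 1 by have := normr_ge0 v; lra.
have s0 : 0 < s by rewrite divr_gt0// mulr_gt0.
have /simplexP/(_ i) : T (x + s *: v).
 apply: he; rewrite mx_norm_ball /ball_/= opprD addNKr normrN normrZ gtr0_norm//.
 by rewrite /s mulrAC ltr_pdivrMr ?mulr_gt0// ltr_pM2l//; have := normr_ge0 v; lra.
rewrite bary_line -baryB b0 bary_node eqxx /=; lra.
Qed.

End Unit.
End Simplex.

(** * The divergence theorem on a simplex, in flux form *)

Section Flux.
Context {R : realType} {d : nat}.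
Local Notation pt := 'rV[R]_d.
Local Notation mu := (leb d).
Local Notation simplex a := (hull [set: 'I_d.+1]%SET a).
Implicit Types (f g : pt -> R) (a : 'I_d.+1 -> pt).
Lemma cont_homothety (b : pt) (s : R) : continuous (fun x : pt => x - s *: (x - b)).
rewrite (_ : (fun x : pt => _) = fun x : pt => s *: b + (1 - s) *: x); last first.
 by apply/funext => x; apply/rowP => j; rewrite !mxE; ring.
move=> x; exact: (cvgD (@cst_continuous _ _ _ x) (@scaler_continuous _ _ (1 - s) x)).
Qed.

(* Integral over the simplex of the divergence of (x - b) f. *)
Definition flux a (b : pt) f : R :=
 \int[mu]_(x in simplex a) (d%:R * f x + dder (x - b) f x).

Section Unit.
Context (a : 'I_d.+1 -> pt) (ua : edges a \in unitmx).
Let T := simplex a.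
Let mT : measurable T := msimplex ua.
Lemma int_simplex f : continuous f -> mu.-integrable T (EFin \o f).
move=> cf; have [M hM] := simplex_bdd ua; have [K hK] := cont_bdd_on M cf.
apply: (@le_integrable _ _ _ mu T mT _ (EFin \o (fun=> `|K|))).
- by apply/measurable_EFinP; apply: measurable_funTS; exact: cont_meas.
- move=> x Tx; rewrite /= lee_fin normr_id; apply: le_trans (hK _ (hM _ Tx)) (ler_norm _).
- apply/integrableP; split; first exact: measurable_cst.
 rewrite integral_cst//= normr_id lte_mul_pinfty// ?lee_fin//.
 exact: simplex_fin.
Qed.

Lemma cont_dder_radial (b : pt) f : C1 f -> continuous (fun x : pt => dder (x - b) f x).
move=> hf x; rewrite /dder; elim: (index_enum _) => [|j r IH].
 by under eq_fun do rewrite big_nil; exact: cst_continuous.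
rewrite (_ : (fun x => _) = fun x : pt => (x 0 j - b 0 j) * pder j f x +
  \sum_(k <- r) (x - b) 0 k * pder k f x); last first.
 by apply/funext => y; rewrite big_cons !mxE.
have [_ h] := hf.2 j.
have hc : (fun y : pt => y 0 j - b 0 j) @ x --> x 0 j - b 0 j.
 exact: (cvgB (@coord_continuous _ _ _ 0 j x) (@cst_continuous _ _ _ x)).
exact: (cvgD (cvgM hc (h x)) IH).
Qed.

Lemma cont_flux (b : pt) f : C1 f -> continuous (fun x : pt => d%:R * f x + dder (x - b) f x).
move=> hf x; exact: (cvgD (cvgM (@cst_continuous _ _ _ x) (hf.1 x)) (@cont_dder_radial b f hf x)).
Qed.

Lemma fluxB b f g : C1 f -> C1 g -> flux a b (fun x => f x - g x) = flux a b f - flux a b g.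
move=> hf hg; rewrite /flux -RintegralB//; first last.
- by apply: int_simplex; exact: cont_flux.
- by apply: int_simplex; exact: cont_flux.
by apply: eq_Rintegral => x _; rewrite dderB//; ring.
Qed.

(** Push x away from vertex i until it meets the opposite facet, where f vanishes, and apply the
    mean value theorem. The displacement factor l/(1 - l) is at most 2l for l < 1/2; for larger l a
    bound on f itself suffices. *)
Lemma face_bound i f : C1 f -> (forall x, T x -> bary a i x = 0 -> f x = 0) ->
 exists2 C, 0 <= C & forall x, T x -> `|f x| <= C * bary a i x.
move=> hf f0; have [M hM] := simplex_bdd ua.
have M0 : 0 <= M by exact: le_trans (normr_ge0 _) (hM _ (simplex_node ua i)).
have [K0 hK0] := cont_bdd_on M hf.1; have [K K_0 hK] := C1_pder_bounded M hf.
exists (2 * `|K0| + d%:R * (4 * M * K)); first by rewrite addr_ge0 ?mulr_ge0.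
move=> x Tx; have /(simplexP ua)/(_ i) l0 := Tx.
set l := bary a i x in l0 *.
have [l2|l2] := lerP 2^-1 l.
 have h0 : `|f x| <= `|K0| by apply: le_trans (hK0 _ (hM _ Tx)) (ler_norm _).
 have h1 : 0 <= d%:R * (4 * M * K) by rewrite !mulr_ge0.
 by have := normr_ge0 K0; nra.
pose t := l / (1 - l); have l1 : 0 < 1 - l by lra.
have t0 : 0 <= t by rewrite divr_ge0// ltW.
have t2 : t <= 2 * l by rewrite /t ler_pdivrMr//; nra.
pose v := t *: (x - a i); pose y := x + v.
have by_ j : bary a j y = bary a j x + t * (bary a j x - (j == i)%:R).
 by rewrite /y /v bary_line -baryB bary_node.
have yi : bary a i y = 0 by rewrite by_ eqxx -/l /t /=; field; rewrite gt_eqF.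
have Ty : T y.
 apply/(simplexP ua) => j; have [->|ji] := eqVneq j i; first by rewrite yi.
 rewrite by_ (negbTE ji) subr0; have /(simplexP ua)/(_ j) lj := Tx.
 by rewrite addr_ge0// mulr_ge0.
have [s s01 sE] := C1_segment_MVT x v hf.
have Tz : T (x + s *: v).
 rewrite (_ : v = y - x); last by rewrite /y addrC addKr.
 exact: simplex_conv.
have vn : `|v| <= 2 * l * (2 * M).
 rewrite /v normrZ ger0_norm//; apply: ler_pM => //.
 apply: le_trans (ler_normB _ _) _; have := hM _ Tx; have := hM _ (simplex_node ua i); lra.
have := dder_bound v (hK _ (hM _ Tz)).
rewrite -sE f0// sub0r normrN => h; apply: le_trans h _.
rewrite mulrDl; apply: ler_wpDl; first by rewrite !mulr_ge0.
rewrite -mulrA ler_wpM2l//; apply: le_trans (ler_wpM2r K_0 vn) _.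
by le_eq; ring.
Qed.

(** Contraction towards vertex i by the ratio 1 - s maps the simplex onto the part where coordinate
    i is at least s. The left side is the integral of f over the remaining layer, in which |f| <= C
    s. *)
Lemma flux_scaling i f (C : R) : C1 f -> 0 <= C -> (forall x, T x -> `|f x| <= C * bary a i x) ->
 forall s, 0 < s < 1 ->
 `|(1 - (1 - s) ^+ d) * \int[mu]_(x in T) f x + (1 - s) ^+ d *
   \int[mu]_(x in T) (f x - f (x - s *: (x - a i)))| <=
  C * s * ((1 - (1 - s) ^+ d) * fine (mu T)).
move=> hf C0 hC s /andP[s0 s1]; pose r := 1 - s; have r0 : 0 < r by rewrite /r; lra.
have r1 : r < 1 by rewrite /r; lra.
pose phi (x : pt) := s *: a i + r *: x.
have phiE x : phi x = x - s *: (x - a i).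
 by apply/rowP => j; rewrite !mxE /r; ring.
have bphi j x : bary a j (phi x) = r * bary a j x + s * (j == i)%:R.
 rewrite phiE -scaleNr bary_line -baryB bary_node// /r; case: (j == i) => /=; ring.
pose S := [set x | T x /\ s <= bary a i x].
have phiS : phi @^-1` S = T.
 apply/seteqP; split => x /=.
  move=> [Tx bx]; apply/(simplexP ua) => j.
  have [e|ji] := eqVneq j i.
   by move: bx; rewrite bphi eqxx mulr1 -e lerDr pmulr_rge0.
  have /(simplexP ua)/(_ j) := Tx; rewrite bphi (negbTE ji) mulr0 addr0.
  by rewrite pmulr_rge0.
 move=> Tx; have /(simplexP ua) h := Tx; split; last first.
  by rewrite bphi eqxx mulr1 lerDr mulr_ge0// ltW.
 by apply/(simplexP ua) => j; rewrite bphi addr_ge0// mulr_ge0// ltW.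
have mS : measurable S.
 have -> : S = T `&` bary a i @^-1` [set y | s <= y] by [].
 apply: measurableI => //; apply: closed_meas.
 apply: closed_comp; last exact: closed_ge.
 by move=> x _; exact: bary_cont.
have ST : S `<=` T by move=> x [].
have rd0 : 0 < r ^+ d by rewrite exprn_gt0.
have iT : mu.-integrable T (EFin \o f) by apply: int_simplex; exact: hf.1.
have iS : mu.-integrable S (EFin \o f) by exact: integrableS iT.
have cphi : continuous phi by rewrite (funext phiE); exact: cont_homothety.
have cfp : continuous (fun x => f (phi x)).
 by move=> x; apply: continuous_comp; [exact: cphi|exact: hf.1].
have E1 : \int[mu]_(x in S) f x = r ^+ d * \int[mu]_(x in T) f (phi x).
 have h : 0 <= r ^- d by rewrite invr_ge0 ltW.
 have := @Rint_scale R d phi (r ^- d) (maffine _ r) h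
  (fun A mA => leb_affine (s *: a i) r0 mA) S f mS iS.
 by rewrite phiS => ->; rewrite mulrA divff ?mul1r// gt_eqF.
have muS : fine (mu S) = r ^+ d * fine (mu T).
 have := leb_affine (s *: a i) r0 mS; rewrite phiS => ->.
 have Soo : (mu S < +oo)%E.
  by apply: le_lt_trans (simplex_fin ua); apply: le_measure; rewrite ?inE.
 have F : fine ((r ^- d)%:E * mu S)%E = r ^- d * fine (mu S).
  by rewrite fineM// ge0_fin_numE.
 by rewrite F mulrA divff ?mul1r// gt_eqF.
have E2 : \int[mu]_(x in T) (f x - f (x - s *: (x - a i))) =
  \int[mu]_(x in T) f x - \int[mu]_(x in T) f (phi x).
 rewrite -RintegralB//; last by apply: int_simplex.
 by apply: eq_Rintegral => x _; rewrite phiE.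
rewrite E2 -/r.
have -> : (1 - r ^+ d) * \int[mu]_(x in T) f x + r ^+ d *
  (\int[mu]_(x in T) f x - \int[mu]_(x in T) f (phi x)) =
  \int[mu]_(x in T) f x - \int[mu]_(x in S) f x by rewrite E1; ring.
have mD : measurable (T `\` S) by exact: measurableD.
have disj : [disjoint S & T `\` S] by apply/disj_setPS => x [/= h [_ /(_ h)]].
have TE : T = S `|` (T `\` S) by rewrite setDUK.
have E3 : \int[mu]_(x in T) f x = \int[mu]_(x in S) f x + \int[mu]_(x in T `\` S) f x.
 by rewrite {1}TE Rintegral_setU// -TE.
rewrite E3 addrAC subrr add0r.
have D0 : fine (mu (T `\` S)) = (1 - r ^+ d) * fine (mu T).
 rewrite measureD//; last exact: simplex_fin.
 have Soo : (mu S < +oo)%E.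
  by apply: le_lt_trans (simplex_fin ua); apply: le_measure; rewrite ?inE.
 rewrite (setIidr ST) fineB ?ge0_fin_numE ?simplex_fin// muS; ring.
have Doo : (mu (T `\` S) < +oo)%E.
 by apply: le_lt_trans (simplex_fin ua); apply: le_measure; rewrite ?inE//; exact: subDsetl.
have iD : mu.-integrable (T `\` S) (EFin \o f) by apply: integrableS iT => //; exact: subDsetl.
apply: le_trans (le_normr_Rintegral mD iD) _.
rewrite -D0 -[leRHS](Rintegral_cst _ mD).
apply: le_Rintegral => //.
- exact: integrable_norm iD.
- exact: (integrableS mT mD (@subDsetl _ _ _) (int_simplex (@cst_continuous _ _ _))).
- move=> x [Tx nS]; apply: le_trans (hC _ Tx) _; rewrite ler_wpM2l// ltW//.
 by rewrite ltNge; apply/negP => h; apply: nS.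
Qed.

(** The field (x - a_i) f has no normal component on the facets through a_i, and f vanishes on the
    opposite one, so the total flux is zero. The proof divides [flux_scaling] by s: (1 - (1 -
    s)^d)/s tends to d, the difference quotient tends to the radial derivative, and the bound tends
    to 0. *)
Lemma flux_face0 i f : C1 f -> (forall x, T x -> bary a i x = 0 -> f x = 0) ->
 flux a (a i) f = 0.
move=> hf f0; have [C C0 hC] := face_bound hf f0.
have [M hM] := simplex_bdd ua; have [K K0 hK] := C1_pder_bounded M hf.
pose s_ n : R := n.+2%:R^-1.
have s01 n : 0 < s_ n < 1.
 by rewrite /s_ invr_gt0 ltr0n /= invf_lt1 ?ltr0n// ltr1n.
have s_cvg : s_ @ \oo --> (0 : R).
 have := @cvg_harmonic R; rewrite -(cvg_shiftS) /=; exact.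
pose q n x := (s_ n)^-1 * (f x - f (x - s_ n *: (x - a i))).
have cq n : continuous (q n).
 move=> x; apply: (cvgM (@cst_continuous _ _ _ x)).
 apply: (cvgB (hf.1 x)).
 exact: (cvg_comp _ _ (@cont_homothety (a i) (s_ n) x) (hf.1 _)).
have qcvg x : T x -> (fun n => q n x) @ \oo --> dder (x - a i) f x.
 move=> _; apply/cvgrPdist_le => e e0.
 have [del d0 hd] := C1_dir_small x (x - a i) hf e0.
 have hn : \forall n \near \oo, s_ n < del by exact: (cvgr_lt _ s_cvg).
 apply: filterS hn => n; have /andP[sp0 _] := s01 n; rewrite -(gtr0_norm sp0) => sn.
 have /andP[sp _] := s01 n.
 have := hd (- s_ n); rewrite normrN => /(_ sn).
 rewrite scaleNr /q (gtr0_norm sp) => h.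
 have -> : dder (x - a i) f x - (s_ n)^-1 * (f x - f (x - s_ n *: (x - a i))) =
   (s_ n)^-1 * (f (x - s_ n *: (x - a i)) - f x - - s_ n * dder (x - a i) f x).
  by field; rewrite gt_eqF.
 by rewrite normrM gtr0_norm ?invr_gt0// mulrC ler_pdivrMr.
have qb n x : T x -> `|q n x| <= d%:R * (2 * M * K).
 move=> Tx; have /andP[sp s1] := s01 n.
 have [t t01 tE] := C1_segment_MVT x (- s_ n *: (x - a i)) hf.
 have Tz : T (x + t *: (- s_ n *: (x - a i))).
  rewrite scalerA (_ : _ *: _ = (t * s_ n) *: (a i - x)).
   apply: simplex_conv => //; last exact: simplex_node.
   by move/andP: t01 => [t0 t1]; rewrite mulr_ge0 ?mulr_ile1// ltW.
  by rewrite mulrN scaleNr -scalerN opprB.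
 have := dder_bound (- s_ n *: (x - a i)) (hK _ (hM _ Tz)).
 rewrite -tE scaleNr distrC /q normrM gtr0_norm ?invr_gt0// => h.
 rewrite mulrC ler_pdivrMr//; apply: le_trans h _.
 have xn : `|x - a i| <= 2 * M.
  by apply: le_trans (ler_normB _ _) _; have := hM _ Tx; have := hM _ (simplex_node ua i); lra.
 rewrite normrN normrZ (gtr0_norm sp) -[leRHS]mulrA ler_wpM2l//.
 by have := ler_wpM2r K0 (ler_wpM2l (ltW sp) xn); lra.
have cD := @cont_dder_radial (a i) f hf.
have [_ Icvg] := @Rint_dominated R d T q (fun x => dder (x - a i) f x)
 (fun=> d%:R * (2 * M * K)) mT
 (fun n => measurable_funTS (cont_meas (cq n)))
 (measurable_funTS (cont_meas cD)) qcvg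
 (int_simplex (@cst_continuous _ _ _)) qb.
pose I0 := \int[mu]_(x in T) f x.
pose g n := (\sum_(k < d) (1 - s_ n) ^+ k) * I0 + (1 - s_ n) ^+ d * \int[mu]_(x in T) q n x.
have r_cvg k : (fun n => (1 - s_ n) ^+ k) @ \oo --> (1 : R).
 have h1 : (fun n => 1 - s_ n) @ \oo --> (1 : R).
  by rewrite -[X in _ --> X]subr0; apply: cvgB => //; exact: cvg_cst.
 elim: k => [|k IH]; first by under eq_fun do rewrite expr0; exact: cvg_cst.
 have h : (fun n => (1 - s_ n) * (1 - s_ n) ^+ k) @ \oo --> (1 * 1 : R) by exact: (cvgM h1 IH).
 rewrite mulr1 in h.
 by rewrite (_ : (fun n => _) = fun n => (1 - s_ n) * (1 - s_ n) ^+ k)//; apply/funext => n; rewrite exprS.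
have g_cvg : g @ \oo --> d%:R * I0 + \int[mu]_(x in T) dder (x - a i) f x.
 have hs m : (fun n => \sum_(k < m) (1 - s_ n) ^+ k) @ \oo --> (m%:R : R).
  elim: m => [|m IH].
   by rewrite (_ : (fun n => _) = fun=> 0); [exact: cvg_cst|apply/funext => n; rewrite big_ord0].
  have h : (fun n => \sum_(k < m) (1 - s_ n) ^+ k + (1 - s_ n) ^+ m) @ \oo --> (m%:R + 1 : R).
   exact: (cvgD IH (r_cvg m)).
  rewrite natr1 in h.
  rewrite (_ : (fun n => _) = fun n => \sum_(k < m) (1 - s_ n) ^+ k + (1 - s_ n) ^+ m)//.
  by apply/funext => n; rewrite big_ord_recr.
 have ga : (fun n => (\sum_(k < d) (1 - s_ n) ^+ k) * I0) @ \oo --> (d%:R * I0 : R).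
  exact: (cvgM (hs d) (cvg_cst I0)).
 have gb : (fun n => (1 - s_ n) ^+ d * \int[mu]_(x in T) q n x) @ \oo -->
   (1 * \int[mu]_(x in T) dder (x - a i) f x : R).
  exact: (cvgM (r_cvg d) Icvg).
 by rewrite mul1r in gb; exact: (cvgD ga gb).
have g_le n : `|g n| <= C * fine (mu T) * (1 - (1 - s_ n) ^+ d).
 have /andP[sp s1] := s01 n.
 have := flux_scaling hf C0 hC (s01 n).
 have Eq : \int[mu]_(x in T) (f x - f (x - s_ n *: (x - a i))) = s_ n * \int[mu]_(x in T) q n x.
  rewrite -RintegralZl//; last by apply: int_simplex; exact: cq.
  by apply: eq_Rintegral => x _; rewrite /q mulrA divff ?mul1r// gt_eqF.
 have Ex : 1 - (1 - s_ n) ^+ d = s_ n * \sum_(k < d) (1 - s_ n) ^+ k.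
  have := subrX1 (1 - s_ n) d; rewrite (_ : 1 - s_ n - 1 = - s_ n); last by ring.
  by move/(congr1 -%R); rewrite opprB mulNr opprK.
 rewrite Eq -/I0 {1}Ex.
 have -> : s_ n * (\sum_(k < d) (1 - s_ n) ^+ k) * I0 + (1 - s_ n) ^+ d * (s_ n * \int[mu]_(x in T) q n x)
   = s_ n * g n by rewrite /g; ring.
 rewrite normrM gtr0_norm// => h.
 rewrite -(ler_pM2l sp); apply: le_trans h _.
 by le_eq; ring.
have g0 : g @ \oo --> (0 : R).
 have h : (fun n => C * fine (mu T) * (1 - (1 - s_ n) ^+ d)) @ \oo -->
   (C * fine (mu T) * (1 - 1) : R).
  exact: (cvgM (cvg_cst (C * fine (mu T))) (cvgB (cvg_cst (1 : R)) (r_cvg d))).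
 rewrite subrr mulr0 in h.
 apply/norm_cvg0P; apply: (squeeze_cvgr _ (cvg_cst (0 : R)) h).
 by apply: nearW => n; rewrite normr_ge0 g_le.
have E0 : d%:R * I0 + \int[mu]_(x in T) dder (x - a i) f x = 0.
 exact: (cvg_unique (@Rhausdorff R) g_cvg g0).
rewrite /flux RintegralD//; first last.
- exact: int_simplex.
- apply: int_simplex => x; exact: (cvgM (@cst_continuous _ _ _ x) (hf.1 x)).
rewrite RintegralZl//; last by apply: int_simplex; exact: hf.1.
Qed.

Lemma bernoulli (s : R) n : 0 <= s <= 1 -> 1 - n%:R * s <= (1 - s) ^+ n.
move=> /andP[s0 s1]; elim: n => [|n IH]; first by rewrite mul0r subr0 expr0.
rewrite exprS -natr1 mulrDl mul1r; apply: le_trans (ler_wpM2l _ IH); last by lra.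
by have : 0 <= n%:R :> R by []; nra.
Qed.

(** Contraction towards the barycentre by 1 - s carries the closed simplex into its interior, so the
    two volumes differ by at most a factor (1 - s)^d, which tends to 1. *)
Lemma simplex_boundary0 : mu (T `\` interior T) = 0.
pose c : pt := \sum_i (d.+1%:R^-1 : R) *: a i.
have bc i : bary a i c = d.+1%:R^-1.
 by rewrite /c bary_uniq// sumr_const card_ord -[_ *+ d.+1]mulr_natr mulVf ?pnatr_eq0.
have mI : measurable (interior T) by apply: open_meas; exact: open_interior.
have IT : interior T `<=` T by exact: interior_subset.
have Ioo : (mu (interior T) < +oo)%E.
 by apply: le_lt_trans (simplex_fin ua); apply: le_measure; rewrite ?inE.
rewrite measureD//; last exact: simplex_fin.
rewrite (setIidr IT).
pose m := fine (mu T); pose n := fine (mu (interior T)).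
have mE : mu T = m%:E by rewrite /m fineK// ge0_fin_numE// simplex_fin.
have nE : mu (interior T) = n%:E by rewrite /n fineK// ge0_fin_numE.
have m0 : 0 <= m by rewrite -lee_fin -mE.
have n0 : 0 <= n by rewrite -lee_fin -nE.
have nm : n <= m by rewrite -lee_fin -mE -nE; apply: le_measure; rewrite ?inE.
have key s : 0 < s < 1 -> m - n <= d.+1%:R * m * s.
 move=> /andP[s0 s1]; have r0 : 0 < 1 - s by lra.
 have rd : 0 < (1 - s) ^+ d by rewrite exprn_gt0.
 have := leb_affine (s *: c) r0 mI; rewrite nE -EFinM => E.
 have sub : T `<=` (fun x => s *: c + (1 - s) *: x) @^-1` interior T.
  move=> x Tx /=; apply/(simplex_interior ua) => i.
  rewrite (_ : s *: c + _ = x + s *: (c - x)).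
   rewrite bary_conv bc; have /(simplexP ua)/(_ i) h := Tx.
   have h1 : 0 <= (1 - s) * bary a i x by rewrite mulr_ge0// ltW.
   by rewrite ltr_wpDl// mulr_gt0// invr_gt0.
  by apply/rowP => j; rewrite !mxE; ring.
 have h : m <= (1 - s) ^- d * n.
  rewrite -lee_fin -mE -E; apply: le_measure; rewrite ?inE//.
  by rewrite -[X in measurable X]setTI; exact: maffine.
 have {}h : m * (1 - s) ^+ d <= n by rewrite -ler_pdivlMr// mulrC.
 have s01 : 0 <= s <= 1 by rewrite !ltW.
 have hb := bernoulli d s01.
 have := ler_wpM2l m0 hb; rewrite -natr1.
 have ms : 0 <= m * s by rewrite mulr_ge0// ltW.
 by nra.
have mn : m - n <= 0.
 apply: (@le_eps0 _ _ (d.+1%:R * m)) => [|eps e0]; first by rewrite mulr_ge0.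
 have [e1|e1] := ltP eps 1; first by apply: key; rewrite e0.
 apply: (@le_trans _ _ m); first by rewrite lerBlDr lerDl.
 rewrite -natr1; have : 0 <= d%:R * m by rewrite mulr_ge0.
 by have := ler_wpM2l m0 e1; have := ler_wpM2l (mulr_ge0 (ler0n R d) m0) e1; lra.
transitivity ((m - n)%:E); first by rewrite EFinB -mE -nE.
by congr EFin; apply/eqP; rewrite eq_le mn subr_ge0.
Qed.

End Unit.
Lemma unit_of_indep a : (forall c : 'I_d.+1 -> R, \sum_i c i = 0 -> \sum_i c i *: a i = 0 ->
 forall i, c i = 0) -> edges a \in unitmx.
move=> H; rewrite -row_free_unit -kermx_eq0; apply/eqP/row_matrixP => k; rewrite row0.
set v := row _ _; have vG : v *m edges a = 0 by rewrite /v -row_mul mulmx_ker row0.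
pose c i := oapp (fun j => v 0 j) (- \sum_j v 0 j) (unlift ord0 i).
have c0 : c ord0 = - \sum_j v 0 j by rewrite /c unlift_none.
have cS j : c (lift ord0 j) = v 0 j by rewrite /c liftK.
have cz : forall i, c i = 0.
 apply: H; first by rewrite big_ord_recl c0 (eq_bigr _ (fun j _ => cS j)) addNr.
 rewrite big_ord_recl c0 (eq_bigr (fun j => v 0 j *: a (lift ord0 j))) => [|j _]; last by rewrite cS.
 move: vG; rewrite mulmx_sum_row => h; rewrite -[RHS]h scaleNr scaler_suml addrC -sumrB.
 by apply: eq_bigr => j _; rewrite rowK scalerBr.
by apply/rowP => j; rewrite -cS cz mxE.
Qed.

Lemma indep_of_unit a (c : 'I_d.+1 -> R) : edges a \in unitmx ->
 \sum_i c i = 0 -> \sum_i c i *: a i = 0 -> forall i, c i = 0.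
move=> ua c0 ca i; have := @bary_uniq _ _ a ua (fun i => bary a i 0 + c i) _ i.
rewrite big_split /= bary_sum c0 addr0 => /(_ erefl).
rewrite (eq_bigr (fun i => bary a i 0 *: a i + c i *: a i)) => [|j _]; last by rewrite scalerDl.
rewrite big_split /= ca addr0 bary_comb// => /eqP.
by rewrite -subr_eq0 opprD addrA subrr sub0r oppr_eq0 => /eqP.
Qed.

Lemma edges_reindex a (s : 'I_d.+1 -> 'I_d.+1) : injective s -> edges a \in unitmx ->
 edges (a \o s) \in unitmx.
move=> si ua; apply: unit_of_indep => c c0 ca i.
have si' := canF_sym (invF_f si).
have E (V : nmodType) (F : 'I_d.+1 -> V) : \sum_i F (s i) = \sum_i F i.
 rewrite [RHS](reindex s)//; apply: onW_bij; exact: injF_bij.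
have := @indep_of_unit a (fun k => c (invF si k)) ua _ _ (s i); rewrite invF_f; apply.
 by rewrite -E -[RHS]c0; apply: eq_bigr => k _; rewrite invF_f.
by rewrite -E -[RHS]ca; apply: eq_bigr => k _; rewrite invF_f.
Qed.

Lemma simplex_reindex a (s : 'I_d.+1 -> 'I_d.+1) : injective s -> simplex (a \o s) = simplex a.
move=> si; have E (V : nmodType) (F : 'I_d.+1 -> V) : \sum_i F (s i) = \sum_i F i.
 rewrite [RHS](reindex s)//; apply: onW_bij; exact: injF_bij.
apply/seteqP; split => x [c [c0 _ c1 ->]].
 exists (fun k => c (invF si k)); split => //; first by move=> i; rewrite inE.
  by rewrite -E -[RHS]c1; apply: eq_bigr => k _; rewrite invF_f.
 by rewrite -[RHS]E; apply: eq_bigr => k _; rewrite invF_f.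
exists (c \o s); split => [i|i|//|]; [exact: c0|by rewrite inE| |].
 by rewrite -[RHS]c1; exact: E.
by rewrite -E.
Qed.

Lemma bary_shear a a' i j x : edges a \in unitmx -> edges a' \in unitmx ->
 (forall j, j != i -> a j = a' j) ->
 bary a' j (x + bary a i x *: (a' i - a i)) = bary a j x.
move=> ua ua' aa'.
have -> : x + bary a i x *: (a' i - a i) = \sum_k bary a k x *: a' k.
 rewrite -{1}(bary_comb ua x) (bigD1 i)//= [RHS](bigD1 i)//=.
 rewrite (eq_bigr (fun k => bary a k x *: a' k)) => [|k ki]; last by rewrite aa'.
 by set S := \sum_(_ | _) _; rewrite -addrA (addrC S) addrA scalerBr [X in X + S]addrC subrK.
by apply: bary_uniq => //; exact: bary_sum.
Qed.

Lemma dbary_shear a a' i v : edges a \in unitmx -> edges a' \in unitmx ->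
 (forall j, j != i -> a j = a' j) ->
 dbary a' i (v + dbary a i v *: (a' i - a i)) = dbary a i v.
move=> ua ua' aa'.
rewrite -[RHS]/(bary a i v - bary a i 0) -(bary_shear i v ua ua' aa') -(bary_shear i 0 ua ua' aa').
rewrite baryB//; congr dbary; rewrite /dbary; apply/rowP => j; rewrite !mxE; ring.
Qed.

Lemma dbaryD a i u v : edges a \in unitmx -> dbary a i (u + v) = dbary a i u + dbary a i v.
move=> ua; have E := bary_line a i u v 1; rewrite scale1r mul1r in E.
by rewrite {1}/dbary E /dbary; ring.
Qed.

Lemma measurable_shear a i (w : pt) : edges a \in unitmx ->
 measurable_fun setT (fun v : pt => v + dbary a i v *: w).
move=> ua; apply: measurable_row => j; under eq_fun do rewrite !mxE.
apply: measurable_funD; first exact: measurable_coord.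
apply: measurable_funM => //; apply: measurable_funB => //.
by apply: cont_meas; exact: bary_cont.
Qed.

(* The affine map fixing the common face and exchanging the opposite vertices
  carries one simplex to the other. *)
Lemma flux_match a a' i f : edges a \in unitmx -> edges a' \in unitmx ->
 (forall j, j != i -> a j = a' j) -> C1 f ->
 flux a (a i) f * fine (mu (simplex a')) = flux a' (a' i) f * fine (mu (simplex a)).
move=> ua ua' aa' hf; pose w := a' i - a i.
have a'a j : j != i -> a' j = a j by move=> /aa' ->.
pose phi (x : pt) := x + bary a i x *: w; pose L (v : pt) := v + dbary a i v *: w.
pose L' (v : pt) := v + dbary a' i v *: (a i - a' i).
have phi_line x v s : phi (x + s *: v) = phi x + s *: L v.
 rewrite /phi /L bary_line; apply/rowP => j; rewrite !mxE; ring.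
have phi0 x : phi x = phi 0 + L x.
 by have := phi_line 0 x 1; rewrite add0r !scale1r.
have LD u v : L (u + v) = L u + L v.
 by rewrite /L dbaryD//; apply/rowP => j; rewrite !mxE; ring.
have LK : cancel L L'.
 by move=> v; rewrite /L' dbary_shear// /L /w; apply/rowP => j; rewrite !mxE; ring.
have L'K : cancel L' L.
 by move=> v; rewrite /L dbary_shear// /L' /w; apply/rowP => j; rewrite !mxE; ring.
have mL : measurable_fun setT L by exact: measurable_shear.
have mL' : measurable_fun setT L' by exact: measurable_shear.
have [c c0 Hc] := leb_linear mL mL' LD LK L'K.
have phiE : phi = fun x => phi 0 + L x by apply/funext => x; exact: phi0.
have mphi : measurable_fun setT phi.
 by rewrite phiE; apply: (measurableT_comp (mtranslate (phi 0)) mL).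
have Hphi A : measurable A -> mu (phi @^-1` A) = (c%:E * mu A)%E.
 move=> mA; rewrite -(leb_translate (phi 0) mA) -Hc.
  by congr (mu _); rewrite [in LHS]phiE.
 by rewrite -[X in measurable X]setTI; exact: mtranslate.
have phiT : phi @^-1` simplex a' = simplex a.
 apply/seteqP; split => x /=; rewrite !simplexP// => h j.
  by have := h j; rewrite bary_shear.
 by rewrite bary_shear.
have cphi : continuous phi.
 move=> x; apply: (cvgD cvg_id); apply: cvgZl; exact: bary_cont.
have [c1 dphi] := C1_affine hf cphi phi_line.
(* [phi] fixes the common facet pointwise, so the difference vanishes there and its flux is zero. *)
have f0 : flux a (a i) (fun x => f x - f (phi x)) = 0.
 apply: flux_face0 => //; first exact: C1B.
 by move=> x _ bx; rewrite /phi bx scale0r addr0 subrr.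
have {f0} E1 : flux a (a i) f = flux a (a i) (fun x => f (phi x)).
 by apply/eqP; rewrite -subr_eq0 -fluxB// f0.
have E2 : flux a (a i) (fun x => f (phi x)) = c * flux a' (a' i) f.
 rewrite /flux -[RHS](@Rint_scale R d phi c mphi (ltW c0) Hphi (simplex a')
  (fun y => d%:R * f y + dder (y - a' i) f y)); last 2 first.
 - exact: msimplex.
 - exact: (int_simplex ua' (@cont_flux (a' i) f hf)).
 rewrite phiT; apply: eq_Rintegral => x _; rewrite dphi; congr (_ + dder _ f _).
 have pa : phi (a i) = a' i.
  by rewrite /phi (bary_node ua) eqxx scale1r /w addrC subrK.
 transitivity (phi x - phi (a i)); last exact: (congr1 (fun t => phi x - t) pa).
 have := phi_line (a i) (x - a i) 1; rewrite !scale1r addrC subrK => ->.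
 by rewrite [RHS]addrC addKr.
have E3 : fine (mu (simplex a)) = c * fine (mu (simplex a')).
 rewrite -phiT Hphi; last exact: msimplex.
 by rewrite fineM// ge0_fin_numE; [exact: (simplex_fin ua')|exact: measure_ge0].
by rewrite E1 E2 E3; ring.
Qed.

End Flux.

(** * General position and two simplices sharing a facet *)

Section Geometry.
Context {R : realType} {d : nat}.
Local Notation pt := 'rV[R]_d.
Implicit Types (f g : pt -> R) (a : 'I_d.+1 -> pt).
Lemma nbhs_segment (q v : pt) (V : set pt) : nbhs q V -> exists2 s : R, 0 < s < 1 & V (q + s *: v).
move=> /nbhs_ballP[e /= e0 he].
have v1 : 0 < `|v| + 1 by have := normr_ge0 v; lra.
pose s := Num.min 2^-1 (e / (2 * (`|v| + 1))).
have s0 : 0 < s by rewrite lt_min invr_gt0 divr_gt0 ?mulr_gt0//= ltr0n.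
exists s; first by rewrite s0 gt_min; apply/orP; left; lra.
apply: he; rewrite mx_norm_ball /ball_/= opprD addNKr normrN normrZ gtr0_norm//.
apply: (@le_lt_trans _ _ (e / (2 * (`|v| + 1)) * `|v|)).
 by rewrite ler_wpM2r// ge_min lexx orbT.
by rewrite mulrAC ltr_pdivrMr ?mulr_gt0// ltr_pM2l//; have := normr_ge0 v; lra.
Qed.

(** The zero set of a nonzero affine function has empty interior, so finitely many can be avoided
    one after the other. This provides points in general position. *)
Lemma open_avoid (I : eqType) (s : seq I) (F : I -> pt -> R) (U : set pt) : open U -> U !=set0 ->
 (forall i, [/\ continuous (F i),
   forall x v (t : R), F i (x + t *: v) = F i x + t * (F i (x + v) - F i x) & exists y, F i y != 0]) ->
 exists2 x, U x & forall i, i \in s -> F i x != 0.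
move=> oU U0 H; elim: s U oU U0 => [|i s IH] U oU [x Ux]; first by exists x.
have [cF aF [y Fy]] := H i.
pose U' := U `&` [set z | F i z != 0].
have oU' : open U'.
 apply: openI => //; rewrite (_ : [set z | F i z != 0] = F i @^-1` (~` [set 0])); last first.
  by apply/seteqP; split => z /= /eqP.
 apply: open_comp; first by move=> z _; exact: cF.
 by apply: closed_openC; exact: (@accessible_closed_set1 _ (hausdorff_accessible (@Rhausdorff R))).
have U'0 : U' !=set0.
 have [Fx|Fx] := eqVneq (F i x) 0; last by exists x.
 have [t /andP[t0 _] Ut] := nbhs_segment (y - x) (open_nbhs_nbhs (conj oU Ux)).
 exists (x + t *: (y - x)); split => //=; rewrite aF Fx add0r subr0.
 by rewrite (addrC x) subrK mulf_neq0// gt_eqF.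
have [z [Uz Fz] hz] := IH U' oU' U'0; exists z => // j; rewrite inE => /orP[/eqP -> //|].
exact: hz.
Qed.

Lemma bary_affine a i (n : nat) (c : 'I_n -> R) (p : 'I_n -> pt) : edges a \in unitmx ->
 \sum_j c j = 1 -> bary a i (\sum_j c j *: p j) = \sum_j c j * bary a i (p j).
move=> ua c1; have -> : \sum_j c j *: p j = \sum_k (\sum_j c j * bary a k (p j)) *: a k.
 under [RHS]eq_bigr do rewrite scaler_suml.
 rewrite exchange_big /=; apply: eq_bigr => j _; rewrite -{1}(bary_comb ua (p j)) scaler_sumr.
 by apply: eq_bigr => k _; rewrite scalerA.
apply: bary_uniq => //; rewrite exchange_big /= -[RHS]c1; apply: eq_bigr => j _.
by rewrite -mulr_sumr bary_sum mulr1.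
Qed.

Lemma node_inj a : edges a \in unitmx -> injective a.
move=> ua j k e; have := bary_node ua j j; rewrite e bary_node// eqxx.
by case: eqP => // _ /eqP; rewrite eq_sym oner_eq0.
Qed.

Section TwoSided.
Context (a a' : 'I_d.+1 -> pt) (i : 'I_d.+1) (ua : edges a \in unitmx) (ua' : edges a' \in unitmx)
 (aa' : forall j, j != i -> a j = a' j).
Let beta := bary a i (a' i).
Local Notation simplex a := (hull [set: 'I_d.+1]%SET a).
Lemma bary_opp x : bary a i x = bary a' i x * beta.
rewrite -{1}(bary_comb ua' x) bary_affine ?bary_sum// (bigD1 i)//= big1 ?addr0// => j ji.
by rewrite -aa'// bary_node// eq_sym (negbTE ji) mulr0.
Qed.

Lemma bary_side j x : j != i -> bary a j x = bary a' j x + bary a' i x * bary a j (a' i).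
move=> ji; rewrite -{1}(bary_comb ua' x) bary_affine ?bary_sum// (bigD1 i)//= addrC; congr (_ + _).
rewrite (bigD1 j)//= -aa'// bary_node// eqxx mulr1 big1 ?addr0// => k /andP[ki kj].
by rewrite -aa'// bary_node// eq_sym (negbTE kj) mulr0.
Qed.

(** The sign of [beta] tells on which side of the facet the second apex lies. If positive, the cells
    would overlap beyond the facet, against the conformity hypothesis; if negative, they fill a
    neighbourhood of q. *)
Lemma two_sided q : bary a i q = 0 -> (forall j, j != i -> 0 < bary a j q) ->
 (forall x, simplex a x -> simplex a' x -> bary a i x = 0) ->
 nbhs q (simplex a `|` simplex a') /\ simplex a' q.
move=> qi qj conf.
have b0 : beta != 0.
 by apply/eqP => b0; have /eqP := bary_opp (a i); rewrite b0 mulr0 bary_node// eqxx oner_eq0.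
have q'i : bary a' i q = 0.
 by have /eqP := bary_opp q; rewrite qi eq_sym mulf_eq0 (negbTE b0) orbF => /eqP.
have q'j j : j != i -> bary a' j q = bary a j q.
 by move=> ji; rewrite (bary_side q ji) q'i mul0r addr0.
have Tq : simplex a' q.
 apply/(simplexP ua') => j; have [->|ji] := eqVneq j i; first by rewrite q'i.
 by rewrite q'j// ltW// qj.
have nb (b : 'I_d.+1 -> pt) : (forall j, continuous (bary b j)) -> (forall j, j != i -> 0 < bary b j q) ->
  nbhs q [set x | forall j, j != i -> 0 < bary b j x].
 move=> cb bq; have -> : [set x | forall j, j != i -> 0 < bary b j x] =
   \big[setI/setT]_(j < d.+1 | j != i) (bary b j @^-1` [set y | 0 < y]).
  apply/seteqP; split => x /=; first by move=> h; rewrite -bigcap_seq_cond => j /= /andP[_ /h].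
  by rewrite -bigcap_seq_cond => h j ji; apply: h; rewrite /= mem_index_enum.
 elim/big_ind: _ => [|A B|j ji]; [exact: filterT|exact: filterI|].
 apply: open_nbhs_nbhs; split; last exact: bq.
 by apply: open_comp; [move=> x _; exact: cb|exact: open_gt].
have n1 : nbhs q [set x | forall j, j != i -> 0 < bary a j x].
 by apply: nb => //; exact: bary_cont.
have n2 : nbhs q [set x | forall j, j != i -> 0 < bary a' j x].
 by apply: nb; [exact: bary_cont|move=> j ji; rewrite q'j// qj].
split => //; have [bneg|bpos] := ltP beta 0.
 apply: filterS2 n1 n2 => x h1 h2; have [xi|xi] := leP 0 (bary a i x).
  left; apply/(simplexP ua) => j; have [->//|ji] := eqVneq j i; exact/ltW/h1.
 right; apply/(simplexP ua') => j; have [->|ji] := eqVneq j i; last exact/ltW/h2.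
 by move: xi; rewrite bary_opp nmulr_llt0// => /ltW.
have {b0}bpos : 0 < beta by rewrite lt_neqAle eq_sym b0.
have [s /andP[s0 s1] h] := nbhs_segment (a' i - q) n1.
have xi : bary a i (q + s *: (a' i - q)) = s * beta by rewrite bary_conv qi mulr0 add0r.
have : bary a i (q + s *: (a' i - q)) = 0.
 apply: conf.
  apply/(simplexP ua) => j; have [->|ji] := eqVneq j i; last exact/ltW/h.
  by rewrite xi mulr_ge0// ltW.
 by apply: simplex_conv => //; [rewrite !ltW|exact: simplex_node].
by rewrite xi => /eqP; rewrite mulf_eq0 !gt_eqF.
Qed.

End TwoSided.
End Geometry.

(** * Conforming meshes whose cells contain cubes of comparable size *)

Section FatMesh.
Context {R : realType} {d : nat}.
Local Notation pt := 'rV[R]_d.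
(** Shape regularity and quasi-uniformity are merged into one constant [kap]. Balls are those of the
    maximum norm, that is cubes, whose volumes are explicit. *)
Record fat_mesh (M : mesh R d) (h kap : R) : Prop := {
 fm_h : 0 < h;
 fm_kap : 0 < kap;
 fm_unit : forall T : elt M, edges (node T) \in unitmx;
 fm_shared : forall T T' : elt M, T != T' -> shared T T' != [set: 'I_d.+1]%SET;
 fm_conf : forall T T' : elt M, T != T' -> cell T `&` cell T' `<=` hull (shared T T') (node T);
 fm_diam : forall (T : elt M) x y, cell T x -> cell T y -> `|x - y| <= h;
 fm_ball : forall T : elt M, exists x, forall y, `|y - x| <= kap * h -> cell T y }.
Context (M : mesh R d) (h kap : R) (fm : fat_mesh M h kap) (S : {set elt M}).
Local Notation W := (interior (cells S)).
Implicit Types (T : elt M) (U : set pt).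
Let h0 := fm_h fm. Let k0 := fm_kap fm.
Definition cen T : pt := xget 0 [set x | forall y, `|y - x| <= kap * h -> cell T y].
Lemma cen_ball T y : `|y - cen T| <= kap * h -> cell T y.
Proof. by have := @xgetPex _ (0 : pt) _ (fm_ball fm T); exact. Qed.
Lemma cen_cell T : cell T (cen T).
Proof. by apply: cen_ball; rewrite subrr normr0 mulr_ge0// ltW. Qed.
Lemma cell_closed T : closed (cell T).
Proof. exact: simplex_closed (fm_unit fm T). Qed.
Lemma cells_closed (A : {set elt M}) : closed (cells A).
have -> : cells A = \bigcup_(T in [set T | T \in A]) cell T by apply/seteqP; split => x [T ? ?]; exists T.
apply: closed_bigcup; first exact: finite_finset.
by move=> T _; exact: cell_closed.
Qed.

Lemma cell_interior T x : interior (cell T) x <-> forall i, 0 < bary (node T) i x.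
Proof. exact: simplex_interior (fm_unit fm T) x. Qed.
Lemma cen_interior T : interior (cell T) (cen T).
apply/nbhs_ballP; exists (kap * h); rewrite /= ?mulr_gt0// => y.
by rewrite mx_norm_ball /ball_/= distrC => /ltW; exact: cen_ball.
Qed.

Lemma sharedTT T : shared T T = [set: 'I_d.+1]%SET.
Proof. by apply/setP => i; rewrite !inE; apply/existsP; exists i. Qed.
Lemma shared_neq T T' i : shared T T' = [set~ i]%SET -> T != T'.
Proof. by move=> e; apply/eqP => E; have /setP/(_ i) := e; rewrite -E sharedTT !inE eqxx. Qed.
Lemma shared_adjacent T T' i : shared T T' = [set~ i]%SET -> Defs.adjacent T T'.
Proof. by move=> e; rewrite /Defs.adjacent (shared_neq e) e cardsC1 card_ord eqxx. Qed.
Lemma interior_disj T T' x : interior (cell T) x -> cell T' x -> T = T'.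
move=> Tx T'x; apply/eqP/negPn/negP => TT'.
have /(hullP (fm_unit fm T))[_ hs] := fm_conf fm TT' (conj (interior_subset Tx) T'x).
have /eqP := fm_shared fm TT'; apply; apply/setP => i; rewrite [RHS]inE.
by apply/negPn/negP => /hs e; have /cell_interior/(_ i) := Tx; rewrite e ltxx.
Qed.

(** The two cells number the vertices of the common facet differently. The matching is completed to
    a permutation by sending the opposite index to the one left over, so that [two_sided] and
    [flux_match] apply after relabelling. *)
Lemma facet_match T T' i : shared T T' = [set~ i]%SET ->
 exists s : 'I_d.+1 -> 'I_d.+1, injective s /\ forall j, j != i -> node T j = node T' (s j).
move=> e; have H j : exists j', j != i -> node T j = node T' j'.
 have [ji|ji] := boolP (j != i); last by exists j.
 have : j \in shared T T' by rewrite e !inE.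
 by rewrite inE => /existsP[j' /eqP ->]; exists j'.
have [f hf] := choice H.
have fi j k : j != i -> k != i -> f j = f k -> j = k.
 by move=> ji ki fe; apply: (node_inj (fm_unit fm T)); rewrite hf// fe -hf.
have [i' hi'] : exists i', forall j, j != i -> f j != i'.
 have : (#|f @: [set~ i]%SET| < #|'I_d.+1|)%N.
  by apply: leq_ltn_trans (leq_imset_card _ _) _; rewrite cardsC1 card_ord.
 move=> hc; have /existsP[i' hi'] : [exists i', i' \notin f @: [set~ i]%SET].
  rewrite -negb_forall; apply/negP => /forallP hall; move: hc; rewrite ltnNge => /negP; apply.
  by rewrite -cardsT; apply: subset_leq_card; apply/fintype.subsetP => x _; exact: hall.
 exists i' => j ji; apply: contraNneq hi' => <-; apply: imset_f.
 by rewrite !inE.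
exists (fun j => if j == i then i' else f j); split.
 move=> j k; case: eqP => [->|/eqP ji]; case: eqP => [->//|/eqP ki].
 - by move=> E; have := hi' k ki; rewrite E eqxx.
 - by move=> E; have := hi' j ji; rewrite E eqxx.
 - exact: fi.
by move=> j ji; rewrite (negbTE ji); exact: hf.
Qed.

Lemma facet_two_sided T T' i q : shared T T' = [set~ i]%SET -> bary (node T) i q = 0 ->
 (forall j, j != i -> 0 < bary (node T) j q) -> nbhs q (cell T `|` cell T') /\ cell T' q.
move=> e qi qj; have [s [si hs]] := facet_match e.
have uT := fm_unit fm T; have uT' := edges_reindex si (fm_unit fm T').
have ee := simplex_reindex (node T') si.
have := @two_sided R d (node T) (node T' \o s) i uT uT' hs q qi qj; rewrite ee; apply.
move=> x Tx T'x; have := fm_conf fm (shared_neq e) (conj Tx T'x).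
by move=> /(hullP uT)[_]; apply; rewrite e !inE eqxx.
Qed.

Definition bfacet T i := [forall T' in S, shared T T' != [set~ i]%SET].
Lemma bfacetPn T i : ~~ bfacet T i -> exists2 T', T' \in S & shared T T' = [set~ i]%SET.
Proof. by rewrite negb_forall => /existsP[T']; rewrite negb_imply negbK => /andP[? /eqP ?]; exists T'. Qed.
Definition cvx U := forall x y (t : R), 0 <= t <= 1 -> U x -> U y -> U (x + t *: (y - x)).
Lemma cell_meet_interior T U : open U -> (exists2 y, cell T y & U y) ->
 (interior (cell T) `&` U) !=set0.
move=> oU [y Ty Uy]; have [s /andP[s0 s1] Us] := nbhs_segment (cen T - y) (open_nbhs_nbhs (conj oU Uy)).
exists (y + s *: (cen T - y)); split => //; apply/cell_interior => i.
rewrite bary_conv; have /cell_interior/(_ i) c0 := cen_interior T.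
have /(simplexP (fm_unit fm T))/(_ i) y0 := Ty.
have h1 : 0 <= (1 - s) * bary (node T) i y by rewrite mulr_ge0// subr_ge0 ltW.
by rewrite ltr_wpDl// mulr_gt0.
Qed.

Lemma bary_avoid T i : [/\ continuous (bary (node T) i),
 forall x v (t : R), bary (node T) i (x + t *: v) =
  bary (node T) i x + t * (bary (node T) i (x + v) - bary (node T) i x) &
 exists y, bary (node T) i y != 0].
split; first exact: bary_cont.
 move=> x v t; rewrite bary_line; congr (_ + t * _).
 by have := bary_line (node T) i x v 1; rewrite scale1r mul1r => ->; rewrite addrC addKr.
by exists (node T i); rewrite bary_node ?(fm_unit fm)// eqxx oner_neq0.
Qed.

(** If some point of U were uncovered, follow a segment from a cell of [A] to it until the last
    covered point. In general position this point is interior to a cell or to a facet; in the latter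
    case the neighbour across the facet also belongs to [A], and the two cells cover a
    neighbourhood, so the point is not the last one. *)
Lemma connected_cover (A : {set elt M}) U : open U -> cvx U -> A \subset S ->
 (forall T, T \in A -> exists2 y, cell T y & U y) -> A != finset.set0 ->
 (forall T T', T \in A -> T' \in S -> Defs.adjacent T T' -> (exists2 y, cell T' y & U y) -> T' \in A) ->
 (forall T i, T \in A -> ~~ bfacet T i) -> U `<=` cells A.
move=> oU cU AS AU A0 Aadj Ab b0 Ub0; apply: contrapT => nb0.
have cA := @cells_closed A.
have oO : open (U `&` ~` cells A) by apply: openI => //; exact: closed_openC.
have [b [Ub nb] hb] := @open_avoid R d _ (enum {: elt M * 'I_d.+1}) (fun Ti => bary (node Ti.1) Ti.2)
 _ oO (ex_intro _ b0 (conj Ub0 nb0)) (fun Ti => bary_avoid Ti.1 Ti.2).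
have {}hb T i : bary (node T) i b != 0 by apply: (hb (T, i)); rewrite mem_enum.
have /finset.set0Pn[T0 T0A] := A0.
(* If two barycentric coordinates vanish at one point of the segment before [b], this determinant is
   zero; avoiding its zeros keeps the segment away from faces of codimension two. [b] is chosen
   first because F must be nonzero at vertex i. Equal indices get the value 1 so that every member
   of the family is a nonzero affine function. *)
pose F (t : elt M * ('I_d.+1 * 'I_d.+1)) (x : pt) : R := if t.2.1 == t.2.2 then 1 else
 bary (node t.1) t.2.1 x * bary (node t.1) t.2.2 b - bary (node t.1) t.2.2 x * bary (node t.1) t.2.1 b.
have oO2 : open (interior (cell T0) `&` U) by apply: openI => //; exact: open_interior.
have [|a [Ta Ua] ha] := @open_avoid R d _ (enum {: elt M * ('I_d.+1 * 'I_d.+1)}) F _ oO2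
  (cell_meet_interior oU (AU _ T0A)).
 move=> [T [i j]]; rewrite /F /=; case: eqP => [_|/eqP ij].
  split; [exact: cst_continuous|by move=> x v t; rewrite subrr mulr0 addr0|].
  by exists 0; rewrite oner_neq0.
 have [ci li _] := bary_avoid T i; have [cj lj _] := bary_avoid T j; split.
 - move=> x; apply: (cvgB (cvgM (ci x) (@cst_continuous _ _ _ x)) (cvgM (cj x) (@cst_continuous _ _ _ x))).
 - by move=> x v t; rewrite (li x) (lj x); ring.
 - exists (node T i); rewrite !bary_node ?(fm_unit fm)// eqxx (eq_sym j i) (negbTE ij) mul1r mul0r subr0.
  exact: hb.
have {}ha T i j : i != j -> bary (node T) i a * bary (node T) j b - bary (node T) j a * bary (node T) i b != 0.
 by move=> ij; have := ha (T, (i, j)); rewrite mem_enum /F /= (negbTE ij); exact.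
pose gam (t : R) := a + t *: (b - a).
pose E := [set t : R | 0 <= t <= 1 /\ cells A (gam t)].
have E0 : E 0.
 split; first by rewrite lexx ler01.
 by rewrite /gam scale0r addr0; exists T0 => //; exact: interior_subset.
have hE : has_sup E by split; [exists 0|exists 1 => t [/andP[]]].
pose ts := sup E.
have ts0 : 0 <= ts by apply: ub_le_sup; [exact: hE.2|exact: E0].
have ts1 : ts <= 1 by apply: ge_sup; [exists 0|move=> t [/andP[]]].
have gamB t u : gam (t + u) = gam t + u *: (b - a) by rewrite /gam scalerDl addrA.
have Eq : cells A (gam ts).
 apply: contrapT => nq.
 have : nbhs (gam ts) (~` cells A) by apply: open_nbhs_nbhs; split => //; exact: closed_openC.
 move=> /nbhs_ballP[e /= e0 he].
 pose v := b - a; have v1 : 0 < `|v| + 1 by have := normr_ge0 v; lra.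
 have d0 : 0 < e / (`|v| + 1) by rewrite divr_gt0.
 have [t [/andP[t0 t1] At] tlt] := sup_adherent d0 hE.
 have tle : t <= ts by apply: ub_le_sup; [exact: hE.2|split => //; rewrite t0].
 have : ball (gam ts) e (gam t).
  rewrite mx_norm_ball /ball_/= (_ : gam ts - gam t = (ts - t) *: v); last first.
    by rewrite /gam /v; apply/rowP => j; rewrite !mxE; ring.
  rewrite normrZ ger0_norm ?subr_ge0//.
  have : (ts - t) * (`|v| + 1) < e by rewrite -ltr_pdivlMr//; rewrite -/ts in tlt; lra.
  have : 0 <= ts - t by rewrite subr_ge0.
  by nra.
 by move/he; exact.
have ts_lt1 : ts < 1.
 rewrite lt_neqAle ts1 andbT; apply/eqP => e1; apply: nb.
 by move: Eq; rewrite e1 /gam scale1r addrC subrK.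
have Uq : U (gam ts) by apply: cU => //; rewrite ts0.
have nint : ~ nbhs (gam ts) (cells A).
 move=> /(nbhs_segment ((1 - ts) *: (b - a)))[s /andP[s0 s1]].
 rewrite scalerA -gamB => As.
 have : ts + s * (1 - ts) <= ts.
  apply: ub_le_sup; first exact: hE.2.
  split => //; have p1 : 0 <= s * (1 - ts) by rewrite mulr_ge0 ?subr_ge0 ?ltW.
  have p2 : s * (1 - ts) <= 1 - ts by rewrite ler_piMl ?subr_ge0// ltW.
  by apply/andP; split; lra.
 by rewrite gerDl leNgt mulr_gt0// subr_gt0.
have [T TA Tq] := Eq; have uT := fm_unit fm T.
have /(simplexP uT) Tq0 := Tq.
have TAs T' : T' \in A -> cell T' `<=` cells A by move=> T'A x; exists T'.
have [/existsP[i /eqP qi]|/existsPn qn] := boolP [exists i, bary (node T) i (gam ts) == 0]; last first.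
 apply: nint; apply: (filterS (TAs _ TA)); apply/cell_interior => i.
 by rewrite lt_neqAle eq_sym qn Tq0.
have qj j : j != i -> 0 < bary (node T) j (gam ts).
 move=> ji; rewrite lt_neqAle Tq0 andbT eq_sym; apply/eqP => qj.
 have := ha T i j; rewrite eq_sym ji => /(_ isT)/eqP; apply.
 have e1 : (1 - ts) * bary (node T) i a = - (ts * bary (node T) i b).
  by apply/eqP; rewrite -addr_eq0 -bary_conv; exact/eqP.
 have e2 : (1 - ts) * bary (node T) j a = - (ts * bary (node T) j b).
  by apply/eqP; rewrite -addr_eq0 -bary_conv; exact/eqP.
 have t1 : 1 - ts != 0 by rewrite subr_eq0 eq_sym lt_eqF.
 apply: (mulfI t1); rewrite mulr0 mulrBr !mulrA e1 e2; ring.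
have [T' T'S e] := bfacetPn (Ab T i TA).
have [nq T'q] := facet_two_sided e qi qj.
have T'A : T' \in A by apply: (Aadj T) => //; [exact: shared_adjacent e|exists (gam ts)].
by apply: nint; apply: filterS nq => x [/(TAs _ TA)|/(TAs _ T'A)].
Qed.

(** Move q towards the barycentre [f] of the facet, into its relative interior. A second cell of [S]
    meeting that point would share the whole facet, so near it only [T] could cover, and [T]
    contains nothing just beyond the facet. *)
Lemma bfacet_out T i q : (0 < d)%N -> T \in S -> bfacet T i -> cell T q -> bary (node T) i q = 0 -> ~ W q.
move=> d0 TS bT Tq qi Wq; have uT := fm_unit fm T.
pose f : pt := \sum_j (if j == i then 0 else d%:R^-1 : R) *: node T j.
have f1 : \sum_(j < d.+1) (if j == i then 0 else d%:R^-1 : R) = 1.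
 rewrite (bigD1 i)//= eqxx add0r (eq_bigr (fun=> d%:R^-1)) => [|j /negbTE -> //].
 by rewrite sumr_const cardC1 card_ord -[_ *+ _]mulr_natr mulVf// pnatr_eq0 -lt0n.
have bf j : bary (node T) j f = if j == i then 0 else d%:R^-1 by exact: bary_uniq.
have oW : open W by exact: open_interior.
have [s /andP[s0 s1] Wq'] := nbhs_segment (f - q) (open_nbhs_nbhs (conj oW Wq)).
set q' := q + _ in Wq'.
have q'i : bary (node T) i q' = 0 by rewrite bary_conv qi bf eqxx !mulr0 addr0.
have q'j j : j != i -> 0 < bary (node T) j q'.
 move=> ji; rewrite bary_conv bf (negbTE ji).
 have /(simplexP uT)/(_ j) y0 := Tq.
 by rewrite ltr_wpDl ?mulr_ge0 ?subr_ge0 ?(ltW s1)// mulr_gt0// invr_gt0 ltr0n.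
have Tq' : cell T q'.
 by apply/(simplexP uT) => j; have [->|ji] := eqVneq j i; rewrite ?q'i// ltW// q'j.
have cB := @cells_closed (S :\ T)%SET.
have [[T'' T''S T''q']|nq'] := pselect (cells (S :\ T)%SET q').
 have [T''T T''S'] : T'' != T /\ T'' \in S by move: T''S; rewrite !inE => /andP.
 rewrite eq_sym in T''T.
 have /(hullP uT)[_ hs] := fm_conf fm T''T (conj Tq' T''q').
 move: bT => /forallP/(_ T''); rewrite T''S' /= => /eqP; apply.
 have sj j : j != i -> j \in shared T T''.
  by move=> ji; apply/negPn/negP => /hs e; have := q'j j ji; rewrite e ltxx.
 apply/setP => j; rewrite !inE; have [->|ji] := eqVneq j i; last first.
  by have := sj j ji; rewrite inE => ->.
 apply/negbTE/negP => ish; have /eqP := fm_shared fm T''T; apply; apply/setP => l.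
 rewrite [RHS]inE; have [->|li] := eqVneq l i; last exact: sj.
 by rewrite inE.
have : nbhs q' (W `&` ~` cells (S :\ T)%SET).
 apply: open_nbhs_nbhs; split => //; apply: openI => //; exact: closed_openC.
move=> /(nbhs_segment (q' - node T i))[t /andP[t0 _]].
set x := q' + _ => -[Wx nx]; have [T'' T''S T''x] := interior_subset Wx.
apply: nx; exists T'' => //; rewrite !inE T''S andbT; apply/eqP => e.
have : 0 <= bary (node T) i x by rewrite e in T''x; have /(simplexP uT)/(_ i) := T''x.
by rewrite /x bary_line -baryB q'i bary_node// eqxx /= add0r sub0r mulrN1 oppr_ge0 leNgt t0.
Qed.

End FatMesh.

(** * Piecewise functions and fields, and their weak divergence *)

Section Piecewise.
Context {R : realType} {d : nat}.
Local Notation pt := 'rV[R]_d.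
Local Notation mu := (leb d).
Context (M : mesh R d) (h kap : R) (fm : fat_mesh M h kap) (Om : set pt).
Local Notation S := (active M Om).
Local Notation W := (OmT M Om).
Local Notation IT T := (interior (cell T)).
Implicit Types (T : elt M) (u v f g : pt -> R).
Let h0 := fm_h fm. Let k0 := fm_kap fm.
Lemma openW : open W. Proof. exact: open_interior. Qed.
Lemma mW_OmT : measurable W. Proof. exact: open_meas openW. Qed.
Lemma mIT T : measurable (IT T).
Proof. apply: open_meas; exact: open_interior. Qed.
Lemma mcell T : measurable (cell T). Proof. exact: msimplex (fm_unit fm T). Qed.
Lemma IT_cell T : IT T `<=` cell T. Proof. exact: interior_subset. Qed.
Lemma IT_W T : T \in S -> IT T `<=` W.
Proof. by move=> TS; apply: interiorS => x Tx; exists T. Qed.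
Lemma bounded_W : exists B, forall x, W x -> `|x| <= B.
have /choice[B hB] T := simplex_bdd (fm_unit fm T).
exists (\sum_T `|B T|) => x /interior_subset[T _ Tx]; apply: le_trans (hB _ _ Tx) _.
by apply: le_trans (ler_norm _) _; rewrite (bigD1 T)//= lerDl sumr_ge0.
Qed.

Lemma cell_fin T : (mu (cell T) < +oo)%E. Proof. exact: simplex_fin (fm_unit fm T). Qed.
Lemma ae_IT T : {ae mu, forall x, cell T x -> IT T x}.
exists (cell T `\` IT T); split.
- by apply: measurableD; [exact: mcell|exact: mIT].
- exact: simplex_boundary0 (fm_unit fm T).
- by move=> x /= /not_implyP.
Qed.

Lemma ae_all_IT : {ae mu, forall x, forall T, cell T x -> IT T x}.
suff H0 : {ae mu, forall x, forall T, T \in enum {: elt M} -> cell T x -> IT T x}.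
 by apply: filterS H0 => x hx T; apply: hx; rewrite mem_enum.
elim: (enum _) => [|T s IH]; first by apply: aeW => x T.
by apply: filterS2 (ae_IT T) IH => x h1 h2 T'; rewrite inE => /orP[/eqP ->//|]; exact: h2.
Qed.

Lemma ae_W : {ae mu, forall x, W x -> exists2 T, T \in S & IT T x}.
Proof. by apply: filterS ae_all_IT => x hx /interior_subset[T TS Tx]; exists T => //; exact: hx. Qed.
Definition pw (F : elt M -> pt -> R) : pt -> R := fun x => \sum_(T in S) zext (IT T) (F T) x.
Lemma pwE F T x : T \in S -> IT T x -> pw F x = F T x.
move=> TS Tx; rewrite /pw (bigD1 T)//= zextE// big1 ?addr0// => T' /andP[_ T'T].
rewrite zext_out// => /interior_subset T'x.
by move/eqP: T'T; apply; apply/esym; exact: (interior_disj fm Tx T'x).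
Qed.

Lemma L2_pw F (D : set pt) : measurable D -> (forall T, T \in S -> L2 (IT T) (F T)) -> L2 D (pw F).
by move=> mD H; apply: L2_sum => // T TS; apply: L2_zext => //; [exact: mIT|exact: H].
Qed.

Lemma ip_pw F g : (forall T, T \in S -> L2 (IT T) (F T)) -> L2 W g ->
 ip W (pw F) g = \sum_(T in S) ip (IT T) (F T) g.
move=> H Lg; rewrite ip_suml//; last 2 first.
- exact: mW_OmT.
- by move=> T TS; apply: L2_zext; [exact: mIT|exact: mW_OmT|exact: H].
by apply: eq_bigr => T TS; rewrite ip_zext//; exact: IT_W.
Qed.

Lemma pw_ae u : {ae mu, forall x, W x -> pw (fun=> u) x = u x}.
Proof. by apply: filterS ae_W => x hx /hx[T TS Tx]; rewrite (pwE _ TS Tx). Qed.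
Lemma L2_IT T u : T \in S -> L2 W u -> L2 (IT T) u.
Proof. by move=> TS; apply: L2_sub; [exact: mIT|exact: mW_OmT|exact: IT_W]. Qed.
Lemma ip_W u v : L2 W u -> L2 W v -> ip W u v = \sum_(T in S) ip (IT T) u v.
move=> Lu Lv; rewrite -(@ip_pw (fun=> u))//; last by move=> T TS; exact: L2_IT.
apply: eq_ip_ae => //; [exact: mW_OmT| |].
 by apply: L2_pw => [|T TS]; [exact: mW_OmT|exact: L2_IT].
by apply: filterS (pw_ae u) => x hx Wx; rewrite hx.
Qed.

Lemma nrm_W u : L2 W u -> nrm W u ^+ 2 = \sum_(T in S) nrm (IT T) u ^+ 2.
Proof. by move=> Lu; rewrite nrm_sq ip_W//; apply: eq_bigr => T _; rewrite nrm_sq. Qed.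
Lemma ip_cell T u v : L2 (cell T) u -> L2 (cell T) v -> ip (IT T) u v = ip (cell T) u v.
move=> Lu Lv; rewrite -(@ip_zext _ _ (IT T) (cell T))//; last exact: IT_cell.
apply: eq_ip_ae => //; first exact: mcell.
 apply: L2_zext; [exact: mIT|exact: mcell|].
 by apply: L2_sub Lu; [exact: mIT|exact: mcell|exact: IT_cell].
by apply: filterS (ae_IT T) => x hx Tx; rewrite zextE//; exact: hx.
Qed.

Lemma L2_cell_cont T u : continuous u -> L2 (cell T) u.
move=> cu; have [B hB] := simplex_bdd (fm_unit fm T); have [K hK] := cont_bdd_on B cu.
apply: (@bounded_L2 _ _ _ _ K); [exact: mcell|exact: cell_fin| |].
 by apply: measurable_funTS; exact: cont_meas.
by move=> x Tx; apply: hK; exact: hB.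
Qed.

Lemma L2_IT_cont T u : continuous u -> L2 (IT T) u.
move=> cu; apply: (L2_sub (mIT T) (mcell T) (@IT_cell T)).
exact: L2_cell_cont.
Qed.

Definition pwv (F : elt M -> pt -> pt) : pt -> pt :=
 fun x => \row_i pw (fun T => vcoord (F T) i) x.
Lemma vcoord_pwv F i : vcoord (pwv F) i = pw (fun T => vcoord (F T) i).
Proof. by apply/funext => x; rewrite /vcoord mxE. Qed.
Lemma pwvE F T x : T \in S -> IT T x -> pwv F x = F T x.
Proof. by move=> TS Tx; apply/rowP => i; rewrite mxE (pwE _ TS Tx). Qed.
(** Each summand is tangent to all facets except the one opposite to vertex i, so the coefficients
    are independent facet fluxes, and polynomial coefficients of degree k give a Raviart-Thomas
    shape function. *)
Definition rtf (G : elt M -> 'I_d.+1 -> pt -> R) T : pt -> pt :=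
 fun x => \sum_i G T i x *: (x - node T i).
Definition rtdiv (G : elt M -> 'I_d.+1 -> pt -> R) T : pt -> R :=
 fun x => \sum_i (d%:R * G T i x + dder (x - node T i) (G T i) x).
Lemma cont_sum I (r : seq I) (F : I -> pt -> R) : (forall i, continuous (F i)) ->
 continuous (fun x => \sum_(i <- r) F i x).
move=> cF; elim: r => [|i r IH].
 by under eq_fun do rewrite big_nil; exact: cst_continuous.
rewrite (_ : (fun x => _) = fun x => F i x + \sum_(j <- r) F j x); last first.
 by apply/funext => x; rewrite big_cons.
by move=> x; exact: (cvgD (cF i x) (IH x)).
Qed.

Lemma vcoord_rtf G T l x : vcoord (rtf G T) l x = \sum_i G T i x * (x 0 l - node T i 0 l).
Proof. by rewrite /vcoord /rtf summxE; apply: eq_bigr => i _; rewrite !mxE. Qed.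
Lemma cont_rtf G T l : (forall i, C1 (G T i)) -> continuous (vcoord (rtf G T) l).
move=> hG; rewrite (funext (vcoord_rtf G T l)); apply: cont_sum => i x.
have [cG _] := hG i.
exact: (cvgM (cG x) (cvgB (@coord_continuous _ _ _ 0 l x) (@cst_continuous _ _ _ x))).
Qed.

Lemma cont_rtdiv G T : (forall i, C1 (G T i)) -> continuous (rtdiv G T).
Proof. by move=> hG; apply: cont_sum => i; apply: cont_flux; exact: hG. Qed.
Lemma Rintegral_sum (D : set pt) I (r : seq I) (F : I -> pt -> R) : measurable D ->
 (forall i, mu.-integrable D (EFin \o F i)) ->
 \int[mu]_(x in D) (\sum_(i <- r) F i x) = \sum_(i <- r) \int[mu]_(x in D) F i x.
move=> mD iF; elim: r => [|i r IH].
 rewrite big_nil -[RHS](mul0r (fine (mu D))) -(Rintegral_cst _ mD).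
 by apply: eq_Rintegral => x _; rewrite big_nil.
have iS (s : seq I) : mu.-integrable D (EFin \o (fun x => \sum_(i <- s) F i x)).
 elim: s => [|j s IHs].
  rewrite (_ : EFin \o _ = cst 0%E); first exact: integrable0.
  by apply/funext => x; rewrite /= big_nil.
 rewrite (_ : EFin \o _ = ((EFin \o F j) \+ (EFin \o (fun x => (\sum_(i <- s) F i x)%R)))%E).
  exact: integrableD.
 by apply/funext => x; rewrite /= big_cons EFinD.
rewrite big_cons -IH -RintegralD//.
by apply: eq_Rintegral => x _; rewrite big_cons.
Qed.

Lemma cell_green G T (phi : pt -> R) : (forall i, C1 (G T i)) -> C1 phi ->
 \sum_l ip (IT T) (vcoord (rtf G T) l) (pder l phi) + ip (IT T) (rtdiv G T) phi =
 \sum_i flux (node T) (node T i) (fun x => G T i x * phi x).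
move=> hG hphi; have uT := fm_unit fm T.
have cp l : continuous (pder l phi) by have [_ cl] := hphi.2 l; exact: cl.
rewrite (eq_bigr (fun l => ip (cell T) (vcoord (rtf G T) l) (pder l phi))) => [|l _]; last first.
 by apply: ip_cell; apply: L2_cell_cont => //; exact: cont_rtf.
rewrite ip_cell; [|by apply: L2_cell_cont; exact: cont_rtdiv|by apply: L2_cell_cont; exact: hphi.1].
have iM u v : continuous u -> continuous v -> mu.-integrable (cell T) (EFin \o (fun x => u x * v x)).
 by move=> cu cv; apply: (int_simplex uT) => x; exact: (cvgM (cu x) (cv x)).
rewrite -Rintegral_sum; last 2 first.
- exact: mcell.
- by move=> l; apply: iM => //; exact: cont_rtf.
rewrite -RintegralD; last 3 first.
- exact: mcell.
- apply: (int_simplex uT); apply: cont_sum => l x.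
 by apply: (cvgM (@cont_rtf G T l hG x) (cp l x)).
- by apply: iM; [exact: cont_rtdiv|exact: hphi.1].
rewrite -Rintegral_sum; last 2 first.
- exact: mcell.
- move=> i; apply: (int_simplex uT); apply: cont_flux.
 exact: (C1M (hG i) hphi).1.
apply: eq_Rintegral => x _.
rewrite (eq_bigr (fun l => \sum_i (G T i x * ((x - node T i) 0 l * pder l phi x)))) => [|l _]; last first.
 by rewrite vcoord_rtf mulr_suml; apply: eq_bigr => i _; rewrite !mxE mulrA.
rewrite exchange_big /= /rtdiv mulr_suml -big_split; apply: eq_bigr => i _ /=.
by rewrite -mulr_sumr (dderM _ _ (hG i) hphi) /dder; ring.
Qed.

(** The cancellation hypothesis is continuity of the normal component in weak form: the boundary
    terms of all cells add up to zero against every test function. *)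
Lemma rt_is_wdiv G : (forall T i, C1 (G T i)) ->
 (forall phi, test_fun W phi ->
  \sum_(T in S) \sum_i flux (node T) (node T i) (fun x => G T i x * phi x) = 0) ->
 L2v W (pwv (rtf G)) /\ is_wdiv W (pwv (rtf G)) (pw (rtdiv G)).
move=> hG H.
have L1 l T : T \in S -> L2 (IT T) (vcoord (rtf G T) l).
 by move=> _; apply: L2_IT_cont; exact: cont_rtf.
have L2' T : T \in S -> L2 (IT T) (rtdiv G T).
 by move=> _; apply: L2_IT_cont; exact: cont_rtdiv.
split; first by move=> l; rewrite vcoord_pwv; apply: L2_pw; [exact: mW_OmT|exact: L1].
split; first by apply: L2_pw; [exact: mW_OmT|exact: L2'].
move=> phi tphi; have := H phi tphi.
have Lp := test_L2 mW_OmT tphi.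
rewrite (eq_bigr (fun T => \sum_l ip (IT T) (vcoord (rtf G T) l) (pder l phi) + ip (IT T) (rtdiv G T) phi)); last first.
 move=> T TS; rewrite cell_green//; exact: test_C1 tphi.
rewrite big_split /= -(ip_pw L2' Lp) => /eqP; rewrite addr_eq0 => /eqP <-.
rewrite exchange_big /=; apply: eq_bigr => l _.
rewrite vcoord_pwv (vcoord_grad phi l) ip_pw//; first exact: L1.
exact: test_L2 mW_OmT (test_pder l tphi).
Qed.

Lemma rt_RT k G : (forall T i, poly_fun k (G T i)) ->
 (forall phi, test_fun W phi ->
  \sum_(T in S) \sum_i flux (node T) (node T i) (fun x => G T i x * phi x) = 0) ->
 RT M Om k (pwv (rtf G)).
move=> hG H; have [Lv hd] := rt_is_wdiv (fun T i => poly_C1 (hG T i)) H.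
split; first by split => //; eexists; exact: hd.
move=> T TS; exists (rtf G T); split; last by move=> x Tx; rewrite (pwvE _ TS Tx).
exists (fun x => - \sum_i G T i x *: node T i), (fun x => \sum_i G T i x); split.
- move=> l; rewrite (_ : vcoord _ l = fun x => -1 * \sum_i node T i 0 l * G T i x).
  by apply: polyZ; apply: poly_sum => i _; exact: polyZ.
 apply/funext => x; rewrite /vcoord mxE summxE mulN1r; congr (- _); apply: eq_bigr => i _.
 by rewrite mxE mulrC.
- exact: poly_sum.
- move=> x; rewrite /rtf scaler_suml addrC -sumrB; apply: eq_bigr => i _.
 by rewrite scalerBr.
Qed.

End Piecewise.

(** * Elementary inequalities for sums and variances *)

Section Elementary.
Context {R : realType}.
(** X is the quantity to be bounded, N the norm of the field built from it: the field pairs with the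
    pressure error to at least c X, while its own norm is of order the square root of X. *)
Lemma sq_absorb (X c A N K : R) : 0 < c -> 0 <= X -> 0 <= A -> 0 <= N -> 0 <= K ->
 c * X <= A * N -> N ^+ 2 <= K * X -> X <= K * A ^+ 2 / c ^+ 2.
move=> c0 X0 A0 N0 K0 h1 h2; rewrite ler_pdivlMr ?exprn_gt0//.
have [->|Xn] := eqVneq X 0; first by rewrite mul0r mulr_ge0// sqr_ge0.
have Xp : 0 < X by rewrite lt_neqAle eq_sym Xn.
rewrite -(ler_pM2r Xp).
have h3 : (c * X) ^+ 2 <= (A * N) ^+ 2 by rewrite ler_sqr ?nnegrE ?mulr_ge0// ltW.
have h4 : A ^+ 2 * N ^+ 2 <= A ^+ 2 * (K * X) by rewrite ler_wpM2l// sqr_ge0.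
move: h3 h4; rewrite !exprMn !expr2; lra.
Qed.

Lemma sum_sq_le (I : finType) (P : pred I) (x : I -> R) :
 (\sum_(i | P i) x i) ^+ 2 <= #|P|%:R * \sum_(i | P i) x i ^+ 2.
have h : 0 <= \sum_(i | P i) \sum_(j | P j) (x i - x j) ^+ 2.
 by apply: sumr_ge0 => i _; apply: sumr_ge0 => j _; exact: sqr_ge0.
have cst (c : R) : \sum_(i | P i) c = #|P|%:R * c by rewrite (sumr_const P) mulr_natl.
have e : \sum_(i | P i) \sum_(j | P j) (x i - x j) ^+ 2 =
  2 * (#|P|%:R * \sum_(i | P i) x i ^+ 2 - (\sum_(i | P i) x i) ^+ 2).
 rewrite (eq_bigr (fun i => #|P|%:R * x i ^+ 2 - 2 * x i * (\sum_(j | P j) x j) + \sum_(j | P j) x j ^+ 2)); last first.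
  move=> i _; rewrite mulr_sumr -cst -sumrB -big_split /=.
  by apply: eq_bigr => j _; ring.
 rewrite big_split /= sumrB -mulr_sumr cst -mulr_suml -mulr_sumr; ring.
by move: h; rewrite e; lra.
Qed.

(** The weights, later the barycentric coordinates of a point, act as probabilities; the left side
    is the mean of s (m - s), which is minus the variance. *)
Lemma variance_ident (I : finType) (lam s : I -> R) : \sum_i lam i = 1 ->
 \sum_i lam i * s i * (\sum_j lam j * (s j - s i)) =
 - \sum_i lam i * (s i - \sum_j lam j * s j) ^+ 2.
move=> l1; set m := \sum_j lam j * s j.
have e i : \sum_j lam j * (s j - s i) = m - s i.
 rewrite (eq_bigr (fun j => lam j * s j - lam j * s i)) => [|j _]; last by rewrite mulrBr.
 by rewrite sumrB -mulr_suml l1 mul1r.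
under eq_bigr do rewrite e.
rewrite (eq_bigr (fun i => m * (lam i * s i) - lam i * s i ^+ 2)) => [|i _]; last by ring.
rewrite [in RHS](eq_bigr (fun i => lam i * s i ^+ 2 - 2 * m * (lam i * s i) + m ^+ 2 * lam i)) => [|i _]; last by ring.
by rewrite sumrB [in RHS]big_split /= sumrB -!mulr_sumr l1 -/m; ring.
Qed.

(** Since one value is 0, the variance contains c ((s_i - m)^2 + m^2), which is at least c s_i^2 /
    2. *)
Lemma variance_ge (I : finType) (lam s : I -> R) (c : R) i0 i : (forall i, c <= lam i) -> 0 <= c ->
 s i0 = 0 -> c / 2 * s i ^+ 2 <= \sum_i lam i * (s i - \sum_j lam j * s j) ^+ 2.
move=> hc c0 s0; set m := \sum_j lam j * s j.
have pos j : 0 <= lam j * (s j - m) ^+ 2 by rewrite mulr_ge0 ?sqr_ge0// (le_trans c0).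
have [->|ii] := eqVneq i i0.
 by rewrite s0 expr0n mulr0; apply: sumr_ge0 => j _.
rewrite (bigD1 i)//= (bigD1 i0)/=; last by rewrite eq_sym.
have h1 : c * (s i - m) ^+ 2 <= lam i * (s i - m) ^+ 2 by rewrite ler_wpM2r ?sqr_ge0.
have h2 : c * (s i0 - m) ^+ 2 <= lam i0 * (s i0 - m) ^+ 2 by rewrite ler_wpM2r ?sqr_ge0.
have h3 : 0 <= \sum_(j | (j != i) && (j != i0)) lam j * (s j - m) ^+ 2 by apply: sumr_ge0 => j _.
have h4 : 0 <= c * (s i - 2 * m) ^+ 2 by rewrite mulr_ge0 ?sqr_ge0.
move: h1 h2 h3 h4; rewrite s0 !expr2; lra.
Qed.

End Elementary.

(** * Volumes, centres and facets of fat cells *)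

Section FatGeometry.
Context {R : realType} {d : nat}.
Local Notation pt := 'rV[R]_d.
Local Notation mu := (leb d).
Lemma poly_dder k (v : pt) p : poly_fun k p ->
 poly_fun k.-1 (dder v p) /\ (k = 0%N -> forall x, dder v p x = 0).
move=> hp; split; last by move=> k0 x; rewrite /dder big1// => j _; rewrite (poly_pder j hp).2// mulr0.
by apply: poly_sum => j _; apply: polyZ; exact: (poly_pder j hp).1.
Qed.

Lemma dder_comb (a : 'I_d.+1 -> pt) x b f y : edges a \in unitmx ->
 dder (x - b) f y = \sum_j bary a j x * dder (a j - b) f y.
move=> ua; rewrite /dder; under [RHS]eq_bigr do rewrite mulr_sumr.
rewrite exchange_big /=; apply: eq_bigr => l _.
under [RHS]eq_bigr do rewrite mulrA.
rewrite -mulr_suml; congr (_ * _); rewrite !mxE.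
rewrite (eq_bigr (fun j => bary a j x * a j 0 l - bary a j x * b 0 l)) => [|j _]; last by rewrite !mxE mulrBr.
rewrite sumrB -mulr_suml bary_sum mul1r -{1}(bary_comb ua x) summxE; congr (_ - _).
by apply: eq_bigr => j _; rewrite mxE.
Qed.

Lemma dderBdir (u v w : pt) f x : dder (u - v) f x = dder (u - w) f x - dder (v - w) f x.
Proof. by rewrite /dder -sumrB; apply: eq_bigr => l _; rewrite !mxE; ring. Qed.
Lemma fluxZ a (b : pt) (t : R) f : edges a \in unitmx -> C1 f ->
 flux a b (fun x => t * f x) = t * flux a b f.
move=> ua hf; rewrite /flux -RintegralZl//; last 2 first.
- exact: msimplex.
- by apply: (int_simplex ua); exact: cont_flux.
apply: eq_Rintegral => x _; rewrite mulrDr mulrCA; congr (_ + _).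
by rewrite /dder mulr_sumr; apply: eq_bigr => l _; rewrite pderZ// mulrCA.
Qed.

Context (M : mesh R d) (h kap : R) (fm : fat_mesh M h kap) (d0 : (0 < d)%N).
Let h0 := fm_h fm. Let k0 := fm_kap fm.
Implicit Types T : elt M.
Definition vol T : R := fine (mu (cell T)).
Lemma vol_ge T : (2 * (kap * h)) ^+ d <= vol T.
have kh : 0 < kap * h by rewrite mulr_gt0.
have -> : (2 * (kap * h)) ^+ d = fine (mu (obox (cen h kap T - const_mx (kap * h)) (cen h kap T + const_mx (kap * h)))).
 rewrite leb_obox; last by move=> i; rewrite !mxE; lra.
 rewrite /= (eq_bigr (fun=> 2 * (kap * h))) => [|i _]; last by rewrite !mxE; ring.
 by rewrite prodr_const card_ord.
apply: fine_le; rewrite ?ge0_fin_numE ?obox_fin ?(cell_fin fm)//.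
apply: le_measure; rewrite ?inE; [exact: mobox|exact: (mcell fm)|].
by move=> x /obox_cbox; rewrite cbox_ball ?(ltW kh)//; exact: (cen_ball fm).
Qed.

Lemma vol_gt0 T : 0 < vol T.
Proof. by apply: lt_le_trans (vol_ge T); rewrite exprn_gt0// !mulr_gt0. Qed.
Lemma cen_dist T x : cell T x -> `|x - cen h kap T| <= h.
Proof. by move=> Tx; apply: (fm_diam fm Tx); exact: (cen_cell fm). Qed.
Lemma vol_le T : vol T <= (4 * h) ^+ d.
have -> : (4 * h) ^+ d = fine (mu (obox (cen h kap T - const_mx (2 * h)) (cen h kap T + const_mx (2 * h)))).
 rewrite leb_obox; last by move=> i; rewrite !mxE; have := h0; lra.
 rewrite /= (eq_bigr (fun=> 4 * h)) => [|i _]; last by rewrite !mxE; ring.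
 by rewrite prodr_const card_ord.
apply: fine_le; rewrite ?ge0_fin_numE ?obox_fin ?(cell_fin fm)//.
apply: le_measure; rewrite ?inE; [exact: (mcell fm)|exact: mobox|].
move=> x /cen_dist hx i; have := coord_le (x - cen h kap T) i.
rewrite !mxE => hi; have := le_trans hi hx; rewrite ler_norml => /andP[? ?]; have := h0.
by move=> ?; apply/andP; split; lra.
Qed.

(** Translating x by kap/2 times the edge from vertex i to vertex j stays in the inscribed cube,
    hence in the cell, and lowers coordinate i by exactly kap/2. This explains why the bumps below
    have half the radius of the cube. *)
Lemma bary_cen T i x : `|x - cen h kap T| <= kap / 2 * h -> kap / 2 <= bary (node T) i x.
move=> hx; have uT := fm_unit fm T.
have [j ji] : exists j : 'I_d.+1, j != i.
 have : (1 < #|'I_d.+1|)%N by rewrite card_ord ltnS.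
 rewrite (cardD1 i) inE /= add1n ltnS => /card_gt0P[j]; rewrite !inE andbT => ji; by exists j.
have : cell T (x + (- (kap / 2)) *: (node T i - node T j)).
 apply: (cen_ball fm); rewrite addrAC; apply: le_trans (ler_normD _ _) _.
 rewrite (_ : kap * h = kap / 2 * h + kap / 2 * h); last by lra.
 apply: lerD => //; rewrite normrZ normrN gtr0_norm ?divr_gt0//.
 apply: ler_wpM2l; first by rewrite divr_ge0// ltW.
 by apply: (fm_diam fm (T:=T)); exact: simplex_node.
move=> /(simplexP uT)/(_ i); rewrite bary_line -(baryB) !bary_node// eqxx eq_sym (negbTE ji) /=.
lra.
Qed.

(** Near the barycentre of the facet and just beyond it, both neighbours must cover the same open
    set, which distinct cells cannot do. *)
Lemma facet_uniq T T' T'' i : shared T T' = [set~ i]%SET -> shared T T'' = [set~ i]%SET -> T' = T''.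
move=> e e'; have uT := fm_unit fm T.
pose q : pt := \sum_j (if j == i then 0 else d%:R^-1 : R) *: node T j.
have f1 : \sum_(j < d.+1) (if j == i then 0 else d%:R^-1 : R) = 1.
 rewrite (bigD1 i)//= eqxx add0r (eq_bigr (fun=> d%:R^-1)) => [|j /negbTE -> //].
 by rewrite sumr_const cardC1 card_ord -[_ *+ _]mulr_natr mulVf// pnatr_eq0 -lt0n.
have bq j : bary (node T) j q = if j == i then 0 else d%:R^-1 by exact: bary_uniq.
have qi : bary (node T) i q = 0 by rewrite bq eqxx.
have qj j : j != i -> 0 < bary (node T) j q.
 by move=> ji; rewrite bq (negbTE ji) invr_gt0 ltr0n.
have [n1 _] := facet_two_sided fm e qi qj; have [n2 _] := facet_two_sided fm e' qi qj.
have n3 : nbhs q ((cell T `|` cell T') `&` (cell T `|` cell T'')) by exact: filterI.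
move: (n3) => /nbhs_ballP[r /= r0 hr].
have oB : open_nbhs q (ball q r : set pt) by split; [exact: ball_open|exact: ballxx].
have [s /andP[s0 s1] Bs] := nbhs_segment (q - node T i) (open_nbhs_nbhs oB).
set x := q + _ in Bs.
have xi : bary (node T) i x < 0.
 rewrite /x bary_line -baryB qi bary_node// eqxx /=; lra.
have nT : ~ cell T x by move=> /(simplexP uT)/(_ i); rewrite leNgt xi.
have oO : open (ball q r `&` [set y | bary (node T) i y < 0] : set pt).
 apply: openI; first exact: ball_open.
 by apply: (@open_comp _ _ (bary (node T) i) [set t | t < 0]); [move=> y _; exact: bary_cont|exact: open_lt].
have notT y : bary (node T) i y < 0 -> ~ cell T y.
 by move=> yi /(simplexP uT)/(_ i); rewrite leNgt yi.
apply: (interior_disj fm (x := x)); last by have [_ []] := hr _ Bs.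
rewrite /interior /=; apply: filterS (open_nbhs_nbhs (conj oO (conj Bs xi))) => y [By yi].
by have [[/(notT _ yi)|]] := hr _ By.
Qed.

End FatGeometry.

(** * Oscillation of the pressure error within cells *)

Section StepOne.
Context {R : realType} {d : nat}.
Local Notation pt := 'rV[R]_d.
Local Notation mu := (leb d).
Context (M : mesh R d) (h kap : R) (fm : fat_mesh M h kap) (d0 : (0 < d)%N) (Om : set pt).
Local Notation S := (active M Om).
Local Notation W := (OmT M Om).
Local Notation IT T := (interior (cell T)).
Let h0 := fm_h fm. Let k0 := fm_kap fm.
Implicit Types T : elt M.
Context (k : nat) (P : elt M -> pt -> R) (A : R) (hP : forall T, poly_fun k (P T)) (A0 : 0 <= A)
 (HP : forall G : elt M -> 'I_d.+1 -> pt -> R, (forall T i, poly_fun k (G T i)) ->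
 (forall phi, test_fun W phi ->
  \sum_(T in S) \sum_i flux (node T) (node T i) (fun x => G T i x * phi x) = 0) ->
 `|\sum_(T in S) ip (IT T) (rtdiv G T) (P T)| <= A * nrmv W (pwv Om (rtf G))) (Cs : R)
 (Cs0 : 0 <= Cs) (hCs : forall (x0 x : pt) (h : R) p, 0 < h -> poly_fun k p -> `|x - x0| <= 1 * h ->
 p x ^+ 2 <= Cs * h ^- d * nrm setT (fun x : pt => cbump x0 (kap / 2 * h) x * p x) ^+ 2).
(** Derivatives along the edges from vertex 0. Multiplied by the barycentric coordinates they give a
    bubble field: its coefficient i vanishes on facet i, so nothing flows out of the cell, and its
    divergence pairs with [P T] to the integrated variance of these derivatives. *)
Let s T i := dder (node T i - node T ord0) (P T).
Let G T i := fun x => bary (node T) i x * s T i x.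
Let E T i : R := nrm setT (fun x : pt => cbump (cen h kap T) (kap / 2 * h) x * s T i x) ^+ 2.
Let poly_s T i : poly_fun k (s T i).
Proof. by apply: poly_le (poly_dder _ (hP T)).1; exact: leq_pred. Qed.
(** The barycentric factor restores the degree lost by differentiation; for k = 0 the derivatives
    vanish altogether. *)
Let poly_G T i : poly_fun k (G T i).
case: (posnP k) => [e|kp].
 rewrite (_ : G T i = fun=> 0); first exact: poly0.
 by apply/funext => x; rewrite /G /s (poly_dder _ (hP T)).2// mulr0.
rewrite -(prednK kp) -[_.+1]add1n; apply: polyM; first exact: bary_poly.
exact: (poly_dder _ (hP T)).1.
Qed.

Let flux_G T i (phi : pt -> R) : C1 phi -> flux (node T) (node T i) (fun x => G T i x * phi x) = 0.
move=> hphi; apply: (flux_face0 (fm_unit fm T)); first exact: (C1M (poly_C1 (poly_G T i)) hphi).1.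
by move=> x _ xi; rewrite /G xi !mul0r.
Qed.

Let E0 T i : 0 <= E T i. Proof. exact: sqr_ge0. Qed.
(** On the support of the bump all barycentric coordinates are at least kap/2, and the derivative of
    index 0 is zero, so [variance_ge] applies pointwise. *)
Let E_le T i : kap / 2 / 2 * E T i <=
 \int[mu]_(x in cell T) (\sum_j bary (node T) j x * (s T j x - \sum_l bary (node T) l x * s T l x) ^+ 2).
have uT := fm_unit fm T; have r0 : 0 < kap / 2 * h by rewrite mulr_gt0// divr_gt0.
have cs j : continuous (s T j) by exact: (poly_C1 (poly_s T j)).1.
have ceta : continuous (fun x : pt => cbump (cen h kap T) (kap / 2 * h) x * s T i x).
 have := test_C1 (@test_cbump R d setT (cen h kap T) (kap / 2 * h) 0 k (s T i) r0 (poly_s T i) (fun _ _ => I)).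
 by case.
rewrite /E nrm_sq -(@ip_mkcond _ _ (cell T)); last 2 first.
- by [].
- move=> x _ nT; rewrite cbump_out ?mul0r//; rewrite ltNge; apply/negP => hx; apply: nT.
 by apply: (cen_ball fm); apply: le_trans hx _; rewrite ler_wpM2r ?(ltW h0)//; have := k0; lra.
rewrite /ip -RintegralZl; last 2 first.
- exact: (mcell fm).
- by apply: (int_simplex uT) => x; exact: (cvgM (ceta x) (ceta x)).
have cm : continuous (fun x => \sum_l bary (node T) l x * s T l x).
 by apply: cont_sum => l x; apply: (cvgM (@bary_cont _ _ (node T) l x) (cs l x)).
apply: le_Rintegral.
- exact: (mcell fm).
- apply: (int_simplex uT) => x.
 exact: (cvgM (@cst_continuous _ _ _ x) (cvgM (ceta x) (ceta x))).
- apply: (int_simplex uT); apply: cont_sum => j x.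
 exact: (cvgM (@bary_cont _ _ (node T) j x) (cvgM (cvgB (cs j x) (cm x)) (cvgB (cs j x) (cm x)))).
- move=> x Tx; have [hx|hx] := leP `|x - cen h kap T| (kap / 2 * h); last first.
  rewrite cbump_out// !mul0r mulr0; apply: sumr_ge0 => j _; rewrite mulr_ge0 ?sqr_ge0//.
  exact: ((simplexP uT x).1 Tx).
 apply: le_trans (@variance_ge _ _ (fun j => bary (node T) j x) (fun j => s T j x) (kap / 2) ord0 i _ _ _).
 + rewrite ler_wpM2l//; first by rewrite !divr_ge0// ltW.
  rewrite -expr2 exprMn ler_piMl ?sqr_ge0// -[leRHS](expr1n _ 2) ler_sqr ?nnegrE ?cbump_ge0 ?ler01//.
  exact: cbump_le1.
 + by move=> j; exact: (bary_cen fm d0).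
 + by rewrite divr_ge0// ltW.
 + by rewrite /s subrr /dder big1// => l _; rewrite mxE mul0r.
Qed.

Let div_G T : - ip (IT T) (rtdiv G T) (P T) = - \int[mu]_(x in cell T)
 (\sum_j bary (node T) j x * (s T j x - \sum_l bary (node T) l x * s T l x) ^+ 2).
have uT := fm_unit fm T; have CP := poly_C1 (hP T).
have CG T' i : C1 (G T' i) := poly_C1 (poly_G T' i).
have cp l : continuous (pder l (P T)) by have [_ cl] := CP.2 l; exact: cl.
have := cell_green fm (CG T) CP.
rewrite [RHS]big1 => [|i _]; last exact: flux_G.
move=> /eqP; rewrite addrC addr_eq0 => /eqP ->; rewrite opprK.
rewrite (eq_bigr (fun l => ip (cell T) (vcoord (rtf G T) l) (pder l (P T)))) => [|l _]; last first.
 by apply: (ip_cell fm); apply: (L2_cell_cont fm) => //; exact: cont_rtf.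
rewrite -Rintegral_sum; last 2 first.
- exact: (mcell fm).
- move=> l; apply: (int_simplex uT) => x.
 exact: (cvgM (@cont_rtf _ _ M G T l (CG T) x) (cp l x)).
rewrite -mulN1r -RintegralZl; last 2 first.
- exact: (mcell fm).
- have cs j : continuous (s T j) by exact: (poly_C1 (poly_s T j)).1.
 have cm : continuous (fun x => \sum_l bary (node T) l x * s T l x).
  by apply: cont_sum => l x; apply: (cvgM (@bary_cont _ _ (node T) l x) (cs l x)).
 apply: (int_simplex uT); apply: cont_sum => j x.
 exact: (cvgM (@bary_cont _ _ (node T) j x) (cvgM (cvgB (cs j x) (cm x)) (cvgB (cs j x) (cm x)))).
apply: eq_Rintegral => x _; rewrite mulN1r.
rewrite -(@variance_ident _ _ (fun j => bary (node T) j x) (fun j => s T j x) (bary_sum _ x)).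
under eq_bigr do rewrite vcoord_rtf mulr_suml.
rewrite exchange_big /=; apply: eq_bigr => i _.
transitivity (G T i x * dder (x - node T i) (P T) x).
 by rewrite /dder mulr_sumr; apply: eq_bigr => l _; rewrite !mxE mulrA.
by rewrite (dder_comb _ _ _ _ uT); congr (_ * _); apply: eq_bigr => j _; rewrite (dderBdir _ _ (node T ord0)).
Qed.

Let s_le T i x : cell T x -> s T i x ^+ 2 <= Cs * h ^- d * E T i.
Proof. by move=> Tx; apply: hCs => //; rewrite mul1r; exact: (cen_dist fm). Qed.
Let norm_G : nrmv W (pwv Om (rtf G)) ^+ 2 <=
 d%:R * d.+1%:R * h ^+ 2 * Cs * 4%:R ^+ d * \sum_(T in S) \sum_i E T i.
have CG T' i : C1 (G T' i) := poly_C1 (poly_G T' i).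
rewrite nrmv_sqE.
have -> : d%:R * d.+1%:R * h ^+ 2 * Cs * 4%:R ^+ d * \sum_(T in S) \sum_i E T i =
 \sum_(l < d) \sum_(T in S) (d.+1%:R * h ^+ 2 * Cs * 4%:R ^+ d * \sum_i E T i).
 by rewrite sumr_const card_ord -mulr_sumr -[RHS]mulr_natl; ring.
apply: ler_sum => l _; rewrite vcoord_pwv.
have Ll T : T \in S -> L2 (IT T) (vcoord (rtf G T) l).
 by move=> _; apply: (L2_IT_cont fm); exact: cont_rtf.
rewrite (nrm_W fm); last by apply: L2_pw => //; exact: mW_OmT.
apply: ler_sum => T TS.
rewrite (eq_nrm (v := vcoord (rtf G T) l)); last by move=> x Tx; rewrite (pwE fm _ TS Tx).
pose B := d.+1%:R * h ^+ 2 * (Cs * h ^- d * \sum_i E T i).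
have B0 : 0 <= B by rewrite !mulr_ge0 ?sqr_ge0 ?invr_ge0 ?exprn_ge0 ?(ltW h0) ?sumr_ge0.
have := @nrm_bounded R d (IT T) (vcoord (rtf G T) l) (Num.sqrt B) (mIT T).
rewrite (sqr_sqrtr B0) => H; apply: le_trans (H _ _ _) _.
- apply: le_lt_trans (cell_fin fm T); apply: le_measure; rewrite ?inE.
 + exact: mIT.
 + exact: (mcell fm).
 + exact: IT_cell.
- by apply: measurable_funTS; apply: cont_meas; exact: cont_rtf.
- move=> x /IT_cell Tx; rewrite -sqrtr_sqr ler_wsqrtr// vcoord_rtf.
 apply: le_trans (sum_sq_le _ _) _; rewrite card_ord /B -mulrA ler_wpM2l ?ler0n//.
 rewrite mulr_sumr mulr_sumr; apply: ler_sum => i _.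
 rewrite exprMn mulrC; apply: ler_pM; rewrite ?sqr_ge0//.
  rewrite -[leLHS](real_normK (num_real _)) ler_sqr ?nnegrE ?normr_ge0 ?(ltW h0)//.
  have -> : x 0 l - node T i 0 l = (x - node T i) 0 l by rewrite !mxE.
  apply: le_trans (coord_le _ _) _; apply: (fm_diam fm Tx); exact: simplex_node (fm_unit fm T) i.
 apply: le_trans (s_le i Tx); rewrite /G exprMn ler_piMl ?sqr_ge0//.
 have b0 : 0 <= bary (node T) i x := (simplexP (fm_unit fm T) x).1 Tx i.
 by rewrite -[leRHS](expr1n _ 2) ler_sqr ?nnegrE ?ler01//; exact: (bary_le1 (fm_unit fm T)).
- have : fine (mu (IT T)) <= (4 * h) ^+ d.
  apply: le_trans (vol_le fm T); apply: fine_le; rewrite ?ge0_fin_numE ?(cell_fin fm)//.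
   apply: le_lt_trans (cell_fin fm T); apply: le_measure; rewrite ?inE.
   + exact: mIT.
   + exact: (mcell fm).
   + exact: IT_cell.
  apply: le_measure; rewrite ?inE; [exact: mIT|exact: (mcell fm)|exact: IT_cell].
 move=> /(ler_wpM2l B0) /le_trans; apply; rewrite /B exprMn.
 have hd : h ^+ d != 0 by rewrite expf_neq0// gt_eqF.
 le_eq; field; exact: hd.
Qed.

(** A difference of values is a derivative along x - y, a combination of edge derivatives with
    coefficients bounded by 1. Their sizes are absorbed by [sq_absorb], with the bubble field as
    test field. *)
Lemma osc_bound : exists al : elt M -> R, [/\ forall T, 0 <= al T,
 forall T x y, cell T x -> cell T y -> `|P T x - P T y| <= al T &
 \sum_(T in S) al T ^+ 2 <= d.+1%:R * Cs * h ^- d *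
  (d%:R * d.+1%:R * h ^+ 2 * Cs * 4%:R ^+ d * A ^+ 2 / (kap / 2 / 2 / d.+1%:R) ^+ 2)].
pose X := \sum_(T in S) \sum_i E T i.
have X0 : 0 <= X by apply: sumr_ge0 => T _; apply: sumr_ge0.
exists (fun T => Num.sqrt (d.+1%:R * (Cs * h ^- d * \sum_i E T i))); split.
- by move=> T; exact: sqrtr_ge0.
- move=> T x y Tx Ty.
 have [t t01] := C1_segment_MVT y (x - y) (poly_C1 (hP T)); rewrite (addrC y) subrK => ->.
 have Tz : cell T (y + t *: (x - y)) by exact: (simplex_conv (fm_unit fm T)).
 set z := y + _ in Tz *.
 rewrite -sqrtr_sqr ler_wsqrtr//.
 have -> : dder (x - y) (P T) z = \sum_i (bary (node T) i x - bary (node T) i y) * s T i z.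
  rewrite (dderBdir x y (node T ord0)) !(dder_comb _ _ _ _ (fm_unit fm T)) -sumrB.
  by apply: eq_bigr => i _; rewrite /s mulrBl.
 apply: le_trans (sum_sq_le _ _) _; rewrite card_ord ler_wpM2l ?ler0n// mulr_sumr.
 apply: ler_sum => i _; apply: le_trans (s_le i Tz); rewrite exprMn ler_piMl ?sqr_ge0//.
 have b0 w : cell T w -> 0 <= bary (node T) i w <= 1.
  move=> Tw; apply/andP; split; last exact: (bary_le1 (fm_unit fm T)).
  exact: (simplexP (fm_unit fm T) w).1 Tw i.
 have /andP[? ?] := b0 _ Tx; have /andP[? ?] := b0 _ Ty.
 rewrite -[leLHS](real_normK (num_real _)) -[leRHS](expr1n _ 2) ler_sqr ?nnegrE ?normr_ge0 ?ler01//.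
 by rewrite ler_norml; apply/andP; split; lra.
- rewrite (eq_bigr (fun T => d.+1%:R * Cs * h ^- d * \sum_i E T i)) => [|T _]; last first.
  by rewrite sqr_sqrtr ?mulrA// !mulr_ge0 ?invr_ge0 ?exprn_ge0 ?(ltW h0) ?sumr_ge0.
 rewrite -mulr_sumr -/X; apply: ler_wpM2l; first by rewrite !mulr_ge0 ?invr_ge0 ?exprn_ge0// ltW.
 apply: (sq_absorb _ X0 A0 (nrmv_ge0 _ _) _ _ norm_G).
 + by rewrite !divr_gt0// ltr0n.
 + by rewrite !mulr_ge0 ?exprn_ge0 ?(ltW h0)// ltW.
 have H : `|\sum_(T in S) ip (IT T) (rtdiv G T) (P T)| <= A * nrmv W (pwv Om (rtf G)).
  apply: HP => // phi tphi; rewrite big1// => T _; rewrite big1// => i _; apply: flux_G.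
  exact: test_C1 tphi.
 apply: le_trans H; apply: le_trans (ler_norm _).
 rewrite mulr_sumr; apply: ler_sum => T _.
 have := div_G T => /oppr_inj ->.
 rewrite mulrAC ler_pdivrMr ?ltr0n//.
 rewrite mulr_sumr; apply: le_trans (_ : _ <= \sum_(i < d.+1) _) _; first by apply: ler_sum => i _; exact: E_le.
 by rewrite /= sumr_const card_ord -[leLHS]mulr_natr.
Qed.

End StepOne.

(** * Jumps of the cell means, boundary facets included *)

Section StepTwo.
Context {R : realType} {d : nat}.
Local Notation pt := 'rV[R]_d.
Local Notation mu := (leb d).
Context (M : mesh R d) (h kap : R) (fm : fat_mesh M h kap) (d0 : (0 < d)%N) (Om : set pt).
Local Notation S := (active M Om).
Local Notation W := (OmT M Om).
Local Notation IT T := (interior (cell T)).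
Let h0 := fm_h fm. Let k0 := fm_kap fm.
Implicit Types T : elt M.
Lemma adjacent_shared T T' : Defs.adjacent T T' -> exists i, shared T T' = [set~ i]%SET.
move=> /andP[_ /eqP c]; have : #|~: shared T T'| == 1%N.
 have := cardsC (shared T T'); rewrite c card_ord; move: #|_| => n.
 by rewrite -addn1 => /addnI ->.
move=> /cards1P[i e]; exists i; by rewrite -[LHS]finset.setCK e.
Qed.

Lemma shared_sym T T' i : shared T T' = [set~ i]%SET -> exists s : 'I_d.+1 -> 'I_d.+1,
 [/\ injective s, forall j, j != i -> node T j = node T' (s j) & shared T' T = [set~ s i]%SET].
move=> e; have [s [si hs]] := facet_match fm e; exists s; split=> //.
apply/setP => j'; rewrite !inE; apply/existsP/idP.
 move=> [j /eqP hj]; apply/eqP => jj.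
 have [ji|ji] := eqVneq j i.
  have : i \in shared T T' by rewrite inE; apply/existsP; exists j'; rewrite hj ji.
  by rewrite e !inE eqxx.
 move: hj; rewrite hs// => /(node_inj (fm_unit fm T')); rewrite jj => /si ij.
 by move: ji; rewrite ij eqxx.
move=> hj; have [t st ts] := injF_bij si.
exists (t j'); rewrite hs ?ts//; apply: contraNneq hj => <-; by rewrite ts.
Qed.

Lemma setC1_inj (I : finType) : injective (fun i : I => [set~ i]%SET).
Proof. by move=> i j /finset.setC_inj/set1_inj. Qed.
(** Rewrites a quantity attached to a facet of a cell as a weight on pairs of cells, zero unless the
    pair shares a facet, so that double sums over pairs can be symmetrised. *)
Definition jump_weight (F : elt M -> 'I_d.+1 -> R) T T' :=
 \sum_i (if shared T T' == [set~ i]%SET then F T i else 0).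
Lemma jump_weightE F T T' i : shared T T' = [set~ i]%SET -> jump_weight F T T' = F T i.
move=> e; rewrite /jump_weight (bigD1 i)//= e eqxx big1 ?addr0// => j ji.
by case: eqP => // /setC1_inj ij; rewrite ij eqxx in ji.
Qed.

Lemma jump_weight_sym F : (forall T T' i i', shared T T' = [set~ i]%SET ->
  shared T' T = [set~ i']%SET -> F T i = F T' i') ->
 forall T T', jump_weight F T T' = jump_weight F T' T.
move=> hF T T'; have [[i e]|n] := pselect (exists i, shared T T' = [set~ i]%SET).
 have [s [_ _ e']] := shared_sym e.
 by rewrite (jump_weightE _ e) (jump_weightE _ e'); exact: hF.
rewrite /jump_weight !big1// => i _; case: eqP => // e.
 by case: n; have [s [_ _ e']] := shared_sym e; exists (s i).
by case: n; exists i.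
Qed.

(** Exchanging the two cells changes the sign of the difference and keeps the weight: a discrete
    integration by parts, with 1/2 because each pair is counted twice. *)
Lemma antisym_sum (m : elt M -> R) (n : elt M -> elt M -> R) : (forall T T', n T T' = n T' T) ->
 \sum_(T in S) \sum_(T' in S) (m T - m T') * n T T' = 0 /\
 \sum_(T in S) \sum_(T' in S) (m T - m T') * n T T' * m T =
  2^-1 * \sum_(T in S) \sum_(T' in S) (m T - m T') ^+ 2 * n T T'.
move=> ns; split.
 set X := \sum_(T in S) _; suff : X = - X by move=> ?; lra.
 rewrite {1}/X exchange_big /= /X -sumrN; apply: eq_bigr => T _; rewrite -sumrN; apply: eq_bigr => T' _.
 by rewrite ns; ring.
set X := \sum_(T in S) _; have -> : X = 2^-1 * (X + X) by lra.
congr (_ * _); rewrite {2}/X exchange_big /= -big_split; apply: eq_bigr => T _ /=.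
by rewrite -big_split; apply: eq_bigr => T' _ /=; rewrite (ns T' T); ring.
Qed.

Context (k : nat) (P : elt M -> pt -> R) (A : R) (hP : forall T, poly_fun k (P T)) (A0 : 0 <= A)
 (HP : forall G : elt M -> 'I_d.+1 -> pt -> R, (forall T i, poly_fun k (G T i)) ->
 (forall phi, test_fun W phi ->
  \sum_(T in S) \sum_i flux (node T) (node T i) (fun x => G T i x * phi x) = 0) ->
 `|\sum_(T in S) ip (IT T) (rtdiv G T) (P T)| <= A * nrmv W (pwv Om (rtf G))).
Definition mean T : R := (\int[mu]_(x in cell T) P T x) / vol T.
Local Notation m := mean.
Lemma mean_osc T x (al : R) : cell T x -> (forall y, cell T y -> `|P T x - P T y| <= al) -> `|P T x - m T| <= al.
move=> Tx hal; have v0 := vol_gt0 fm T; have uT := fm_unit fm T.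
have cP : continuous (P T) by exact: (poly_C1 (hP T)).1.
have mT := mcell fm T.
have i1 := int_simplex uT cP.
have i2 : mu.-integrable (cell T) (EFin \o (fun=> P T x)).
 by apply: (int_simplex uT); exact: cst_continuous.
have i3 : mu.-integrable (cell T) (EFin \o (fun y => P T x - P T y)).
 by apply: (int_simplex uT) => y; exact: (cvgB (@cst_continuous _ _ _ y) (cP y)).
have -> : P T x - m T = (\int[mu]_(y in cell T) (P T x - P T y)) / vol T.
 by rewrite RintegralB// Rintegral_cst// mulrBl mulfK// gt_eqF.
rewrite normrM (gtr0_norm (x := (vol T)^-1)) ?invr_gt0// ler_pdivrMr//.
apply: le_trans (le_normr_Rintegral mT i3) _.
have -> : al * vol T = \int[mu]_(y in cell T) al by rewrite Rintegral_cst.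
apply: le_Rintegral => //.
- have c3 : continuous (fun y => P T x - P T y).
  by move=> y; exact: (cvgB (@cst_continuous _ _ _ y) (cP y)).
 by apply: (int_simplex uT) => y; exact: (cvg_norm (c3 y)).
- by apply: (int_simplex uT); exact: cst_continuous.
Qed.

(** The jump of the means across facet i, with the value outside the active mesh taken to be 0. That
    value is natural because discrete fields have a free normal trace on the boundary of the active
    domain. *)
Let sv T i : R := \sum_(T' in S | shared T T' == [set~ i]%SET) (m T - m T') + (if bfacet S T i then m T else 0).
(** Dividing by the volume makes the flux of the constant field through a facet the same from both
    sides, by [flux_match]; the jumps have opposite signs there, so the field is conforming. *)
Let G T i : pt -> R := fun=> sv T i / vol T.
Let sv_sq T i : sv T i ^+ 2 =
 \sum_(T' in S | shared T T' == [set~ i]%SET) (m T - m T') ^+ 2 + (if bfacet S T i then m T ^+ 2 else 0).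
rewrite /sv; case: ifPn => [/forallP b|/bfacetPn[T' T'S e]].
 have F T' : ~~ ((T' \in S) && (shared T T' == [set~ i]%SET)).
  by have := b T'; rewrite negb_and; case: (T' \in S).
 by rewrite !big1 ?add0r// => T' /(negP (F T')).
rewrite !addr0 (bigD1 T') ?T'S ?e ?eqxx//= big1 ?addr0 => [|T'' /andP[/andP[_ /eqP e'] n]]; last first.
 by move: n; rewrite (facet_uniq fm d0 e e') eqxx.
rewrite (bigD1 T') ?T'S ?e ?eqxx//= big1 ?addr0// => T'' /andP[/andP[_ /eqP e'] n].
by move: n; rewrite (facet_uniq fm d0 e e') eqxx.
Qed.

Let sum_sv (F : elt M -> 'I_d.+1 -> R) T : \sum_i sv T i * F T i =
 \sum_(T' in S) (m T - m T') * jump_weight F T T' + \sum_i (if bfacet S T i then m T * F T i else 0).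
rewrite (eq_bigr (fun i => \sum_(T' in S) (m T - m T') * (if shared T T' == [set~ i]%SET then F T i else 0) +
  (if bfacet S T i then m T * F T i else 0))) => [|i _]; last first.
 rewrite /sv mulrDl; congr (_ + _); last by case: ifP; rewrite ?mul0r.
 by rewrite mulr_suml big_mkcondr; apply: eq_bigr => T' _; case: ifP; rewrite ?mulr0.
rewrite big_split /=; congr (_ + _); rewrite exchange_big /=; apply: eq_bigr => T' _.
by rewrite /jump_weight mulr_sumr.
Qed.

Let conf phi : test_fun W phi ->
 \sum_(T in S) \sum_i flux (node T) (node T i) (fun x => G T i x * phi x) = 0.
move=> tphi; have Cphi := test_C1 tphi.
pose F T i := flux (node T) (node T i) phi / vol T.
rewrite (eq_bigr (fun T => \sum_(T' in S) (m T - m T') * jump_weight F T T')) => [|T TS]; last first.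
 rewrite (eq_bigr (fun i => sv T i * F T i)) => [|i _]; last first.
  by rewrite /G fluxZ ?(fm_unit fm)// /F mulrAC mulrA.
 rewrite sum_sv [X in _ + X]big1 ?addr0// => i _; case: ifP => // b.
 (* On a boundary facet the test function vanishes, as such points lie outside the open active
    domain. *)
 rewrite /F flux_face0 ?(fm_unit fm)// ?mul0r ?mulr0// => x Tx xi.
 exact: (test_out tphi (bfacet_out fm d0 TS b Tx xi)).
apply: (antisym_sum _ (jump_weight_sym _)).1 => T T' i i' e e'.
have [s [si hs e'']] := shared_sym e.
have <- : s i = i' by apply: setC1_inj; rewrite -e' -e''.
have uT' := edges_reindex si (fm_unit fm T').
have ee := simplex_reindex (node T') si.
have := flux_match (fm_unit fm T) uT' hs Cphi.
rewrite /flux ee => H; rewrite /F /flux.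
move: H; rewrite -/(cell T) -/(cell T') -/(vol T) -/(vol T') /= => H.
have v0 T1 : vol T1 != 0 by rewrite gt_eqF// (vol_gt0 fm).
by apply: (canRL (mulfK (v0 T'))); rewrite mulrAC H mulfK.
Qed.

Let Y T : R := \sum_i sv T i ^+ 2.
Let X : R := \sum_(T in S) Y T.
Let Y0 T : 0 <= Y T. Proof. by apply: sumr_ge0 => i _; exact: sqr_ge0. Qed.
(** An interior jump enters X from both of its cells but the pairing only once, whereas a boundary
    term enters both equally; hence the factor 1/2. *)
Let div_G : d%:R * 2^-1 * X <= \sum_(T in S) ip (IT T) (rtdiv G T) (P T).
have e1 T : ip (IT T) (rtdiv G T) (P T) = d%:R * \sum_i sv T i * m T.
 have cP : continuous (P T) by exact: (poly_C1 (hP T)).1.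
 have eG : rtdiv G T = fun=> d%:R * (\sum_i sv T i) / vol T.
  apply/funext => x; rewrite /rtdiv mulr_sumr mulr_suml; apply: eq_bigr => i _.
  rewrite {2}/G /dder big1 ?addr0 ?mulrA// => l _.
  by rewrite (C1_cst (sv T i / vol T)).2 mulr0.
 rewrite eG (ip_cell fm); [|apply: (L2_cell_cont fm); exact: cst_continuous|exact: (L2_cell_cont fm)].
 rewrite /ip RintegralZl; last 2 first.
 - exact: (mcell fm).
 - exact: (int_simplex (fm_unit fm T) cP).
 by rewrite /mean -mulr_suml; ring.
rewrite (eq_bigr _ (fun T _ => e1 T)) -mulr_sumr -mulrA ler_wpM2l ?ler0n//.
pose F (T : elt M) (i : 'I_d.+1) : R := 1.
have Fs := @jump_weight_sym F (fun _ _ _ _ _ _ => erefl).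
have e2 T : \sum_i sv T i * m T = \sum_(T' in S) (m T - m T') * jump_weight F T T' * m T +
  \sum_i (if bfacet S T i then m T ^+ 2 else 0).
 rewrite -mulr_suml; have -> : \sum_i sv T i = \sum_i sv T i * F T i.
  by apply: eq_bigr => i _; rewrite mulr1.
 rewrite sum_sv mulrDl mulr_suml; congr (_ + _); rewrite mulr_suml; apply: eq_bigr => i _.
 by case: ifP; rewrite /F ?mul0r// mulr1 expr2.
rewrite (eq_bigr _ (fun T _ => e2 T)) big_split /= (antisym_sum m Fs).2.
have e3 T : Y T = \sum_(T' in S) (m T - m T') ^+ 2 * jump_weight F T T' + \sum_i (if bfacet S T i then m T ^+ 2 else 0).
 rewrite /Y; under eq_bigr do rewrite sv_sq.
 rewrite big_split /=; congr (_ + _).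
 under eq_bigr do rewrite big_mkcondr /=.
 rewrite exchange_big /=; apply: eq_bigr => T' _; rewrite /jump_weight mulr_sumr; apply: eq_bigr => i _.
 by case: ifP; rewrite ?mulr0 ?mulr1.
rewrite /X (eq_bigr _ (fun T _ => e3 T)) big_split /= mulrDr lerD2l.
set Z := \sum_(T in S) \sum_i _; have : 0 <= Z by do 2![apply: sumr_ge0 => ? _]; case: ifP => // _; exact: sqr_ge0.
lra.
Qed.

Let norm_G : nrmv W (pwv Om (rtf G)) ^+ 2 <= d%:R * (d.+1%:R * h ^+ 2 / (2 * (kap * h)) ^+ d) * X.
have CG T' i : C1 (G T' i) by exact: (C1_cst _).1.
have kh : 0 < (2 * (kap * h)) ^+ d by rewrite exprn_gt0// !mulr_gt0.
rewrite nrmv_sqE.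
have -> : d%:R * (d.+1%:R * h ^+ 2 / (2 * (kap * h)) ^+ d) * X =
 \sum_(l < d) \sum_(T in S) (d.+1%:R * h ^+ 2 / (2 * (kap * h)) ^+ d * Y T).
 by rewrite sumr_const card_ord -mulr_sumr -[RHS]mulr_natl -/X; ring.
apply: ler_sum => l _; rewrite vcoord_pwv.
have Ll T : T \in S -> L2 (IT T) (vcoord (rtf G T) l).
 by move=> _; apply: (L2_IT_cont fm); exact: cont_rtf.
rewrite (nrm_W fm); last by apply: L2_pw => //; exact: mW_OmT.
apply: ler_sum => T TS; have v0 := vol_gt0 fm T.
rewrite (eq_nrm (v := vcoord (rtf G T) l)); last by move=> x Tx; rewrite (pwE fm _ TS Tx).
pose B := d.+1%:R * h ^+ 2 * (Y T / vol T ^+ 2).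
have B0 : 0 <= B.
 apply: mulr_ge0; apply: mulr_ge0; [exact: ler0n|exact: sqr_ge0|exact: Y0|].
 by rewrite invr_ge0 sqr_ge0.
have := @nrm_bounded R d (IT T) (vcoord (rtf G T) l) (Num.sqrt B) (mIT T).
have mle : (mu (IT T) <= mu (cell T))%E.
 apply: le_measure; rewrite ?inE; [exact: mIT|exact: (mcell fm)|exact: IT_cell].
have mfin : (mu (IT T) < +oo)%E by apply: le_lt_trans mle (cell_fin fm T).
rewrite (sqr_sqrtr B0) => H; apply: le_trans (H mfin _ _) _.
- by apply: measurable_funTS; apply: cont_meas; exact: cont_rtf.
- move=> x /IT_cell Tx; rewrite -sqrtr_sqr ler_wsqrtr// vcoord_rtf.
 apply: le_trans (sum_sq_le _ _) _; rewrite card_ord /B -mulrA ler_wpM2l ?ler0n//.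
 rewrite /Y mulr_suml mulr_sumr; apply: ler_sum => i _.
 rewrite exprMn mulrC exprMn exprVn; apply: ler_wpM2r; first by rewrite mulr_ge0 ?invr_ge0 ?sqr_ge0.
 rewrite -[leLHS](real_normK (num_real _)) ler_sqr ?nnegrE ?normr_ge0 ?(ltW h0)//.
 have -> : x 0 l - node T i 0 l = (x - node T i) 0 l by rewrite !mxE.
 apply: le_trans (coord_le _ _) _; apply: (fm_diam fm Tx); exact: simplex_node (fm_unit fm T) i.
- have : fine (mu (IT T)) <= vol T by apply: fine_le; rewrite ?ge0_fin_numE ?(cell_fin fm).
 move=> /(ler_wpM2l B0) /le_trans; apply; rewrite /B.
 have -> : d.+1%:R * h ^+ 2 * (Y T / vol T ^+ 2) * vol T = d.+1%:R * h ^+ 2 * Y T / vol T.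
  by field; rewrite gt_eqF.
 rewrite [leRHS]mulrAC; apply: ler_wpM2l.
  by apply: mulr_ge0; [apply: mulr_ge0; [exact: ler0n|exact: sqr_ge0]|exact: Y0].
 by rewrite lef_pV2 ?posrE// (vol_ge fm).
Qed.

Lemma jump_bound : exists be : elt M -> R, [/\ forall T, 0 <= be T,
 forall T T', T \in S -> T' \in S -> Defs.adjacent T T' -> `|m T - m T'| <= be T,
 forall T i, T \in S -> bfacet S T i -> `|m T| <= be T &
 \sum_(T in S) be T ^+ 2 <=
  d%:R * (d.+1%:R * h ^+ 2 / (2 * (kap * h)) ^+ d) * A ^+ 2 / (d%:R * 2^-1) ^+ 2].
exists (fun T => Num.sqrt (Y T)); split.
- by move=> T; exact: sqrtr_ge0.
- move=> T T' TS T'S /adjacent_shared[i e]; rewrite -sqrtr_sqr ler_wsqrtr// /Y (bigD1 i)//= sv_sq.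
 rewrite (bigD1 T') ?T'S ?e ?eqxx//= -!addrA lerDl !addr_ge0//.
 + by apply: sumr_ge0 => ? _; exact: sqr_ge0.
 + by case: ifP => // _; exact: sqr_ge0.
 + by apply: sumr_ge0 => ? _; exact: sqr_ge0.
- move=> T i TS b; rewrite -sqrtr_sqr ler_wsqrtr// /Y (bigD1 i)//= sv_sq b addrAC lerDr addr_ge0//.
 + by apply: sumr_ge0 => ? _; exact: sqr_ge0.
 + by apply: sumr_ge0 => ? _; exact: sqr_ge0.
- rewrite (eq_bigr Y) => [|T _]; last by rewrite sqr_sqrtr.
 have X0 : 0 <= X by exact: sumr_ge0.
 apply: (sq_absorb _ X0 A0 (nrmv_ge0 _ _) _ _ norm_G).
 + by rewrite divr_gt0// ltr0n.
 + by rewrite !mulr_ge0 ?invr_ge0 ?exprn_ge0 ?mulr_ge0 ?(ltW h0)// ltW.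
 apply: le_trans div_G _; apply: le_trans (ler_norm _) _.
 by apply: HP; [move=> T i; exact: poly_cst|exact: conf].
Qed.

End StepTwo.

(** * Counting by volume *)

Section Count.
Context {R : realType} {d : nat}.
Local Notation pt := 'rV[R]_d.
Local Notation mu := (leb d).
(** Disjoint cubes of half-width r are packed in one cube of half-width R0 + r. This bounds the
    number of active grid functions at a point and the overlap of cell neighbourhoods. *)
Lemma count_boxes (I : finType) (P : pred I) (z : I -> pt) (r R0 : R) (x0 : pt) : 0 < r -> 0 <= R0 ->
 (forall i j, P i -> P j -> i != j ->
   obox (z i - const_mx r) (z i + const_mx r) `&` obox (z j - const_mx r) (z j + const_mx r) = set0) ->
 (forall i, P i -> `|z i - x0| <= R0) -> #|P|%:R <= ((R0 + r) / r) ^+ d.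
move=> r0 R00 dis hz.
pose B i : set pt := obox (z i - const_mx r) (z i + const_mx r).
have mB i : measurable (B i) by exact: mobox.
have vB i : mu (B i) = ((2 * r) ^+ d)%:E.
 rewrite leb_obox; last by move=> l; rewrite !mxE; lra.
 rewrite (eq_bigr (fun=> 2 * r)) => [|l _]; last by rewrite !mxE; ring.
 by rewrite prodr_const card_ord.
have H (s : seq I) : uniq s -> all P s ->
  mu (\big[setU/set0]_(i <- s) B i) = ((size s)%:R * (2 * r) ^+ d)%:E.
 elim: s => [|i s IH] /=; first by rewrite big_nil measure0 mul0r.
 move=> /andP[ins us] /andP[Pi Ps]; rewrite big_cons measureU//; last 2 first.
 - by apply: bigsetU_measurable => j _.
 - apply/seteqP; split => // x [xi]; rewrite -bigcup_seq => -[j /= js xj].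
  have ij : i != j by apply: contraNneq ins => ->.
  have /seteqP[e _] := dis i j Pi (allP Ps j js) ij; exact: (e x).
 transitivity (((2 * r) ^+ d)%:E + ((size s)%:R * (2 * r) ^+ d)%:E)%E.
  congr (_ + _)%E; [exact: vB|exact: IH].
 by rewrite -EFinD; congr EFin; rewrite -addn1 natrD; ring.
have Rr : 0 < R0 + r by rewrite ltr_wpDl.
have := H (enum P) (enum_uniq _) _; rewrite -cardE => h.
pose B0 : set pt := obox (x0 - const_mx (R0 + r)) (x0 + const_mx (R0 + r)).
have : (mu (\big[setU/set0]_(i <- enum P) B i) <= mu B0)%E.
 apply: le_measure; rewrite ?inE; [by apply: bigsetU_measurable|exact: mobox|].
 move=> x; rewrite -bigcup_seq => -[i /=]; rewrite mem_enum => Pi xi l.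
 have := xi l; have := le_trans (coord_le (z i - x0) l) (hz i Pi).
 rewrite !mxE ler_norml => /andP[? ?] /andP[? ?]; apply/andP; split; lra.
rewrite h; last by apply/allP => i; rewrite mem_enum.
rewrite /B0 leb_obox; last by move=> l; rewrite !mxE; lra.
rewrite (eq_bigr (fun=> 2 * (R0 + r))) => [|l _]; last by rewrite !mxE; ring.
rewrite prodr_const card_ord lee_fin -ler_pdivlMr ?exprn_gt0 ?mulr_gt0// => h'.
apply: le_trans h' _; rewrite -exprVn -exprMn; le_eq; congr (_ ^+ _).
by field; rewrite gt_eqF.
Qed.

End Count.

(** * Oscillation of cell values over a convex set *)

Section Oscillation.
Context {R : realType} {d : nat}.
Local Notation pt := 'rV[R]_d.
Context (M : mesh R d) (h kap : R) (fm : fat_mesh M h kap) (Om : set pt).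
Local Notation S := (active M Om).
Local Notation W := (OmT M Om).
Implicit Types (T : elt M) (U : set pt).
Context (m del : elt M -> R) (del0 : forall T, 0 <= del T)
 (mdel : forall T T', T \in S -> T' \in S -> Defs.adjacent T T' -> `|m T - m T'| <= del T)
 (mbd : forall T i, T \in S -> bfacet S T i -> `|m T| <= del T).
Definition meeting U : {set elt M} := [set T in S | `[< exists2 y, cell T y & U y >]]%SET.
Lemma meetingP U T : T \in meeting U <-> T \in S /\ exists2 y, cell T y & U y.
Proof. by rewrite inE; split => [/andP[? /asboolP]//|[-> /asboolP]]. Qed.
Let adjin U := [rel T T' | [&& T \in meeting U, T' \in meeting U & Defs.adjacent T T']].
Lemma path_osc U T T' : T \in meeting U -> connect (adjin U) T T' ->
 T' \in meeting U /\ `|m T - m T'| <= \sum_(T in meeting U) del T.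
move=> TU /connectP[p pp ->]; case/shortenP: pp => p' pp' up _.
have all_in : all (fun T => T \in meeting U) p'.
 by elim: p' T {TU up} pp' => //= T1 q IH T /andP[/and3P[_ T1U _] /IH ->]; rewrite T1U.
split; first by have := mem_last T p'; rewrite inE => /orP[/eqP ->//|]; exact: (allP all_in).
apply: (@le_trans _ _ (\sum_(t <- T :: p') del t)).
 elim: p' T {TU up all_in} pp' => [|T1 q IH] T /=.
  by rewrite subrr normr0 big_seq1 => _.
 move=> /andP[/and3P[/meetingP[TS _] /meetingP[T1S _] adj] /IH h1].
 rewrite big_cons; apply: le_trans (lerD (mdel TS T1S adj) h1).
 have -> : m T - m (last T1 q) = (m T - m T1) + (m T1 - m (last T1 q)) by ring.
 exact: ler_normD.
rewrite big_uniq//= [leRHS](bigID (mem (T :: p'))) /= -[leLHS]addr0; apply: lerD.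
 le_eq; apply: eq_bigl => t.
 rewrite andbC; case: (boolP (t \in T :: p')) => //=; rewrite inE => /orP[/eqP ->|/(allP all_in) ->]//.
by apply: sumr_ge0.
Qed.

(** Consider the cells reached from T0 by crossing facets within U. If one of them has a boundary
    facet, the value at T0 is small by the boundary bound along a path. If none has,
    [connected_cover] makes them cover U, so U lies in the active domain and every cell meeting U
    has been reached. No information on the shape of the active domain is needed. *)
Lemma osc_or U T0 : open U -> cvx U -> T0 \in meeting U ->
 `|m T0| <= 2 * \sum_(T in meeting U) del T \/
 (U `<=` W /\ forall T, T \in meeting U -> `|m T0 - m T| <= \sum_(T in meeting U) del T).
move=> oU cU T0U; set D := \sum_(T in _) _.
have [[T [i [cT b]]]|nb] := pselect (exists T i, connect (adjin U) T0 T /\ bfacet S T i).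
 left; have [TU h1] := path_osc T0U cT; have /meetingP[TS _] := TU.
 have h2 : del T <= D by rewrite /D (bigD1 T)//= lerDl sumr_ge0.
 have -> : m T0 = (m T0 - m T) + m T by ring.
 apply: le_trans (ler_normD _ _) _; have := mbd TS b; move: h1 h2; rewrite -/D; lra.
right; pose A := [set T in meeting U | connect (adjin U) T0 T]%SET.
have cov : U `<=` cells A.
 apply: (connected_cover fm (S := S)) => //.
 - by apply/fintype.subsetP => T; rewrite inE => /andP[/meetingP[]].
 - by move=> T; rewrite inE => /andP[/meetingP[]].
 - by apply/finset.set0Pn; exists T0; rewrite inE T0U connect0.
 - move=> T T'; rewrite inE => /andP[TU cT] T'S adj T'U.
  have T'm : T' \in meeting U by apply/meetingP.
  by rewrite inE T'm (connect_trans cT)// connect1//= TU T'm.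
 - by move=> T i; rewrite inE => /andP[TU cT]; apply/negP => b; apply: nb; exists T, i.
split.
 move=> x Ux; apply: (@interiorS _ U).
  by move=> y /cov[T]; rewrite inE => /andP[/meetingP[TS _] _] Ty; exists T.
 by apply: open_nbhs_nbhs.
move=> T TU; have /meetingP[TS mT] := TU.
have [x [Tx Ux]] := cell_meet_interior fm oU mT.
have [T' ] := cov x Ux; rewrite inE => /andP[T'U cT'] T'x.
by rewrite (interior_disj fm Tx T'x); exact: (path_osc T0U cT').2.
Qed.

Lemma osc_meeting U T T' : open U -> cvx U -> T \in meeting U -> T' \in meeting U ->
 `|m T - m T'| <= 4 * \sum_(T in meeting U) del T.
move=> oU cU TU T'U; set D := \sum_(T in _) _.
have D0 : 0 <= D by exact: sumr_ge0.
have [h1|[_ h1]] := osc_or oU cU TU; last by apply: le_trans (h1 _ T'U) _; rewrite -/D; lra.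
have [h2|[_ h2]] := osc_or oU cU T'U; last by rewrite distrC; apply: le_trans (h2 _ TU) _; rewrite -/D; lra.
by apply: le_trans (ler_normB _ _) _; move: h1 h2; rewrite -/D; lra.
Qed.

(** The value 0 for sets that leave the active domain keeps the approximation compactly supported;
    by [osc_or] all cell values are small there, so nothing is lost. *)
Definition local_value U : R :=
 if `[< U `<=` W >] then (if [pick T in meeting U] is Some T then m T else 0) else 0.
Lemma local_value_osc U T : open U -> cvx U -> T \in meeting U ->
 `|m T - local_value U| <= 4 * \sum_(T in meeting U) del T.
move=> oU cU TU; rewrite /local_value; case: asboolP => UW.
 by case: pickP => [T' T'U|/(_ T)]; [exact: osc_meeting|rewrite TU].
rewrite subr0; have [h1|[/UW//]] := osc_or oU cU TU.
apply: le_trans h1 _; have : 0 <= \sum_(T in meeting U) del T by exact: sumr_ge0.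
lra.
Qed.

Lemma local_value_neq0 U : local_value U != 0 -> U `<=` W.
Proof. by rewrite /local_value; case: asboolP; rewrite ?eqxx. Qed.
End Oscillation.

(** * A smooth partition of unity by integer translates *)

Section Partition.
Context {R : realType} {d : nat}.
Local Notation pt := 'rV[R]_d.
(** A difference of two steps shifted by one, so that the sum over integer translates telescopes.
    The form 1 * t + b is the one to which [smooth1_comp] applies. *)
Definition theta (t : R) : R := step (1 * t + 1) - step (1 * t + 0).
Lemma smooth1_theta : smooth1 theta.
rewrite /theta (_ : (fun t : R => _) = fun t => step (1 * t + 1) + -1 * step (1 * t + 0)); last first.
 by apply/funext => t; rewrite mulN1r.
apply: smooth1D; first exact: (@smooth1_comp _ _ 1 1 (@smooth1_step R)).
apply: smooth1M; first exact: smooth1C.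
exact: (@smooth1_comp _ _ 1 0 (@smooth1_step R)).
Qed.

Lemma theta_out t : 1 <= `|t| -> theta t = 0.
rewrite /theta !mul1r addr0 ler_normr => /orP[|] h.
 by rewrite !step1 ?subrr//; lra.
by rewrite !step0 ?subrr//; lra.
Qed.

(** The telescope ends at step(t + N + 2) = 1 and step(t - N) = 0, which is why 2(N + 1) translates
    are taken. *)
Lemma theta_sum (N : nat) t : `|t| <= N%:R -> 
 \sum_(n < (2 * N.+1)%N) theta (t + N.+1%:R - n%:R) = 1.
rewrite ler_norml => /andP[t1 t2].
rewrite (eq_bigr (fun n : 'I__ => - (step (t + N.+1%:R + 1 - n.+1%:R) - step (t + N.+1%:R + 1 - n%:R)))) => [|n _].
 rewrite sumrN -(big_mkord xpredT (fun n => step (t + N.+1%:R + 1 - n.+1%:R) - step (t + N.+1%:R + 1 - n%:R))).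
 rewrite telescope_sumr// step0 ?step1; first by rewrite sub0r opprK.
 - by rewrite subr0 -natr1; lra.
 - by rewrite natrM -natr1; lra.
rewrite /theta !mul1r opprB; congr (step _ - step _); rewrite -?natr1; ring.
Qed.

Definition Theta : pt -> R := prodf (fun=> theta).
Lemma Theta_out x : 1 < `|x| -> Theta x = 0.
move=> x1; apply/eqP/negPn/negP; rewrite /Theta /prodf => /prodf_neq0 h'.
move: x1; rewrite ltNge => /negP; apply; apply/row_normP => // i; rewrite leNgt.
by apply: contra (h' i isT) => /ltW /theta_out ->.
Qed.

End Partition.

(** * Smoothing a piecewise function on a grid of width h *)

Section Approx.
Context {R : realType} {d : nat}.
Local Notation pt := 'rV[R]_d.
Lemma open_obox (a b : pt) : open (obox a b).
have -> : obox a b = \big[setI/setT]_(i < d) ((fun x : pt => x 0 i) @^-1` [set t | a 0 i < t < b 0 i]).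
 apply/seteqP; split => x /=.
  by move=> h; rewrite -bigcap_seq => i _; exact: h.
 by rewrite -bigcap_seq => h i; apply: h; rewrite /= mem_index_enum.
elim/big_ind: _ => [|A B|i _]; [exact: openT|exact: openI|].
apply: open_comp; first by move=> x _; exact: coord_continuous.
rewrite (_ : [set t | _] = [set t | a 0 i < t] `&` [set t | t < b 0 i]).
 by apply: openI; [exact: open_gt|exact: open_lt].
by apply/seteqP; split => t /= => [/andP[]|[-> ->]].
Qed.

Lemma smooth_Theta_affine (c : pt) (t : R) : smooth (fun x : pt => Theta (c + t *: x)).
have -> : (fun x : pt => Theta (c + t *: x)) = prodf (fun i s => theta (t * s + c 0 i)).
 by apply/funext => x; rewrite /Theta /prodf; apply: eq_bigr => i _; rewrite !mxE addrC.
by apply: smooth_prodf => i; exact: smooth1_comp (@smooth1_theta R).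
Qed.

Lemma Theta_pder_bounded : exists2 K, 0 <= K & forall i (x : pt), `|pder i Theta x| <= K.
have sT : smooth (Theta : pt -> R).
 have := smooth_Theta_affine 0 1; rewrite (_ : (fun x => _) = Theta)//.
 by apply/funext => x; rewrite add0r scale1r.
have bT : bsupp (Theta : pt -> R) by exists 1 => x; exact: Theta_out.
have /choice[K hK] i : exists K, 0 <= K /\ forall x : pt, `|pder i Theta x| <= K.
 have [K K0 hK] := bsupp_bounded ((smooth_C1 sT).2 i).2 (bsupp_pder i bT); by exists K.
exists (\sum_i K i); first by apply: sumr_ge0 => i _; exact: (hK i).1.
move=> i x; apply: le_trans ((hK i).2 x) _; rewrite (bigD1 i)//= lerDl.
by apply: sumr_ge0 => j _; exact: (hK j).1.
Qed.

Lemma Theta_le1 (x : pt) : `|Theta x| <= 1.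
rewrite /Theta /prodf normr_prod; apply: prodr_ile1 => i _; rewrite normr_ge0 /theta /=.
have h1 := @step_ge0 R (1 * x 0 i + 1); have h2 := @step_le1 R (1 * x 0 i + 1).
have h3 := @step_ge0 R (1 * x 0 i + 0); have h4 := @step_le1 R (1 * x 0 i + 0).
by rewrite ler_norml; apply/andP; split; lra.
Qed.

Context (M : mesh R d) (h kap : R) (fm : fat_mesh M h kap) (d0 : (0 < d)%N) (Om : set pt).
Local Notation S := (active M Om).
Local Notation W := (OmT M Om).
Local Notation IT T := (interior (cell T)).
Let h0 := fm_h fm. Let k0 := fm_kap fm.
Implicit Types T : elt M.
Context (P : elt M -> pt -> R) (m del : elt M -> R) (K1 : R) (K10 : 0 <= K1)
 (hK1 : forall i (x : pt), `|pder i Theta x| <= K1) (del0 : forall T, 0 <= del T)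
 (mdel : forall T T', T \in S -> T' \in S -> Defs.adjacent T T' -> `|m T - m T'| <= del T)
 (mbd : forall T i, T \in S -> bfacet S T i -> `|m T| <= del T)
 (hPm : forall T x, T \in S -> cell T x -> `|P T x - m T| <= del T) (N : nat)
 (hN : forall x, W x -> `|x| < N%:R * h).
(** For a point of [T] in the support of a grid function, every cell meeting the corresponding ball
    [U j] has its centre at distance less than h + h + 2h + h from that of [T]; 6h leaves room. *)
Definition near_osc T : R := \sum_(T' in S | `|cen h kap T - cen h kap T'| <= 6 * h) del T'.
Let J := {ffun 'I_d -> 'I_(2 * N.+1)}.
Let g (j : J) : pt := \row_i ((j i)%:R - N.+1%:R).
Let psi (j : J) : pt -> R := fun x => Theta (- g j + h^-1 *: x).
(** Radius 2h, while the grid function is supported in radius h: its support is then a compact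
    subset of the open set [U j]. *)
Let U (j : J) : set pt := [set y | `|y - h *: g j| < 2 * h].
Let argE j (x : pt) : - g j + h^-1 *: x = h^-1 *: (x - h *: g j).
Proof. by rewrite scalerBr scalerA mulVf ?gt_eqF// scale1r addrC. Qed.
Let psi_out j x : h < `|x - h *: g j| -> psi j x = 0.
move=> hx; rewrite /psi argE Theta_out// normrZ gtr0_norm ?invr_gt0// mulrC ltr_pdivlMr// mul1r.
exact: hx.
Qed.

Let psi_test j : U j `<=` W -> test_fun W (psi j).
move=> UW; split; first exact: smooth_Theta_affine.
exists (cbox (h *: g j - const_mx h) (h *: g j + const_mx h)); split; first exact: compact_cbox.
 move=> x /(cbox_ball _ _ (ltW h0)) hx; apply: UW; rewrite /U /=; apply: le_lt_trans hx _.
 by have := h0; lra.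
move=> x hx; apply: psi_out; rewrite ltNge; apply/negP => hx'; apply: hx.
by apply/(cbox_ball _ _ (ltW h0)).
Qed.

Let openU j : open (U j).
have -> : U j = ball (h *: g j : pt) (2 * h); last exact: ball_open.
by rewrite mx_norm_ball; apply/seteqP; split => y; rewrite /U /ball_ /= distrC.
Qed.

Let cvxU j : cvx (U j).
move=> x y t /andP[t0 t1]; rewrite /U /= => xU yU.
have -> : x + t *: (y - x) - h *: g j = (1 - t) *: (x - h *: g j) + t *: (y - h *: g j).
 by apply/rowP => i; rewrite !mxE; ring.
apply: le_lt_trans (ler_normD _ _) _; rewrite !normrZ (ger0_norm t0) ger0_norm ?subr_ge0//.
set p := `|_| in xU *; set q := `|_| in yU *.
have [->|tn] := eqVneq t 0; first by rewrite subr0 mul1r mul0r addr0.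
have tp : 0 < t by rewrite lt_neqAle eq_sym tn.
have : t * q < t * (2 * h) by rewrite ltr_pM2l.
have : (1 - t) * p <= (1 - t) * (2 * h) by rewrite ler_wpM2l ?subr_ge0// ltW.
lra.
Qed.

Let count_near (x : pt) (c : R) (Q : pred J) : 0 <= c -> (forall j, Q j -> `|x - h *: g j| <= c * h) ->
 #|Q|%:R <= (2 * c + 1) ^+ d.
move=> c0 hQ; have h2 : 0 < h / 2 by rewrite divr_gt0.
have := @count_boxes R d _ Q (fun j => h *: g j) (h / 2) (c * h) x h2 (mulr_ge0 c0 (ltW h0)).
rewrite (_ : (c * h + h / 2) / (h / 2) = 2 * c + 1); last by field; rewrite gt_eqF.
apply; last by move=> j /hQ; rewrite distrC.
move=> j j' _ _ jj; rewrite -subset0 => y /= [yj yj'].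
have [i ji] : exists i, j i != j' i.
 apply: contrapT => n; move/eqP: jj; apply; apply/ffunP => i.
 by apply/eqP/negPn/negP => ne; apply: n; exists i.
have := yj i; have := yj' i; rewrite !mxE => /andP[a1 a2] /andP[a3 a4].
have : (j i : nat) != j' i by [].
rewrite neq_ltn => /orP[lt|lt].
 have e : (j i)%:R + 1 <= (j' i)%:R :> R by rewrite natr1 ler_nat.
 have : h * ((j i)%:R + 1) <= h * (j' i)%:R by rewrite ler_wpM2l// ltW.
 move: a1 a2 a3 a4; rewrite !mulrBr mulrDr; lra.
have e : (j' i)%:R + 1 <= (j i)%:R :> R by rewrite natr1 ler_nat.
have : h * ((j' i)%:R + 1) <= h * (j i)%:R by rewrite ler_wpM2l// ltW.
move: a1 a2 a3 a4; rewrite !mulrBr mulrDr; lra.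
Qed.

Let psi_sum x : `|x| <= N%:R * h -> \sum_j psi j x = 1.
move=> hx; rewrite /psi /Theta /prodf.
rewrite (eq_bigr (fun j : J => \prod_i theta (h^-1 * x 0 i + N.+1%:R - (j i)%:R))) => [|j _]; last first.
 by apply: eq_bigr => i _; congr theta; rewrite !mxE; ring.
rewrite -(bigA_distr_bigA (fun (i : 'I_d) (n : 'I_(2 * N.+1)) => theta (h^-1 * x 0 i + N.+1%:R - n%:R))) /=.
apply: big1 => i _; apply: theta_sum.
rewrite normrM gtr0_norm ?invr_gt0// mulrC ler_pdivrMr//; apply: le_trans hx; exact: coord_le.
Qed.

Let C1psi j : C1 (psi j). Proof. exact: smooth_C1 (smooth_Theta_affine _ _). Qed.
Let pder_psi_sum i x : W x -> \sum_j pder i (psi j) x = 0.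
move=> Wx; have [CS pS] := @C1_sum _ _ _ (index_enum _) xpredT psi (fun j _ => C1psi j).
rewrite -(pS i x).
have : pder i (fun x => \sum_j psi j x - 1) x = 0.
 apply: pder_near0; have := open_nbhs_nbhs (conj (@openW _ _ M Om) Wx); apply: filterS => y Wy.
 by rewrite psi_sum ?subrr// ltW// hN.
by rewrite pderB//; [rewrite (C1_cst 1).2 subr0|exact: (C1_cst 1).1].
Qed.

Let pder_psi i j x : `|pder i (psi j) x| <= h^-1 * K1.
have CT : C1 (Theta : pt -> R).
 have := smooth_C1 (smooth_Theta_affine 0 1); rewrite (_ : (fun x => _) = Theta)//.
 by apply/funext => y; rewrite add0r scale1r.
rewrite /psi (pder_scale _ _ _ _ CT) normrM gtr0_norm ?invr_gt0//.
by rewrite ler_wpM2l// invr_ge0 ltW.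
Qed.

Let pder_psi_out i j x : h < `|x - h *: g j| -> pder i (psi j) x = 0.
move=> hx; apply: pder_near0.
have : nbhs x [set y : pt | h < `|y - h *: g j|].
 apply/nbhs_ballP; exists (`|x - h *: g j| - h); rewrite /= ?subr_gt0// => y.
 rewrite mx_norm_ball /ball_ /= => xy.
 have := ler_normD (x - y) (y - h *: g j); rewrite addrA subrK.
 by move: xy; set p := `|x - y|; set q := `|x - _|; lra.
by apply: filterS => y; exact: psi_out.
Qed.

Let value j := local_value Om m (U j).
Let value_osc T x j : T \in S -> IT T x -> `|x - h *: g j| <= h -> `|m T - value j| <= 4 * near_osc T.
move=> TS Tx hx; have TU : T \in meeting M Om (U j).
 by apply/meetingP; split => //; exists x; [exact: IT_cell|rewrite /U /=; apply: le_lt_trans hx _; have := h0; lra].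
apply: le_trans (local_value_osc fm del0 mdel mbd (@openU j) (@cvxU j) TU) _.
rewrite ler_pM2l//; rewrite /near_osc.
rewrite [leRHS](bigID (mem (meeting M Om (U j)))) /= -[leLHS]addr0; apply: lerD; last exact: sumr_ge0.
le_eq; apply: eq_bigl => T'.
case: (boolP (T' \in meeting M Om (U j))); rewrite ?andbF// => /meetingP[T'S [y T'y yU]].
rewrite T'S /= andbT; symmetry.
have h1 := cen_dist fm (IT_cell Tx); have h2 := cen_dist fm T'y.
have -> : cen h kap T - cen h kap T' = - (x - cen h kap T) + (x - h *: g j) - (y - h *: g j) + (y - cen h kap T').
 by apply/rowP => i; rewrite !mxE; ring.
apply: le_trans (ler_normD _ _) _; move: yU; rewrite /U /= => yU.
have h3 := ler_normB (- (x - cen h kap T) + (x - h *: g j)) (y - h *: g j).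
have h4 := ler_normD (- (x - cen h kap T)) (x - h *: g j); rewrite normrN in h4.
have := h0; lra.
Qed.

Lemma near_osc_ge T : T \in S -> del T <= near_osc T.
move=> TS; rewrite /near_osc (bigD1 T) ?TS ?subrr ?normr0 ?mulr_ge0 ?(ltW h0)//= lerDl.
exact: sumr_ge0.
Qed.

(** The approximation takes the local value on each ball. At a point at most 3^d grid functions are
    active, each with a value close to the mean of the cell; for the gradient that mean is
    subtracted first, which is allowed because the grid functions sum to a constant near the
    point. *)
Lemma smooth_approx : exists et, test_fun W et /\ forall T x, T \in S -> IT T x ->
 `|P T x - et x| <= 3 ^+ d * (5 * near_osc T) /\
 forall i, `|pder i et x| <= 3 ^+ d * (h^-1 * K1 * (4 * near_osc T)).
pose et x := \sum_j value j * psi j x.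
have Cv j : C1 (fun x => value j * psi j x) by apply: C1Z; exact: C1psi.
have [_ pet] := @C1_sum _ _ _ (index_enum _) xpredT (fun j x => value j * psi j x) (fun j _ => Cv j).
exists et; split.
 apply: test_sum => j _; have [v0|vn] := eqVneq (value j) 0.
  by rewrite (_ : (fun x => _) = fun=> 0); [exact: test0|apply/funext => x; rewrite v0 mul0r].
 by apply: testZ; apply: psi_test; exact: local_value_neq0 vn.
move=> T x TS Tx; have Wx := IT_W TS Tx.
have Q0 : 0 <= near_osc T by apply: sumr_ge0.
have key (F : J -> R) (B : R) : 0 <= B -> (forall j, h < `|x - h *: g j| -> F j = 0) ->
  (forall j, `|x - h *: g j| <= h -> `|F j| <= B) -> `|\sum_j F j| <= 3 ^+ d * B.
 move=> B0 F0 FB; rewrite (bigID (fun j : J => `|x - h *: g j| <= h)) /= [X in _ + X]big1 ?addr0; last first.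
  by move=> j; rewrite -ltNge; exact: F0.
 apply: le_trans (ler_norm_sum _ _ _) _.
 apply: le_trans (_ : \sum_(j | `|x - h *: g j| <= h) B <= _); first by apply: ler_sum => j; exact: FB.
 rewrite (sumr_const (fun j : J => `|x - h *: g j| <= h)) -[leLHS]mulr_natl ler_wpM2r//.
 have := @count_near x 1 (fun j : J => `|x - h *: g j| <= h) ler01.
 by rewrite mul1r (_ : 2 * 1 + 1 = 3 :> R); [apply|lra].
split.
 have -> : P T x - et x = \sum_j (P T x - value j) * psi j x.
  under [RHS]eq_bigr do rewrite mulrBl.
  by rewrite sumrB -mulr_sumr psi_sum ?mulr1// ltW// hN.
 apply: key; first by rewrite mulr_ge0.
  by move=> j /psi_out ->; rewrite mulr0.
 move=> j hx; rewrite normrM -[leRHS]mulr1; apply: ler_pM => //; last exact: Theta_le1.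
 have -> : P T x - value j = (P T x - m T) + (m T - value j) by ring.
 apply: le_trans (ler_normD _ _) _.
 have := hPm TS (IT_cell Tx); have := value_osc TS Tx hx; have := near_osc_ge TS; lra.
move=> i; rewrite (pet i x).
have -> : \sum_j pder i (fun x => value j * psi j x) x = \sum_j (value j - m T) * pder i (psi j) x.
 under [RHS]eq_bigr do rewrite mulrBl.
 rewrite sumrB -mulr_sumr pder_psi_sum// mulr0 subr0; apply: eq_bigr => j _.
 by rewrite pderZ.
apply: key; first by rewrite !mulr_ge0 ?invr_ge0 ?(ltW h0).
 by move=> j /(pder_psi_out i) ->; rewrite mulr0.
move=> j hx; rewrite normrM mulrC; apply: ler_pM => //.
by rewrite distrC; exact: (value_osc TS Tx hx).
Qed.

(** The inscribed cubes of distinct cells are disjoint, so a neighbourhood has a bounded number of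
    cells. The count is used twice: in Cauchy-Schwarz and after exchanging the sums. *)
Lemma near_osc_sum : \sum_(T in S) near_osc T ^+ 2 <=
 (((6 + kap) / kap) ^+ d) ^+ 2 * \sum_(T in S) del T ^+ 2.
set N0 := ((6 + kap) / kap) ^+ d.
have N00 : 0 <= N0 by rewrite exprn_ge0// divr_ge0 ?addr_ge0// ltW.
have cnt T (Q : pred (elt M)) : (forall T', Q T' -> `|cen h kap T - cen h kap T'| <= 6 * h) -> #|Q|%:R <= N0.
 move=> hQ; have kh : 0 < kap * h by rewrite mulr_gt0.
 have := @count_boxes R d _ Q (cen h kap) (kap * h) (6 * h) (cen h kap T) kh (mulr_ge0 (ler0n _ 6) (ltW h0)).
 rewrite (_ : (6 * h + kap * h) / (kap * h) = (6 + kap) / kap); last by field; rewrite !gt_eqF.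
 apply; last by move=> T' /hQ; rewrite distrC.
 move=> T1 T2 _ _ T12; rewrite -subset0 => y /= [y1 y2].
 have sub T' : obox (cen h kap T' - const_mx (kap * h)) (cen h kap T' + const_mx (kap * h)) `<=` cell T'.
  by move=> z /obox_cbox; rewrite cbox_ball ?(ltW kh)//; exact: (cen_ball fm).
 move/eqP: T12; apply; apply: (interior_disj fm (x := y)); last exact: sub.
 apply: (@interiorS _ (obox (cen h kap T1 - const_mx (kap * h)) (cen h kap T1 + const_mx (kap * h)))); first exact: sub.
 by apply: open_nbhs_nbhs; split => //; exact: open_obox.
apply: (@le_trans _ _ (\sum_(T in S) N0 * \sum_(T' in S | `|cen h kap T - cen h kap T'| <= 6 * h) del T' ^+ 2)).
 apply: ler_sum => T _; apply: le_trans (sum_sq_le _ _) _.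
 by apply: ler_wpM2r; [apply: sumr_ge0 => ? _; exact: sqr_ge0|apply: (cnt T) => T' /andP[]].
rewrite -mulr_sumr expr2 -mulrA ler_wpM2l//.
rewrite (exchange_big_dep (fun T => T \in S)) /=; last by move=> T T' _ /andP[].
rewrite mulr_sumr; apply: ler_sum => T TS.
rewrite (eq_bigl (fun i => (i \in S) && (`|cen h kap i - cen h kap T| <= 6 * h))) => [|i]; last by rewrite TS.
rewrite (sumr_const (fun i => (i \in S) && (`|cen h kap i - cen h kap T| <= 6 * h))) -[leLHS]mulr_natl.
by rewrite ler_wpM2r ?sqr_ge0//; apply: (cnt T) => T' /andP[_]; rewrite distrC.
Qed.

End Approx.

(** * A test function close to the pressure error *)

Section TestApprox.
Context {R : realType} {d : nat}.
Local Notation pt := 'rV[R]_d.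
Local Notation mu := (leb d).
Lemma le_sqrt_mul (x a b : R) : 0 <= a -> 0 <= b -> x ^+ 2 <= a * b ^+ 2 -> x <= Num.sqrt a * b.
move=> a0 b0 h; apply: le_trans (ler_norm _) _; rewrite -sqrtr_sqr.
have -> : Num.sqrt a * b = Num.sqrt (a * b ^+ 2) by rewrite sqrtrM// sqrtr_sqr ger0_norm.
by rewrite ler_wsqrtr.
Qed.

Lemma L2_ae (D : set pt) u v : measurable D -> measurable_fun D u -> L2 D v ->
 {ae mu, forall x, D x -> u x = v x} -> L2 D u.
move=> mD mu1 [mv iv] [N [mN N0 sub]]; split=> //; rewrite (_ : (\int[mu]_(x in D) _)%E = (\int[mu]_(x in D) (v x ^+ 2)%:E)%E)//.
apply: ge0_ae_eq_integral => //.
- by apply/measurable_EFinP; exact: measurable_funX.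
- by apply/measurable_EFinP; exact: measurable_funX.
- by move=> x _; rewrite lee_fin sqr_ge0.
- by move=> x _; rewrite lee_fin sqr_ge0.
- by exists N; split => // x /= hx; apply: sub => /= k; apply: hx => Sx; rewrite k.
Qed.

Section Dg.
Context (M : mesh R d) (h kap : R) (fm : fat_mesh M h kap) (Om : set pt).
Local Notation S := (active M Om).
Local Notation W := (OmT M Om).
Local Notation IT T := (interior (cell T)).
Implicit Types T : elt M.
Lemma dg_rep k q : dg M Om k q -> exists P : elt M -> pt -> R,
 (forall T, poly_fun k (P T)) /\ forall T x, T \in S -> IT T x -> q x = P T x.
move=> [_ hq]; have /choice[P hP] T : exists p, poly_fun k p /\ (T \in S -> forall x, IT T x -> q x = p x).
 have [TS|_] := boolP (T \in S); last by exists (fun=> 0); split => //; exact: poly0.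
 by have [p [p1 p2]] := hq T TS; exists p.
by exists P; split => [T|T x TS]; [exact: (hP T).1|exact: (hP T).2].
Qed.

Lemma pw_ae_eq (P : elt M -> pt -> R) q : (forall T x, T \in S -> IT T x -> q x = P T x) ->
 {ae mu, forall x, W x -> q x = pw Om P x}.
move=> hq; apply: filterS (ae_W fm Om) => x hx /hx[T TS Tx].
by rewrite (pwE fm _ TS Tx); exact: hq.
Qed.

Lemma dg_L2 k q : dg M Om k q -> L2 W q.
move=> dq; have [P [pP hP]] := dg_rep dq.
apply: (L2_ae (@mW_OmT _ _ M Om) dq.1 _ (pw_ae_eq hP)).
apply: L2_pw; first exact: mW_OmT.
by move=> T _; apply: (L2_IT_cont fm); exact: (poly_C1 (pP T)).1.
Qed.

Lemma cellwise_nrm u (v : elt M -> pt -> R) (B : elt M -> R) : L2 W u ->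
 (forall T x, T \in S -> IT T x -> u x = v T x /\ `|v T x| <= B T) ->
 (forall T, T \in S -> continuous (v T)) ->
 nrm W u ^+ 2 <= (4 * h) ^+ d * \sum_(T in S) B T ^+ 2.
move=> Lu hv cv; rewrite (nrm_W fm Lu) mulr_sumr; apply: ler_sum => T TS.
have mle : (mu (IT T) <= mu (cell T))%E.
 apply: le_measure; rewrite ?inE; [exact: mIT|exact: (mcell fm)|exact: IT_cell].
have mfin : (mu (IT T) < +oo)%E by apply: le_lt_trans mle (cell_fin fm T).
rewrite (@eq_nrm _ _ _ _ (v T)); last by move=> x Tx; exact: (hv T x TS Tx).1.
apply: le_trans (nrm_bounded (mIT T) mfin _ (fun x Tx => (hv T x TS Tx).2)) _.
 by apply: measurable_funTS; apply: cont_meas; exact: cv.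
rewrite mulrC ler_wpM2r ?sqr_ge0//; apply: le_trans (vol_le fm T).
by apply: fine_le; rewrite ?ge0_fin_numE ?(cell_fin fm).
Qed.

End Dg.
(** The constant is fixed before the mesh, so it depends only on the dimension, k and [kap]. The
    oscillation of a cell is the sum of its internal oscillation and its facet jumps. *)
Theorem test_approx (k : nat) (kap : R) : (0 < d)%N -> 0 < kap -> exists2 C, 0 <= C &
 forall (M : mesh R d) (h : R) (Om : set pt) e A, fat_mesh M h kap -> dg M Om k e -> 0 <= A ->
 (forall v, RT M Om k v -> `|ip (OmT M Om) (wdiv (OmT M Om) v) e| <= A * nrmv (OmT M Om) v) ->
 exists et, [/\ test_fun (OmT M Om) et, nrm (OmT M Om) (fun x => e x - et x) <= C * h * A &
  forall i, nrm (OmT M Om) (pder i et) <= C * A].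
move=> d0 k0; have r0 : 0 < kap / 2 by rewrite divr_gt0.
have [Cs Cs0 hCs] := @poly_sup R d k (kap / 2) 1 r0.
have {}hCs x0 x h p h1 pp hx := (hCs x0 x h p h1 pp hx).1.
have [K1 K10 hK1] := @Theta_pder_bounded R d.
(* [c1] and [c2] are the constants of [osc_bound] and [jump_bound] once h^2 A^2 / h^d is factored
   out, and [c3] adds the overlap count. The last two constants add the 3^d active grid functions
   and the cell volume (4h)^d, which cancels h^-d. *)
pose c1 : R := d.+1%:R * Cs * (d%:R * d.+1%:R * Cs * 4%:R ^+ d / (kap / 2 / 2 / d.+1%:R) ^+ 2).
pose c2 : R := d%:R * (d.+1%:R / (2 * kap) ^+ d) / (d%:R * 2^-1) ^+ 2.
pose c3 := (((6 + kap) / kap) ^+ d) ^+ 2 * (2 * (c1 + c2)).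
pose C1' := 4 ^+ d * ((3 ^+ d * 5) ^+ 2 * c3).
pose C2' := 4 ^+ d * ((3 ^+ d * (K1 * 4)) ^+ 2 * c3).
have d0' : 0 < d%:R :> R by rewrite ltr0n.
have c10 : 0 <= c1.
 by rewrite /c1 !mulr_ge0// ?exprn_ge0// invr_ge0 sqr_ge0.
have c20 : 0 <= c2.
 by rewrite /c2 !mulr_ge0// ?invr_ge0 ?sqr_ge0 ?exprn_ge0 ?mulr_ge0// ltW.
have c30 : 0 <= c3 by rewrite mulr_ge0 ?sqr_ge0// mulr_ge0// addr_ge0.
have C10 : 0 <= C1' by rewrite mulr_ge0 ?exprn_ge0// mulr_ge0 ?sqr_ge0.
have C20 : 0 <= C2' by rewrite mulr_ge0 ?exprn_ge0// mulr_ge0 ?sqr_ge0.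
exists (Num.sqrt C1' + Num.sqrt C2'); first by rewrite addr_ge0 ?sqrtr_ge0.
move=> M h Om e A fm dge A0 He; have h0 := fm_h fm.
set W := OmT M Om in He *; set S := active M Om.
have [P [pP hP]] := dg_rep dge; have Le := dg_L2 fm dge.
have mW : measurable W by exact: mW_OmT.
have CP T : continuous (P T) by exact: (poly_C1 (pP T)).1.
have HP : forall G : elt M -> 'I_d.+1 -> pt -> R, (forall T i, poly_fun k (G T i)) ->
 (forall phi, test_fun W phi ->
  \sum_(T in S) \sum_i flux (node T) (node T i) (fun x => G T i x * phi x) = 0) ->
 `|\sum_(T in S) ip (interior (cell T)) (rtdiv G T) (P T)| <= A * nrmv W (pwv Om (rtf G)).
 move=> G pG cG; have CG T i := poly_C1 (pG T i).
 have hv := rt_RT fm pG cG; have [_ hd] := rt_is_wdiv fm CG cG.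
 have LG T : T \in S -> L2 (interior (cell T)) (rtdiv G T).
  by move=> TS; apply: (L2_IT_cont fm); exact: cont_rtdiv.
 have := He _ hv; rewrite (@eq_ip_ae _ _ W _ (pw Om (rtdiv G)) e mW _ _ Le); last 3 first.
 - by have [_ _] := HdivP hv.1.
 - exact: L2_pw.
 - exact: wdiv_ae (@openW _ _ M Om) hd.
 rewrite (ip_pw LG Le); congr (`|_| <= _); apply: eq_bigr => T TS; apply: eq_ip => // x Tx.
 exact: hP.
have [al [al0 hal sal]] := osc_bound fm d0 pP A0 HP Cs0 hCs.
have [be [be0 hbe hbb sbe]] := jump_bound fm d0 pP A0 HP.
pose del T := al T + be T.
have del0 T : 0 <= del T by rewrite addr_ge0.
have mdel T T' : T \in S -> T' \in S -> Defs.adjacent T T' -> `|mean P T - mean P T'| <= del T.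
 by move=> TS T'S adj; apply: le_trans (hbe T T' TS T'S adj) _; rewrite lerDr.
have mbd T i : T \in S -> bfacet S T i -> `|mean P T| <= del T.
 by move=> TS b; apply: le_trans (hbb T i TS b) _; rewrite lerDr.
have hPm T x : T \in S -> cell T x -> `|P T x - mean P T| <= del T.
 move=> TS Tx; apply: le_trans (mean_osc fm pP Tx (hal T x ^~ Tx)) _; by rewrite lerDl.
have [N hN] : exists N : nat, forall x, W x -> `|x| < N%:R * h.
 have [B hB] := bounded_W fm Om.
 exists (Num.bound (`|B| / h)) => x Wx; rewrite -ltr_pdivrMr//.
 apply: (@le_lt_trans _ _ (`|B| / h)); last by apply: archi_boundP; rewrite divr_ge0// ltW.
 by rewrite ler_wpM2r ?invr_ge0 ?(ltW h0)//; apply: le_trans (hB _ Wx) (ler_norm _).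
have [et [tet het]] := smooth_approx fm K10 hK1 del0 mdel mbd hPm hN.
pose X := h ^- d * h ^+ 2 * A ^+ 2.
have X0 : 0 <= X by rewrite !mulr_ge0 ?sqr_ge0 ?invr_ge0 ?exprn_ge0// ltW.
have sQ : \sum_(T in S) near_osc h kap Om del T ^+ 2 <= c3 * X.
 apply: le_trans (near_osc_sum fm Om del) _; rewrite /c3 -mulrA ler_wpM2l ?sqr_ge0//.
 have : \sum_(T in S) del T ^+ 2 <= 2 * \sum_(T in S) al T ^+ 2 + 2 * \sum_(T in S) be T ^+ 2.
  rewrite !mulr_sumr -big_split; apply: ler_sum => T _ /=.
  by have := sqr_ge0 (al T - be T); rewrite /del; lra.
 move=> /le_trans; apply; rewrite -mulrDr -mulrA ler_pM2l// mulrDl; apply: lerD.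
  apply: le_trans sal _; le_eq; rewrite /c1 /X.
  by field; rewrite !expf_neq0 ?gt_eqF// ?addrC ?natr1 ?ltr0n.
 apply: le_trans sbe _; le_eq; rewrite /c2 /X !exprMn.
 by field; rewrite !expf_neq0 ?gt_eqF.
have hX : h ^+ d * X = (h * A) ^+ 2 by rewrite /X exprMn; field; rewrite expf_neq0 ?gt_eqF.
have hX' : h ^+ d * X * h^-1 ^+ 2 = A ^+ 2 by rewrite hX exprMn mulrAC -exprMn divff ?gt_eqF// expr1n mul1r.
have Cet := test_C1 tet.
exists et; split=> //.
- apply: (@le_trans _ _ (Num.sqrt C1' * (h * A))).
  apply: le_sqrt_mul => //; first by rewrite mulr_ge0// ltW.
  apply: le_trans (@cellwise_nrm M h kap fm Om _ (fun T x => P T x - et x)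
   (fun T => 3 ^+ d * (5 * near_osc h kap Om del T)) _ _ _) _.
  + by apply: L2B => //; exact: test_L2 mW tet.
  + by move=> T x TS Tx; split; [rewrite (hP T x TS Tx)|exact: (het T x TS Tx).1].
  + by move=> T TS x; exact: (cvgB (CP T x) (Cet.1 x)).
  rewrite (eq_bigr (fun T => (3 ^+ d * 5) ^+ 2 * near_osc h kap Om del T ^+ 2)) => [|T _]; last by rewrite !exprMn; ring.
  rewrite -mulr_sumr /C1' exprMn -hX.
  have -> : 4 ^+ d * ((3 ^+ d * 5) ^+ 2 * c3) * (h ^+ d * X) = 4 ^+ d * h ^+ d * ((3 ^+ d * 5) ^+ 2 * (c3 * X)) by ring.
  apply: ler_wpM2l; first by rewrite mulr_ge0 ?exprn_ge0// ltW.
  by apply: ler_wpM2l => //; exact: sqr_ge0.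
 by rewrite -mulrA ler_wpM2r ?mulr_ge0 ?(ltW h0)// lerDl sqrtr_ge0.
- move=> i; apply: (@le_trans _ _ (Num.sqrt C2' * A)); last by rewrite ler_wpM2r// lerDr sqrtr_ge0.
 apply: le_sqrt_mul => //.
 apply: le_trans (@cellwise_nrm M h kap fm Om _ (fun T => pder i et)
   (fun T => 3 ^+ d * (h^-1 * K1 * (4 * near_osc h kap Om del T))) _ _ _) _.
 + exact: test_L2 mW (test_pder i tet).
 + by move=> T x TS Tx; split; [|exact: (het T x TS Tx).2].
 + by move=> T TS; have [_ cp] := Cet.2 i.
 rewrite (eq_bigr (fun T => (3 ^+ d * (K1 * 4)) ^+ 2 * h^-1 ^+ 2 * near_osc h kap Om del T ^+ 2)) => [|T _]; last by rewrite !exprMn; ring.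
 rewrite -mulr_sumr /C2' exprMn -hX'.
 have -> : 4 ^+ d * ((3 ^+ d * (K1 * 4)) ^+ 2 * c3) * (h ^+ d * X * h^-1 ^+ 2) =
  4 ^+ d * h ^+ d * ((3 ^+ d * (K1 * 4)) ^+ 2 * h^-1 ^+ 2 * (c3 * X)) by ring.
 apply: ler_wpM2l; first by rewrite mulr_ge0 ?exprn_ge0// ltW.
 by apply: ler_wpM2l => //; rewrite mulr_ge0 ?sqr_ge0.
Qed.

End TestApprox.

(** * Divergences of Raviart-Thomas fields and an inverse inequality *)

Section RTtools.
Context {R : realType} {d : nat}.
Local Notation pt := 'rV[R]_d.
Local Notation mu := (leb d).
Lemma nrmv_grad_le (W : set pt) (phi : pt -> R) B : (forall i, nrm W (pder i phi) <= B) ->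
 nrmv W (grad phi) <= d%:R * B.
move=> hB; apply: le_trans (le_nrmv_sum _ _) _.
apply: le_trans (_ : \sum_(i < d) B <= _); last by rewrite sumr_const card_ord -[leLHS]mulr_natl.
by apply: ler_sum => i _; rewrite vcoord_grad.
Qed.

(** Replacing e by the test function allows integration by parts against a field without any
    regularity on the boundary; the weight [h] on the divergence is the accuracy of that
    replacement. *)
Lemma ip_wdiv_bound (W : set pt) rho e et (C h A : R) : measurable W -> Hdiv W rho -> L2 W e ->
 test_fun W et -> nrm W (fun x => e x - et x) <= C * h * A -> (forall i, nrm W (pder i et) <= C * A) ->
 0 <= C -> 0 <= A -> 0 <= h ->
 `|ip W (wdiv W rho) e| <= (1 + d%:R) * C * A * (nrmv W rho + h * nrm W (wdiv W rho)).
move=> mW Hr Le tet h1 h2 C0 A0 h0; have [Lr dr Ld] := HdivP Hr.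
have Let := test_L2 mW tet; have Lg := grad_L2v mW tet.
have -> : ip W (wdiv W rho) e = ip W (wdiv W rho) (fun x => e x - et x) - ipv W rho (grad et).
 by rewrite ipBr// (dr.2 _ tet); ring.
apply: le_trans (ler_normB _ _) _.
have h3 := ip_CS mW Ld (L2B mW Le Let); have h4 := ipv_CS mW Lr Lg.
have h5 := nrmv_grad_le h2.
have h6 := ler_wpM2l (nrm_ge0 W (wdiv W rho)) h1; have h7 := ler_wpM2l (nrmv_ge0 W rho) h5.
have p1 : 0 <= C * A * nrmv W rho by rewrite !mulr_ge0 ?nrmv_ge0.
have p2 : 0 <= d%:R * (C * A * (h * nrm W (wdiv W rho))) by rewrite !mulr_ge0 ?nrm_ge0.
apply: le_trans (lerD (le_trans h3 h6) (le_trans h4 h7)) _.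
rewrite -subr_ge0; set u := nrmv W rho in p1 *; set v := nrm W _ in p2 *.
have -> : (1 + d%:R) * C * A * (u + h * v) - (v * (C * h * A) + u * (d%:R * (C * A))) =
 C * A * u + d%:R * (C * A * (h * v)) by ring.
exact: addr_ge0.
Qed.

Lemma cbump_pder_bounded (r : R) : 0 < r -> exists2 K, 0 <= K &
 forall (x0 x : pt) (h : R) i, 0 < h -> `|h * pder i (cbump x0 (r * h)) x| <= K.
move=> r0; have tc : test_fun setT (cbump (0 : pt) r).
 have := @test_cbump R d setT 0 r 0 0 (fun=> 1) r0 (poly_cst 0 1) (fun _ _ => I).
 by rewrite (_ : (fun x => _) = cbump 0 r)//; apply/funext => x; rewrite expr1 mulr1.
have Cc := test_C1 tc; have bc := test_bsupp tc.
have /choice[K hK] i : exists K, 0 <= K /\ forall x : pt, `|pder i (cbump 0 r) x| <= K.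
 have [K K0 hK] := bsupp_bounded (Cc.2 i).2 (bsupp_pder i bc); by exists K.
exists (\sum_i K i); first by apply: sumr_ge0 => i _; exact: (hK i).1.
move=> x0 x h i h0.
have -> : h * pder i (cbump x0 (r * h)) x = pder i (cbump 0 r) (- (h^-1 *: x0) + h^-1 *: x).
 have e : cbump x0 (r * h) = fun x : pt => cbump 0 r (- (h^-1 *: x0) + h^-1 *: x).
  apply/funext => y; rewrite -(@cbump_scale _ _ x0 _ h r h0 r0); congr (cbump _ _ _).
  by rewrite scalerDr scalerN !scalerA divff ?gt_eqF// !scale1r addrA subrr add0r.
 by rewrite {1}e pder_scale// mulrA divff ?gt_eqF// mul1r.
apply: le_trans ((hK i).2 _) _; rewrite (bigD1 i)//= lerDl.
by apply: sumr_ge0 => j _; exact: (hK j).1.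
Qed.

Section Local.
Context (M : mesh R d) (h kap : R) (fm : fat_mesh M h kap) (Om : set pt).
Local Notation S := (active M Om).
Local Notation W := (OmT M Om).
Local Notation IT T := (interior (cell T)).
Let h0 := fm_h fm. Let k0 := fm_kap fm.
Let kh : 0 < kap / 2 * h. Proof. by rewrite mulr_gt0// divr_gt0. Qed.
Implicit Types T : elt M.
Local Notation eta T := (cbump (cen h kap T) (kap / 2 * h)).
Lemma cen_ball_IT T x : `|x - cen h kap T| <= kap / 2 * h -> IT T x.
move=> hx; apply/nbhs_ballP; exists (kap / 2 * h) => //= y; rewrite mx_norm_ball /ball_ /= => xy.
apply: (cen_ball fm); have -> : y - cen h kap T = (x - cen h kap T) - (x - y) by apply/rowP => i; rewrite !mxE; ring.
by apply: le_trans (ler_normB _ _) _; move: hx xy; set p := `|_|; set q := `|_|; lra.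
Qed.

Lemma cbump_out_IT T x : ~ IT T x -> eta T x = 0.
by move=> nT; rewrite cbump_out//; rewrite ltNge; apply/negP => hx; apply: nT; exact: cen_ball_IT.
Qed.

Lemma cbump_nrm_le T u n p : (forall x, IT T x -> u x = p x) -> poly_fun n p ->
 nrm setT (fun x => eta T x * p x) ^+ 2 <= nrm (IT T) u ^+ 2.
move=> hu pp; rewrite ler_sqr ?nnegrE ?nrm_ge0// (@eq_nrm _ _ (IT T) u p)//.
have cp : continuous p := (poly_C1 pp).1.
have -> : nrm setT (fun x => eta T x * p x) = nrm (IT T) (fun x => eta T x * p x).
 congr Num.sqrt; symmetry; apply: ip_mkcond => // x _ /cbump_out_IT ->.
 by rewrite !mul0r.
apply: nrm_le; [exact: mIT| | |].
- by apply: (L2_sub (mIT T) measurableT) => //; exact: L2_cbump pp.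
- exact: (L2_IT_cont fm).
- move=> x _; rewrite normrM ler_piMl ?normr_ge0// ger0_norm ?cbump_ge0//; exact: cbump_le1.
Qed.

(** In the divergence of s(x) x each term x_i times a derivative of s has degree at most k again.
    The equality is almost everywhere because [wdiv] is an arbitrary representative. *)
Lemma RT_wdiv k w : RT M Om k w -> exists q, dg M Om k q /\ {ae mu, forall x, W x -> wdiv W w x = q x}.
move=> [Hw hw]; have [Lw dw Ldw] := HdivP Hw.
have /choice[p hp] T : exists p, T \in S -> RTpoly k p /\ forall x, IT T x -> w x = p x.
 by have [TS|_] := boolP (T \in S); [have [p hp] := hw T TS; exists p|exists (fun=> 0)].
pose D T : pt -> R := fun x => \sum_i pder i (vcoord (p T) i) x.
have CP T i : T \in S -> C1 (vcoord (p T) i) /\ poly_fun k (pder i (vcoord (p T) i)).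
 move=> TS; have [[v [s [pv ps e]]] _] := hp T TS.
 have -> : vcoord (p T) i = fun x => vcoord v i x + s x * x 0 i.
  by apply/funext => x; rewrite /vcoord e !mxE.
 have Cv := poly_C1 (pv i); have Cs := poly_C1 ps; have Cx := poly_C1 (@poly_coord R d i).
 have Csx := (C1M Cs Cx).1; split; first exact: (C1D Cv Csx).1.
 rewrite (_ : pder i _ = fun x => pder i (vcoord v i) x + (pder i s x * x 0 i + s x)); last first.
  apply/funext => x; rewrite (pderD _ _ Cv Csx) (pderM _ _ Cs Cx) (coord_C1 i).2 eqxx mulr1.
  by [].
 apply: polyD; first by apply: poly_le (poly_pder i (pv i)).1; exact: leq_pred.
 apply: polyD => //; case: (posnP k) => [k0'|kp].
  rewrite (_ : (fun x => _) = fun=> 0); first exact: poly0.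
  by apply/funext => x; rewrite (poly_pder i ps).2// mul0r.
 rewrite -(prednK kp) -addn1; apply: polyM; first exact: (poly_pder i ps).1.
 exact: poly_coord.
have pD T : T \in S -> poly_fun k (D T) by move=> TS; apply: poly_sum => i _; exact: (CP T i TS).2.
have aeD T : T \in S -> {ae mu, forall x, IT T x -> wdiv W w x = D T x}.
 move=> TS; have oI : open (IT T) by exact: open_interior.
 have h1 := is_wdiv_sub (@openW _ _ M Om) oI (IT_W TS) dw.
 apply: (is_wdiv_uniq oI h1).
 have := @is_wdiv_of_wder _ _ (IT T) (p T) (fun i => pder i (vcoord (p T) i)) oI.
 case=> [i|L H].
  apply: is_wder_C1 => //; first exact: (CP T i TS).1.
  by apply: (L2_IT_cont fm); exact: ((CP T i TS).1.2 i).2.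
 split=> // phi tphi; rewrite -(H _ tphi); apply: eq_ipv => // x Tx; exact: (hp T TS).2.
have LD T : T \in S -> L2 (IT T) (D T) by move=> TS; apply: (L2_IT_cont fm); exact: (poly_C1 (pD T TS)).1.
exists (pw Om D); split.
 split; first by have [] := L2_pw (@mW_OmT _ _ M Om) LD.
 by move=> T TS; exists (D T); split; [exact: pD|move=> x Tx; exact: (pwE fm _ TS Tx)].
have H : {ae mu, forall x, forall T, T \in enum S -> IT T x -> wdiv W w x = D T x}.
 have : {subset enum S <= S} by move=> T; rewrite mem_enum.
 elim: (enum S) => [|T s IH] sub; first by apply: aeW => x T.
 have sub' : {subset s <= S} by move=> T' T's; apply: sub; rewrite inE T's orbT.
 apply: filterS2 (aeD T (sub T (mem_head _ _))) (IH sub') => x a1 a2 T'.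
 by rewrite inE => /orP[/eqP ->//|]; exact: a2.
apply: filterS2 (ae_W fm Om) H => x a1 a2 Wx; have [T TS Tx] := a1 Wx.
by rewrite (pwE fm _ TS Tx); apply: a2 => //; rewrite mem_enum.
Qed.

End Local.
(* Test div (v - w) against the bubbles eta^2 q, where q is the piecewise
  polynomial div w - g: the bubbles obey an inverse inequality. *)
Lemma inverse_div k (kap : R) : 0 < kap -> exists2 C, 0 <= C &
 forall (M : mesh R d) (h : R) (Om : set pt) v w g, fat_mesh M h kap ->
 Hdiv (OmT M Om) v -> RT M Om k w -> dg M Om k g ->
 h * nrm (OmT M Om) (fun x => wdiv (OmT M Om) v x - wdiv (OmT M Om) w x) <=
 C * (nrmv (OmT M Om) (fun x => v x - w x) + h * nrm (OmT M Om) (fun x => wdiv (OmT M Om) v x - g x)).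
move=> k0; have r0 : 0 < kap / 2 by rewrite divr_gt0.
have [Cs Cs0 hCs] := @poly_sup R d k (kap / 2) 1 r0.
have [K K0 hK] := cbump_pder_bounded r0.
pose L : R := 4 ^+ d * Cs.
pose L2' : R := 4 ^+ d * ((2 * K + 1) ^+ 2 * Cs).
have L0 : 0 <= L by rewrite mulr_ge0.
have L20 : 0 <= L2' by rewrite mulr_ge0// mulr_ge0 ?sqr_ge0.
pose C : R := Num.sqrt L * (d%:R * Num.sqrt L2' + 1) + 1.
exists C; first by rewrite addr_ge0// mulr_ge0 ?sqrtr_ge0// addr_ge0// mulr_ge0 ?sqrtr_ge0.
move=> M h Om v w g fm Hv RTw dgg; set W := OmT M Om; set S := active M Om.
have h0 := fm_h fm; have mW : measurable W by exact: mW_OmT.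
have kh : 0 < kap / 2 * h by rewrite mulr_gt0.
have oW : open W by exact: openW.
have [Lv dv Ldv] := HdivP Hv; have [Lw dw Ldw] := HdivP RTw.1.
have [q0 [dq0 aeq0]] := RT_wdiv fm RTw.
have Lg := dg_L2 fm dgg; have Lq0 := dg_L2 fm dq0.
have [P0 [pP0 hP0]] := dg_rep dq0; have [P1 [pP1 hP1]] := dg_rep dgg.
pose P T : pt -> R := fun x => P0 T x - P1 T x.
have pP T : poly_fun k (P T) by exact: polyB.
pose q : pt -> R := fun x => q0 x - g x.
have Lq : L2 W q by exact: L2B.
have hP T x : T \in S -> interior (cell T) x -> q x = P T x.
 by move=> TS Tx; rewrite /q (hP0 T x TS Tx) (hP1 T x TS Tx).
pose E T : R := nrm setT (fun x : pt => cbump (cen h kap T) (kap / 2 * h) x * P T x) ^+ 2.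
pose Y := \sum_(T in S) E T.
have Y0 : 0 <= Y by apply: sumr_ge0 => T _; exact: sqr_ge0.
have bnd T x : interior (cell T) x -> P T x ^+ 2 <= Cs * h ^- d * E T /\
  forall i, (h * pder i (P T) x) ^+ 2 <= Cs * h ^- d * E T.
 by move=> /IT_cell Tx; apply: hCs => //; rewrite mul1r; exact: (cen_dist fm).
pose B T := Num.sqrt (Cs * h ^- d * E T).
have B0 T : 0 <= Cs * h ^- d * E T.
 by rewrite mulr_ge0 ?sqr_ge0// mulr_ge0// invr_ge0 exprn_ge0// ltW.
have CP T : C1 (P T) by exact: poly_C1.
have sB : \sum_(T in S) B T ^+ 2 = Cs * h ^- d * Y.
 by rewrite mulr_sumr; apply: eq_bigr => T _; rewrite sqr_sqrtr.
have hd : h ^+ d != 0 by rewrite expf_neq0// gt_eqF.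
have nq : nrm W q <= Num.sqrt L * Num.sqrt Y.
 apply: le_sqrt_mul; rewrite ?sqrtr_ge0// (sqr_sqrtr Y0).
 apply: le_trans (@cellwise_nrm _ _ M h kap fm Om q P B Lq _ _) _.
 - move=> T x TS Tx; split; first exact: hP.
  by rewrite -sqrtr_sqr ler_wsqrtr//; exact: (bnd T x Tx).1.
 - by move=> T _; exact: (CP T).1.
 by rewrite sB exprMn /L; le_eq; field.
pose eta (T : elt M) : pt -> R := cbump (cen h kap T) (kap / 2 * h).
pose b (T : elt M) : pt -> R := fun x => eta T x ^+ 2 * P T x.
pose phi : pt -> R := fun x => \sum_(T in S) b T x.
have tb T : T \in S -> test_fun W (b T).
 move=> TS; apply: test_cbump => // x hx.
 by apply: (IT_W TS); exact: (cen_ball_IT fm).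
have tphi : test_fun W phi by exact: test_sum.
have te T : C1 (eta T).
 have := @test_cbump R d setT (cen h kap T) (kap / 2 * h) 0 0 (fun=> 1) kh (poly_cst 0 1) (fun _ _ => I).
 by rewrite (_ : (fun x => _) = eta T); [exact: test_C1|apply/funext => x; rewrite expr1 mulr1].
have b_out T T' x : T \in S -> T' != T -> interior (cell T) x -> b T' x = 0.
 move=> TS TT Tx; rewrite /b /eta (cbump_out_IT fm) ?expr0n ?mul0r// => /IT_cell T'x.
 by move/eqP: TT; apply; apply/esym; exact: (interior_disj fm Tx T'x).
have phiE T x : T \in S -> interior (cell T) x -> phi x = b T x.
 by move=> TS Tx; rewrite /phi (bigD1 T)//= big1 ?addr0// => T' /andP[_ n]; exact: b_out n Tx.
have pphi T i x : T \in S -> interior (cell T) x -> pder i phi x = pder i (b T) x.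
 move=> TS Tx; apply/eqP; rewrite -subr_eq0 -pderB; last 2 first.
 - exact: test_C1 tphi.
 - exact: test_C1 (tb T TS).
 apply/eqP; apply: pder_near0.
 have : nbhs x (interior (cell T)) by apply: open_nbhs_nbhs; split => //; exact: open_interior.
 by apply: filterS => y Ty; rewrite (phiE T)// subrr.
have Lphi := test_L2 mW tphi.
have e01 T x : 0 <= eta T x <= 1 by rewrite cbump_ge0 cbump_le1.
have nphi : nrm W phi <= Num.sqrt Y.
 rewrite -[leRHS]mul1r -[1]sqrtr1; apply: le_sqrt_mul; rewrite ?sqrtr_ge0// (sqr_sqrtr Y0) mul1r.
 rewrite (nrm_W fm Lphi); apply: ler_sum => T TS.
 rewrite (eq_nrm (v := b T)); last by move=> x Tx; exact: phiE.
 have LE : L2 setT (fun x => eta T x * P T x) by exact: L2_cbump (pP T).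
 rewrite /E ler_sqr ?nnegrE ?nrm_ge0//.
 apply: le_trans (nrm_sub (mIT T) measurableT (@subsetT _ _) LE).
 apply: nrm_le; [exact: mIT| | |].
 - by apply: L2_sub (test_L2 measurableT (tb T TS)) => //; exact: mIT.
 - by apply: L2_sub LE => //; exact: mIT.
 - move=> x _; have /andP[a1 a2] := e01 T x.
  by rewrite /b expr2 !normrM (ger0_norm a1) -mulrA ler_piMl// mulr_ge0.
have ngrad i : nrm W (pder i phi) <= Num.sqrt L2' * (h^-1 * Num.sqrt Y).
 apply: (le_sqrt_mul L20); first by rewrite mulr_ge0 ?invr_ge0 ?(ltW h0) ?sqrtr_ge0.
 rewrite [X in _ * X]exprMn (sqr_sqrtr Y0).
 apply: le_trans (@cellwise_nrm _ _ M h kap fm Om _ (fun T => pder i (b T))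
   (fun T => h^-1 * ((2 * K + 1) * B T)) _ _ _) _.
 - exact: test_L2 mW (test_pder i tphi).
 - move=> T x TS Tx; split; first exact: pphi.
  rewrite -ler_pdivrMl ?invr_gt0// invrK -[X in X * _](gtr0_norm h0) -normrM.
  (* The product rule for eta^2 P is the origin of the factor 2K + 1. *)
  have -> : h * pder i (b T) x = 2 * (eta T x * (h * pder i (eta T) x) * P T x) + eta T x ^+ 2 * (h * pder i (P T) x).
   have C2 := (C1M (te T) (te T)).1.
   have -> : b T = fun x => (eta T x * eta T x) * P T x by apply/funext => y; rewrite /b expr2.
   by rewrite (pderM _ _ C2 (CP T)) (pderM _ _ (te T) (te T)); ring.
  have /andP[a1 a2] := e01 T x.
  have b1 : `|P T x| <= B T by rewrite -sqrtr_sqr ler_wsqrtr//; exact: (bnd T x Tx).1.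
  have b2 : `|h * pder i (P T) x| <= B T by rewrite -sqrtr_sqr ler_wsqrtr//; exact: (bnd T x Tx).2.
  have b3 := hK (cen h kap T) x h i h0.
  apply: le_trans (ler_normD _ _) _; have -> : (2 * K + 1) * B T = 2 * (K * B T) + B T by ring.
  apply: lerD.
   rewrite normrM (ger0_norm (ler0n _ 2)) ler_pM2l// normrM; apply: ler_pM => //.
   by rewrite normrM (ger0_norm a1) -[leRHS]mul1r; apply: ler_pM.
  rewrite normrM -[leRHS]mul1r; apply: ler_pM => //.
  by rewrite normrX (ger0_norm a1) expr_le1.
 - by move=> T TS; exact: ((test_C1 (tb T TS)).2 i).2.
 rewrite (eq_bigr (fun T => h^-1 ^+ 2 * (2 * K + 1) ^+ 2 * B T ^+ 2)) => [|T _]; last by rewrite !exprMn mulrA.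
 rewrite -mulr_sumr sB exprMn /L2'; le_eq; field.
 by rewrite hd gt_eqF.
have YE : Y = ip W q phi.
 rewrite (ip_W fm Lq Lphi); apply: eq_bigr => T TS.
 rewrite /E nrm_sq -(@ip_mkcond _ _ (interior (cell T))); last 2 first.
 - by [].
 - by move=> x _ /(cbump_out_IT fm) ->; rewrite !mul0r.
 apply: eq_Rintegral => x /set_mem Tx; rewrite (hP T x TS Tx) (phiE T x TS Tx) /b /eta; ring.
have Ldiff : L2 W (fun x => wdiv W v x - g x) by exact: (L2B mW Ldv Lg).
(* q is (div v - g) - (div v - div w) almost everywhere; integrating the second difference by parts
   against the bubbles leaves only v - w. *)
have YE2 : Y = ipv W (fun x => v x - w x) (grad phi) + ip W (fun x => wdiv W v x - g x) phi.
 rewrite YE /q (ipBl mW Lq0 Lg Lphi) -(@eq_ip_ae _ _ W (wdiv W w) q0 phi mW Ldw Lq0 Lphi aeq0) (ipBl mW Ldv Lg Lphi).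
 have tg := grad_L2v mW tphi.
 have e1 : ipv W v (grad phi) = - ip W (wdiv W v) phi by exact: dv.2 tphi.
 have e2 : ipv W w (grad phi) = - ip W (wdiv W w) phi by exact: dw.2 tphi.
 rewrite (ipvBl mW Lv Lw tg) e1 e2 -/W.
 by move: (ip W (wdiv W w) phi) (ip W g phi) (ip W (wdiv W v) phi) => t1 t2 t3; ring.
have hY : Num.sqrt Y <= d%:R * Num.sqrt L2' * h^-1 * nrmv W (fun x => v x - w x) + nrm W (fun x => wdiv W v x - g x).
 have [->|Yn] := eqVneq Y 0.
  by rewrite sqrtr0 addr_ge0 ?nrm_ge0// !mulr_ge0 ?sqrtr_ge0 ?invr_ge0 ?nrmv_ge0// ltW.
 have sY : 0 < Num.sqrt Y by rewrite sqrtr_gt0 lt_neqAle eq_sym Yn.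
 rewrite -(ler_pM2r sY) -expr2 sqr_sqrtr// {1}YE2 mulrDl.
 have Lvw : L2v W (fun x => v x - w x) by exact: (L2vB mW Lv Lw).
 have tg := grad_L2v mW tphi.
 apply: le_trans (ler_norm _) _; apply: le_trans (ler_normD _ _) _; apply: lerD.
  apply: le_trans (ipv_CS mW Lvw tg) _.
  apply: le_trans (ler_wpM2l (nrmv_ge0 _ _) (nrmv_grad_le ngrad)) _.
  by le_eq; ring.
 apply: le_trans (ip_CS mW Ldiff Lphi) _; exact: (ler_wpM2l (nrm_ge0 _ _) nphi).
set a := nrmv W _ in hY *; set c := nrm W (fun x => wdiv W v x - g x) in hY *.
have : nrm W (fun x => wdiv W v x - wdiv W w x) <= c + Num.sqrt L * Num.sqrt Y.
 apply: (@le_trans _ _ (c + nrm W q)); last by rewrite lerD2l.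
 rewrite (@eq_nrm_ae _ _ W _ (fun x => (wdiv W v x - g x) - q x) mW (L2B mW Ldv Ldw) (L2B mW Ldiff Lq)).
   exact: (nrmB mW Ldiff Lq).
 by apply: filterS aeq0 => x hx Wx; rewrite hx// /q; ring.
move=> /(ler_wpM2l (ltW h0)) /le_trans; apply.
have h1 := ler_wpM2l (sqrtr_ge0 L) hY; have {h1} h1 := ler_wpM2l (ltW h0) h1.
have a0 : 0 <= a by exact: nrmv_ge0. have c0 : 0 <= c by exact: nrm_ge0.
rewrite mulrDr; apply: le_trans (lerD (lexx _) h1) _; rewrite -subr_ge0.
rewrite /C; have : 0 <= Num.sqrt L by exact: sqrtr_ge0.
have : 0 <= Num.sqrt L2' by exact: sqrtr_ge0.
move: (Num.sqrt L) (Num.sqrt L2') => sL sL2 s20 s10.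
have -> : (sL * (d%:R * sL2 + 1) + 1) * (a + h * c) - (h * c + h * (sL * (d%:R * sL2 * h^-1 * a + c))) =
 sL * a + a + sL * d%:R * sL2 * (h * c) by field; rewrite gt_eqF.
by rewrite !addr_ge0 ?mulr_ge0// ltW.
Qed.

End RTtools.

(** * The strip between the domain and the active domain *)

Section Enorm.
Context {R : realType} {d : nat}.
Local Notation pt := 'rV[R]_d.
Lemma coord_le_enorm (x : pt) i : `|x 0 i| <= enorm x.
by rewrite /enorm -sqrtr_sqr ler_wsqrtr// (bigD1 i)//= lerDl; apply: sumr_ge0 => j _; exact: sqr_ge0.
Qed.

Lemma norm_le_enorm (x : pt) : `|x| <= enorm x.
Proof. by apply/row_normP; [exact: sqrtr_ge0|move=> i; exact: coord_le_enorm]. Qed.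
Lemma enorm_le (x : pt) B : `|x| <= B -> enorm x <= d%:R * B.
move=> hB; have B0 : 0 <= B by apply: le_trans hB.
have := @sqrt_sum_le R _ xpredT (fun i : 'I_d => `|x 0 i|) B B0; rewrite card_ord.
rewrite /enorm (_ : \sum_i x 0 i ^+ 2 = \sum_i `|x 0 i| ^+ 2); last first.
 by apply: eq_bigr => i _; rewrite real_normK ?num_real.
by apply=> i _; rewrite normr_ge0 (le_trans (coord_le _ _)).
Qed.

Lemma dot_le (e y : pt) : enorm e = 1 -> `|\sum_i y 0 i * e 0 i| <= d%:R * `|y|.
move=> e1; apply: le_trans (ler_norm_sum _ _ _) _.
apply: le_trans (_ : \sum_(i < d) `|y| <= _); last by rewrite sumr_const card_ord -[leLHS]mulr_natl.
apply: ler_sum => i _; rewrite normrM -[leRHS]mulr1; apply: ler_pM => //.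
 exact: coord_le.
by rewrite -e1; exact: coord_le_enorm.
Qed.

Lemma enorm1_sum (e : pt) : enorm e = 1 -> \sum_i e 0 i * e 0 i = 1.
move=> e1; have : enorm e ^+ 2 = 1 by rewrite e1 expr1n.
rewrite sqr_sqrtr; first by under eq_bigr do rewrite expr2.
by apply: sumr_ge0 => i _; exact: sqr_ge0.
Qed.

(** If the segment never met the boundary, its parameters in [Om] would be open and closed in
    [0, 1]. *)
Lemma bdry_between (Om : set pt) z x : open Om -> Om z -> ~ Om x ->
 exists2 b, bdry Om b & `|x - b| <= `|x - z|.
move=> oO Oz nx; apply: contrapT => nb.
pose gam (t : R) : pt := z + t *: (x - z).
have cg : continuous gam.
 move=> t; apply: cvgD; first exact: cvg_cst.
 by apply: cvgZr_tmp; exact: cvg_id.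
have key : `[0 : R, 1] `&` gam @^-1` Om = `[0 : R, 1]%classic.
 apply: (@segment_connected R 0 1).
 - by exists 0; split; rewrite /= ?in_itv/= ?lexx ?ler01// /gam scale0r addr0.
 - by exists (gam @^-1` Om) => //; apply: open_comp => // t _; exact: cg.
 - exists (gam @^-1` closure Om); first by apply: closed_comp => [t _|]; [exact: cg|exact: closed_closure].
  apply/seteqP; split => t [t01 Ot]; split => //; first exact: subset_closure.
  apply: contrapT => nO; apply: nb; exists (gam t).
   by split => //; rewrite ((@interior_id _ _).1 oO).
  move: t01; rewrite /= in_itv/= => /andP[t0 t1].
  have -> : x - gam t = (1 - t) *: (x - z) by apply/rowP => i; rewrite !mxE; ring.
  rewrite normrZ ger0_norm ?subr_ge0// ler_piMl//; lra.
have : (`[0 : R, 1] `&` gam @^-1` Om) 1 by rewrite key /= in_itv/= lexx ler01.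
by move=> [_]; rewrite /= /gam scale1r addrC subrK.
Qed.

(** A finite list of directions, independent of [h] and of the mesh, such that every point of the
    strip leaves the active domain after a shift by h times one of them. In a boundary chart one
    moves upwards, away from the graph; compactness of the boundary makes the list finite. *)
Lemma strip_geom (Om : set pt) : (0 < d)%N -> open Om -> bounded_dom Om -> lipschitz_boundary Om ->
 exists s : seq pt, forall (h : R) (W : set pt), 0 < h ->
  (forall y, W y -> exists2 z, Om z & `|y - z| <= h) ->
  forall x, W x -> ~ Om x -> exists2 v, v \in s & ~ W (x + h *: v).
move=> d0 oO [B hB] lip; have d0' : 0 < d%:R :> R by rewrite ltr0n.
pose M0 := `|B|; have hM z : Om z -> `|z| <= M0.
 by move=> Oz; apply: le_trans (norm_le_enorm z) _; apply: le_trans (hB z Oz) (ler_norm _).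
have M00 : 0 <= M0 by exact: normr_ge0.
pose chart (b : pt) (eKr : pt * (R * R)) := [/\ enorm eKr.1 = 1, 0 < eKr.2.1, 0 < eKr.2.2 &
 forall (h : R) W x b', 0 < h -> h < eKr.2.2 / (2 * (d%:R * (2 + eKr.2.1))) ->
  (forall y, W y -> exists2 z, Om z & `|y - z| <= h) ->
  `|b' - b| < eKr.2.2 / (4 * d%:R) -> `|x - b'| <= h -> ~ Om x -> ~ W (x + h *: (eKr.2.1 *: eKr.1))].
have /choice[c hc] (b : pt) : exists eKr, bdry Om b -> chart b eKr.
 have [bb|nb] := pselect (bdry Om b); last by exists (0, (0, 0)).
 have [e [rho [L [g [e1 r0 gL ge hO]]]]] := lip b bb.
 (* A shifted point of W would have a point of [Om] within h in the maximum norm. K h is the rise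
    |L| d h of the graph over that distance plus the possible change d h in height, so that point
    could not lie below the graph. *)
 pose K := d%:R * (`|L| + 1); have K0 : 0 < K by rewrite mulr_gt0// ltr_wpDl.
 exists (e, (K, rho)) => _; split=> //= h W x b' h0 hh hW bb' xb' nx.
 move=> /hW[z Oz]; set y := x + _ => yz.
 have dK0 : 0 < 2 * (d%:R * (2 + K)) by rewrite !mulr_gt0// addr_gt0.
 have hh' : h * (2 * (d%:R * (2 + K))) < rho by rewrite -ltr_pdivlMr.
 have bb'' : d%:R * `|b' - b| < rho / 4.
  have : rho / (4 * d%:R) = rho / 4 / d%:R by rewrite invfM mulrA.
  by move=> er; move: bb'; rewrite er ltr_pdivlMr// mulrC.
 have near w : `|w - b| <= 2 * h + h * K + `|b' - b| -> enorm (w - b) < rho.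
  move=> /enorm_le /le_lt_trans; apply.
  move: hh' bb''; rewrite !mulrDr; set t := `|b' - b|; rewrite !mulrA; set dd := d%:R; lra.
 have xb : enorm (x - b) < rho.
  apply: near; have -> : x - b = (x - b') + (b' - b) by rewrite addrA subrK.
  apply: le_trans (ler_normD _ _) _; have : 0 <= h * K by rewrite mulr_ge0// ltW.
  by move: xb'; set p := `|x - b'|; set q := `|b' - b|; lra.
 have yx : `|y - x| <= h * K.
  rewrite /y addrC addKr scalerA normrZ gtr0_norm ?mulr_gt0//.
  apply: ler_piMr; first by rewrite mulr_ge0 ?(ltW h0) ?(ltW K0).
  by rewrite -e1; exact: norm_le_enorm.
 have zb : enorm (z - b) < rho.
  apply: near; have -> : z - b = - (y - z) + (y - x) + (x - b') + (b' - b) by apply/rowP => i; rewrite !mxE; ring.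
  have n1 := ler_normD (- (y - z) + (y - x) + (x - b')) (b' - b).
  have n2 := ler_normD (- (y - z) + (y - x)) (x - b').
  have n3 := ler_normD (- (y - z)) (y - x); rewrite normrN in n3.
  move: n1 n2 n3 yz yx xb'; lra.
 have gx : g x <= \sum_i x 0 i * e 0 i by rewrite leNgt; apply/negP => /(hO x xb).2.
 have gz : \sum_i z 0 i * e 0 i < g z by apply/(hO z zb).1.
 have gzy : g z <= g x + `|L| * (d%:R * h).
  have -> : g x = g y by rewrite /y scalerA ge.
  have h1 : `|g z - g y| <= `|L| * (d%:R * h).
   apply: le_trans (gL z y) _; apply: (@le_trans _ _ (`|L| * enorm (z - y))).
    by rewrite ler_wpM2r ?sqrtr_ge0// ler_norm.
   by rewrite ler_wpM2l//; apply: enorm_le; rewrite distrC.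
  by move: h1; rewrite ler_norml => /andP[? ?]; lra.
 have ye : \sum_i y 0 i * e 0 i = \sum_i x 0 i * e 0 i + h * K.
  rewrite -[h * K]mulr1 -(enorm1_sum e1) mulr_sumr -big_split; apply: eq_bigr => i _ /=.
  by rewrite !mxE; ring.
 have yze : `|\sum_i y 0 i * e 0 i - \sum_i z 0 i * e 0 i| <= d%:R * h.
  rewrite -sumrB (eq_bigr (fun i => (y - z) 0 i * e 0 i)) => [|i _]; last by rewrite !mxE mulrBl.
  by apply: le_trans (dot_le _ e1) _; rewrite ler_pM2l.
 move: yze; rewrite ler_norml ye => /andP[_ yz2].
 have eK : h * K = `|L| * (d%:R * h) + d%:R * h by rewrite /K; ring.
 move: gx gz gzy yz2; rewrite eK; move: (`|L| * (d%:R * h)) => t; lra.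
have cb : compact (bdry Om).
 apply: (@subclosed_compact _ _ [set x : pt | `|x| <= M0]); [|exact: compact_normball|].
  by apply: closedI; [exact: closed_closure|apply: open_closedC; exact: open_interior].
 move=> x [cx _]; have : closure [set x : pt | `|x| <= M0] x by exact: closure_subset cx.
 have cl : closed [set x : pt | `|x| <= M0].
  apply: (@closed_comp _ _ (fun y : pt => `|y|) [set t | t <= M0]); last exact: closed_le.
  by move=> y _; exact: norm_continuous.
 by rewrite -((closure_id _).1 cl).
move: cb; rewrite compact_cover => /(_ pt (bdry Om) (fun b => ball b ((c b).2.2 / (4 * d%:R)))).
case.
- by move=> b bb; exact: ball_open.
- move=> b bb; exists b => //; apply: ballxx; have [_ _ r0 _] := hc b bb.
 by rewrite divr_gt0// mulr_gt0.
move=> D sD cov; pose i0 : 'I_d := Ordinal d0.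
pose h1 b := (c b).2.2 / (2 * (d%:R * (2 + (c b).2.1))).
(* The second family serves mesh sizes too large for a chart: there h is at least [h1 b], and a
   shift by at least 2 M0 + 3h leaves the bounded set containing W. *)
exists ([seq (c b).2.1 *: (c b).1 | b <- finmap.enum_fset D] ++ [seq (2 * M0 / h1 b + 3) *: delta_mx 0 i0 | b <- finmap.enum_fset D]).
move=> h W h0 hW x Wx nx.
have [z Oz xz] := hW x Wx.
have [b' bb' xb'] := bdry_between oO Oz nx.
have [b /= bD b'b] := cov b' bb'.
have [e1 K0 r0 hch] := hc b (set_mem (sD b bD)).
have h1b : 0 < h1 b by rewrite /h1 divr_gt0// !mulr_gt0// addr_gt0.
have [hh|hh] := ltP h (h1 b).
 exists ((c b).2.1 *: (c b).1); first by rewrite mem_cat; apply/orP; left; apply/mapP; exists b.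
 apply: (hch h W x b') => //; last exact: le_trans xb' xz.
 by move: b'b; rewrite mx_norm_ball /ball_/= distrC.
exists ((2 * M0 / h1 b + 3) *: delta_mx 0 i0).
 by rewrite mem_cat; apply/orP; right; apply/mapP; exists b.
have bW y : W y -> `|y 0 i0| <= M0 + h.
 move=> /hW[z' Oz' yz']; apply: le_trans (coord_le y i0) _.
 have -> : y = z' + (y - z') by rewrite addrC subrK.
 by apply: le_trans (ler_normD _ _) _; apply: lerD => //; exact: hM.
move=> /bW; have := bW x Wx; rewrite !mxE !eqxx !mulr1 !ler_norml => /andP[a1 a2] /andP[_].
have : 2 * M0 <= h * (2 * M0 / h1 b).
 by rewrite mulrA ler_pdivlMr// mulrC ler_wpM2r// mulr_ge0.
by rewrite mulrDr; lra.
Qed.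

(** [S] is split according to whether the first direction already leads out of W; that part is
    treated by [test_transl_le], the rest by the remaining directions. *)
Lemma strip_nrm (s : seq pt) (W S : set pt) phi : open W -> measurable S -> test_fun W phi ->
 (forall x, S x -> exists2 v, v \in s & ~ W (x + v)) ->
 nrm S phi <= \sum_(v <- s) \sum_i `|v 0 i| * nrm W (pder i phi).
move=> oW + tphi; elim: s S => [|v s IH] S mS hS.
 rewrite big_nil (_ : S = set0); first by rewrite /nrm /ip Rintegral_set0 sqrtr0.
 by apply/seteqP; split => // x /hS[].
have mWv : measurable [set x | W (x + v)].
 rewrite (_ : [set x | _] = (fun x => v + x) @^-1` W).
  by rewrite -[X in measurable X]setTI; apply: mtranslate => //; exact: open_meas.
 by apply/seteqP; split => x /=; rewrite addrC.
pose S1 := S `\` [set x | W (x + v)]; pose S2 := S `&` [set x | W (x + v)].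
have m1 : measurable S1 by exact: measurableD.
have m2 : measurable S2 by exact: measurableI.
have eS : S = S1 `|` S2 by rewrite setUC setUIDK.
rewrite big_cons; have n1 : nrm S1 phi <= \sum_i `|v 0 i| * nrm W (pder i phi).
 by apply: (test_transl_le m1 tphi) => x [].
have n2 : nrm S2 phi <= \sum_(v <- s) \sum_i `|v 0 i| * nrm W (pder i phi).
 apply: IH => // x [/hS[w]]; rewrite inE => /orP[/eqP -> nW Wv|ws nW _]; last by exists w.
 by case: nW.
apply: le_trans (lerD n1 n2); rewrite -ler_sqr ?nnegrE ?addr_ge0 ?nrm_ge0// {1}eS nrm_setU//.
- by rewrite sqrrD addrAC lerDl mulrn_wge0// mulr_ge0 ?nrm_ge0.
- by apply/disj_setPS => x [[_ n] [_]].
- by rewrite -eS; exact: test_L2 mS tphi.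
Qed.

End Enorm.

(** * From the triangulation to a fat mesh *)

Section FromTriangulation.
Context {R : realType} {d : nat}.
Local Notation pt := 'rV[R]_d.
Local Notation mu := (leb d).
Context (M : mesh R d) (Om Omt : set pt).
Lemma enorm_le_diam (T : elt M) x y : edges (node T) \in unitmx ->
 cell T x -> cell T y -> enorm (x - y) <= diam T.
move=> uT Tx Ty; have [B hB] := simplex_bdd uT.
have lb : (ereal_sup [set (enorm (xy.1 - xy.2))%:E | xy in cell T `*` cell T] <= (d%:R * (B + B))%:E)%E.
 apply: ge_ereal_sup => _ [[p q] /= [Tp Tq] <-]; rewrite lee_fin; apply: enorm_le.
 by apply: le_trans (ler_normB _ _) _; apply: lerD; exact: hB.
have ub : ((enorm (x - y))%:E <= ereal_sup [set (enorm (xy.1 - xy.2))%:E | xy in cell T `*` cell T])%E.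
 by apply: ereal_sup_ubound; exists (x, y).
rewrite /diam /ediam -lee_fin fineK; first by rewrite le_max ub orbT.
rewrite ge0_fin_numE ?le_max ?lexx// gt_max ltry /=; exact: le_lt_trans lb (ltry _).
Qed.

Lemma diam_le_mesh (T : elt M) : diam T <= mesh_size M.
Proof. by rewrite /mesh_size; apply: (le_bigmax_cond _ _ (P := xpredT)). Qed.
(** The factor d compares the Euclidean and the maximum norm. The maxima with 1 guard against given
    constants that are small or negative. *)
Lemma fat_triangulation c_shape c_unif : (0 < d)%N -> Omt !=set0 -> triangulation M Omt ->
 shape_regular M c_shape -> quasi_uniform M c_unif ->
 fat_mesh M (mesh_size M) (d%:R * Num.max 1 c_unif * Num.max 1 c_shape)^-1.
move=> d0 [x0 Ox0] [uM shM cfM covM] sh qu.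
have d0' : 0 < d%:R :> R by rewrite ltr0n.
have u1 : 1 <= Num.max 1 c_unif by rewrite le_max lexx.
have s1 : 1 <= Num.max 1 c_shape by rewrite le_max lexx.
have uT (T : elt M) : edges (node T) \in unitmx := uM T.
have dpos (T : elt M) : 0 < diam T.
 have [x [rho [r0 le_d hb]]] := sh T.
 pose i0 : 'I_d := Ordinal d0.
 have n : node T ord0 != node T (lift ord0 i0).
  by apply/eqP => /(node_inj (uT T))/eqP; rewrite (negbTE (neq_lift _ _)).
 apply: lt_le_trans (enorm_le_diam (uT T) (simplex_node (uT T) ord0) (simplex_node (uT T) (lift ord0 i0))).
 by apply: lt_le_trans (norm_le_enorm _); rewrite normr_gt0 subr_eq0.
have hpos : 0 < mesh_size M.
 have : cells [set: elt M]%SET x0 by rewrite -covM; exact: subset_closure.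
 by move=> [T _ _]; apply: lt_le_trans (dpos T) (diam_le_mesh T).
have kpos : 0 < d%:R * Num.max 1 c_unif * Num.max 1 c_shape.
 by rewrite !mulr_gt0// (lt_le_trans ltr01).
split => //.
- by rewrite invr_gt0.
- move=> T x y Tx Ty; apply: le_trans (norm_le_enorm _) _.
 exact: le_trans (enorm_le_diam (uT T) Tx Ty) (diam_le_mesh T).
move=> T; have [x [rho [r0 le_d hb]]] := sh T; exists x => y yx; apply: hb.
apply: le_trans (enorm_le yx) _.
have h1 : mesh_size M <= Num.max 1 c_unif * (Num.max 1 c_shape * rho).
 apply: le_trans (qu T) _.
 apply: (@le_trans _ _ (Num.max 1 c_unif * diam T)).
  by rewrite ler_wpM2r ?(ltW (dpos T))// le_max lexx orbT.
 rewrite ler_wpM2l ?(le_trans ler01)//; apply: le_trans le_d _.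
 by rewrite ler_wpM2r ?(ltW r0)// le_max lexx orbT.
rewrite mulrA.
have -> : d%:R / (d%:R * Num.max 1 c_unif * Num.max 1 c_shape) * mesh_size M =
  mesh_size M / (Num.max 1 c_unif * Num.max 1 c_shape).
 by field; rewrite !gt_eqF// (lt_le_trans ltr01).
by rewrite ler_pdivrMr ?mulr_gt0 ?(lt_le_trans ltr01)// mulrC -mulrA.
Qed.

Context (h kap : R) (fm : fat_mesh M h kap).
Local Notation S := (active M Om).
Local Notation W := (OmT M Om).
Lemma meet_active (T : elt M) y : open Om -> cell T y -> Om y -> T \in S.
move=> oO Ty Oy; rewrite inE; apply/asboolP.
have [x [Tx Ox]] := cell_meet_interior fm oO (ex_intro2 _ _ y Ty Oy).
have : nbhs x (interior (cell T) `&` Om).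
 by apply: open_nbhs_nbhs; split => //; apply: openI => //; exact: open_interior.
move=> /nbhs_ballP[r /= r0 hr]; have r2 : 0 < r / 2 by rewrite divr_gt0.
apply: (@lt_le_trans _ _ (mu (obox (x - const_mx (r / 2)) (x + const_mx (r / 2))))).
 rewrite leb_obox; last by move=> i; rewrite !mxE; lra.
 by rewrite lte_fin; apply: prodr_gt0 => i _; rewrite !mxE; lra.
apply: le_measure; rewrite ?inE; [exact: mobox| |].
 by apply: measurableI; [exact: (mcell fm)|exact: open_meas].
move=> z /obox_cbox /(cbox_ball _ _ (ltW r2)) hz.
have [/IT_cell Tz Oz] : (interior (cell T) `&` Om) z; last by [].
by apply: hr; rewrite mx_norm_ball /ball_/= distrC; apply: le_lt_trans hz _; lra.
Qed.

Lemma sub_OmT : open Om -> Om `<=` cells [set: elt M]%SET -> Om `<=` W.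
move=> oO cov x Ox; apply: (@interiorS _ Om); last exact: open_nbhs_nbhs.
by move=> y Oy; have [T _ Ty] := cov y Oy; exists T => //; exact: meet_active Ty Oy.
Qed.

Lemma OmT_near y : W y -> exists2 z, Om z & `|y - z| <= h.
move=> /interior_subset[T]; rewrite inE => /asboolP pos Ty.
have [z [Tz Oz]] : (cell T `&` Om) !=set0.
 by apply/set0P/negP => /eqP e; move: pos; rewrite e measure0 ltxx.
by exists z => //; exact: (fm_diam fm Ty Tz).
Qed.

Lemma stabilized_sub (CC : {set {set elt M}}) : (forall P, P \in CC -> P \subset S) -> stabilized CC `<=` W.
move=> act; apply: interiorS => x [F]; rewrite inE => /existsP[T /existsP[T' /and3P[/eqP -> _]]].
move=> /existsP[P /andP[PC /andP[TP T'P]]] [T0 T0F T0x]; exists T0 => //.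
by move: T0F => /set2P[] ->; apply: (fintype.subsetP (act P PC)).
Qed.

End FromTriangulation.

(** * Scalar approximation obtained from vector interpolation *)

Section DgApprox.
Context {R : realType} {d : nat}.
Local Notation pt := 'rV[R]_d.
(** The scalar is placed on axis i and interpolated as a field. Component i of the interpolant may
    have degree k + 1; the excess is removed by [RT_project] at a cost measured by component j,
    where the exact field is zero, so that this cost is itself an interpolation error. Two distinct
    axes are needed. *)
Lemma dg_approx k (kap : R) (i j : 'I_d) : i != j -> 0 < kap -> exists2 C, 0 <= C &
 forall (M : mesh R d) (h : R) (Om : set pt) s w B, fat_mesh M h kap -> L2 (OmT M Om) s ->
 RT M Om k w -> nrmv (OmT M Om) (fun x => axis i s x - w x) <= B ->
 exists2 g, dg M Om k g & nrm (OmT M Om) (fun x => s x - g x) <= C * B.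
move=> ij k0; have r0 : 0 < kap / 2 by rewrite divr_gt0.
have [C0 C00 hC] := @RT_project R d k (kap / 2) 1 i j ij r0.
exists (1 + Num.sqrt (4 ^+ d * C0)); first by rewrite addr_ge0 ?sqrtr_ge0.
move=> M h Om s w B fm Ls RTw hB; set W := OmT M Om; set S := active M Om.
have h0 := fm_h fm; have mW : measurable W by exact: mW_OmT.
have [Lw _ _] := HdivP RTw.1.
have /choice[p hp] (T : elt M) : exists p, T \in S -> RTpoly k p /\ forall x, interior (cell T) x -> w x = p x.
 by have [TS|_] := boolP (T \in S); [have [p hp] := RTw.2 T TS; exists p|exists (fun=> 0)].
have /choice[g hg] (T : elt M) : exists g, T \in S -> poly_fun k g /\
  forall x : pt, `|x - cen h kap T| <= 1 * h -> (p T x 0 i - g x) ^+ 2 <=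
  C0 * h ^- d * nrm setT (fun x : pt => cbump (cen h kap T) (kap / 2 * h) x * p T x 0 j) ^+ 2.
 have [TS|_] := boolP (T \in S); last by exists (fun=> 0).
 by have [g hg] := hC (cen h kap T) h (p T) h0 (hp T TS).1; exists g.
have cp T l : T \in S -> exists n, poly_fun n (fun x => p T x 0 l).
 move=> TS; have [[v [t [pv pt' e]]] _] := hp T TS.
 exists (k + 1)%N; rewrite (_ : (fun x => _) = fun x => vcoord v l x + t x * x 0 l).
  by apply: polyD; [apply: poly_le (pv l); rewrite leq_addr|apply: polyM => //; exact: poly_coord].
 by apply/funext => x; rewrite e !mxE.
have pg T : T \in S -> poly_fun k (g T) by move=> TS; exact: (hg T TS).1.
have Lg : L2 W (pw Om g).
 by apply: L2_pw => // T TS; apply: (L2_IT_cont fm); exact: (poly_C1 (pg T TS)).1.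
exists (pw Om g).
 split; first by have [] := Lg.
 by move=> T TS; exists (g T); split; [exact: pg|move=> x Tx; exact: (pwE fm _ TS Tx)].
have B0 : 0 <= B by apply: le_trans hB; exact: nrmv_ge0.
have La : L2v W (axis i s) by move=> l; rewrite vcoord_axis; case: ifP => // _; exact: L20.
have hl l := le_trans (nrm_vcoord W (fun x => axis i s x - w x) l) hB.
have nj : nrm W (vcoord w j) <= B.
 rewrite -(nrmN W (vcoord w j)); apply: le_trans (hl j); le_eq.
 by apply: eq_nrm => x _; rewrite /vcoord !mxE eqxx /= eq_sym (negbTE ij) mulr0 add0r.
have ni : nrm W (fun x => s x - vcoord w i x) <= B.
 apply: le_trans (hl i); le_eq.
 by apply: eq_nrm => x _; rewrite /vcoord !mxE !eqxx mulr1.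
have Lwg : L2 W (fun x => vcoord w i x - pw Om g x) by exact: (L2B mW (Lw i) Lg).
have nwg : nrm W (fun x => vcoord w i x - pw Om g x) <= Num.sqrt (4 ^+ d * C0) * B.
 apply: le_sqrt_mul => //; first by rewrite mulr_ge0.
 pose E (T : elt M) := nrm (interior (cell T)) (vcoord w j) ^+ 2.
 apply: le_trans (@cellwise_nrm _ _ M h kap fm Om _ (fun T x => p T x 0 i - g T x)
   (fun T => Num.sqrt (C0 * h ^- d * E T)) Lwg _ _) _.
 - move=> T x TS Tx; split; first by rewrite (pwE fm _ TS Tx) /vcoord (hp T TS).2.
  rewrite -sqrtr_sqr ler_wsqrtr//; apply: le_trans ((hg T TS).2 x _) _.
   by rewrite mul1r; apply: (cen_dist fm); exact: IT_cell.
  rewrite ler_wpM2l ?mulr_ge0 ?invr_ge0 ?exprn_ge0 ?(ltW h0)//.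
  have [n pn] := cp T j TS; apply: (cbump_nrm_le fm _ pn) => y Ty.
  by rewrite /vcoord (hp T TS).2.
 - move=> T TS x; have [n pn] := cp T i TS.
  exact: (cvgB ((poly_C1 pn).1 x) ((poly_C1 (pg T TS)).1 x)).
 rewrite (eq_bigr (fun T => C0 * h ^- d * E T)) => [|T _]; last first.
  by rewrite sqr_sqrtr// mulr_ge0 ?sqr_ge0// mulr_ge0 ?invr_ge0 ?exprn_ge0 ?(ltW h0).
 rewrite -mulr_sumr -(nrm_W fm (Lw j)).
 apply: (@le_trans _ _ (4 ^+ d * C0 * nrm W (vcoord w j) ^+ 2)).
  have hd : h ^+ d != 0 by rewrite expf_neq0// gt_eqF.
  by rewrite -/W exprMn; le_eq; field; exact: hd.
 by rewrite ler_wpM2l ?mulr_ge0// ler_sqr ?nnegrE ?nrm_ge0.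
have Lsw : L2 W (fun x => s x - vcoord w i x) by exact: (L2B mW Ls (Lw i)).
have -> : (fun x => s x - pw Om g x) = fun x => (s x - vcoord w i x) + (vcoord w i x - pw Om g x).
 by apply/funext => x; rewrite addrA subrK.
by apply: le_trans (nrmD mW Lsw Lwg) _; rewrite mulrDl mul1r lerD.
Qed.

End DgApprox.

(** * Discrete spaces, the ghost penalty and the divergence residual *)

Section Discrete.
Context {R : realType} {d : nat}.
Local Notation pt := 'rV[R]_d.
Context (M : mesh R d) (Om : set pt).
Local Notation W := (OmT M Om).
Lemma dgZB k (t : R) q r : dg M Om k q -> dg M Om k r -> dg M Om k (fun x => t * q x - r x).
move=> [mq hq] [mr hr]; split.
 by apply: measurable_funB => //; apply: measurable_funM => //; exact: measurable_cst.
move=> T TS; have [p [pp ep]] := hq T TS; have [s [ps es]] := hr T TS.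
exists (fun x => t * p x - s x); split; first by apply: polyB => //; exact: polyZ.
by move=> x Tx; rewrite ep// es.
Qed.

Lemma dg_cst0 k : dg M Om k (fun=> 0).
Proof. by split=> [|T _]; [exact: measurable_cst|exists (fun=> 0); split; [exact: poly0|]]. Qed.
Lemma RT_DZ k (t : R) v w : RT M Om k v -> RT M Om k w -> RT M Om k (fun x => t *: v x + w x).
move=> [Hv hv] [Hw hw]; split; first by apply: HdivD; [exact: openW|apply: HdivZ => //; exact: openW|].
move=> T TS; have [p1 [[v1 [s1 [pv ps e]]] E]] := hv T TS.
have [p2 [[v2 [s2 [pv2 ps2 e2]]] E2]] := hw T TS.
exists (fun x => (t *: v1 x + v2 x) + (t * s1 x + s2 x) *: x); split.
 exists (fun x => t *: v1 x + v2 x), (fun x => t * s1 x + s2 x); split => //.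
 - move=> i; rewrite (_ : vcoord _ i = fun x => t * vcoord v1 i x + vcoord v2 i x).
   by apply: polyD => //; exact: polyZ.
  by apply/funext => x; rewrite /vcoord !mxE.
 - by apply: polyD => //; exact: polyZ.
move=> x Tx; rewrite E// E2// e e2; apply/rowP => i; rewrite !mxE; ring.
Qed.

Lemma RTB k v w : RT M Om k v -> RT M Om k w -> RT M Om k (fun x => v x - w x).
move=> hv hw; have := RT_DZ (-1) hw hv; rewrite (_ : (fun x => _) = fun x => v x - w x)//.
by apply/funext => x; rewrite scaleN1r addrC.
Qed.

Lemma RT_dgv k v : RT M Om k v -> dgv M Om k.+1 v.
move=> [Hv hv] i; have [Lv _ _] := HdivP Hv; split; first by case: (Lv i).
move=> T TS; have [p [[v1 [s1 [pv ps e]]] E]] := hv T TS.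
exists (fun x => vcoord v1 i x + s1 x * x 0 i); split; last first.
 by move=> x Tx; rewrite /vcoord E// e !mxE.
apply: polyD; first by apply: poly_le (pv i).
by rewrite -addn1; apply: polyM => //; exact: poly_coord.
Qed.

Section Ghost.
Context (CC : {set {set elt M}}) (j : {set elt M} -> (pt -> pt) -> (pt -> pt) -> R)
 (k : nat) (c : R) (gp : ghost_penalty Om CC j k c).
Implicit Types v w r : pt -> pt.
Lemma jh_l a v w r : RT M Om k v -> RT M Om k w -> RT M Om k r ->
 jh CC j (fun x => a *: v x + w x) r = a * jh CC j v r + jh CC j w r.
move=> /RT_dgv hv /RT_dgv hw /RT_dgv hr; rewrite /jh mulr_sumr -big_split; apply: eq_bigr => F hF /=.
exact: (gp_linearl gp hF).
Qed.

Lemma jh_r a v w r : RT M Om k v -> RT M Om k w -> RT M Om k r ->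
 jh CC j r (fun x => a *: v x + w x) = a * jh CC j r v + jh CC j r w.
by move=> hv hw hr; rewrite (gp_sym gp hr (RT_DZ a hv hw)) jh_l// (gp_sym gp hv hr) (gp_sym gp hw hr).
Qed.

Lemma jh_quad t v w : RT M Om k v -> RT M Om k w ->
 jh CC j (fun x => t *: w x + v x) (fun x => t *: w x + v x) =
 jh CC j v v + t * jh CC j v w *+ 2 + t ^+ 2 * jh CC j w w.
move=> hv hw; have hs := RT_DZ t hw hv.
by rewrite jh_l// !jh_r// (gp_sym gp hw hv); ring.
Qed.

Lemma jh_CS v w : RT M Om k v -> RT M Om k w -> `|jh CC j v w| <= jnorm CC j v * jnorm CC j w.
move=> hv hw; apply: quad_CS; [exact: (gp_ge0 gp)|exact: (gp_ge0 gp)|].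
by move=> t; rewrite -jh_quad//; apply: (gp_ge0 gp); exact: RT_DZ.
Qed.

Lemma jnormD v w : RT M Om k v -> RT M Om k w ->
 jnorm CC j (fun x => v x + w x) <= jnorm CC j v + jnorm CC j w.
move=> hv hw; have := jh_quad 1 hw hv; rewrite (_ : (fun x => _) = fun x => v x + w x); last first.
 by apply/funext => x; rewrite scale1r.
rewrite mul1r expr1n mul1r => e; rewrite addrC.
apply: (sqrt_triangle _ _ (jh_CS hw hv) e); exact: (gp_ge0 gp).
Qed.

End Ghost.
(** The divergence of [uh] is a piecewise polynomial up to a null set, and the second equation makes
    the residual orthogonal to all of these: minus that divergence is the best approximation of
    [fh]. *)
Lemma residual_le (h kap : R) (fm : fat_mesh M h kap) k fh uh g : RT M Om k uh -> L2 W fh ->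
 (forall q, dg M Om k q -> ip W (wdiv W uh) q = - ip W fh q) -> dg M Om k g ->
 nrm W (fun x => fh x + wdiv W uh x) <= nrm W (fun x => fh x - g x).
move=> hu Lf ort dgg; have mW : measurable W by exact: mW_OmT.
have [_ _ Ld] := HdivP hu.1; have [r [dr aer]] := RT_wdiv fm hu.
have Lr := dg_L2 fm dr; have Lg := dg_L2 fm dgg.
have LX : L2 W (fun x => fh x + wdiv W uh x) by exact: (L2D mW Lf Ld).
have LY : L2 W (fun x => fh x - g x) by exact: (L2B mW Lf Lg).
set X := fun x => fh x + _; have e : ip W X X = ip W X (fun x => fh x - g x).
 pose q := fun x => -1 * r x - g x; have dq : dg M Om k q by exact: dgZB.
 have Lq := dg_L2 fm dq.
 have o : ip W X q = 0 by rewrite (ipDl mW Lf Ld Lq) (ort _ dq) subrr.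
 have -> : ip W X (fun x => fh x - g x) = ip W X (fun x => X x + q x).
  rewrite ![ip W X _]ipC; apply: eq_ip_ae => //; first exact: (L2D mW LX Lq).
  by apply: filterS aer => x hx Wx; rewrite /q /X hx//; ring.
 by rewrite (ipDr mW LX Lq LX) o addr0.
have [->|Xn] := eqVneq (nrm W X) 0; first exact: nrm_ge0.
have X0 : 0 < nrm W X by rewrite lt_neqAle eq_sym Xn nrm_ge0.
rewrite -(ler_pM2l X0) -expr2 nrm_sq e; apply: le_trans (ler_norm _) _; exact: (ip_CS mW LX LY).
Qed.

End Discrete.

(** * Consequences of the continuous problems *)

Section WeakFacts.
Context {R : realType} {d : nat}.
Local Notation pt := 'rV[R]_d.
Local Notation mu := (leb d).
Implicit Types (Om W : set pt).
Lemma axis_test Om i (phi : pt -> R) : open Om -> test_fun Om phi ->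
 L2v Om (axis i phi) /\ is_wdiv Om (axis i phi) (pder i phi).
move=> oO tphi; have mO := open_meas oO.
have La : L2v Om (axis i phi).
 by move=> l; rewrite vcoord_axis; case: ifP => _; [exact: test_L2 mO tphi|exact: L20].
split=> //; have := @is_wdiv_of_wder _ _ Om (axis i phi) (fun l => if l == i then pder i phi else fun=> 0) oO.
case=> [l|L H].
 rewrite vcoord_axis; case: eqP => [->|_]; last exact: is_wder0.
 by apply: is_wder_C1 => //; [exact: test_C1 tphi|exact: test_L2 mO (test_pder i tphi)].
have e x : \sum_l (if l == i then pder i phi else fun=> 0) x = pder i phi x.
 by rewrite (bigD1 i)//= eqxx big1 ?addr0// => l /negbTE ->.
by rewrite -(funext e).
Qed.

Lemma ipv_axis Om i (phi : pt -> R) w : ipv Om w (axis i phi) = ip Om (vcoord w i) phi.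
by rewrite /ipv (bigD1 i)//= vcoord_axis eqxx big1 ?addr0// => l /negbTE n; rewrite vcoord_axis n ip0r.
Qed.

Lemma wgrad_axis Om i (phi q : pt -> R) : open Om -> test_fun Om phi -> Hm Om 1 q ->
 ipv Om (axis i phi) (wgrad Om q) + ip Om (wdiv Om (axis i phi)) q = 0.
move=> oO tphi hq; have [La da] := axis_test i oO tphi; have mO := open_meas oO.
have [Lw H] := Hm_wder i hq; have := H phi tphi; rewrite mder_unit sum_unit_al expr1 mulN1r => e.
rewrite (eq_ip_ae mO _ da.1 hq.1 (wdiv_ae oO da)); last by have [_ _] := HdivP (conj La (ex_intro _ _ da)).
by rewrite ipvC ipv_axis vcoord_wgrad (ipC _ (pder i phi)) e subrr.
Qed.

(** A test function on one axis has zero normal pairing, so the first equation says that u is the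
    weak gradient of p. In particular p is in H^1 even when l = 0. *)
Lemma mixed_weak Om f pD u p : open Om -> L2 Om f -> Hhalf Om pD -> mixed_poisson Om f pD u p ->
 (forall i, is_wder Om (unit_al i) p (vcoord u i)) /\ {ae mu, forall x, Om x -> wdiv Om u x = - f x}.
move=> oO Lf hD [Hu Lp e1 e2]; have [Lu du Ldu] := HdivP Hu; have mO := open_meas oO.
split=> [i|].
 split=> // phi tphi; have [La da] := axis_test i oO tphi.
 have Ha : Hdiv Om (axis i phi) by split => //; exists (pder i phi).
 have := e1 _ Ha; rewrite /normal_pairing.
 have [hP _] := @xgetPex _ (fun=> 0 : R) [set P | Hm Om 1 P /\ is_trace Om P pD] hD.
 rewrite (wgrad_axis i oO tphi hP) ipv_axis => /eqP; rewrite addrC addr_eq0 => /eqP e.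
 rewrite mder_unit sum_unit_al expr1 mulN1r -e ipC; symmetry; have [_ _ Lda] := HdivP Ha.
 exact: (eq_ip_ae mO Lda da.1 Lp (wdiv_ae oO da)).
apply: (ae_eq_of_test oO Ldu); first exact: (L2N mO Lf).
move=> phi tphi; have Lphi := test_L2 mO tphi.
by rewrite e2// (ipNl mO Lf Lphi).
Qed.

Lemma is_wder_ae Om al u v g : open Om -> L2 Om u -> L2 Om v ->
 {ae mu, forall x, Om x -> u x = v x} -> is_wder Om al u g -> is_wder Om al v g.
move=> oO Lu Lv uv [Lg H]; split => // phi tphi; rewrite -H//; symmetry.
have mO := open_meas oO.
apply: eq_ip_ae => //; exact: test_L2 mO (test_mder al tphi).
Qed.

Lemma wgrad_ext_ae Om W q r i g : open Om -> open W -> Om `<=` W -> Hm W 1 q -> L2 Om r ->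
 {ae mu, forall x, Om x -> q x = r x} -> is_wder Om (unit_al i) r g ->
 {ae mu, forall x, Om x -> wder W (unit_al i) q x = g x}.
move=> oO oW OW hq Lr qr hr.
have Lq : L2 Om q by apply: (L2_sub (open_meas oO) (open_meas oW) OW hq.1).
have h1 := is_wder_sub oW oO OW (Hm_wder i hq).
exact: (is_wder_uniq oO (is_wder_ae oO Lq Lr qr h1) hr).
Qed.

Lemma poisson_wdiv Om g z : open Om -> L2 Om g -> poisson_solution Om g z ->
 is_wdiv Om (wgrad Om z) (fun x => - g x).
move=> oO Lg [hz H]; have mO := open_meas oO; split; first exact: (L2N mO Lg).
move=> phi tphi; rewrite (ipNl mO Lg (test_L2 mO tphi)) opprK -(H _ (H10_test oO tphi)).
have Lz := wgrad_L2v hz.1; have Lp := (H10_test oO tphi).1.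
rewrite ![ipv _ (wgrad Om z) _]ipvC; apply: eq_bigr => i _; apply: eq_ip_ae => //.
- by rewrite vcoord_grad; exact: test_L2 mO (test_pder i tphi).
- exact: wgrad_L2v.
- rewrite vcoord_grad vcoord_wgrad.
 have := wder_ae oO (is_wder_C1 oO (test_C1 tphi) (test_L2 mO (test_pder i tphi))).
 by apply: filterS => x h Ox; rewrite h.
Qed.

End WeakFacts.

(** * Energy argument and duality *)

Section ErrorAnalysis.
Context {R : realType} {d : nat}.
Local Notation pt := 'rV[R]_d.
Local Notation mu := (leb d).
(** The linear terms are absorbed by the squares of X - K eps and Y - K eps. Since [K3] >= 1, it is
    at most its square, so it also serves after taking roots. *)
Lemma energy_absorb (X Y gam K eps : R) : 0 <= X -> 0 <= Y -> 0 <= gam -> 0 <= K -> 0 <= eps ->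
 X ^+ 2 + gam * Y ^+ 2 <= K * eps * (eps + X + gam * Y) ->
 let K3 := 1 + (1 + gam) * (2 * K + K ^+ 2 * (1 + gam)) in X <= K3 * eps /\ gam * Y <= K3 * eps.
move=> X0 Y0 g0 K0 e0 H K3; pose K2 := 2 * K + K ^+ 2 * (1 + gam).
have K20 : 0 <= K2 by rewrite addr_ge0 ?mulr_ge0 ?sqr_ge0 ?addr_ge0.
have a1 : 0 <= gam * (Y - K * eps) ^+ 2 by rewrite mulr_ge0 ?sqr_ge0.
have a2 : 0 <= (X - K * eps) ^+ 2 by exact: sqr_ge0.
have H2 : X ^+ 2 + gam * Y ^+ 2 <= K2 * eps ^+ 2.
 by move: H a1 a2; rewrite /K2 !expr2; lra.
have gK : 0 <= gam * K2 by rewrite mulr_ge0.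
have K31 : 1 <= K3 by rewrite /K3 -/K2; lra.
have K3sq : K3 <= K3 ^+ 2 by rewrite expr2 ler_peMl//; lra.
have e20 : 0 <= eps ^+ 2 by exact: sqr_ge0.
have gY0 : 0 <= gam * Y ^+ 2 by rewrite mulr_ge0 ?sqr_ge0.
have X20 : 0 <= X ^+ 2 by exact: sqr_ge0.
have Ke0 : 0 <= K3 * eps by rewrite mulr_ge0//; lra.
have m1 : K2 * eps ^+ 2 <= K3 ^+ 2 * eps ^+ 2.
 by rewrite ler_wpM2r//; apply: le_trans K3sq; rewrite /K3 -/K2; lra.
have m2 : gam * K2 * eps ^+ 2 <= K3 ^+ 2 * eps ^+ 2.
 by rewrite ler_wpM2r//; apply: le_trans K3sq; rewrite /K3 -/K2; lra.
split; rewrite -ler_sqr ?nnegrE ?Ke0 ?mulr_ge0//.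
 by rewrite exprMn; lra.
have m3 : gam * (gam * Y ^+ 2) <= gam * (K2 * eps ^+ 2) by rewrite ler_wpM2l//; lra.
by rewrite !exprMn; move: m2 m3; rewrite !expr2; lra.
Qed.

Lemma sum_bound6 (a1 a2 a3 a4 a5 a6 k1 k2 k3 k4 k5 k6 t : R) :
 - a1 <= k1 * t -> - a2 <= k2 * t -> a3 <= k3 * t -> a4 <= k4 * t -> a5 <= k5 * t -> a6 <= k6 * t ->
 - (a1 + (a2 - a3 - a4 - a5)) + a6 <= (k1 + k2 + k3 + k4 + k5 + k6) * t.
Proof. lra. Qed.
(** Every mesh-dependent ingredient is stated with the one constant [c], and [eps] stands for the
    right-hand side of the velocity estimate. All later constants are formulas in [c], [gam] and
    [d], which gives uniformity in the mesh and the cut. *)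
Record error_setting (k l : nat) (gam c cgp : R) (M : mesh R d) (h kap : R) (Om : set pt)
 (CC : {set {set elt M}}) (j : {set elt M} -> (pt -> pt) -> (pt -> pt) -> R)
 (I : (pt -> pt) -> pt -> pt) (u uh uE : pt -> pt) (f fh e : pt -> R) (eps : R) : Prop := {
 es_fm : fat_mesh M h kap;
 es_hc : h <= c;
 es_open : open Om;
 es_sub : Om `<=` OmT M Om;
 es_bd : forall x, OmT M Om x -> `|x| <= c;
 es_eps : 0 <= eps;
 es_gp : ghost_penalty Om CC j k cgp;
 es_le : forall r, RT M Om k r -> jnorm CC j r <= c * nrmv (OmT M Om) r;
 es_ge : forall r, RT M Om k r -> nrmv (OmT M Om) r <= c * (nrmv Om r + jnorm CC j r);
 es_I : forall m r, (m <= k.+1)%N -> Hmv (OmT M Om) m r -> [/\ RT M Om k (I r),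
  nrmv (OmT M Om) (fun x => r x - I r x) <= c * (h ^+ m * hsemiv (OmT M Om) m r) &
  jnorm CC j (I r) <= c * (h ^+ m * hsemiv (OmT M Om) m r)];
 es_dg : forall m s, (m <= k.+1)%N -> Hm (OmT M Om) m s ->
  exists2 g, dg M Om k g & nrm (OmT M Om) (fun x => s x - g x) <= c * (h ^+ m * hsemi (OmT M Om) m s);
 es_inv : forall v w g, Hdiv (OmT M Om) v -> RT M Om k w -> dg M Om k g ->
  h * nrm (OmT M Om) (fun x => wdiv (OmT M Om) v x - wdiv (OmT M Om) w x) <=
  c * (nrmv (OmT M Om) (fun x => v x - w x) + h * nrm (OmT M Om) (fun x => wdiv (OmT M Om) v x - g x));
 es_test : forall A, 0 <= A ->
  (forall v, RT M Om k v -> `|ip (OmT M Om) (wdiv (OmT M Om) v) e| <= A * nrmv (OmT M Om) v) ->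
  exists et, [/\ test_fun (OmT M Om) et, nrm (OmT M Om) (fun x => e x - et x) <= c * h * A &
   forall i, nrm (OmT M Om) (pder i et) <= c * A];
 es_strip : forall phi B, test_fun (OmT M Om) phi -> (forall i, nrm (OmT M Om) (pder i phi) <= B) ->
  nrm (OmT M Om `\` Om) phi <= c * (h * B);
 es_e : dg M Om k e;
 es_uh : RT M Om k uh;
 es_err : forall v, RT M Om k v -> ip (OmT M Om) (wdiv (OmT M Om) v) e =
  ipv Om (fun x => u x - uh x) v - gam * jh CC j uh v;
 es_ort : forall q, dg M Om k q -> ip (OmT M Om) (wdiv (OmT M Om) uh) q = - ip (OmT M Om) fh q;
 es_fh : L2 (OmT M Om) fh;
 es_f : L2 Om f;
 es_u : Hdiv Om u;
 es_du : {ae mu, forall x, Om x -> wdiv Om u x = - f x};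
 es_uE : Hmv (OmT M Om) l.+1 uE;
 es_uEu : {ae mu, forall x, Om x -> uE x = u x};
 es_fE : Hm (OmT M Om) l.+1 (fun x => - wdiv (OmT M Om) uE x);
 es_bu : h ^+ l.+1 * hsemiv (OmT M Om) l.+1 uE <= c * eps;
 es_bf : forall m, (m <= l.+1)%N ->
  h ^+ l.+1 * hsemi (OmT M Om) m (fun x => - wdiv (OmT M Om) uE x) <= c * eps;
 es_ffE : nrm (OmT M Om) (fun x => fh x - - wdiv (OmT M Om) uE x) <= c * eps;
 es_m2 : forall z, Hm Om 2 z -> H10 Om z ->
  ip Om (fun x => fh x - f x) z <= c * (h * eps * hnorm Om 2 z);
 es_dual : exists z q, [/\ poisson_solution Om e z, Hm Om 2 z, hnorm Om 2 z <= c * nrm Om e &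
  [/\ Hm (OmT M Om) 2 q, hnorm (OmT M Om) 2 q <= c * nrm Om e & {ae mu, forall x, Om x -> q x = z x}]]
}.
Context (k l : nat) (gam c cgp : R)
 (d0 : (0 < d)%N) (lk : (l <= k)%N) (gam0 : 0 <= gam) (c1 : 1 <= c).
Let c0 : 0 <= c. Proof. exact: le_trans c1. Qed.

Section Fixed.
Context (M : mesh R d) (h kap : R) (Om : set pt)
 (CC : {set {set elt M}}) (j : {set elt M} -> (pt -> pt) -> (pt -> pt) -> R)
 (I : (pt -> pt) -> pt -> pt) (u uh uE : pt -> pt) (f fh e : pt -> R) (eps : R)
 (es : error_setting k l gam c cgp h kap Om CC j I u uh uE f fh e eps).
Local Notation W := (OmT M Om).
Let h0 : 0 <= h. Proof. exact: ltW (fm_h (es_fm es)). Qed.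
Let e0 := es_eps es.
Let oW : open W. Proof. exact: openW. Qed.
Let mW : measurable W. Proof. exact: mW_OmT. Qed.
Let mO : measurable Om. Proof. exact: open_meas (es_open es). Qed.
Let OW := es_sub es.
Let gp := es_gp es.
Let RTv v : RT M Om k v -> [/\ L2v W v, L2v Om v, Hdiv W v & L2 W (wdiv W v)].
move=> [hv _]; have [Lv _ Ld] := HdivP hv; split => //.
exact: (L2v_sub mO mW OW Lv).
Qed.

Let Le : L2 W e := dg_L2 (es_fm es) (es_e es).
Let Luh : [/\ L2v W uh, L2v Om uh, Hdiv W uh & L2 W (wdiv W uh)] := RTv (es_uh es).
Let HuE : Hdiv W uE := Hmv_Hdiv oW (es_uE es).
Let Lu : L2v Om u. Proof. by have [] := HdivP (es_u es). Qed.
Let LuE : L2v W uE. Proof. by have [] := HdivP HuE. Qed.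
Let LdE : L2 W (wdiv W uE). Proof. by have [] := HdivP HuE. Qed.
Let jn0 v : 0 <= jnorm CC j v. Proof. exact: sqrtr_ge0. Qed.
Definition data_error := nrmv Om (fun x => u x - uh x) + gam * c * jnorm CC j uh.
Local Notation A := data_error.
Let A0 : 0 <= A. Proof. by rewrite addr_ge0 ?nrmv_ge0// mulr_ge0// mulr_ge0. Qed.
Let err_le v : RT M Om k v -> `|ip W (wdiv W v) e| <= A * nrmv W v.
move=> hv; rewrite (es_err es hv); apply: le_trans (ler_normB _ _) _; rewrite mulrDl; apply: lerD.
 have [Lv LvO _ _] := RTv hv; have [_ LhO _ _] := Luh.
 apply: le_trans (ipv_CS mO (L2vB mO Lu LhO) LvO) _.
 by rewrite ler_wpM2l ?nrmv_ge0//; exact: (nrmv_sub mO mW OW Lv).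
rewrite normrM ger0_norm// -!mulrA ler_wpM2l//; apply: le_trans (jh_CS gp (es_uh es) hv) _.
by rewrite mulrCA ler_wpM2l//; exact: (es_le es).
Qed.

(** The three claims use the test function of [es_test] in three ways: as a substitute for e under
    the divergence, through the strip estimate, and through the Poincare inequality on the active
    domain. *)
Lemma dual_bound : [/\ forall rho, Hdiv W rho ->
  `|ip W (wdiv W rho) e| <= (1 + d%:R) * c * A * (nrmv W rho + h * nrm W (wdiv W rho)),
 nrm (W `\` Om) e <= 2 * c ^+ 2 * h * A & nrm W e <= (1 + 3 * d%:R) * c ^+ 2 * A].
have [et [tet b1 b2]] := es_test es A0 err_le.
have Let := test_L2 mW tet.
have mD : measurable (W `\` Om) by exact: measurableD.
have subD : W `\` Om `<=` W by exact: subDsetl.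
have eE : e = fun x => (e x - et x) + et x by apply/funext => x; rewrite subrK.
have Ld : L2 W (fun x => e x - et x) by exact: (L2B mW Le Let).
have chA0 : 0 <= c * h * A by rewrite mulr_ge0// mulr_ge0.
split.
- by move=> rho hr; exact: (ip_wdiv_bound mW hr Le tet b1 b2 c0 A0 h0).
- rewrite {1}eE; apply: le_trans (nrmD mD _ (L2_sub mD mW subD Let)) _; first exact: (L2_sub mD mW subD Ld).
 have s1 := le_trans (nrm_sub mD mW subD Ld) b1; have s2 := es_strip es tet b2.
 have s3 : c * h * A <= c ^+ 2 * h * A by have := ler_wpM2r chA0 c1; rewrite mul1r expr2; lra.
 apply: le_trans (lerD s1 s2) _; move: s3; rewrite expr2; lra.
- rewrite {1}eE; apply: le_trans (nrmD mW Ld Let) _.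
 have s1 : nrm W (fun x => e x - et x) <= c ^+ 2 * A.
  by apply: le_trans b1 _; rewrite expr2 ler_wpM2r// ler_wpM2l//; exact: (es_hc es).
 have s2 := poincare_test d0 oW (lt_le_trans ltr01 c1) (es_bd es) tet.
 have s3 : \sum_i nrm W (pder i et) <= d%:R * (c * A).
  apply: le_trans (_ : \sum_(i < d) c * A <= _); first by apply: ler_sum => i _; exact: b2.
  by rewrite sumr_const card_ord -[leLHS]mulr_natl.
 have s4 := ler_wpM2l (mulr_ge0 (ler0n _ 3) c0) s3.
 by move: s1 s2 s4; rewrite expr2; lra.
Qed.

Let ip_ae_uE v : L2v Om v -> ipv Om u v = ipv Om uE v.
move=> Lv; apply: (eq_ipv_ae mO Lu (L2v_sub mO mW OW LuE) Lv).
by apply: filterS (es_uEu es) => x hx Ox; rewrite hx.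
Qed.

Let nrmv_ae_uE w : L2v Om w -> nrmv Om (fun x => u x - w x) = nrmv Om (fun x => uE x - w x).
move=> Lw; have LEO := L2v_sub mO mW OW LuE.
apply: (eq_nrmv_ae mO (L2vB mO Lu Lw) (L2vB mO LEO Lw)).
by apply: filterS (es_uEu es) => x hx Ox; rewrite hx.
Qed.

Let wdivB_nrm v w : Hdiv W v -> RT M Om k w ->
 nrm W (wdiv W (fun x => v x - w x)) = nrm W (fun x => wdiv W v x - wdiv W w x).
move=> hv hw; have [_ _ Hw Lw] := RTv hw; have [_ _ Lv] := HdivP hv.
have [_ _ L] := HdivP (HdivB oW hv Hw).
exact: (eq_nrm_ae mW L (L2B mW Lv Lw) (wdivB_ae oW hv Hw)).
Qed.

Lemma residual_bound : nrm W (fun x => fh x + wdiv W uh x) <= (c + c ^+ 2) * eps.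
have [g dgg bg] := es_dg es (m := l.+1) lk (es_fE es).
apply: le_trans (residual_le (es_fm es) (es_uh es) (es_fh es) (es_ort es) dgg) _.
have Lg := dg_L2 (es_fm es) dgg; have LfE := (es_fE es).1.
rewrite (_ : (fun x => _) = fun x => (fh x - - wdiv W uE x) + (- wdiv W uE x - g x)); last first.
 by apply/funext => x; ring.
apply: le_trans (nrmD mW (L2B mW (es_fh es) LfE) (L2B mW LfE Lg)) _.
rewrite mulrDl; apply: lerD; first exact: (es_ffE es).
apply: le_trans bg _; rewrite expr2 -mulrA ler_wpM2l//; exact: (es_bf es).
Qed.

(** [K4] bounds the pairing of e with the divergence of the discrete velocity error by eps times the
    data error, [K5] bounds the data error by eps plus the energy quantities, [K] is the resulting
    constant of the energy inequality and [K3] the outcome of [energy_absorb]. *)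
Definition K4 := c * ((1 + 3 * d%:R) * c ^+ 2) + (1 + d%:R) * c * (c ^+ 2 + c * (c ^+ 2 + c ^+ 2)).
Definition K5 := 1 + c + c ^+ 2 * (1 + gam * c).
Definition K := c ^+ 2 + K4 * K5.
Definition K3 := 1 + (1 + gam) * (2 * K + K ^+ 2 * (1 + gam)).
Local Ltac pos := repeat first [exact: ler01 | exact: ler0n | exact: sqr_ge0 | assumption | apply: addr_ge0 | apply: mulr_ge0].

Lemma K_ge0 : [/\ 0 <= K4, 0 <= K5, 0 <= K & 0 <= K3].
have dd : 0 <= d%:R :> R by exact: ler0n.
have c2 : 0 <= c ^+ 2 by exact: sqr_ge0.
have k4 : 0 <= K4 by rewrite /K4; pos.
have k5 : 0 <= K5 by rewrite /K5; pos.
have kk : 0 <= K by rewrite addr_ge0// mulr_ge0.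
split => //; rewrite /K3; pos.
Qed.

Lemma velocity_bound : exists2 w, RT M Om k w & [/\ w = (fun x => uh x - I uE x),
 nrmv Om w <= K3 * eps, gam * jnorm CC j w <= K3 * eps &
 [/\ nrmv W (fun x => uE x - I uE x) <= c ^+ 2 * eps, jnorm CC j (I uE) <= c ^+ 2 * eps &
  A <= K5 * (1 + 2 * K3) * eps]].
have [RTI bI jI] := es_I es (m := l.+1) lk (es_uE es).
have d1 : nrmv W (fun x => uE x - I uE x) <= c ^+ 2 * eps.
 by apply: le_trans bI _; rewrite expr2 -mulrA ler_wpM2l//; exact: (es_bu es).
have d2 : jnorm CC j (I uE) <= c ^+ 2 * eps.
 by apply: le_trans jI _; rewrite expr2 -mulrA ler_wpM2l//; exact: (es_bu es).
pose w x := uh x - I uE x; have RTw : RT M Om k w by exact: RTB (es_uh es) RTI.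
have [Lw LwO Hw Ldw] := RTv RTw; have [LI LIO HI LdI] := RTv RTI; have [Lh LhO Hh Ldh] := Luh.
have LEO := L2v_sub mO mW OW LuE.
have uhE : uh = fun x => 1 *: w x + I uE x by apply/funext => x; rewrite scale1r /w subrK.
set X := nrmv Om w; set Y := jnorm CC j w.
have X0 : 0 <= X by exact: nrmv_ge0.
have d1O : nrmv Om (fun x => uE x - I uE x) <= c ^+ 2 * eps.
 by apply: le_trans d1; apply: (nrmv_sub mO mW OW); exact: (L2vB mW LuE LI).
have Ale : A <= K5 * (eps + X + gam * Y).
 have a1 : nrmv Om (fun x => u x - uh x) <= c ^+ 2 * eps + X.
  rewrite (nrmv_ae_uE LhO) (_ : (fun x => _) = fun x => (uE x - I uE x) - w x); last first.
   by apply/funext => x; rewrite /w; apply/rowP => i; rewrite !mxE; ring.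
  by apply: le_trans (nrmvB mO (L2vB mO LEO LIO) LwO) _; rewrite lerD2r.
 have a2 : jnorm CC j uh <= Y + c ^+ 2 * eps.
  have := jnormD gp RTw RTI; rewrite (_ : (fun x => _) = uh); last first.
   by apply/funext => x; rewrite /w subrK.
  by move=> /le_trans; apply; rewrite lerD2l.
 have a3 := ler_wpM2l (mulr_ge0 gam0 c0) a2.
 have p1 : 0 <= gam * Y by rewrite mulr_ge0// jn0.
 have p2 : 0 <= c * eps by rewrite mulr_ge0.
 have p3 : 0 <= c * X by rewrite mulr_ge0.
 have p4 : 0 <= c ^+ 2 * (1 + gam * c) * (X + gam * Y).
  by rewrite mulr_ge0 ?addr_ge0// mulr_ge0 ?sqr_ge0// addr_ge0 ?mulr_ge0.
 by rewrite /data_error /K5; move: a1 a3 p1 p2 p3 p4 e0; rewrite expr2; lra.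
have [D _ De] := dual_bound.
have bdiv : `|ip W (wdiv W w) e| <= K4 * eps * A.
 have LEI : L2 W (fun x => wdiv W uE x - wdiv W (I uE) x) by exact: (L2B mW LdE LdI).
 have Lffe := L2B mW (es_fh es) (es_fE es).1.
 have HEI := HdivB oW HuE HI.
 (* As e itself is a discrete pressure, the second equation replaces the divergence of [uh] by
    -[fh]; the interpolation error and the extension error of the data remain. *)
 have -> : ip W (wdiv W w) e = ip W (wdiv W (fun x => uE x - I uE x)) e - ip W (fun x => fh x - - wdiv W uE x) e.
  have [_ _ LwEI] := HdivP HEI.
  rewrite (eq_ip_ae mW Ldw (L2B mW Ldh LdI) Le (wdivB_ae oW Hh HI)).
  rewrite (eq_ip_ae mW LwEI LEI Le (wdivB_ae oW HuE HI)).
  rewrite (ipBl mW Ldh LdI Le) (ipBl mW LdE LdI Le) (ipBl mW (es_fh es) (es_fE es).1 Le) (ipNl mW LdE Le).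
  rewrite (es_ort es (es_e es)).
  by move: (ip W fh e) (ip W (wdiv W (I uE)) e) (ip W (wdiv W uE) e) => x y z; ring.
 apply: le_trans (ler_normB _ _) _.
 have [g dgg bg] := es_dg es (leqW lk) (Hm_le (leqnSn l) (es_fE es)).
 (* g approximates minus the divergence of [uE], hence the sign; the subtracted zero only fits the
    form of [dgZB]. *)
 have dg' : dg M Om k (fun x => -1 * g x - 0) by exact: dgZB dgg (dg_cst0 M Om k).
 have b1 := es_inv es HuE RTI dg'.
 have b2 : h * nrm W (fun x => wdiv W uE x - (-1 * g x - 0)) <= c ^+ 2 * eps.
  rewrite (_ : (fun x => _) = fun x => - (- wdiv W uE x - g x)); last by apply/funext => x; ring.
  rewrite nrmN; apply: le_trans (ler_wpM2l h0 bg) _.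
  by have := ler_wpM2l c0 (es_bf es (leqnSn l)); rewrite exprS expr2; lra.
 have b3 := D _ HEI; rewrite (wdivB_nrm HuE RTI) in b3.
 have b4 := ip_CS mW Lffe Le.
 have b5 : nrm W (fun x => fh x - - wdiv W uE x) * nrm W e <= c * eps * ((1 + 3 * d%:R) * c ^+ 2 * A).
  by apply: ler_pM; rewrite ?nrm_ge0//; exact: (es_ffE es).
 have b6 := ler_wpM2l c0 (lerD d1 b2); have b7 := lerD d1 (le_trans b1 b6).
 have cA : 0 <= (1 + d%:R) * c * A by rewrite mulr_ge0// mulr_ge0.
 have b8 := ler_wpM2l cA b7.
 apply: le_trans (lerD (le_trans b3 b8) (le_trans b4 b5)) _.
 by rewrite /K4; le_eq; ring.
have en : X ^+ 2 + gam * Y ^+ 2 <= K * eps * (eps + X + gam * Y).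
 (* The error equation is tested with w = [uh] - I [uE]: the squares of its norm and of its penalty
    split off, and only interpolation errors and the pressure term remain. *)
 have i1 : ipv Om (fun x => u x - uh x) w = ipv Om (fun x => uE x - I uE x) w - X ^+ 2.
  rewrite (ipvBl mO Lu LhO LwO) (ip_ae_uE LwO) (ipvBl mO LEO LIO LwO) nrmv_sq uhE.
  rewrite (_ : (fun x => 1 *: w x + I uE x) = fun x => w x + I uE x); last first.
   by apply/funext => x; rewrite scale1r.
  rewrite (ipvDl mO LwO LIO LwO); ring.
 have i2 : jh CC j uh w = Y ^+ 2 + jh CC j (I uE) w.
  by rewrite {1}uhE (jh_l gp)// mul1r /Y /jnorm sqr_sqrtr//; exact: (gp_ge0 gp).
 have i3 := es_err es RTw; rewrite i1 i2 in i3.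
 have j1 : ipv Om (fun x => uE x - I uE x) w <= c ^+ 2 * eps * X.
  apply: le_trans (ler_norm _) _; apply: le_trans (ipv_CS mO (L2vB mO LEO LIO) LwO) _.
  by rewrite ler_wpM2r.
 have j2 : - jh CC j (I uE) w <= c ^+ 2 * eps * Y.
  apply: le_trans (ler_norm _) _; rewrite normrN; apply: le_trans (jh_CS gp RTI RTw) _.
  by rewrite ler_wpM2r ?jn0.
 have j3 : - ip W (wdiv W w) e <= K4 * eps * A by apply: le_trans (ler_norm _) _; rewrite normrN.
 have j4 := ler_wpM2l gam0 j2.
 have K40 : 0 <= K4 * eps.
  by have [k4 _ _ _] := K_ge0; rewrite mulr_ge0.
 have j5 := ler_wpM2l K40 Ale.
 have p1 : 0 <= c ^+ 2 * eps * eps by rewrite mulr_ge0// mulr_ge0 ?sqr_ge0.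
 rewrite /K; move: i3 j1 j3 j4 j5 p1; move: (ipv Om _ w) (jh CC j (I uE) w) (ip W _ e) => a b q.
 by move: K4 K5 A => k4 k5 a'; rewrite !expr2; lra.
have [_ K50 Kge _] := K_ge0.
have [bX bY] := energy_absorb X0 (jn0 w) gam0 Kge e0 en.
exists w => //; split => //; split => //.
apply: le_trans Ale _; rewrite -mulrA ler_wpM2l//; move: bX bY; rewrite -/K3 -/X -/Y; lra.
Qed.

Definition K7 := K3 + gam * c ^+ 2.
Let jump_uh : gam * jnorm CC j uh <= K7 * eps.
have [w RTw [ew _ b [_ bj _]]] := velocity_bound.
have [RTI _ _] := es_I es (m := l.+1) lk (es_uE es).
have := jnormD gp RTw RTI; rewrite (_ : (fun x => _) = uh); last first.
 by apply/funext => x; rewrite ew subrK.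
move=> h1; have := ler_wpM2l gam0 h1; have := ler_wpM2l gam0 bj; rewrite /K7; lra.
Qed.

(** [K3 / gam] bounds the penalty of the discrete error for positive [gam], in order to pass from
    [Om] to the active domain. For [gam] = 0 the quotient is 0 by convention, and [norm_gamma] is
    then the norm on [Om], which does not need it. *)
Definition KA := (c ^+ 2 + K3 + c * (K3 + K3 / gam)) + (c + (c + c ^+ 2)) + K7.
Lemma velocity_estimate :
 norm_Sigma M Om gam (fun x => uE x - uh x) + gam * jnorm CC j uh <= KA * eps.
have [w RTw [ew bX bY [bW _ _]]] := velocity_bound.
have [RTI _ _] := es_I es (m := l.+1) lk (es_uE es).
have [Lw LwO _ _] := RTv RTw; have [LI LIO _ _] := RTv RTI; have [Lh LhO Hh Ldh] := Luh.
have [_ _ _ K30] := K_ge0.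
have eE : (fun x => uE x - uh x) = fun x => (uE x - I uE x) - w x.
 by apply/funext => x; rewrite ew; apply/rowP => i; rewrite !mxE; ring.
have K3g : 0 <= K3 / gam by rewrite divr_ge0.
have p1 : 0 <= c * (K3 + K3 / gam) * eps by apply: mulr_ge0 => //; apply: mulr_ge0 => //; exact: addr_ge0.
have b1 : norm_gamma M Om gam (fun x => uE x - uh x) <= (c ^+ 2 + K3 + c * (K3 + K3 / gam)) * eps.
 rewrite /norm_gamma eE; case: ltP => [g0|_].
  apply: le_trans (nrmvB mW (L2vB mW LuE LI) Lw) _.
  have bj : jnorm CC j w <= K3 / gam * eps.
   by rewrite mulrAC ler_pdivlMr// mulrC.
  have h1 := ler_wpM2l c0 (lerD bX bj); have h2 := le_trans (es_ge es RTw) h1.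
  have : 0 <= K3 * eps by rewrite mulr_ge0.
  by move: bW h2; lra.
 have LEO := L2v_sub mO mW OW LuE.
 apply: le_trans (nrmvB mO (L2vB mO LEO LIO) LwO) _.
 have := nrmv_sub mO mW OW (L2vB mW LuE LI); move: bW bX p1; lra.
have b2 : nrm W (wdiv W (fun x => uE x - uh x)) <= (c + (c + c ^+ 2)) * eps.
 rewrite (wdivB_nrm HuE (es_uh es)).
 rewrite (_ : (fun x => _) = fun x => (fh x - - wdiv W uE x) - (fh x + wdiv W uh x)); last first.
  by apply/funext => x; ring.
 apply: le_trans (nrmB mW (L2B mW (es_fh es) (es_fE es).1) (L2D mW (es_fh es) Ldh)) _.
 by have := es_ffE es; have := residual_bound; lra.
have b3 : norm_Sigma M Om gam (fun x => uE x - uh x) <=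
  norm_gamma M Om gam (fun x => uE x - uh x) + nrm W (wdiv W (fun x => uE x - uh x)).
 rewrite /norm_Sigma; set a := norm_gamma _ _ _ _; set b := nrm _ _.
 have a0 : 0 <= a by rewrite /a /norm_gamma; case: ifP => _; exact: nrmv_ge0.
 have bb0 : 0 <= b by exact: nrm_ge0.
 rewrite -[leRHS](ger0_norm (addr_ge0 a0 bb0)) -sqrtr_sqr ler_wsqrtr// sqrrD addrAC lerDl.
 by rewrite mulrn_wge0// mulr_ge0.
by have := jump_uh; rewrite /KA; move: b1 b2 b3; lra.
Qed.

Definition K6 := K5 * (1 + 2 * K3).
Definition K8 := d%:R * (@nal R d 1 * c).
Definition KZ := (1 + d%:R) * c * K6 * (c * K8 + c * (c * K8 + d%:R * c)) +
 (c + c ^+ 2) * (c * (@nal R d 1 * c)) + c ^+ 2 + K6 * (c * K8) + K7 * (c * K8) +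
 d%:R * c * (2 * c ^+ 2 * K6).
(** q extends the solution z of the dual problem with datum e, and v is its gradient. The squared
    norm of e splits into six terms, each bounded by [eps] times h times the norm of e: every term
    pairs a quantity of order eps with an approximation or strip quantity of order h, or uses the
    negative norm of the data. *)
Lemma duality_bound : nrm Om e <= KZ * (h * eps).
have [w0 _ [_ _ _ [_ _ bA]]] := velocity_bound; rewrite -/K6 in bA.
have [D Dst _] := dual_bound; have [_ K50 _ K30] := K_ge0.
have K60 : 0 <= K6 by rewrite mulr_ge0// addr_ge0// mulr_ge0.
have [z [q [pz Hz bz [Hq bq qz]]]] := es_dual es.
set N := nrm Om e in bz bq *; have N0 : 0 <= N by exact: nrm_ge0.
have LeO : L2 Om e := L2_sub mO mW OW Le.
have [Lh LhO Hh Ldh] := Luh.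
pose v := wgrad W q; have Hv : Hmv W 1 v by exact: Hmv_wgrad.
have HdV : Hdiv W v := Hmv_Hdiv oW Hv.
have [Lv dv Ldv] := HdivP HdV; have LvO := L2v_sub mO mW OW Lv.
have [RTI bI jI] := es_I es (m := 1) (ltn0Sn k) Hv; rewrite expr1 in bI jI.
have [LI LIO HI LdI] := RTv RTI.
have hs : hsemiv W 1 v <= K8 * N.
 apply: le_trans (hsemiv_wgrad oW Hq) _; rewrite /K8 -!mulrA ler_wpM2l ?ler0n//.
 by rewrite ler_wpM2l ?nal_ge0.
have hsc : c * (h * hsemiv W 1 v) <= c * K8 * (h * N).
 by have := ler_wpM2l c0 (ler_wpM2l h0 hs); lra.
have {}bI := le_trans bI hsc; have {}jI := le_trans jI hsc.
have bd : nrm W (wdiv W v) <= d%:R * (c * N).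
 by apply: le_trans (nrm_wdiv_wgrad oW Hq) _; rewrite ler_wpM2l ?ler0n.
have wg X : L2v Om X -> ipv Om v X = ipv Om (wgrad Om z) X.
 move=> LX; have Lz := wgrad_L2v pz.1.1; apply: eq_bigr => i _.
 apply: (eq_ip_ae mO (LvO i) (Lz i) (LX i)); rewrite /v !vcoord_wgrad.
 exact: (wgrad_ext_ae (es_open es) oW OW (Hm_le (leqnSn 1) Hq) pz.1.1.1 qz (Hm_wder i pz.1.1)).
have dvO : {ae mu, forall x, Om x -> wdiv W v x = - e x}.
 have h1 : is_wdiv Om v (wdiv W v) := is_wdiv_sub oW (es_open es) OW dv.
 apply: (is_wdiv_uniq (es_open es) h1); split; first exact: (L2N mO LeO).
 move=> phi tphi; rewrite -((poisson_wdiv (es_open es) LeO pz).2 _ tphi).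
 by apply: wg; exact: (grad_L2v mO tphi).
have LdvO : L2 Om (wdiv W v) := L2_sub mO mW OW Ldv.
have mD : measurable (W `\` Om) by exact: measurableD.
have subD : W `\` Om `<=` W by exact: subDsetl.
have eW : W = Om `|` (W `\` Om) by rewrite setDUK.
have dis : [disjoint Om & W `\` Om] by apply/disj_setPS => x [Ox [_]].
(* Outside [Om] the extension satisfies no equation, so the strip contribution is added back; it is
   small because e is O(h A) there. *)
have id1 : N ^+ 2 = - ip W (wdiv W v) e + ip (W `\` Om) (wdiv W v) e.
 have -> : ip W (wdiv W v) e = ip Om (wdiv W v) e + ip (W `\` Om) (wdiv W v) e.
  by rewrite -(ip_setU mO mD dis) -?eW.
 rewrite (eq_ip_ae mO LdvO (L2N mO LeO) LeO dvO) (ipNl mO LeO LeO) /N nrm_sq.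
 by move: (ip Om e e) (ip _ _ e) => a b; ring.
have HEI := HdivB oW HdV HI.
have id2 : ip W (wdiv W v) e = ip W (wdiv W (fun x => v x - I v x)) e + ip W (wdiv W (I v)) e.
 have [_ _ LEI] := HdivP HEI.
 rewrite (eq_ip_ae mW LEI (L2B mW Ldv LdI) Le (wdivB_ae oW HdV HI)) (ipBl mW Ldv LdI Le).
 by move: (ip W (wdiv W v) e) (ip W (wdiv W (I v)) e) => a b; ring.
have Ldiff := L2vB mO Lu LhO; have LvI := L2vB mO LvO LIO.
have id3 : ipv Om (fun x => u x - uh x) (I v) =
  ipv Om (fun x => u x - uh x) (wgrad Om z) - ipv Om (fun x => u x - uh x) (fun x => v x - I v x).
 by rewrite (ipvBr mO LvO LIO Ldiff) ![ipv Om (fun x => u x - uh x) _]ipvC (wg _ Ldiff) subKr.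
have HhO := Hdiv_sub oW (es_open es) OW Hh.
have Hdiff := HdivB (es_open es) (es_u es) HhO.
have LhdO : L2 Om (wdiv W uh) := L2_sub mO mW OW Ldh.
have LfhO : L2 Om fh := L2_sub mO mW OW (es_fh es).
have Lz : L2 Om z := pz.1.1.1.
have Lr : L2 W (fun x => fh x + wdiv W uh x) by exact: (L2D mW (es_fh es) Ldh).
(* Green's formula for z, which vanishes on the boundary, turns the velocity error into the discrete
   residual and the data error [fh] - [f]. *)
have id4 : ipv Om (fun x => u x - uh x) (wgrad Om z) =
  ip Om (fun x => fh x + wdiv W uh x) z - ip Om (fun x => fh x - f x) z.
 rewrite (H10_green (es_open es) pz.1 Hdiff).
 have [_ _ Ldd] := HdivP Hdiff.
 rewrite (@eq_ip_ae _ _ Om _ (fun x => - f x - wdiv W uh x) z mO Ldd (L2B mO (L2N mO (es_f es)) LhdO) Lz).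
  rewrite (ipBl mO (L2N mO (es_f es)) LhdO Lz) (ipNl mO (es_f es) Lz).
  rewrite (ipDl mO LfhO LhdO Lz) (ipBl mO LfhO (es_f es) Lz).
  by move: (ip Om f z) (ip Om fh z) (ip Om (wdiv W uh) z) => a b b'; ring.
 apply: filterS3 (wdivB_ae (es_open es) (es_u es) HhO) (es_du es) (wdiv_sub_ae oW (es_open es) OW Hh).
 by move=> x h1 h2 h3 Ox; rewrite h1// h2// h3.
have hN0 : 0 <= h * N by rewrite mulr_ge0.
have ehN0 : 0 <= eps * (h * N) by rewrite mulr_ge0.
have t1 : `|ip W (wdiv W (fun x => v x - I v x)) e| <=
  (1 + d%:R) * c * K6 * (c * K8 + c * (c * K8 + d%:R * c)) * (eps * (h * N)).
 apply: le_trans (D _ HEI) _; rewrite (wdivB_nrm HdV RTI).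
 have b1 := es_inv es HdV RTI (dg_cst0 M Om k).
 have b2 : h * nrm W (fun x => wdiv W v x - 0) <= d%:R * c * (h * N).
  rewrite (_ : (fun x => _) = wdiv W v); last by apply/funext => x; rewrite subr0.
  by apply: le_trans (ler_wpM2l h0 bd) _; le_eq; ring.
 have b3 := ler_wpM2l c0 (lerD bI b2); have b4 := lerD bI (le_trans b1 b3).
 have cd : 0 <= (1 + d%:R) * c by rewrite mulr_ge0// addr_ge0 ?ler0n.
 apply: le_trans (ler_pM _ _ (ler_wpM2l cd bA) b4) _.
 - by rewrite mulr_ge0.
 - by rewrite addr_ge0 ?nrmv_ge0// mulr_ge0 ?nrm_ge0.
 - by le_eq; ring.
have t2 : - ip Om (fun x => fh x + wdiv W uh x) z <= (c + c ^+ 2) * (c * (@nal R d 1 * c)) * (eps * (h * N)).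
 (* The residual is orthogonal to discrete pressures on the whole active domain, not on [Om];
    extending z by zero allows a discrete approximation to be subtracted there. *)
 have Hz0 := Hm_zext (es_open es) oW OW pz.1.
 have [g dgg bg] := es_dg es (m := 1) (ltn0Sn k) Hz0; rewrite expr1 in bg.
 have Lg := dg_L2 (es_fm es) dgg; have Lz0 := Hz0.1.
 have o : ip W (fun x => fh x + wdiv W uh x) g = 0.
  by rewrite (ipDl mW (es_fh es) Ldh Lg) (es_ort es dgg) subrr.
 rewrite ipC -(ip_zext _ _ OW) ipC.
 rewrite (_ : ip W _ (zext Om z) = ip W (fun x => fh x + wdiv W uh x) (fun x => zext Om z x - g x)); last first.
  by rewrite (ipBr mW Lz0 Lg Lr) o subr0.
 apply: le_trans (ler_norm _) _; rewrite normrN.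
 apply: le_trans (ip_CS mW Lr (L2B mW Lz0 Lg)) _.
 have b1 : nrm W (fun x => zext Om z x - g x) <= c * (@nal R d 1 * c) * (h * N).
  have b2 := le_trans (hsemi_zext 1 (es_open es) oW OW pz.1) (ler_wpM2l (@nal_ge0 R d 1) bz).
  apply: le_trans bg _; apply: le_trans (ler_wpM2l c0 (ler_wpM2l h0 b2)) _.
  le_eq; ring.
 apply: le_trans (ler_pM (nrm_ge0 _ _) (nrm_ge0 _ _) residual_bound b1) _.
 by le_eq; ring.
have t3 : ip Om (fun x => fh x - f x) z <= c ^+ 2 * (eps * (h * N)).
 apply: le_trans (es_m2 es Hz pz.1) _.
 rewrite mulrA; apply: le_trans (ler_wpM2l (mulr_ge0 c0 (mulr_ge0 h0 e0)) bz) _.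
 le_eq; ring.
have t4 : ipv Om (fun x => u x - uh x) (fun x => v x - I v x) <= K6 * (c * K8) * (eps * (h * N)).
 apply: le_trans (ler_norm _) _; apply: le_trans (ipv_CS mO Ldiff LvI) _.
 have b1 : nrmv Om (fun x => u x - uh x) <= K6 * eps.
  apply: le_trans bA; rewrite lerDl; rewrite mulr_ge0// mulr_ge0//.
 have b2 := le_trans (nrmv_sub mO mW OW (L2vB mW Lv LI)) bI.
 apply: le_trans (ler_pM (nrmv_ge0 _ _) (nrmv_ge0 _ _) b1 b2) _.
 by le_eq; ring.
have t5 : gam * jh CC j uh (I v) <= K7 * (c * K8) * (eps * (h * N)).
 have b1 := le_trans (ler_norm _) (jh_CS gp (es_uh es) RTI).
 have b2 := ler_wpM2l gam0 b1; rewrite mulrA in b2; apply: le_trans b2 _.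
 apply: le_trans (ler_pM _ (jn0 _) jump_uh jI) _; first by rewrite mulr_ge0// jn0.
 by le_eq; ring.
have t6 : ip (W `\` Om) (wdiv W v) e <= d%:R * c * (2 * c ^+ 2 * K6) * (eps * (h * N)).
 apply: le_trans (ler_norm _) _.
 apply: le_trans (ip_CS mD (L2_sub mD mW subD Ldv) (L2_sub mD mW subD Le)) _.
 have b1 := le_trans (nrm_sub mD mW subD Ldv) bd.
 have ch : 0 <= 2 * c ^+ 2 * h by rewrite mulr_ge0// mulr_ge0 ?sqr_ge0.
 have b2 := le_trans Dst (ler_wpM2l ch bA).
 apply: le_trans (ler_pM (nrm_ge0 _ _) (nrm_ge0 _ _) b1 b2) _.
 by le_eq; ring.
have fin : N ^+ 2 <= KZ * (h * eps) * N.
 have := es_err es RTI; rewrite id3 id4 => id5.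
 have t1' : - ip W (wdiv W (fun x => v x - I v x)) e <=
   (1 + d%:R) * c * K6 * (c * K8 + c * (c * K8 + d%:R * c)) * (eps * (h * N)).
  by apply: le_trans t1; rewrite -normrN; exact: ler_norm.
 rewrite id1 id2 id5; have -> : KZ * (h * eps) * N = KZ * (eps * (h * N)) by ring.
 exact: (sum_bound6 t1' t2 t3 t4 t5 t6).
(* Division by N needs N > 0; for N = 0 it remains to see that the constant is nonnegative. *)
have [->|Nn] := eqVneq N 0.
 have [_ _ _ _] := K_ge0.
 have K80 : 0 <= K8 by rewrite mulr_ge0 ?ler0n// mulr_ge0 ?nal_ge0.
 have c20 : 0 <= c ^+ 2 by exact: sqr_ge0.
 have K70 : 0 <= K7 by rewrite addr_ge0// mulr_ge0.
 apply: mulr_ge0; last exact: mulr_ge0.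
 rewrite /KZ; repeat first [exact: c20 | exact: K60 | exact: K70 | exact: K80 | exact: c0 | exact: ler01 | exact: ler0n | exact: nal_ge0 | apply: addr_ge0 | apply: mulr_ge0].
have Np : 0 < N by rewrite lt_neqAle eq_sym Nn.
by rewrite -(ler_pM2r Np) -expr2.
Qed.

Definition KB := KZ + 2 * c ^+ 2 * K6.
Lemma pressure_estimate : nrm W e <= KB * (h * eps).
have [w0 _ [_ _ _ [_ _ bA]]] := velocity_bound; rewrite -/K6 in bA.
have [_ Dst _] := dual_bound.
have mD : measurable (W `\` Om) by exact: measurableD.
have eW : W = Om `|` (W `\` Om) by rewrite setDUK.
have dis : [disjoint Om & W `\` Om] by apply/disj_setPS => x [Ox [_]].
have ch : 0 <= 2 * c ^+ 2 * h by rewrite mulr_ge0// mulr_ge0 ?sqr_ge0.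
have b2 := le_trans Dst (ler_wpM2l ch bA); have b1 := duality_bound.
apply: (@le_trans _ _ (nrm Om e + nrm (W `\` Om) e)); last by rewrite /KB; move: b1 b2; lra.
rewrite -ler_sqr ?nnegrE ?addr_ge0 ?nrm_ge0//.
have -> : nrm W e ^+ 2 = nrm Om e ^+ 2 + nrm (W `\` Om) e ^+ 2.
 by rewrite -(nrm_setU mO mD dis) -?eW.
by rewrite sqrrD addrAC lerDl mulrn_wge0// mulr_ge0 ?nrm_ge0.
Qed.

End Fixed.
End ErrorAnalysis.

(** * The negative norm in the assumption on the data *)

Section NegativeNorm.
Context {R : realType} {d : nat}.
Local Notation pt := 'rV[R]_d.
Local Notation mu := (leb d).
Lemma ae_forall_fin (I : finType) (P : I -> pt -> Prop) : (forall i, {ae mu, forall x, P i x}) ->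
 {ae mu, forall x, forall i, P i x}.
move=> hP; suff H : {ae mu, forall x, forall i, i \in enum I -> P i x}.
 by apply: filterS H => x hx i; apply: hx; rewrite mem_enum.
elim: (enum I) => [|i s IH]; first by apply: aeW.
by apply: filterS2 (hP i) IH => x a b i'; rewrite inE => /orP[/eqP ->//|]; exact: b.
Qed.

Lemma hnorm_nrm (Om : set pt) m z : open Om -> L2 Om z -> nrm Om z <= hnorm Om m z.
move=> oO Lz; have wz := is_wder_al0 Lz; rewrite -(nrm_wder oO wz).
by apply: wder_hnorm; rewrite big1.
Qed.

(** A supremum in the extended reals is nonnegative only if some admissible quotient is: a bump in
    [Om] or its negative provides one. *)
Lemma norm_m2_ge0 (Om : set pt) g : open Om -> Om !=set0 -> L2 Om g -> (0 <= norm_m2 Om g)%E.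
move=> oO [x0 Ox0] Lg; have mO := open_meas oO.
have [r /= r0 hr] := (nbhs_ballP _ _).1 (open_nbhs_nbhs (conj oO Ox0)).
have r2 : 0 < r / 2 by rewrite divr_gt0.
have tb : test_fun Om (cbump x0 (r / 2)).
 have := @test_cbump R d Om x0 (r / 2) 0 0 (fun=> 1) r2 (poly_cst 0 1).
 rewrite (_ : (fun x => _) = cbump x0 (r / 2)); last by apply/funext => x; rewrite expr1 mulr1.
 by apply=> x hx; apply: hr; rewrite mx_norm_ball /ball_/= distrC; apply: le_lt_trans hx _; lra.
have key phi : test_fun Om phi -> phi x0 != 0 -> 0 <= ip Om g phi -> (0 <= norm_m2 Om g)%E.
 move=> tphi p0 hip; have Lp := test_L2 mO tphi.
 have hn : hnorm Om 2 phi != 0.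
  apply/eqP => h0; move/eqP: p0; apply.
  have n0 : nrm Om phi = 0 by apply: le_anti; rewrite nrm_ge0 andbT -h0 hnorm_nrm.
  exact: (cont_ae0 oO (test_C1 tphi).1 (nrm0_ae mO Lp n0)).
 apply: (@le_trans _ _ (ip Om g phi / hnorm Om 2 phi)%:E).
  by rewrite lee_fin divr_ge0// hnorm_ge0.
 apply: ereal_sup_ubound; exists phi => //; split => //; last exact: H10_test.
 by apply: Hm_test => //; exact: test_sub tphi.
have c0 : cbump x0 (r / 2) x0 != 0 by rewrite gt_eqF// cbump_gt0// subrr normr0.
have [h|h] := leP 0 (ip Om g (cbump x0 (r / 2))); first exact: key tb c0 h.
apply: (key _ (testZ (-1) tb)); first by rewrite mulN1r oppr_eq0.
by rewrite (ipZr (-1) mO (test_L2 mO tb) Lg) mulN1r oppr_ge0 ltW.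
Qed.

(** Both summands are nonnegative, so each is bounded by B. Functions of zero norm are excluded from
    the supremum and are treated by Cauchy-Schwarz. *)
Lemma Ef_split (Om : set pt) a h g B : 0 < h -> open Om -> Om !=set0 -> L2 Om g ->
 (a%:E + (h^-1)%:E * norm_m2 Om g <= B%:E)%E -> 0 <= a ->
 a <= B /\ forall z, Hm Om 2 z -> H10 Om z -> ip Om g z <= h * B * hnorm Om 2 z.
move=> h0 oO O0 Lg H a0; have mO := open_meas oO.
have n0 := norm_m2_ge0 oO O0 Lg; have hV : 0 < h^-1 by rewrite invr_gt0.
have aB : a <= B.
 by rewrite -lee_fin; apply: le_trans H; rewrite leeDl// mule_ge0// lee_fin ltW.
split => // z Hz H1z; have [e|hn] := eqVneq (hnorm Om 2 z) 0.
 have nz : nrm Om z = 0 by apply: le_anti; rewrite nrm_ge0 andbT -e hnorm_nrm//; exact: Hz.1.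
 by rewrite e mulr0; apply: le_trans (ler_norm _) _; apply: le_trans (ip_CS mO Lg Hz.1) _; rewrite nz mulr0.
have hp : 0 < hnorm Om 2 z by rewrite lt_neqAle eq_sym hn hnorm_ge0.
have : ((h^-1)%:E * (ip Om g z / hnorm Om 2 z)%:E <= B%:E)%E.
 apply: le_trans H; apply: (@le_trans _ _ ((h^-1)%:E * norm_m2 Om g)%E); last by rewrite leeDr// lee_fin.
 by rewrite lee_pmul2l ?lte_fin//; apply: ereal_sup_ubound; exists z.
by rewrite -EFinM lee_fin mulrC ler_pdivrMr// ler_pdivrMr// (mulrC B).
Qed.

End NegativeNorm.

(** * The error estimates for the unfitted method *)

Lemma two_axes d : (1 < d)%N -> exists i j : 'I_d, i != j.
Proof. by move=> d1; exists (Ordinal (ltnW d1)), (Ordinal d1). Qed.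
Theorem corollary8 (R : realType) (d : nat) (Om Omt : set 'rV[R]_d)
    (k l : nat) (gammau : R)
    (c_shape c_unif c_gp c_Ef : R) (N_elt N_path : nat)
    (c_ext c_proper : nat -> R) :
  (d = 2 \/ d = 3)%N ->
  is_domain Om -> bounded_dom Om -> lipschitz_boundary Om ->
  is_domain Omt -> closure Om `<=` Omt ->
  (l <= k)%N -> 0 <= gammau ->
  L2_H2_regular Om ->
  exists C : R,
  forall (Th : mesh R d) (CC : {set {set elt Th}})
    (j : {set elt Th} -> ('rV[R]_d -> 'rV[R]_d) -> ('rV[R]_d -> 'rV[R]_d) -> R)
    (E E0 : ('rV[R]_d -> R) -> ('rV[R]_d -> R))
    (f fh pD p ph : 'rV[R]_d -> R) (u uh : 'rV[R]_d -> 'rV[R]_d) (kf : nat),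
  triangulation Th Omt -> shape_regular Th c_shape -> quasi_uniform Th c_unif ->
  patches Om CC N_elt N_path ->
  ghost_penalty Om CC j k c_gp ->
  is_E0 Th Om k E0 ->
  L2 Om f -> Hhalf Om pD ->
  mixed_poisson Om f pD u p ->
  Hmv Om l.+1 u -> Hm Om l p -> Hm Om l.+1 f ->
  extension_operator Th Om E c_ext ->
  proper_extension Th Om E c_proper f u p ->
  L2 (OmT Th Om) fh ->
  (l <= kf)%N ->
  assumption_Ef Th Om c_Ef kf l.+1 f (extf Th Om E p) fh ->
  unfitted_fem Om CC j k gammau fh pD uh ph ->
  norm_Sigma Th Om gammau (fun x => extu Th Om E p x - uh x)
      + gammau * jnorm CC j uh
    <= C * (mesh_size Th ^+ l.+1 * hnormv Om l.+1 u
            + mesh_size Th ^+ l.+1 * hnorm Om l.+1 f)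
  /\
  nrm (OmT Th Om) (ph \- E0 p)
    <= C * (mesh_size Th ^+ l.+2 * hnormv Om l.+1 u
            + mesh_size Th ^+ l.+2 * hnorm Om l.+1 f).
Proof.
move=> d23 [oO _ O0] bO lip [oT _ T0] clOT lk gam0 [cr hcr].
have d1 : (1 < d)%N by case: d23 => ->.
have d0 : (0 < d)%N by exact: ltnW.
have [i0 [i1 i01]] := two_axes d1.
have mO := open_meas oO.
(* A finite triangulation covers a bounded set. If the background domain is unbounded no
   triangulation exists, and any constant will do. *)
have [[H0 hH0]|nb] := pselect (exists H, forall x, closure Omt x -> `|x| <= H); last first.
  exists 0 => Th CC j E E0 f fh pD p ph u uh kf [uT _ _ cov]; case: nb.
  have /choice[B hB] T := simplex_bdd (uT T).
  exists (\sum_T `|B T|) => x; rewrite cov => -[T _ Tx]; apply: le_trans (hB _ _ Tx) _.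
  by apply: le_trans (ler_norm _) _; rewrite (bigD1 T)//= lerDl sumr_ge0.
pose kap : R := (d%:R * Num.max 1 c_unif * Num.max 1 c_shape)^-1.
have mx (x : R) : 0 < Num.max 1 x by rewrite lt_max ltr01.
have kap0 : 0 < kap by rewrite invr_gt0 !mulr_gt0// ltr0n.
have [C1 C10 hC1] := @test_approx R d k kap d0 kap0.
have [C2 C20 hC2] := @inverse_div R d k kap kap0.
have [C3 C30 hC3] := @dg_approx R d k kap i0 i1 i01 kap0.
have [s hs] := strip_geom d0 oO bO lip.
(* The given constants may be negative; their positive parts are used instead. *)
pose M0 (x : R) := Num.max 0 x.
have M00 x : 0 <= M0 x by rewrite le_max lexx.
have Mle x y z : x <= y * z -> 0 <= z -> x <= M0 y * z.
  by move=> h1 z0; apply: le_trans h1 _; rewrite ler_wpM2r// le_max lexx orbT.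
pose Sv : R := \sum_(v <- s) \sum_i `|v 0 i|.
have Sv0 : 0 <= Sv by apply: sumr_ge0 => v _; apply: sumr_ge0.
pose nS : R := \sum_(m < l.+2) @nal R d m.
have nS0 : 0 <= nS by apply: sumr_ge0 => m _; exact: nal_ge0.
have nalS m : (m <= l.+1)%N -> @nal R d m <= nS.
  by move=> ml; rewrite /nS (bigD1 (Ordinal (ml : m < l.+2)%N))//= lerDl; apply: sumr_ge0 => *; exact: nal_ge0.
pose c3 := C3 * M0 c_gp; pose cu := d%:R * (nS * M0 (c_proper l.+1)).
pose cf := nS * M0 (c_proper l.+1); pose ce := M0 (c_ext 2) * M0 cr.
have c30 : 0 <= c3 by rewrite mulr_ge0.
have cu0 : 0 <= cu by rewrite mulr_ge0 ?ler0n// mulr_ge0.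
have cf0 : 0 <= cf by rewrite mulr_ge0.
have ce0 : 0 <= ce by rewrite mulr_ge0.
have Hh0 : 0 <= `|H0| / kap by rewrite divr_ge0// ltW.
have H00 : 0 <= `|H0| by [].
have g0 := M00 c_gp; have E00 := M00 c_Ef; have r0 := M00 cr.
(* The sum dominates every constant required by [error_setting] and is formed before the mesh is
   introduced. *)
pose c : R := 1 + `|H0| / kap + `|H0| + M0 c_gp + c3 + C2 + C1 + Sv + cu + cf + M0 c_Ef + M0 cr + ce.
have [[w1 w2 w3] [w4 w5 w6] [w7 w8 w9] [w10 w11 w12 w13]] : [/\ [/\ 1 <= c, `|H0| / kap <= c & `|H0| <= c],
   [/\ M0 c_gp <= c, c3 <= c & C2 <= c], [/\ C1 <= c, Sv <= c & cu <= c] &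
   [/\ cf <= c, M0 c_Ef <= c, M0 cr <= c & ce <= c]] by rewrite /c; split; split; lra.
exists (`|@KA R d gammau c| + `|@KB R d gammau c|) => Th CC j E E0 f fh pD p ph u uh kf.
move=> tri sh qu pat gp hE0 Lf hpD mix Hu Hp Hf ext [pu pf] Lfh lkf [_ Ef] [RTuh dph fem1 fem2].
have fm := fat_triangulation d0 T0 tri sh qu; rewrite -/kap in fm.
set h := mesh_size Th in fm Ef *; set W := OmT Th Om.
have h0 : 0 < h := fm_h fm.
have [_ _ _ cov] := tri.
have OW : Om `<=` W.
  by apply: (sub_OmT fm oO) => x Ox; rewrite -cov; apply: subset_closure; apply: clOT; exact: subset_closure.
have oW : open W by exact: openW.
have mW : measurable W by exact: mW_OmT.
have Wb x : W x -> `|x| <= `|H0|.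
  move=> /interior_subset[T _ Tx]; apply: le_trans (ler_norm _); apply: hH0.
  by rewrite cov; exists T.
have [T0' _] : exists T : elt Th, T \in [set: elt Th]%SET.
  by case: T0 => x Tx; have := subset_closure Tx; rewrite cov => -[T TS _]; exists T.
(* The cube inside any one cell lies in the bounded background domain, which bounds the mesh
   size. *)
have hc : h <= `|H0| / kap.
  rewrite ler_pdivlMr// mulrC.
  have cb (t : R) : `|t| = kap * h -> `|cen h kap T0' + t *: delta_mx 0 i0| <= `|H0|.
    move=> et; apply: le_trans (ler_norm _); apply: hH0; rewrite cov; exists T0' => //.
    apply: (cen_ball fm); rewrite addrC addKr normrZ et ler_piMr// ?mulr_ge0 ?(ltW kap0) ?(ltW h0)//.
    by apply/row_normP => // i; rewrite mxE eqxx /=; case: eqP => _; rewrite ?normr1 ?normr0.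
  have kh0 : 0 <= kap * h by rewrite mulr_ge0 ?(ltW kap0) ?(ltW h0).
  have b1 := cb (kap * h) (ger0_norm kh0).
  have b2 := cb (- (kap * h)) (etrans (normrN _) (ger0_norm kh0)).
  have := le_trans (coord_le _ i0) b1; have := le_trans (coord_le _ i0) b2.
  rewrite !mxE !eqxx !mulr1 !ler_norml => /andP[a1 a2] /andP[a3 a4]; lra.
have [Hud Lp mix1 mix2] := mix.
have [wp du] := mixed_weak oO Lf hpD mix.
(* The first equation gives p one more derivative than assumed when l = 0, so that its extension has
   a gradient. *)
have Hp1 : Hm Om 1 p by apply: Hm1P => // i; exists (vcoord u i).
have [HEp bEp] := ext_bounded ext Hp1; have Epp := ext_id ext Lp.
pose uE := extu Th Om E p; pose e x := ph x - E0 p x.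
have [HuE buE] := pu _ Hu; have [HfE bfE] := pf _ Hf.
pose eps := h ^+ l.+1 * hnormv Om l.+1 u + h ^+ l.+1 * hnorm Om l.+1 f.
have hl : 0 <= h ^+ l.+1 by rewrite exprn_ge0// ltW.
have e1 : 0 <= h ^+ l.+1 * hnormv Om l.+1 u by rewrite mulr_ge0 ?hnormv_ge0.
have e2 : 0 <= h ^+ l.+1 * hnorm Om l.+1 f by rewrite mulr_ge0 ?hnorm_ge0.
have eps0 : 0 <= eps by exact: addr_ge0.
have [dE0 oE0] := hE0 p Lp.
have de : dg Th Om k e.
  by have := dgZB 1 dph dE0; rewrite (_ : (fun x => _) = e)//; apply/funext => x; rewrite mul1r.
have Le := dg_L2 fm de; have LeO := L2_sub mO mW OW Le.
have LphW := dg_L2 fm dph; have LE0 := dg_L2 fm dE0.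
have [I hI] := gp_interp gp.
have stab := stabilized_sub (patch_active pat).
have hI' m r : (m <= k.+1)%N -> Hmv W m r -> [/\ RT Th Om k (I r),
    nrmv W (fun x => r x - I r x) <= M0 c_gp * (h ^+ m * hsemiv W m r) &
    jnorm CC j (I r) <= M0 c_gp * (h ^+ m * hsemiv W m r)].
  move=> mk Hr; have [a1 a2 a3] := hI m r mk Hr; have hm0 := exprn_ge0 m (ltW h0); split; first exact: a1.
    apply: Mle; first (rewrite mulrA; exact: a2).
    exact: (mulr_ge0 hm0 (hsemiv_ge0 _ _ _)).
  apply: le_trans (_ : M0 c_gp * (h ^+ m * hsemiv (stabilized CC) m r) <= _).
    apply: Mle; first (rewrite mulrA; exact: a3).
    exact: (mulr_ge0 hm0 (hsemiv_ge0 _ _ _)).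
  apply: (ler_wpM2l (M00 _)); apply: (ler_wpM2l hm0); apply: hsemiv_sub; [exact: oW|exact: open_interior|exact: stab|exact: Hr].
have wk (a y x : R) : a <= c -> 0 <= y -> x <= a * y -> x <= c * y.
  by move=> ac y0 h1; apply: le_trans h1 _; rewrite ler_wpM2r.
have [Ef1 Ef2] := Ef_split h0 oO O0 (L2B mO (L2_sub mO mW OW Lfh) Lf) Ef (nrm_ge0 _ _).
have ue : h ^+ l.+1 * hnormv Om l.+1 u <= eps by rewrite /eps lerDl.
have fe : h ^+ l.+1 * hnorm Om l.+1 f <= eps by rewrite /eps lerDr.
have Efb : c_Ef * h ^+ l.+1 * hnorm Om l.+1 f <= c * eps.
  apply: (wk (M0 c_Ef)) => //; apply: (@le_trans _ _ (M0 c_Ef * (h ^+ l.+1 * hnorm Om l.+1 f))).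
    by apply: Mle => //; rewrite mulrA.
  by rewrite ler_wpM2l.
have es : error_setting k l gammau c c_gp h kap Om CC j I u uh uE f fh e eps.
  split.
  - exact: fm.
  - exact: le_trans hc w2.
  - exact: oO.
  - exact: OW.
  - by move=> x Wx; exact: le_trans (Wb x Wx) w3.
  - exact: eps0.
  - exact: gp.
  - move=> r hr; apply: (wk _ _ _ w4 (nrmv_ge0 _ _)); apply: Mle (nrmv_ge0 _ _).
    by apply: le_trans (gp_equiv_le gp hr); rewrite lerDr nrmv_ge0.
  - move=> r hr; have n0 : 0 <= nrmv Om r + jnorm CC j r by rewrite addr_ge0 ?nrmv_ge0 ?sqrtr_ge0.
    by apply: (wk _ _ _ w4 n0); apply: Mle n0; exact: (gp_equiv_ge gp hr).
  - move=> m r mk Hr; have [a1 a2 a3] := hI' m r mk Hr.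
    have n0 : 0 <= h ^+ m * hsemiv W m r by rewrite mulr_ge0 ?hsemiv_ge0// exprn_ge0// ltW.
    by split=> //; exact: (wk _ _ _ w4 n0).
  - move=> m r mk Hr; have [a1 a2 _] := hI' m _ mk (Hmv_axis i0 Hr).
    rewrite (hsemiv_axis _ _ _ oW) in a2.
    have [g dgg bg] := hC3 Th h Om r _ _ fm Hr.1 a1 a2; exists g => //.
    have n0 : 0 <= h ^+ m * hsemi W m r by rewrite mulr_ge0 ?hsemi_ge0// exprn_ge0// ltW.
    by apply: (wk _ _ _ w5 n0); rewrite /c3 -mulrA.
  - move=> v w g Hv RTw dgg; apply: (wk _ _ _ w6) (hC2 Th h Om v w g fm Hv RTw dgg).
    by rewrite addr_ge0 ?nrmv_ge0// mulr_ge0 ?nrm_ge0// ltW.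
  - move=> A A0 HA; have [et [tet b1 b2]] := hC1 Th h Om e A fm de A0 HA; exists et; split => //.
      apply: le_trans b1 _; rewrite -!mulrA ler_wpM2r// mulr_ge0// ltW//.
    by move=> i; apply: le_trans (b2 i) _; rewrite ler_wpM2r.
  - move=> phi B tphi hB; have B0 : 0 <= B by apply: le_trans (hB i0); exact: nrm_ge0.
    have n0 : 0 <= h * B by rewrite mulr_ge0// ltW.
    apply: (wk _ _ _ w8 n0).
    apply: le_trans (@strip_nrm _ _ [seq h *: v | v <- s] W _ _ oW (measurableD mW mO) tphi _) _.
      move=> x [Wx nOx]; have [v vs nW] := hs h W h0 (OmT_near fm) x Wx nOx.
      by exists (h *: v) => //; apply: map_f.
    rewrite big_map /Sv mulr_suml; apply: ler_sum => v _; rewrite mulr_suml; apply: ler_sum => i _.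
    rewrite mxE normrM (gtr0_norm h0) (mulrC h) -mulrA ler_wpM2l// ler_wpM2l// ltW//.
  - exact: de.
  - exact: RTuh.
  - move=> v RTv; have [Lv _ _] := HdivP RTv.1.
    have [q [dq aeq]] := RT_wdiv fm RTv; have Lq := dg_L2 fm dq.
    have HvO := Hdiv_sub oW oO OW RTv.1; have [LvO _ LdvO] := HdivP HvO.
    have [Luh _ _] := HdivP RTuh.1; have [Lu _ _] := HdivP Hud.
    have [_ _ Ldv] := HdivP RTv.1; have LuhO := L2v_sub mO mW OW Luh.
    have LqO := L2_sub mO mW OW Lq.
    (* The divergence of v is a piecewise polynomial up to a null set, so the definition of [E0]
       exchanges p on [Om] for its discrete image on the active domain. *)
    have i1' : ip Om (wdiv Om v) p = ip W (wdiv W v) (E0 p).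
      have o1 : ip W (E0 p) q = ip Om p q := oE0 q dq.
      rewrite (eq_ip_ae mW Ldv Lq LE0 aeq) [RHS]ipC o1 [RHS]ipC.
      apply: (eq_ip_ae mO LdvO LqO Lp).
      by apply: filterS2 (wdiv_sub_ae oW oO OW RTv.1) aeq => x g1 g2 Ox; rewrite g1// g2//; exact: OW.
    have := fem1 v RTv; rewrite -(mix1 v HvO) i1' /e (ipBr mW LphW LE0 Ldv) (ipvBl mO Lu LuhO LvO) -/W.
    move: (ipv Om uh v) (ipv Om u v) (jh CC j uh v) (ip W _ ph) (ip W _ (E0 p)) => a1 a2 a3 a4 a5; clear; lra.
  - exact: fem2.
  - exact: Lfh.
  - exact: Lf.
  - exact: Hud.
  - exact: du.
  - exact: HuE.
  - apply: filterS (ae_forall_fin (fun i => wgrad_ext_ae oO oW OW HEp Lp Epp (wp i))) => x hx Ox.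
    by apply/rowP => i; rewrite /uE /extu mxE; exact: hx.
  - exact: HfE.
  - apply: (wk cu) => //; apply: le_trans (_ : cu * (h ^+ l.+1 * hnormv Om l.+1 u) <= _); last by rewrite ler_wpM2l.
    have b1 : hnormv W l.+1 uE <= M0 (c_proper l.+1) * hnormv Om l.+1 u.
      by apply: Mle; [exact: buE|exact: hnormv_ge0].
    have b2 := le_trans (hsemiv_hnormv W uE (leqnn l.+1)) (ler_wpM2l (ler0n _ d) (ler_pM (nal_ge0 _) (hnormv_ge0 _ _ _) (nalS _ (leqnn _)) b1)).
    apply: le_trans (ler_wpM2l hl b2) _; rewrite /cu.
    by le_eq; ring.
  - move=> m ml; apply: (wk cf) => //; apply: le_trans (_ : cf * (h ^+ l.+1 * hnorm Om l.+1 f) <= _); last by rewrite ler_wpM2l.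
    have b1 : hnorm W l.+1 (extf Th Om E p) <= M0 (c_proper l.+1) * hnorm Om l.+1 f.
      by apply: Mle; [exact: bfE|exact: hnorm_ge0].
    have b2 := le_trans (hsemi_hnorm W (extf Th Om E p) ml) (ler_pM (nal_ge0 _) (hnorm_ge0 _ _ _) (nalS _ ml) b1).
    apply: le_trans (ler_wpM2l hl b2) _; rewrite /cf.
    by le_eq; ring.
  - exact: le_trans Ef1 Efb.
  - move=> z Hz H1z; apply: le_trans (Ef2 z Hz H1z) _.
    apply: le_trans (ler_wpM2r (hnorm_ge0 Om 2 z) (ler_wpM2l (ltW h0) Efb)) _.
    by le_eq; ring.
  (* The dual problem has e restricted to [Om] as datum, and its solution is extended to H^2 of the
     active domain by the same operator [E]. *)
  - have Mpos : 0 < `|H0| + 1 by rewrite ltr_wpDl.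
    have HH1 : `|H0| <= `|H0| + 1 by rewrite lerDl ler01.
    have [z pz] := poisson_exists d0 oO Mpos (fun x Ox => le_trans (Wb x (OW x Ox)) HH1) LeO.
    have [Hz bz] := hcr e LeO z pz; have [Hq bq] := ext_bounded ext Hz.
    have N0 := nrm_ge0 Om e; have bz' : hnorm Om 2 z <= M0 cr * nrm Om e by exact: Mle.
    exists z, (E z); split => //; first exact: (wk _ _ _ w12 N0).
    have EZ := ext_id ext Hz.1.
    split; [exact: Hq| |exact: EZ].
    apply: (wk ce) => //; rewrite /ce -mulrA.
    have b1 : hnorm W 2 (E z) <= M0 (c_ext 2) * hnorm Om 2 z by apply: Mle; [exact: bq|exact: hnorm_ge0].
    by apply: le_trans b1 _; rewrite ler_wpM2l.
have A1 := velocity_estimate d0 lk gam0 w1 es.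
have A2 := pressure_estimate d0 lk gam0 w1 es.
split.
  apply: le_trans A1 _; rewrite ler_wpM2r//; apply: le_trans (ler_norm _) _.
  by rewrite lerDl.
have -> : h ^+ l.+2 * hnormv Om l.+1 u + h ^+ l.+2 * hnorm Om l.+1 f = h * eps.
  by rewrite /eps !exprS; ring.
apply: le_trans A2 _; rewrite ler_wpM2r ?mulr_ge0 ?(ltW h0)//; apply: le_trans (ler_norm _) _.
by rewrite lerDr.
Qed.
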